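(* Let $0<p\le 1$ and let $f=h+\overline{g}:\mathbb{D}\to\mathbb{C}$ be a univalent sense-preserving harmonic mapping whose dilatation $w$ belongs to $Q_{p,0}$ and satisfies $\|w\|<1$. Assume that for some $\lambda\in\partial\mathbb{D}$ the analytic function $\varphi=h+\lambda g$ is a conformal map of $\mathbb{D}$ such that $\varphi(\partial\mathbb{D})$ is a closed Jordan curve. If $d\mu(z)=|S_f(z)|^2(1-|z|^2)^{2+p}\,dA(z)$ is a vanishing $p$-Carleson measure, then $F=\log J_f\in\widetilde{\mathcal{Q}}_{p,0}$.
   Context: $\mathbb{D}$ is the unit disk and $dA$ is Lebesgue area measure. A sense-preserving locally univalent harmonic mapping $f:\mathbb{D}\to\mathbb{C}$ is written $f=h+\overline{g}$ with $h,g$ analytic in $\mathbb{D}$, $h(0)=g(0)=0$, $h'\neq 0$ in $\mathbb{D}$; its dilatation is $w=g'/h'$, an analytic function with $|w|<1$ in $\mathbb{D}$, and its Jacobian is $J_f=|h'|^2-|g'|^2>0$. Write $\|w\|=\sup_{z\in\mathbb{D}}|w(z)|$. With $\partial_z=\frac12(\partial_x-i\partial_y)$, $\partial_{\bar z}=\frac12(\partial_x+i\partial_y)$ and $F=\log J_f$, the Schwarzian derivative of $f$ is $S_f=F_{zz}-\frac12 F_z^2$; explicitly $S_f=S_h+\frac{\overline{w}}{1-|w|^2}\big(w'\frac{h''}{h'}-w''\big)-\frac32\big(\frac{w'\overline{w}}{1-|w|^2}\big)^2$, where $S_h=(h''/h')'-\frac12(h''/h')^2$. For $a\in\mathbb{D}$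 let $\varphi_a(z)=\frac{a-z}{1-\overline{a}z}$. For $0<p<\infty$: $Q_{p,0}$ is the space of analytic $u$ on $\mathbb{D}$ with $\lim_{|a|\to1^-}\int_{\mathbb{D}}|u'(z)|^2(1-|\varphi_a(z)|^2)^p\,dA(z)=0$; $\widetilde{\mathcal{Q}}_{p,0}$ is the class of smooth $G:\mathbb{D}\to\mathbb{C}$ with $\lim_{|a|\to1^-}\int_{\mathbb{D}}(|G_z(z)|+|G_{\bar z}(z)|)^2(1-|\varphi_a(z)|^2)^p\,dA(z)=0$. A positive Borel measure $\mu$ on $\mathbb{D}$ is a vanishing $p$-Carleson measure if $\sup_{a\in\mathbb{D}}\int_{\mathbb{D}}|\varphi_a'|^p\,d\mu<\infty$ and $\lim_{|a|\to1^-}\int_{\mathbb{D}}|\varphi_a'(z)|^p\,d\mu(z)=0$. *)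

(* Defs.v *)
(* MathComp-Analysis over an abstract R : realType,
   complex plane C := R[i] (mathcomp-real-closed), viewed as a numClosedFieldType
   so that it is a normed module over itself (complex derivative = 'D_1). *)
From HB Require Import structures.
From mathcomp Require Import all_boot all_order all_algebra.
From mathcomp Require Import all_classical all_reals all_analysis.
From mathcomp Require Import complex.
Import Order.TTheory GRing.Theory Num.Theory.
Import numFieldNormedType.Exports.

Set Implicit Arguments.
Unset Strict Implicit.
Unset Printing Implicit Defensive.

Local Open Scope ring_scope.
Local Open Scope classical_set_scope.

Section HarmonicDefs.
Variable R : realType.

Definition Cplx : numClosedFieldType := (R[i] : numClosedFieldType).

Definition cabs (z : Cplx) : R := ComplexField.Normc.normc (z : R[i]).

Definition cre (z : Cplx) : R := complex.Re (z : R[i]).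
Definition cim (z : Cplx) : R := complex.Im (z : R[i]).
Definition RtoC (x : R) : Cplx := (Complex x 0 : R[i]).
Definition toC (q : R * R) : Cplx := (Complex q.1 q.2 : R[i]).
Definition ofC (z : Cplx) : R * R := (cre z, cim z).
Definition cconj (z : Cplx) : Cplx := (Complex (cre z) (- cim z) : R[i]).

Definition disk : set Cplx := [set z | cabs z < 1].
Definition cdisk : set Cplx := [set z | cabs z <= 1].
Definition circle : set Cplx := [set z | cabs z = 1].
Definition disk2 : set (R * R) := toC @^-1` disk.

Definition cder (f : Cplx -> Cplx) : Cplx -> Cplx := 'D_1 f.
Definition analytic_on_disk (f : Cplx -> Cplx) : Prop :=
  forall z, disk z -> derivable f z 1.

Definition univalent_on_disk (f : Cplx -> Cplx) : Prop :=
  forall z1 z2, disk z1 -> disk z2 -> f z1 = f z2 -> z1 = z2.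

Definition phi (a : Cplx) (z : Cplx) : Cplx := (a - z) / (1 - cconj a * z).

Fixpoint iterD (vs : seq (R * R)) (u : R * R -> R) : R * R -> R :=
  match vs with
  | [::] => u
  | v :: vs' => 'D_v (iterD vs' u)
  end.

Definition smooth2_on (D : set (R * R)) (u : R * R -> R) : Prop :=
  forall (vs : seq (R * R)) (q : R * R), D q -> differentiable (iterD vs u) q.

Definition reF (G : Cplx -> Cplx) : R * R -> R := fun q => cre (G (toC q)).
Definition imF (G : Cplx -> Cplx) : R * R -> R := fun q => cim (G (toC q)).

Definition smooth_on_disk (G : Cplx -> Cplx) : Prop :=
  smooth2_on disk2 (reF G) /\ smooth2_on disk2 (imF G).

Definition dx (G : Cplx -> Cplx) (z : Cplx) : Cplx :=
  (Complex ('D_(1, 0) (reF G) (ofC z)) ('D_(1, 0) (imF G) (ofC z)) : R[i]).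
Definition dy (G : Cplx -> Cplx) (z : Cplx) : Cplx :=
  (Complex ('D_(0, 1) (reF G) (ofC z)) ('D_(0, 1) (imF G) (ofC z)) : R[i]).

Definition iC : Cplx := (Complex 0 1 : R[i]).
Definition Wz (G : Cplx -> Cplx) (z : Cplx) : Cplx := (dx G z - iC * dy G z) / 2.
Definition Wzb (G : Cplx -> Cplx) (z : Cplx) : Cplx := (dx G z + iC * dy G z) / 2.

Definition plane := (measurableTypeR R * measurableTypeR R)%type.
Definition area : {measure set plane -> \bar R} :=
  ((@lebesgue_measure R) \x (@lebesgue_measure R))%E.

Definition disk_int (k : Cplx -> R) : \bar R :=
  (\int[area]_(q in disk2) (k (toC q))%:E)%E.

Definition vanishes_at_boundary (X : Cplx -> \bar R) : Prop :=
  forall e : R, 0 < e -> exists r : R, r < 1 /\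
    forall a, r < cabs a -> cabs a < 1 -> (X a < e%:E)%E.

Definition Qp0 (p : R) (u : Cplx -> Cplx) : Prop :=
  analytic_on_disk u /\
  vanishes_at_boundary (fun a =>
    disk_int (fun z => cabs (cder u z) ^+ 2 * (1 - cabs (phi a z) ^+ 2) `^ p)).

Definition tQp0 (p : R) (G : Cplx -> Cplx) : Prop :=
  smooth_on_disk G /\
  vanishes_at_boundary (fun a =>
    disk_int (fun z => (cabs (Wz G z) + cabs (Wzb G z)) ^+ 2
                         * (1 - cabs (phi a z) ^+ 2) `^ p)).

(* vanishing p-Carleson measure (positive Borel measure on D, here a measure
   on R^2 = C; integrals are taken over D) *)
Definition carleson_int (mu : {measure set plane -> \bar R}) (p : R) (a : Cplx)
  : \bar R :=
  (\int[mu]_(q in disk2) ((cabs (cder (phi a) (toC q))) `^ p)%:E)%E.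

Definition vanishing_carleson (p : R) (mu : {measure set plane -> \bar R}) : Prop :=
  (exists M : R, forall a, disk a -> (carleson_int mu p a <= M%:E)%E) /\
  vanishes_at_boundary (carleson_int mu p).

Definition harm (h g : Cplx -> Cplx) (z : Cplx) : Cplx := h z + cconj (g z).
Definition jac (h g : Cplx -> Cplx) (z : Cplx) : R :=
  cabs (cder h z) ^+ 2 - cabs (cder g z) ^+ 2.
Definition logJ (h g : Cplx -> Cplx) (z : Cplx) : Cplx := RtoC (ln (jac h g z)).
Definition schwarzian (h g : Cplx -> Cplx) (z : Cplx) : Cplx :=
  Wz (Wz (logJ h g)) z - (Wz (logJ h g) z) ^+ 2 / 2.

End HarmonicDefs.

(* Main.v *)
(** Put [u = h''/h'], [A = conj w / (1 - |w|^2)] and [d = 1 - |z|]. Then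
    [dF/dz = u - A w'], [dF/dzbar] is its conjugate, and
    [S_f = S_h + A (w' u - w'') - 3/2 (A w')^2] with [S_h = u' - u^2/2], so everything reduces to
    the weighted smallness of [u], the part [A w'] being controlled by [w] in [Q_{p,0}].
    The mean value property turns the integral hypotheses into pointwise ones: [d |w'|] and
    [d^2 |w''|] tend to 0, and [d^2 |S_h|] is small wherever [d |u|] is bounded. That [d |u|] is
    bounded follows by Zalcman rescaling: otherwise a rescaled limit would solve the Riccati
    equation [q' = q^2/2] with [|q| <= 4] and [q(0) = 1], which blows up.
    Since [h + lambda g] is bounded and [|w| <= k < 1], [d |h'|] is bounded; a quantity monotone
    along radii shows that [d |u|] could stay away from 0 only if [|h'|] grew faster than that,
    hence [d |u|] tends to 0. Finally a Hardy and a Caccioppoli inequality with the weight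
    [(1 - |phi_a|^2)^p] bound the weighted norm of [u] by that of [d u'], respectively of [d w''] by
    that of [w']; as [u' = u^2/2 + S_h] and [d |u|] is small, the quadratic term is absorbed.

    To keep all integrands compactly supported, the weight is replaced by its analogue on the disk
    [|z|^2 < m], with estimates uniform in [m < 1]. *)
Require Import Defs.
From HB Require Import structures.
From mathcomp Require Import all_boot all_order all_algebra.
From mathcomp Require Import all_classical all_reals all_analysis.
From mathcomp Require Import measurable_realfun complex.
From mathcomp Require Import ring lra.
Import Order.TTheory GRing.Theory Num.Theory.
Import numFieldNormedType.Exports.
Set Implicit Arguments.
Unset Strict Implicit.
Unset Printing Implicit Defensive.
Local Open Scope ring_scope.
Local Open Scope classical_set_scope.

(** * Complex numbers and complex derivatives *)

Section ComplexBasics.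
Variable R : realType.
Local Notation C := (Cplx R).
Implicit Types z w : C.

(** Differentiability is only assumed pointwise, so even the continuity of [h'] has to be earned:
    Goursat's bisection yields local primitives, and a mean value formula is then differentiated
    through its kernel. Area averages against the bumps [pos (1 - s |z - z0|^2) ^ n] take the place
    of circle integrals, so that every integration by parts is Fubini on one fixed square.

    The cut-off at [m < 1] also makes the absorption legitimate: a multiple of the weighted norm of
    [u] is subtracted from both sides, and for [m < 1] that norm is finite beforehand.

    Along a ray, [y = - (1 - t) zeta u / 2] solves, in the time [- log (1 - t)], a perturbation of
    the logistic equation [y' = - y (1 + y)]. The rest point 0 is attracting. The repelling one, -1,
    belongs to [|h'|] growing like [(1 - t)^-2], which the bound on [d |h'|] forbids; the monotone
    quantity turns this into an estimate uniform in the direction. *)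

Lemma creD z w : cre (z + w) = cre z + cre w. Proof. by case: z w => [a b] [c d]. Qed.
Lemma cimD z w : cim (z + w) = cim z + cim w. Proof. by case: z w => [a b] [c d]. Qed.
Lemma creN z : cre (- z) = - cre z. Proof. by case: z. Qed.
Lemma cimN z : cim (- z) = - cim z. Proof. by case: z. Qed.
Lemma creB z w : cre (z - w) = cre z - cre w. Proof. by rewrite creD creN. Qed.
Lemma cimB z w : cim (z - w) = cim z - cim w. Proof. by rewrite cimD cimN. Qed.
Lemma creM z w : cre (z * w) = cre z * cre w - cim z * cim w.
Proof. by case: z w => [a b] [c d]. Qed.
Lemma cimM z w : cim (z * w) = cre z * cim w + cim z * cre w.
Proof. by case: z w => [a b] [c d]. Qed.
Lemma cre1 : cre (1 : C) = 1. Proof. by []. Qed.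
Lemma cim1 : cim (1 : C) = 0. Proof. by []. Qed.
Lemma cre0 : cre (0 : C) = 0. Proof. by []. Qed.
Lemma cim0 : cim (0 : C) = 0. Proof. by []. Qed.
Lemma creR (x : R) : cre (RtoC x) = x. Proof. by []. Qed.
Lemma cimR (x : R) : cim (RtoC x) = 0. Proof. by []. Qed.
Lemma creconj z : cre (cconj z) = cre z. Proof. by case: z. Qed.
Lemma cimconj z : cim (cconj z) = - cim z. Proof. by case: z. Qed.
Lemma creI : cre (iC R) = 0. Proof. by []. Qed.
Lemma cimI : cim (iC R) = 1. Proof. by []. Qed.

Lemma cplx_eq z w : cre z = cre w -> cim z = cim w -> z = w.
Proof. by case: z w => [a b] [c d] /= -> ->. Qed.

Definition cE := (creD, cimD, creN, cimN, creM, cimM, cre1, cim1, cre0, cim0, creR, cimR,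
  creconj, cimconj, creI, cimI).

Lemma RtoCD (x y : R) : RtoC (x + y) = RtoC x + RtoC y.
Proof. by apply: cplx_eq; rewrite !cE ?addr0. Qed.
Lemma RtoCM (x y : R) : RtoC (x * y) = RtoC x * RtoC y.
Proof. by apply: cplx_eq; rewrite !cE; ring. Qed.
Lemma RtoCN (x : R) : RtoC (- x) = - RtoC x.
Proof. by apply: cplx_eq; rewrite !cE ?oppr0. Qed.
Lemma RtoC0 : RtoC (0 : R) = 0. Proof. by []. Qed.
Lemma RtoC1 : RtoC (1 : R) = 1. Proof. by []. Qed.
Lemma RtoCX (x : R) n : RtoC (x ^+ n) = RtoC x ^+ n.
Proof. by elim: n => [|n IH]; rewrite ?expr0 // !exprS RtoCM IH. Qed.
Lemma RtoCV (x : R) : RtoC (x^-1) = (RtoC x)^-1.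
Proof.
have [->|x0] := eqVneq x 0; first by rewrite invr0 RtoC0 invr0.
have h : RtoC x != 0 by apply/eqP => /(congr1 (@cre R)) /= /eqP; rewrite (negbTE x0).
by apply: (mulfI h); rewrite divff// -RtoCM divff.
Qed.
Lemma RtoC_nat n : RtoC (n%:R : R) = n%:R.
Proof. by elim: n => [|n IH] //; rewrite -(addn1 n) !natrD RtoCD IH. Qed.

Lemma cconjD z w : cconj (z + w) = cconj z + cconj w.
Proof. by apply: cplx_eq; rewrite !cE; ring. Qed.
Lemma cconjM z w : cconj (z * w) = cconj z * cconj w.
Proof. by apply: cplx_eq; rewrite !cE; ring. Qed.
Lemma cconjN z : cconj (- z) = - cconj z.
Proof. by apply: cplx_eq; rewrite !cE; ring. Qed.
Lemma cconjK z : cconj (cconj z) = z.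
Proof. by apply: cplx_eq; rewrite !cE; ring. Qed.
Lemma cconjR (x : R) : cconj (RtoC x) = RtoC x.
Proof. by apply: cplx_eq; rewrite !cE; ring. Qed.
Lemma cconj1 : cconj (1 : C) = 1.
Proof. by apply: cplx_eq; rewrite !cE; ring. Qed.

Lemma cabs_ge0 z : 0 <= cabs z.
Proof. by case: z => a b; exact: sqrtr_ge0. Qed.
Lemma cabs2 z : cabs z ^+ 2 = cre z ^+ 2 + cim z ^+ 2.
Proof. by case: z => a b; rewrite /cabs/= sqr_sqrtr// addr_ge0// sqr_ge0. Qed.
Lemma cabsE z : cabs z = Num.sqrt (cre z ^+ 2 + cim z ^+ 2).
Proof. by case: z. Qed.
Lemma cabsM z w : cabs (z * w) = cabs z * cabs w.
Proof. exact: ComplexField.Normc.normcM. Qed.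
Lemma cabs0 : cabs (0 : C) = 0. Proof. exact: ComplexField.Normc.normc0. Qed.
Lemma cabs1 : cabs (1 : C) = 1. Proof. exact: ComplexField.Normc.normc1. Qed.
Lemma cabsN z : cabs (- z) = cabs z.
Proof. by rewrite !cabsE creN cimN !sqrrN. Qed.
Lemma cabsD z w : cabs (z + w) <= cabs z + cabs w.
Proof. exact: (@le_normcD R). Qed.
Lemma cabsB z w : cabs (z - w) <= cabs z + cabs w.
Proof. by rewrite (le_trans (cabsD _ _))// cabsN. Qed.
Lemma cabs_sub z w : cabs (z - w) = cabs (w - z).
Proof. by rewrite -cabsN opprB. Qed.
Lemma cabs_eq0 z : (cabs z == 0) = (z == 0).
Proof.
apply/eqP/eqP => [|->]; last exact: cabs0.
exact: ComplexField.Normc.eq0_normc.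
Qed.
Lemma cabs_gt0 z : (0 < cabs z) = (z != 0).
Proof. by rewrite lt_def cabs_ge0 andbT cabs_eq0. Qed.
Lemma cabsV z : cabs z^-1 = (cabs z)^-1.
Proof. exact: ComplexField.Normc.normcV. Qed.
Lemma cabsX z n : cabs (z ^+ n) = cabs z ^+ n.
Proof. by elim: n => [|n IH]; rewrite ?expr0 ?cabs1// !exprS cabsM IH. Qed.
Lemma cabsR (x : R) : cabs (RtoC x) = `|x|.
Proof. by rewrite cabsE !cE expr0n addr0 sqrtr_sqr. Qed.
Lemma cabsconj z : cabs (cconj z) = cabs z.
Proof. by rewrite !cabsE !cE sqrrN. Qed.
Lemma cabsI : cabs (iC R) = 1.
Proof. by rewrite !cabsE !cE expr0n add0r expr1n sqrtr1. Qed.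
Lemma cre_le z : `|cre z| <= cabs z.
Proof. by rewrite cabsE -sqrtr_sqr ler_wsqrtr// lerDl sqr_ge0. Qed.
Lemma cim_le z : `|cim z| <= cabs z.
Proof. by rewrite cabsE -sqrtr_sqr ler_wsqrtr// lerDr sqr_ge0. Qed.
Lemma cabs_le z : cabs z <= `|cre z| + `|cim z|.
Proof.
rewrite -[leRHS]ger0_norm ?addr_ge0// -sqrtr_sqr cabsE ler_wsqrtr//.
rewrite sqrrD !real_normK ?num_real// lerD2r lerDl.
by rewrite mulrn_wge0// mulr_ge0.
Qed.
Lemma cabs_triangle z w : cabs z <= cabs (z - w) + cabs w.
Proof. by rewrite -{1}(subrK w z) cabsD. Qed.
Lemma cabs_dist z w : `|cabs z - cabs w| <= cabs (z - w).
Proof.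
rewrite ler_norml; apply/andP; split.
  by rewrite lerNl opprB lerBlDr cabs_sub cabs_triangle.
by rewrite lerBlDr cabs_triangle.
Qed.

Lemma mulcconj z : z * cconj z = RtoC (cabs z ^+ 2).
Proof. by apply: cplx_eq; rewrite cabs2 !cE; ring. Qed.

Lemma toCK z : toC (ofC z) = z. Proof. by case: z. Qed.
Lemma ofCK (q : R * R) : ofC (toC q) = q. Proof. by case: q. Qed.

Lemma normC z : `|z| = RtoC (cabs z).
Proof. by rewrite (@normc_def R z) /RtoC cabsE. Qed.

Lemma ltRtoC (x y : R) : (RtoC x < RtoC y) = (x < y).
Proof. exact: ltcR. Qed.
Lemma leRtoC (x y : R) : (RtoC x <= RtoC y) = (x <= y).
Proof. exact: lecR. Qed.

(** In the order of [Cplx R] only real elements are positive; this turns complex epsilons and radii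
    into real ones. *)
Lemma posC_ex (e : C) : 0 < e -> exists2 x : R, 0 < x & e = RtoC x.
Proof. by case: e => a b; rewrite ltcE /= => /andP[/eqP -> a0]; exists a. Qed.

Lemma nbhsCP z (P : set C) :
  nbhs z P <-> exists2 e : R, 0 < e & forall w, cabs (w - z) < e -> P w.
Proof.
split=> [/nbhs_ballP [e /= e0 eP]|[e e0 eP]].
  have [x x0 ex] := posC_ex e0; rewrite ex in eP.
  exists x => // w wz; apply: eP.
  by rewrite /ball/= normC ltRtoC cabs_sub.
apply/nbhs_ballP; exists (RtoC e) => /=; first by rewrite -RtoC0 ltRtoC.
by move=> w; rewrite /ball/= normC ltRtoC cabs_sub; exact: eP.
Qed.

(** The norm of [Cplx R] takes its values in [Cplx R] itself. Restating the complex derivative with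
    the real modulus [cabs] and real epsilons keeps all later estimates in [R]. *)
Definition der_at (f : C -> C) z l := forall e : R, 0 < e ->
  exists2 d : R, 0 < d & forall w, cabs (w - z) < d ->
    cabs (f w - f z - l * (w - z)) <= e * cabs (w - z).

Lemma der_at_cvg f z l : der_at f z l ->
  h^-1 *: (f (h *: 1 + z) - f z) @[h --> (0 : C)^'] --> l.
Proof.
move=> dfl; apply/cvgrPdist_le => /= e e0.
have [x x0 ->] := posC_ex e0.
have [d d0 H] := dfl _ x0.
apply/nbhsCP; exists d => // h; rewrite subr0 => hd h0.
rewrite normC leRtoC.
have := H (h *: 1 + z); rewrite addrK /GRing.scale/= mulr1 => /(_ hd) {}H.
rewrite -(ler_pM2r (x := cabs h)) ?cabs_gt0// -cabsM.
rewrite /GRing.scale/=.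
apply: le_trans H; rewrite -cabsN.
rewrite le_eqVlt; apply/orP; left; apply/eqP; congr cabs.
by field.
Qed.

Lemma der_at_derive f z l : der_at f z l -> is_derive z (1 : C) f l.
Proof.
move=> /der_at_cvg H; split; first by apply/cvg_ex; exists l.
exact: (cvg_lim _ H).
Qed.

Lemma derive_der_at f z l : is_derive z (1 : C) f l -> der_at f z l.
Proof.
move=> [dfz Dl] e e0.
have : h^-1 *: (f (h *: 1 + z) - f z) @[h --> (0 : C)^'] --> l by rewrite -Dl.
move/cvgrPdist_le => /(_ (RtoC e)); rewrite -RtoC0 ltRtoC => /(_ e0).
move=> /nbhsCP [d d0 H]; exists d => // w wz.
have [->|wz0] := eqVneq w z; first by rewrite !subrr mulr0 subr0 cabs0 mulr0.
have hn : w - z != 0 by rewrite subr_eq0.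
have := H (w - z); rewrite /= subr0 => /(_ wz hn).
rewrite normC leRtoC /GRing.scale/= mulr1 subrK => {}H.
rewrite -(ler_pM2r (x := cabs (w - z))) ?cabs_gt0// -cabsM in H.
apply: le_trans H; rewrite -cabsN.
rewrite le_eqVlt; apply/orP; left; apply/eqP; congr cabs.
by field.
Qed.

Lemma derivable_der_at f z : derivable f z (1 : C) -> der_at f z (cder f z).
Proof. by move=> dfz; apply: derive_der_at; exact: derivableP. Qed.

Lemma der_at_cder f z l : der_at f z l -> cder f z = l.
Proof. by move/der_at_derive => [_]. Qed.
Lemma der_at_derivable f z l : der_at f z l -> derivable f z (1 : C).
Proof. by move/der_at_derive => [+ _]. Qed.

Lemma disk_open z : disk z -> exists2 r : R, 0 < r &
  forall w, cabs (w - z) < r -> disk w.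
Proof.
rewrite /disk/= => zd; exists (1 - cabs z); rewrite ?subr_gt0// => w.
by rewrite ltrBrDr => /(le_lt_trans (cabs_triangle w z)).
Qed.

End ComplexBasics.

(** * Derivatives of curves in the plane *)

Section Curves.
Variable R : realType.
Local Notation C := (Cplx R).
Implicit Types (z w l : C) (t : R) (f g : R -> R) (c d : R -> C).

Lemma rder_ext f g t a b : is_derive t 1 f a -> (forall s, f s = g s) -> a = b ->
  is_derive t 1 g b.
Proof. by move=> + /funext fg ab; rewrite fg ab. Qed.

Lemma rderD f g t a b : is_derive t 1 f a -> is_derive t 1 g b ->
  is_derive t 1 (fun s => f s + g s) (a + b).
Proof. by move=> ? ?; exact: is_deriveD. Qed.
Lemma rderN f t a : is_derive t 1 f a -> is_derive t 1 (fun s => - f s) (- a).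
Proof. by move=> ?; exact: is_deriveN. Qed.
Lemma rderB f g t a b : is_derive t 1 f a -> is_derive t 1 g b ->
  is_derive t 1 (fun s => f s - g s) (a - b).
Proof. by move=> ? ?; exact: is_deriveB. Qed.
Lemma rderM f g t a b : is_derive t 1 f a -> is_derive t 1 g b ->
  is_derive t 1 (fun s => f s * g s) (a * g t + f t * b).
Proof.
move=> fa gb; apply: (rder_ext (is_deriveM fa gb)) => //.
by rewrite /GRing.scale/=; ring.
Qed.
Lemma rder_cst (k : R) t : is_derive t 1 (fun=> k) 0.
Proof. exact: is_derive_cst. Qed.
Lemma rder_id t : is_derive t 1 (fun s => s) 1.
Proof. exact: is_derive_id. Qed.
Lemma rder_comp f g t a b : is_derive (g t) 1 f a -> is_derive t 1 g b ->
  is_derive t 1 (fun s => f (g s)) (a * b).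
Proof. by move=> ? ?; exact: is_derive1_comp. Qed.
Lemma rderV f t a : f t != 0 -> is_derive t 1 f a ->
  is_derive t 1 (fun s => (f s)^-1) (- a / f t ^+ 2).
Proof.
move=> f0 fa; apply: (rder_ext (is_deriveV f0 fa)) => //.
by rewrite /GRing.scale/= mulNr mulrC mulNr.
Qed.
Lemma rderX f n t a : is_derive t 1 f a ->
  is_derive t 1 (fun s => f s ^+ n.+1) (n.+1%:R * f t ^+ n * a).
Proof.
move=> fa; elim: n => [|n IH].
  by apply: (rder_ext fa) => *; rewrite ?expr1// expr0; ring.
apply: (rder_ext (rderM fa IH)) => [s|]; first by rewrite -exprS.
by rewrite -(addn1 n.+1) natrD !exprS; ring.
Qed.

Lemma rder_local f g t a (r : R) : 0 < r -> (forall s, `|s - t| < r -> f s = g s) ->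
  is_derive t 1 f a -> is_derive t 1 g a.
Proof.
move=> r0 fg fa; apply: (near_eq_is_derive (f := f)) => //.
apply/nbhs_ballP; exists r => //= s; rewrite /ball/= distrC; exact: fg.
Qed.

Lemma rderP f t a : is_derive t 1 f a <-> forall e : R, 0 < e ->
  exists2 d : R, 0 < d & forall s, `|s - t| < d ->
    `|f s - f t - a * (s - t)| <= e * `|s - t|.
Proof.
split=> [[dft Dl] e e0|H].
  have : h^-1 *: (f (h *: 1 + t) - f t) @[h --> 0^'] --> a by rewrite -Dl.
  move/cvgrPdist_le => /(_ e e0) /nbhs_ballP [d /= d0 H].
  exists d => // s sd.
  have [->|st0] := eqVneq s t; first by rewrite !subrr mulr0 subr0 normr0 mulr0.
  have hn : s - t != 0 by rewrite subr_eq0.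
  have := H (s - t); rewrite /ball/= sub0r normrN => /(_ sd hn).
  rewrite /GRing.scale/= mulr1 subrK => {}H.
  rewrite -(ler_pM2r (x := `|s - t|)) ?normr_gt0// -normrM in H.
  apply: le_trans H; rewrite -normrN.
  rewrite le_eqVlt; apply/orP; left; apply/eqP; congr (`|_|).
  by field.
have H' : h^-1 *: (f (h *: 1 + t) - f t) @[h --> 0^'] --> a.
  apply/cvgrPdist_le => /= e e0; have [d d0 {}H] := H _ e0.
  apply/nbhs_ballP; exists d => //= h; rewrite /ball/= sub0r normrN => hd h0.
  have := H (h *: 1 + t); rewrite addrK /GRing.scale/= mulr1 => /(_ hd) {}H.
  rewrite -(ler_pM2r (x := `|h|)) ?normr_gt0// -normrM.
  apply: le_trans H; rewrite -normrN.
  rewrite le_eqVlt; apply/orP; left; apply/eqP; congr (`|_|).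
  by field.
split; first by apply/cvg_ex; exists a.
exact: (cvg_lim _ H').
Qed.

(** Curves are differentiated coordinatewise, so that the real mean value theorem and the
    fundamental theorem of calculus apply to each coordinate. *)
Definition cder1 c t l :=
  is_derive t 1 (fun s => cre (c s)) (cre l) /\ is_derive t 1 (fun s => cim (c s)) (cim l).

Lemma cder1_re c t l : cder1 c t l -> is_derive t 1 (fun s => cre (c s)) (cre l).
Proof. by case. Qed.

Lemma cder1_eq c t l l' : cder1 c t l -> l = l' -> cder1 c t l'.
Proof. by move=> + <-. Qed.
Lemma cder1_ext c d t l l' : cder1 c t l -> (forall s, c s = d s) -> l = l' -> cder1 d t l'.
Proof. by move=> + /funext <- <-. Qed.
Lemma cder1_local c d t l (r : R) : 0 < r -> (forall s, `|s - t| < r -> c s = d s) ->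
  cder1 c t l -> cder1 d t l.
Proof.
by move=> r0 cd [H1 H2]; split; [apply: rder_local H1|apply: rder_local H2];
  try exact: r0; move=> s st; rewrite cd.
Qed.
Lemma cder1_cst z t : cder1 (fun=> z) t 0.
Proof. by split; exact: rder_cst. Qed.
Lemma cder1R f t a : is_derive t 1 f a -> cder1 (fun s => RtoC (f s)) t (RtoC a).
Proof. by split => //; exact: rder_cst. Qed.
Lemma cder1D c d t l l' : cder1 c t l -> cder1 d t l' ->
  cder1 (fun s => c s + d s) t (l + l').
Proof.
move=> [c1 c2] [d1 d2]; split.
  by apply: (rder_ext (rderD c1 d1)) => *; rewrite !cE.
by apply: (rder_ext (rderD c2 d2)) => *; rewrite !cE.
Qed.
Lemma cder1N c t l : cder1 c t l -> cder1 (fun s => - c s) t (- l).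
Proof.
move=> [c1 c2]; split.
  by apply: (rder_ext (rderN c1)) => *; rewrite !cE.
by apply: (rder_ext (rderN c2)) => *; rewrite !cE.
Qed.
Lemma cder1B c d t l l' : cder1 c t l -> cder1 d t l' ->
  cder1 (fun s => c s - d s) t (l - l').
Proof. by move=> cl dl; apply: cder1D cl _; exact: cder1N. Qed.
Lemma cder1M c d t l l' : cder1 c t l -> cder1 d t l' ->
  cder1 (fun s => c s * d s) t (l * d t + c t * l').
Proof.
move=> [c1 c2] [d1 d2]; split.
  by apply: (rder_ext (rderB (rderM c1 d1) (rderM c2 d2))) => *; rewrite !cE; ring.
by apply: (rder_ext (rderD (rderM c1 d2) (rderM c2 d1))) => *; rewrite !cE; ring.
Qed.
Lemma cder1conj c t l : cder1 c t l -> cder1 (fun s => cconj (c s)) t (cconj l).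
Proof.
move=> [c1 c2]; split; first by apply: (rder_ext c1) => *; rewrite !cE.
by apply: (rder_ext (rderN c2)) => *; rewrite !cE.
Qed.

Lemma cder1P c t l : cder1 c t l <-> forall e : R, 0 < e ->
  exists2 d : R, 0 < d & forall s, `|s - t| < d ->
    cabs (c s - c t - RtoC (s - t) * l) <= e * `|s - t|.
Proof.
split=> [[/rderP H1 /rderP H2] e e0|H].
  have e2 : 0 < e / 2 by rewrite divr_gt0.
  have [d1 d10 {}H1] := H1 _ e2; have [d2 d20 {}H2] := H2 _ e2.
  exists (Num.min d1 d2); first by rewrite lt_min d10.
  move=> s; rewrite lt_min => /andP[/H1 {}H1 /H2 {}H2].
  apply: (le_trans (cabs_le _)); rewrite !cE.
  rewrite [in leRHS](splitr e) [leRHS]mulrDl; apply: lerD.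
    by apply: le_trans H1; rewrite le_eqVlt; apply/orP; left; apply/eqP; congr (`|_|); ring.
  by apply: le_trans H2; rewrite le_eqVlt; apply/orP; left; apply/eqP; congr (`|_|); ring.
split; apply/rderP => e e0; have [d d0 {}H] := H _ e0; exists d => // s /H {}H.
  apply: (le_trans _ (le_trans (cre_le _) H)); rewrite !cE.
  by rewrite le_eqVlt; apply/orP; left; apply/eqP; congr (`|_|); ring.
apply: (le_trans _ (le_trans (cim_le _) H)); rewrite !cE.
by rewrite le_eqVlt; apply/orP; left; apply/eqP; congr (`|_|); ring.
Qed.

Lemma cder1_comp (F : C -> C) c t l m : der_at F (c t) m -> cder1 c t l ->
  cder1 (fun s => F (c s)) t (m * l).
Proof.
move=> HF /cder1P Hc; apply/cder1P => e e0.
(* The added 1 keeps both constants positive. Half of [e] pays for the error of [F] on increments of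
   size [L |s - t|], half for the error of the curve multiplied by [|m|]. *)
pose L := cabs l + 1; pose M := cabs m + 1.
have L0 : 0 < L by rewrite ltr_wpDl// cabs_ge0.
have M0 : 0 < M by rewrite ltr_wpDl// cabs_ge0.
have [d1 d10 {}HF] := HF (e / (2 * L)) (divr_gt0 e0 (mulr_gt0 (ltr0Sn _ 1) L0)).
have [d2 d20 H2] := Hc 1 ltr01.
have [d3 d30 H3] := Hc (e / (2 * M)) (divr_gt0 e0 (mulr_gt0 (ltr0Sn _ 1) M0)).
exists (Num.min (d1 / L) (Num.min d2 d3)).
  by rewrite !lt_min d20 d30 divr_gt0.
move=> s; rewrite !lt_min => /and3P[s1 /H2 {}H2 /H3 {}H3].
have Hl : cabs (c s - c t) <= L * `|s - t|.
  apply: (le_trans (cabs_triangle _ (RtoC (s - t) * l))).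
  rewrite /L [leRHS]mulrDl [leRHS]addrC lerD//.
  by rewrite cabsM cabsR mulrC.
have {}HF : cabs (F (c s) - F (c t) - m * (c s - c t)) <= e / 2 * `|s - t|.
  apply: (le_trans (HF _ _)).
    by apply: (le_lt_trans Hl); rewrite mulrC -ltr_pdivlMr.
  apply: (le_trans (ler_wpM2l _ Hl)); first by rewrite divr_ge0// ltW// mulr_gt0.
  by rewrite le_eqVlt; apply/orP; left; apply/eqP; field; rewrite gt_eqF.
have -> : F (c s) - F (c t) - RtoC (s - t) * (m * l) =
   (F (c s) - F (c t) - m * (c s - c t)) + m * (c s - c t - RtoC (s - t) * l) by ring.
apply: (le_trans (cabsD _ _)); rewrite [in leRHS](splitr e) [leRHS]mulrDl lerD//.
rewrite cabsM; apply: (le_trans (ler_wpM2l (cabs_ge0 _) H3)).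
rewrite mulrA ler_wpM2r// mulrA ler_pdivrMr ?mulr_gt0//.
have -> : e / 2 * (2 * M) = M * e by field.
by rewrite ler_wpM2r ?(ltW e0)// lerDl.
Qed.

Lemma der_at_inv z : z != 0 -> der_at (fun w : C => w^-1) z (- (z ^+ 2)^-1).
Proof.
move=> z0 e e0; have az : 0 < cabs z by rewrite cabs_gt0.
exists (Num.min (cabs z / 2) (e * cabs z ^+ 3 / 2)).
  by rewrite lt_min !divr_gt0// mulr_gt0// exprn_gt0.
move=> w; rewrite lt_min => /andP[w1 w2].
have wz : cabs z / 2 <= cabs w.
  have := cabs_triangle z w; rewrite cabs_sub => H.
  by rewrite -(lerD2l (cabs z / 2)) -splitr (le_trans H)// lerD2r ltW.
have aw : 0 < cabs w by rewrite (lt_le_trans _ wz)// divr_gt0.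
have w0 : w != 0 by rewrite -cabs_gt0.
have -> : w^-1 - z^-1 - - (z ^+ 2)^-1 * (w - z) = (w - z) * ((w - z) / (w * z ^+ 2)).
  by field; rewrite w0 z0.
rewrite cabsM mulrC ler_wpM2r ?cabs_ge0// cabsM cabsV cabsM cabsX.
rewrite ler_pdivrMr ?mulr_gt0// ?exprn_gt0//.
apply: (le_trans (ltW w2)).
have -> : e * cabs z ^+ 3 / 2 = e * (cabs z / 2 * cabs z ^+ 2) by field.
by rewrite ler_wpM2l ?(ltW e0)// ler_wpM2r// exprn_ge0// cabs_ge0.
Qed.

End Curves.

(** * Continuity and integrals over a box *)

Section PlaneMeasurability.
Variable R : realType.
Local Notation C := (Cplx R).

(** [plane] carries the product sigma-algebra, which contains rectangles by construction; an open
    set is the countable union of the rational rectangles inside it. *)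
Lemma open_measurable_plane (U : set (plane R)) : open (U : set (R * R)) -> measurable U.
Proof.
move=> oU.
pose B (t : rat * rat * rat * rat) : set (plane R) :=
  `]ratr t.1.1.1, ratr t.1.1.2[%classic `*` `]ratr t.1.2, ratr t.2[%classic.
pose F t : set (plane R) := if `[< B t `<=` U >] then B t else set0.
have -> : U = \bigcup_t F t.
  apply/seteqP; split=> [[x y] Uq|q [t _]]; last first.
    by rewrite /F; case: asboolP => // BU; exact: BU.
  have : nbhs ((x, y) : R * R) U by exact: open_nbhs_nbhs.
  move=> /nbhs_ballP[e /= e0 eU].
  have [q1 /[!in_itv]/= /andP[q11 q12]] := rat_in_itvoo (ltr_pwDr e0 (lexx (x - e))).
  have [q2 /[!in_itv]/= /andP[q21 q22]] := rat_in_itvoo (ltr_pwDr e0 (lexx x)).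
  have [q3 /[!in_itv]/= /andP[q31 q32]] := rat_in_itvoo (ltr_pwDr e0 (lexx (y - e))).
  have [q4 /[!in_itv]/= /andP[q41 q42]] := rat_in_itvoo (ltr_pwDr e0 (lexx y)).
  have BU : B (q1, q2, q3, q4) `<=` U.
    move=> [a b] /= []; rewrite /= !in_itv/= => /andP[a1 a2] /andP[b1 b2].
    by apply: eU; split => /=; rewrite /ball/= ltr_norml; lra.
  exists (q1, q2, q3, q4) => //; rewrite /F; case: asboolP => // _.
  by split; rewrite /= in_itv/=; apply/andP; split; lra.
apply: countable_bigcupT_measurable; first exact: countableP.
move=> t; rewrite /F; case: asboolP => // _.
by apply: measurableX.
Qed.

Lemma measurable_fun_plane (U : set (plane R)) (f : R * R -> R) :
  open (U : set (R * R)) -> (forall q : R * R, U q -> {for q, continuous f}) ->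
  measurable_fun U (f : plane R -> measurableTypeR R).
Proof.
move=> oU cf; apply: (measurability _ (measurable_realfun.RGenOpens.measurableE R)).
move=> _ [_ [a [b ->] <-]]; apply: open_measurable_plane.
rewrite openE => q [Uq fq]; apply: filterI; first exact: open_nbhs_nbhs.
apply: cf => //; apply: open_nbhs_nbhs; split => //; exact: interval_open.
Qed.

Lemma toC_continuous : continuous (@toC R).
Proof.
move=> [x y]; apply/cvgrPdist_lt => /= e e0.
have [x0 er ->] := posC_ex e0.
suff : nbhs ((x, y) : R * R) (fun t => `|toC (x, y) - toC t| < RtoC x0) by [].
apply/nbhs_ballP; exists (x0 / 2) => /=; first by rewrite divr_gt0.
move=> [a b] []; rewrite /ball/= => h1 h2.
rewrite normC ltRtoC (le_lt_trans (cabs_le _))// !cE/=; lra.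
Qed.

Lemma contP (k : C -> R) z : {for z, continuous k} <->
  forall e : R, 0 < e -> exists2 d : R, 0 < d &
    forall w, cabs (w - z) < d -> `|k w - k z| < e.
Proof.
have FF : Filter (nbhs z) by exact: nbhs_filter.
split=> [/cvgrPdist_lt H e e0|H].
  have /nbhsCP[d d0 {}H] := H e e0; exists d => // w wz; rewrite distrC; exact: H.
apply/cvgrPdist_lt => e e0; have [d d0 {}H] := H e e0.
apply/nbhsCP; exists d => // w wz /=; rewrite distrC; exact: H.
Qed.
Lemma ccontP (k : C -> C) z : {for z, continuous k} <->
  forall e : R, 0 < e -> exists2 d : R, 0 < d &
    forall w, cabs (w - z) < d -> cabs (k w - k z) < e.
Proof.
have FF : Filter (nbhs z) by exact: nbhs_filter.
split=> [/cvgrPdist_lt H e e0|H].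
  have /nbhsCP[d d0 {}H] : \forall t \near z, `|k z - k t| < RtoC e.
    by apply: H; rewrite -RtoC0 ltRtoC.
  by exists d => // w wz; rewrite cabs_sub -ltRtoC -normC; exact: H.
apply/cvgrPdist_lt => e e0.
have [x0 er ->] := posC_ex e0.
have [d d0 {}H] := H _ er.
by apply/nbhsCP; exists d => // w wz /=; rewrite normC ltRtoC cabs_sub; exact: H.
Qed.

Lemma cont_cabs : continuous (@cabs R).
Proof.
move=> z; apply/contP => e e0; exists e => // w; exact: le_lt_trans (cabs_dist _ _).
Qed.
Lemma cont_cre : continuous (@cre R).
Proof.
by move=> z; apply/contP => e e0; exists e => // w; rewrite -creB; exact: le_lt_trans (cre_le _).
Qed.
Lemma cont_cim : continuous (@cim R).
Proof.
by move=> z; apply/contP => e e0; exists e => // w; rewrite -cimB; exact: le_lt_trans (cim_le _).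
Qed.
Lemma cont_ncim : continuous (fun z : C => - cim z).
Proof.
move=> z; apply/contP => e e0; exists e => // w.
by rewrite -opprD normrN -cimB; exact: le_lt_trans (cim_le _).
Qed.
Lemma cont_cconj : continuous (@cconj R).
Proof.
move=> z; apply/ccontP => e e0; exists e => // w.
by rewrite -cconjN -cconjD cabsconj.
Qed.
Lemma cont_RtoC : continuous (@RtoC R).
Proof.
move=> z; apply/cvgrPdist_lt => /= e e0.
have [x0 er ->] := posC_ex e0.
apply/nbhs_ballP; exists x0 => //= w.
by rewrite /ball/= -RtoCN -RtoCD normC ltRtoC cabsR.
Qed.
Lemma der_at_cont (f : C -> C) z l : der_at f z l -> {for z, continuous f}.
Proof.
move=> H; apply/ccontP => e e0.
have [d d0 {}H] := H 1 ltr01.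
pose L := 1 + cabs l.
have L0 : 0 < L by rewrite ltr_pwDl// cabs_ge0.
exists (Num.min d (e / L)); first by rewrite lt_min d0 divr_gt0.
move=> w; rewrite lt_min => /andP[/H {}H w2].
apply: (le_lt_trans (cabs_triangle _ (l * (w - z)))).
apply: (le_lt_trans (lerD H (lexx _))).
by rewrite cabsM -mulrDl mulrC -ltr_pdivlMr.
Qed.

Local Notation I11 := (`[(-1)%R : R, 1%R : R]%classic).

Lemma cont_compRC (c : R -> C) (f : C -> C) t : {for t, continuous c} ->
  {for c t, continuous f} -> {for t, continuous (fun s => f (c s))}.
Proof. exact: (@continuous_comp R C C). Qed.
Lemma cont_compRR (c : R -> C) (f : C -> R) t : {for t, continuous c} ->
  {for c t, continuous f} -> {for t, continuous (fun s => f (c s))}.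
Proof. exact: (@continuous_comp R C R). Qed.

(** Continuity at a point is wrapped in a record so that unification in the closure lemmas cannot
    unfold it into a statement about filters. *)
Record cct (F : C -> C) (z : C) : Prop := Cct {cctP : {for z, continuous F}}.
Record rct (F : C -> R) (z : C) : Prop := Rct {rctP : {for z, continuous F}}.
Definition rcont (F : C -> R) := forall z, rct F z.
Definition ccont (F : C -> C) := forall z, cct F z.
Lemma rcontP F : rcont F -> continuous F.
Proof. by move=> h z; exact: rctP (h z). Qed.

Lemma ct_cst (w z : C) : cct (fun=> w) z.
Proof. by split; exact: cst_continuous. Qed.
Lemma ct_id (z : C) : cct (fun w => w) z.
Proof. by split; exact: cvg_id. Qed.
Lemma ct_D (F G : C -> C) z : cct F z -> cct G z -> cct (fun w => F w + G w) z.
Proof. by move=> [h1] [h2]; split; exact: (cvgD h1 h2). Qed.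
Lemma ct_N (F : C -> C) z : cct F z -> cct (fun w => - F w) z.
Proof. by move=> [h1]; split; exact: (cvgN h1). Qed.
Lemma ct_B (F G : C -> C) z : cct F z -> cct G z -> cct (fun w => F w - G w) z.
Proof. by move=> h1 h2; exact: (ct_D h1 (ct_N h2)). Qed.
Lemma ct_M (F G : C -> C) z : cct F z -> cct G z -> cct (fun w => F w * G w) z.
Proof. by move=> [h1] [h2]; split; exact: (cvgM h1 h2). Qed.
Lemma ct_ext (F G : C -> C) z : (forall w, F w = G w) -> cct F z -> cct G z.
Proof. by move=> /funext ->. Qed.
Lemma ct_X (F : C -> C) n z : cct F z -> cct (fun w => F w ^+ n) z.
Proof.
move=> h; elim: n => [|n IH]; first exact: ct_cst.
by apply: (ct_ext _ (ct_M h IH)) => w; rewrite -exprS.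
Qed.
Lemma ct_V (F : C -> C) z : F z != 0 -> cct F z -> cct (fun w => (F w)^-1) z.
Proof.
move=> F0 [h]; split.
exact: (@continuous_comp C C C F (fun w => w^-1) z h (der_at_cont (der_at_inv F0))).
Qed.
Lemma ct_conj (F : C -> C) z : cct F z -> cct (fun w => cconj (F w)) z.
Proof. by move=> [h]; split; exact: (@continuous_comp C C C F (@cconj R) z h (@cont_cconj _)). Qed.
Lemma ct_RtoC (k : C -> R) z : rct k z -> cct (fun w => RtoC (k w)) z.
Proof. by move=> [h]; split; exact: (@continuous_comp C R C k (@RtoC R) z h (@cont_RtoC _)). Qed.
Lemma ct_re (F : C -> C) z : cct F z -> rct (fun w => cre (F w)) z.
Proof. by move=> [h]; split; exact: (@continuous_comp C C R F (@cre R) z h (@cont_cre _)). Qed.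
Lemma ct_im (F : C -> C) z : cct F z -> rct (fun w => cim (F w)) z.
Proof. by move=> [h]; split; exact: (@continuous_comp C C R F (@cim R) z h (@cont_cim _)). Qed.
Lemma ct_abs (F : C -> C) z : cct F z -> rct (fun w => cabs (F w)) z.
Proof. by move=> [h]; split; exact: (@continuous_comp C C R F (@cabs R) z h (@cont_cabs _)). Qed.
Lemma ct_der (F : C -> C) z l : der_at F z l -> cct F z.
Proof. by move=> /der_at_cont. Qed.
Lemma cctE (F : C -> C) z : cct F z <-> forall e : R, 0 < e -> exists2 d : R, 0 < d &
  forall w, cabs (w - z) < d -> cabs (F w - F z) < e.
Proof. by split=> [[]/ccontP//|/ccontP]. Qed.
Lemma rctE (F : C -> R) z : rct F z <-> forall e : R, 0 < e -> exists2 d : R, 0 < d &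
  forall w, cabs (w - z) < d -> `|F w - F z| < e.
Proof. by split=> [[]/contP//|/contP]. Qed.
Lemma rt_cst (w : R) (z : C) : rct (fun=> w) z.
Proof. by split; exact: cst_continuous. Qed.
Lemma rt_D (F G : C -> R) z : rct F z -> rct G z -> rct (fun w => F w + G w) z.
Proof. by move=> [h1] [h2]; split; exact: (cvgD h1 h2). Qed.
Lemma rt_N (F : C -> R) z : rct F z -> rct (fun w => - F w) z.
Proof. by move=> [h1]; split; exact: (cvgN h1). Qed.
Lemma rt_B (F G : C -> R) z : rct F z -> rct G z -> rct (fun w => F w - G w) z.
Proof. by move=> h1 h2; exact: (rt_D h1 (rt_N h2)). Qed.
Lemma rt_M (F G : C -> R) z : rct F z -> rct G z -> rct (fun w => F w * G w) z.
Proof. by move=> [h1] [h2]; split; exact: (cvgM h1 h2). Qed.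
Lemma rt_ext (F G : C -> R) z : (forall w, F w = G w) -> rct F z -> rct G z.
Proof. by move=> /funext ->. Qed.
Lemma rt_X (F : C -> R) n z : rct F z -> rct (fun w => F w ^+ n) z.
Proof.
move=> h; elim: n => [|n IH]; first exact: rt_cst.
by apply: (rt_ext _ (rt_M h IH)) => w; rewrite -exprS.
Qed.
Lemma rt_comp (f : R -> R) (F : C -> R) z : rct F z -> {for F z, continuous f} ->
  rct (fun w => f (F w)) z.
Proof. by move=> [h1] h2; split; exact: (@continuous_comp C R R F f z). Qed.
Lemma rt_V (F : C -> R) z : F z != 0 -> rct F z -> rct (fun w => (F w)^-1) z.
Proof. by move=> F0 h; apply: (rt_comp (f := fun x => x^-1)) h _; exact: inv_continuous. Qed.

(** This square contains the unit disk, and a function supported inside the open disk vanishes on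
    its sides; one domain of integration thus serves all compactly supported integrands. *)
Definition box : set (plane R) := I11 `*` I11.

Lemma measurable_box : measurable box.
Proof. by apply: measurableX. Qed.

Lemma bounded_box (k : C -> R) : rcont k ->
  exists M : R, forall q, box q -> `|k (toC q)| <= M.
Proof.
move=> /rcontP ck.
have cb : compact (box : set (R * R)) by apply: compact_setX; exact: segment_compact.
have cK : compact ((fun q : R * R => k (toC q)) @` (box : set (R * R))).
  apply: continuous_compact => //; apply: continuous_subspaceT => q.
  by apply: continuous_comp; [exact: toC_continuous|exact: ck].
have /compact_bounded[M [_ H]] := cK.
by exists (M + 1) => q bq; apply: (H (M + 1)); [rewrite ltrDl|exists q].
Qed.

Lemma area_box : (@area R box = 4%:E)%E.
Proof.
transitivity (@lebesgue_measure R I11 * @lebesgue_measure R I11)%E.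
  exact: product_measure1E.
rewrite lebesgue_measure_itv/= lte_fin.
have -> : (-1 < 1 :> R) by lra.
by rewrite -EFinD -EFinM; congr EFin; lra.
Qed.

Lemma integrable_box (k : C -> R) : rcont k ->
  (@area R).-integrable box (fun q => (k (toC q))%:E).
Proof.
move=> ck; have [M HM] := bounded_box ck; move/rcontP: ck => ck.
have -> : (fun q => (k (toC q))%:E) = EFin \o (fun q : plane R => k (toC q)) by [].
apply: (@measurable_bounded_integrable _ _ _ (@area R) (fun q => k (toC q)) _ measurable_box).
- by rewrite [ltLHS]area_box ltry.
- apply: (@measurable_funS _ _ _ _ setT) => //.
  apply: measurable_fun_plane; first exact: openT.
  by move=> q _; apply: continuous_comp; [exact: toC_continuous|exact: ck].
- exists M; split; first exact: num_real.
  by move=> x Mx q bq; apply: (le_trans (HM _ bq)); exact: ltW.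
Qed.

Definition J (k : C -> R) : R := \int[@area R]_(q in box) k (toC q).

Lemma J_D (k1 k2 : C -> R) : rcont k1 -> rcont k2 ->
  J (fun z => k1 z + k2 z) = J k1 + J k2.
Proof.
move=> c1 c2; rewrite /J RintegralD//; [exact: measurable_box|exact: integrable_box|exact: integrable_box].
Qed.
Lemma J_B (k1 k2 : C -> R) : rcont k1 -> rcont k2 ->
  J (fun z => k1 z - k2 z) = J k1 - J k2.
Proof.
move=> c1 c2; rewrite /J RintegralB//; [exact: measurable_box|exact: integrable_box|exact: integrable_box].
Qed.
Lemma J_Z (x : R) (k : C -> R) : rcont k -> J (fun z => x * k z) = x * J k.
Proof.
move=> c1; rewrite /J RintegralZl//; [exact: measurable_box|exact: integrable_box].
Qed.
Lemma J_le (k1 k2 : C -> R) : rcont k1 -> rcont k2 ->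
  (forall z, k1 z <= k2 z) -> J k1 <= J k2.
Proof.
move=> c1 c2 H; apply: le_Rintegral => //;
  [exact: measurable_box|exact: integrable_box|exact: integrable_box].
Qed.
Lemma J_le_box (k1 k2 : C -> R) : rcont k1 -> rcont k2 ->
  (forall q, box q -> k1 (toC q) <= k2 (toC q)) -> J k1 <= J k2.
Proof.
move=> c1 c2 H; apply: le_Rintegral => //;
  [exact: measurable_box|exact: integrable_box|exact: integrable_box].
Qed.
Lemma J_norm_le (k1 k2 : C -> R) : rcont k1 -> rcont k2 ->
  (forall q, box q -> `|k1 (toC q)| <= k2 (toC q)) -> `|J k1| <= J k2.
Proof.
move=> c1 c2 H; have cN : rcont (fun z => -1 * k2 z).
  by move=> z; apply: rt_M; [exact: rt_cst|exact: c2].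
rewrite ler_norml -mulN1r -J_Z//; apply/andP; split; apply: J_le_box => // q bq.
  by rewrite mulN1r lerNl; apply: le_trans (H _ bq); rewrite -normrN ler_norm.
exact: (le_trans (ler_norm _)) (H _ bq).
Qed.
Lemma J_ge0 (k : C -> R) : (forall z, 0 <= k z) -> 0 <= J k.
Proof. by move=> H; apply: Rintegral_ge0. Qed.
Lemma J_cst (x : R) : J (fun=> x) = 4 * x.
Proof.
by rewrite /J (Rintegral_cst _ measurable_box) [X in fine X]area_box mulrC.
Qed.
Lemma J_ext (k1 k2 : C -> R) : (forall z, k1 z = k2 z) -> J k1 = J k2.
Proof. by move=> /funext ->. Qed.

Lemma J_fubini_xy (k : C -> R) : rcont k ->
  (J k)%:E = (\int[@lebesgue_measure R]_(y in I11)
    (\int[@lebesgue_measure R]_(x in I11) (k (toC (x, y)))%:E))%E.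
Proof.
move=> ck; rewrite /J /Rintegral fineK; last first.
  by apply: integrable_fin_num; [exact: measurable_box|exact: integrable_box].
have ik := integrable_box ck.
rewrite integral_mkcond.
have ir : (@area R).-integrable setT ((fun q => (k (toC q))%:E) \_ box).
  by rewrite -integrable_mkcond//; exact: measurable_box.
rewrite -(integral21_prod_meas1 ir) [RHS]integral_mkcond.
apply: eq_integral => y _; rewrite /fubini_G patchE.
case: ifPn => yI.
  rewrite [RHS]integral_mkcond; apply: eq_integral => x _.
  rewrite !patchE; congr (if _ then _ else _).
  rewrite inE in yI; apply/idP/idP; rewrite !inE; first by case.
  by move=> xI; split.
rewrite (eq_integral (cst 0%E)) ?integral0// => x _.
rewrite patchE; case: ifPn => //; rewrite inE => -[_ /= yI'].
by move/negP: yI; case; rewrite inE.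
Qed.

Lemma J_fubini_yx (k : C -> R) : rcont k ->
  (J k)%:E = (\int[@lebesgue_measure R]_(x in I11)
    (\int[@lebesgue_measure R]_(y in I11) (k (toC (x, y)))%:E))%E.
Proof.
move=> ck; rewrite /J /Rintegral fineK; last first.
  by apply: integrable_fin_num; [exact: measurable_box|exact: integrable_box].
have ik := integrable_box ck.
rewrite integral_mkcond.
have ir : (@area R).-integrable setT ((fun q => (k (toC q))%:E) \_ box).
  by rewrite -integrable_mkcond//; exact: measurable_box.
rewrite -(integral12_prod_meas1 ir) [RHS]integral_mkcond.
apply: eq_integral => y _; rewrite /fubini_F patchE.
case: ifPn => yI.
  rewrite [RHS]integral_mkcond; apply: eq_integral => x _.
  rewrite !patchE; congr (if _ then _ else _).
  rewrite inE in yI; apply/idP/idP; rewrite !inE; first by case.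
  by move=> xI; split.
rewrite (eq_integral (cst 0%E)) ?integral0// => x _.
rewrite patchE; case: ifPn => //; rewrite inE => -[/= yI' _].
by move/negP: yI; case; rewrite inE.
Qed.

Lemma toC_subx (x w y : R) : toC (x, y) - toC (w, y) = RtoC (x - w) :> C.
Proof. by apply: cplx_eq; rewrite !cE/=; ring. Qed.
Lemma toC_suby (x w y : R) : toC (x, y) - toC (x, w) = iC R * RtoC (y - w) :> C.
Proof. by apply: cplx_eq; rewrite !cE/=; ring. Qed.
Lemma cont_toCx (y : R) : continuous (fun x : R => toC (x, y)).
Proof.
move=> x; apply/cvgrPdist_lt => /= e e0.
have [r er ->] := posC_ex e0.
apply/nbhs_ballP; exists r => //= w; rewrite /ball/= => xw.
rewrite normC ltRtoC.
rewrite toC_subx.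
by rewrite ?cabsM ?cabsI cabsR ?mul1r.
Qed.
Lemma cont_toCy (x : R) : continuous (fun y : R => toC (x, y)).
Proof.
move=> y; apply/cvgrPdist_lt => /= e e0.
have [r er ->] := posC_ex e0.
apply/nbhs_ballP; exists r => //= w; rewrite /ball/= => xw.
rewrite normC ltRtoC.
rewrite toC_suby.
by rewrite ?cabsM ?cabsI cabsR ?mul1r.
Qed.

Lemma FTC_box (f F : R -> R) (a b : R) : a < b -> continuous f ->
  (forall x : R, is_derive x 1 F (f x)) ->
  (\int[@lebesgue_measure R]_(x in `[a, b]) (f x)%:E = (F b - F a)%:E)%E.
Proof.
move=> ab cf dF; rewrite (@continuous_FTC2 _ f F) -?EFinB//.
- exact: continuous_subspaceT.
- have cF x : {for x, continuous F}.
    by apply: differentiable_continuous; apply/derivable1_diffP; apply: ex_derive.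
  split; [by move=> x _; apply: ex_derive|exact: cvg_at_right_filter (cF a)|
    exact: cvg_at_left_filter (cF b)].
- by move=> x _; rewrite derive1E derive_val.
Qed.

(** Fubini, then the fundamental theorem of calculus on each horizontal segment, whose end points
    lie on the vertical sides. *)
Lemma ibp_x (G Gx : C -> R) : rcont Gx ->
  (forall x y : R, is_derive x 1 (fun s => G (toC (s, y))) (Gx (toC (x, y)))) ->
  (forall z, `|cre z| = 1 -> G z = 0) -> J Gx = 0.
Proof.
move=> cG dG G0; apply: EFin_inj; rewrite J_fubini_xy//.
rewrite (eq_integral (cst 0%E)) ?integral0// => y _.
move/rcontP: cG => cG; rewrite (@FTC_box (fun x => Gx (toC (x, y))) (fun x => G (toC (x, y))))//.
- by rewrite !G0 ?subrr//= ?normrN normr1.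
- by move=> x; apply: continuous_comp; [exact: cont_toCx|exact: cG].
Qed.

Lemma ibp_y (G Gy : C -> R) : rcont Gy ->
  (forall x y : R, is_derive y 1 (fun s => G (toC (x, s))) (Gy (toC (x, y)))) ->
  (forall z, `|cim z| = 1 -> G z = 0) -> J Gy = 0.
Proof.
move=> cG dG G0; apply: EFin_inj; rewrite J_fubini_yx//.
rewrite (eq_integral (cst 0%E)) ?integral0// => x _.
move/rcontP: cG => cG; rewrite (@FTC_box (fun y => Gy (toC (x, y))) (fun y => G (toC (x, y))))//.
- by rewrite !G0 ?subrr//= ?normrN normr1.
- by move=> y; apply: continuous_comp; [exact: cont_toCy|exact: cG].
Qed.

End PlaneMeasurability.

(** * Goursat's theorem and primitives *)

Section Goursat.
Variable R : realType.

Lemma mean_value_ineq (f f' : R -> R) (a b K : R) : a <= b ->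
  (forall x, a <= x <= b -> is_derive x 1 f (f' x)) ->
  (forall x, a <= x <= b -> `|f' x| <= K) -> `|f b - f a| <= K * (b - a).
Proof.
rewrite le_eqVlt => /predU1P[->|ab] df f'K; first by rewrite !subrr normr0 mulr0.
have [x|x|c /[!in_itv]/= /andP[ac cb] ->] := @MVT R f f' a b ab.
- by rewrite in_itv/= => /andP[ax xb]; apply: df; rewrite !ltW.
- by apply: derivable_within_continuous => t /[!in_itv]/= tab; have [] := df _ tab.
- have f'c : `|f' c| <= K by apply: f'K; rewrite !ltW.
  by rewrite normrM [`|b - a|]gtr0_norm ?subr_gt0// ler_wpM2r// subr_ge0 ltW.
Qed.

Variables (P Q p q : R -> R -> R) (a b w0 h0 : R).
Hypotheses (w00 : 0 <= w0) (h00 : 0 <= h0).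
Let inr (x y : R) := (a <= x <= a + w0) && (b <= y <= b + h0).
Hypothesis dP : forall x y, inr x y -> is_derive x 1 (P y) (p x y).
Hypothesis dQ : forall x y, inr x y -> is_derive y 1 (Q x) (q x y).
(** The same [B] in both expansions says that [p dx + q dy] is closed at the point: the
    [y]-derivative of [p] is the [x]-derivative of [q]. No continuity of these derivatives is
    asked. *)
Hypothesis dpq : forall x y, inr x y -> exists A B D : R, forall e : R, 0 < e ->
  exists2 d : R, 0 < d & forall x' y', inr x' y' -> `|x' - x| < d -> `|y' - y| < d ->
    `|p x' y' - p x y - A * (x' - x) - B * (y' - y)| <= e * (`|x' - x| + `|y' - y|) /\
    `|q x' y' - q x y - B * (x' - x) - D * (y' - y)| <= e * (`|x' - x| + `|y' - y|).

(** The counterclockwise integral of [p dx + q dy] around the rectangle with lower left corner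
    [(x, y)] and sides [w], [h], written with antiderivatives along the sides. *)
Let L (x y w h : R) := P y (x + w) - P y x - (P (y + h) (x + w) - P (y + h) x)
  + (Q (x + w) (y + h) - Q (x + w) y) - (Q x (y + h) - Q x y).

(** Selects the corner of a quarter rectangle that carries at least a quarter of the boundary
    integral; if three quarters fail, the triangle inequality forces the fourth, which is why it is
    not tested. *)
Let step (w h : R) (z : R * R) : R * R :=
  if 4^-1 * `|L z.1 z.2 (2 * w) (2 * h)| <= `|L z.1 z.2 w h| then z else
  if 4^-1 * `|L z.1 z.2 (2 * w) (2 * h)| <= `|L (z.1 + w) z.2 w h| then (z.1 + w, z.2) else
  if 4^-1 * `|L z.1 z.2 (2 * w) (2 * h)| <= `|L z.1 (z.2 + h) w h| then (z.1, z.2 + h) else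
  (z.1 + w, z.2 + h).

Let stepP (w h : R) z : 4^-1 * `|L z.1 z.2 (2 * w) (2 * h)|
  <= `|L (step w h z).1 (step w h z).2 w h|.
Proof.
rewrite /step; case: ifPn => // H1; case: ifPn => // H2; case: ifPn => // H3.
rewrite -!ltNge in H1 H2 H3 => /=.
have E : L z.1 z.2 (2 * w) (2 * h) =
  L z.1 z.2 w h + L (z.1 + w) z.2 w h + L z.1 (z.2 + h) w h + L (z.1 + w) (z.2 + h) w h.
  have -> : 2 * w = w + w by ring.
  have -> : 2 * h = h + h by ring.
  by rewrite /L !addrA; ring.
have := ler_normD (L z.1 z.2 w h + L (z.1 + w) z.2 w h + L z.1 (z.2 + h) w h) (L (z.1 + w) (z.2 + h) w h).
have := ler_normD (L z.1 z.2 w h + L (z.1 + w) z.2 w h) (L z.1 (z.2 + h) w h).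
have := ler_normD (L z.1 z.2 w h) (L (z.1 + w) z.2 w h).
rewrite -E; lra.
Qed.

Let step_in w h z : 0 <= w -> 0 <= h ->
  [/\ z.1 <= (step w h z).1, (step w h z).1 + w <= z.1 + 2 * w,
      z.2 <= (step w h z).2 & (step w h z).2 + h <= z.2 + 2 * h].
Proof.
move=> w0' h0'; rewrite /step.
by case: ifP => _; [|case: ifP => _; [|case: ifP => _]]; split => /=; lra.
Qed.

Let wn n := w0 / 2 ^+ n.
Let hn n := h0 / 2 ^+ n.
Let wn2 n : 2 * wn n.+1 = wn n.
Proof. by rewrite /wn exprS; field; rewrite expf_neq0. Qed.
Let hn2 n : 2 * hn n.+1 = hn n.
Proof. by rewrite /hn exprS; field; rewrite expf_neq0. Qed.
Let wn0 n : 0 <= wn n. Proof. by rewrite /wn divr_ge0// exprn_ge0. Qed.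
Let hn0 n : 0 <= hn n. Proof. by rewrite /hn divr_ge0// exprn_ge0. Qed.

Fixpoint zn n : R * R := if n is m.+1 then step (wn m.+1) (hn m.+1) (zn m) else (a, b).

Let znS n : [/\ (zn n).1 <= (zn n.+1).1, (zn n.+1).1 + wn n.+1 <= (zn n).1 + wn n,
  (zn n).2 <= (zn n.+1).2 & (zn n.+1).2 + hn n.+1 <= (zn n).2 + hn n].
Proof. by have := step_in (zn n) (wn0 n.+1) (hn0 n.+1); rewrite wn2 hn2. Qed.

Let zn_mono m n : [/\ (zn n).1 <= (zn (m + n)%N).1, (zn (m + n)%N).1 + wn (m + n)%N <= (zn n).1 + wn n,
  (zn n).2 <= (zn (m + n)%N).2 & (zn (m + n)%N).2 + hn (m + n)%N <= (zn n).2 + hn n].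
Proof.
elim: m => [|m [H1 H2 H3 H4]]; first by split.
by have [K1 K2 K3 K4] := znS (m + n)%N; rewrite addSn; split; lra.
Qed.

Let zn_le m n : (zn m).1 <= (zn n).1 + wn n /\ (zn m).2 <= (zn n).2 + hn n.
Proof.
have [H1 H2 H3 H4] := zn_mono n m; have [K1 K2 K3 K4] := zn_mono m n.
rewrite addnC in H1 H2 H3 H4.
by have := wn0 (m + n)%N; have := hn0 (m + n)%N; lra.
Qed.

Let Ln n : (4^-1) ^+ n * `|L a b w0 h0| <= `|L (zn n).1 (zn n).2 (wn n) (hn n)|.
Proof.
elim: n => [|n IH]; first by rewrite expr0 mul1r /wn /hn !expr0 !divr1.
have := stepP (wn n.+1) (hn n.+1) (zn n); rewrite wn2 hn2; apply: le_trans.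
by rewrite exprS -mulrA ler_wpM2l// invr_ge0.
Qed.

Lemma wn_small (c d : R) : 0 < d -> exists n, c / 2 ^+ n < d.
Proof.
move=> d0; have [n Hn] : exists n : nat, c / d < n%:R.
  by exists (Num.bound `|c / d|); rewrite (le_lt_trans (ler_norm _))// archi_boundP.
exists n; rewrite ltr_pdivrMr ?exprn_gt0// mulrC -ltr_pdivrMr//.
by rewrite (lt_le_trans Hn)// -natrX ler_nat ltnW// ltn_expl.
Qed.

(** Bisection: the chosen quarters shrink to a point. There the affine part of the form has no
    circulation, as it is closed, so the integral at stage [n] is small compared with the squared
    size, while it is at least [4^-n] times the original one. *)
Lemma goursat_rectangle : P b (a + w0) - P b a - (P (b + h0) (a + w0) - P (b + h0) a)
  + (Q (a + w0) (b + h0) - Q (a + w0) b) - (Q a (b + h0) - Q a b) = 0.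
Proof.
rewrite -[LHS]/(L a b w0 h0).
(* The corners increase in both coordinates, so the common point of the nested rectangles is given
   by two suprema. *)
pose X := [set (zn n).1 | n in setT]; pose Y := [set (zn n).2 | n in setT].
have supX n : (zn n).1 <= sup X <= (zn n).1 + wn n.
  apply/andP; split.
    apply: ub_le_sup; last by exists n.
    by exists ((zn 0).1 + wn 0) => _ [m _ <-]; have [] := zn_le m 0.
  apply: ge_sup; first by exists (zn 0).1, 0.
  by move=> _ [m _ <-]; have [] := zn_le m n.
have supY n : (zn n).2 <= sup Y <= (zn n).2 + hn n.
  apply/andP; split.
    apply: ub_le_sup; last by exists n.
    by exists ((zn 0).2 + hn 0) => _ [m _ <-]; have [] := zn_le m 0.
  apply: ge_sup; first by exists (zn 0).2, 0.
  by move=> _ [m _ <-]; have [] := zn_le m n.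
set x := sup X in supX *; set y := sup Y in supY *.
have zin n x' y' : (zn n).1 <= x' <= (zn n).1 + wn n ->
    (zn n).2 <= y' <= (zn n).2 + hn n -> inr x' y'.
  have [H1 H2 H3 H4] := zn_mono n 0; rewrite addn0 in H1 H2 H3 H4.
  have ew : wn 0 = w0 by rewrite /wn expr0 divr1.
  have eh : hn 0 = h0 by rewrite /hn expr0 divr1.
  rewrite ew eh /= in H1 H2 H3 H4.
  by rewrite /inr; move=> /andP[? ?] /andP[? ?]; apply/andP; split; apply/andP; split; lra.
have xyin : inr x y by exact: (zin 0).
have [A [B [D H]]] := dpq xyin.
have main (e : R) : 0 < e -> `|L a b w0 h0| <= 2 * e * (w0 + h0) ^+ 2.
  move=> e0; have [d d0 {}H] := H e e0.
  have [n Hn] := wn_small (w0 + h0) d0.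
  have whn : wn n + hn n < d by rewrite /wn /hn -mulrDl.
  have := Ln n; set x0 := (zn n).1; set y0 := (zn n).2.
  have /andP[X1 X2] := supX n; have /andP[Y1 Y2] := supY n.
  rewrite -/x0 in X1 X2; rewrite -/y0 in Y1 Y2.
  set W := wn n; set Hh := hn n; rewrite -/W in X2 whn; rewrite -/Hh in Y2 whn.
  have W0 : 0 <= W := wn0 n. have H0 : 0 <= Hh := hn0 n.
  have est x' y' : x0 <= x' <= x0 + W -> y0 <= y' <= y0 + Hh ->
    `|p x' y' - p x y - A * (x' - x) - B * (y' - y)| <= e * (W + Hh) /\
    `|q x' y' - q x y - B * (x' - x) - D * (y' - y)| <= e * (W + Hh).
    move=> hx hy; have h1 : `|x' - x| <= W by move/andP: hx => [? ?]; rewrite ler_norml; lra.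
    have h2 : `|y' - y| <= Hh by move/andP: hy => [? ?]; rewrite ler_norml; lra.
    have [] := H x' y' (zin n _ _ hx hy) ltac:(lra) ltac:(lra).
    move=> E1 E2; split; [apply: (le_trans E1)|apply: (le_trans E2)].
      by rewrite ler_wpM2l ?(ltW e0)//; lra.
    by rewrite ler_wpM2l ?(ltW e0)//; lra.
  have I0 : y0 <= y0 <= y0 + Hh by lra.
  have I1 : y0 <= y0 + Hh <= y0 + Hh by lra.
  have K0 : x0 <= x0 <= x0 + W by lra.
  have K1 : x0 <= x0 + W <= x0 + W by lra.
  (* Opposite horizontal sides differ by [B * Hh] per unit length up to [2 e (W + Hh)]; the vertical
     sides below produce the same term with the opposite sign. *)
  have EP : `|(P y0 (x0 + W) - P (y0 + Hh) (x0 + W) + B * Hh * (x0 + W))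
      - (P y0 x0 - P (y0 + Hh) x0 + B * Hh * x0)| <= 2 * e * (W + Hh) * (x0 + W - x0).
    apply: (@mean_value_ineq (fun s => P y0 s - P (y0 + Hh) s + B * Hh * s)
       (fun s => p s y0 - p s (y0 + Hh) + B * Hh)); first lra.
      move=> s hs; apply: rder_ext (rderD (rderB (dP (zin n _ _ hs I0)) (dP (zin n _ _ hs I1))) (rderM (rder_cst (B * Hh) _) (rder_id _))) _ _.
      - by [].
      - by rewrite mul0r add0r mulr1.
    move=> s hs; have [E1 _] := est _ _ hs I0; have [E2 _] := est _ _ hs I1.
    by rewrite !ler_norml in E1 E2 *; lra.
  have EQ : `|(Q (x0 + W) (y0 + Hh) - Q x0 (y0 + Hh) - B * W * (y0 + Hh))
      - (Q (x0 + W) y0 - Q x0 y0 - B * W * y0)| <= 2 * e * (W + Hh) * (y0 + Hh - y0).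
    apply: (@mean_value_ineq (fun s => Q (x0 + W) s - Q x0 s - B * W * s)
       (fun s => q (x0 + W) s - q x0 s - B * W)); first lra.
      move=> s hs; apply: rder_ext (rderB (rderB (dQ (zin n _ _ K1 hs)) (dQ (zin n _ _ K0 hs))) (rderM (rder_cst (B * W) _) (rder_id _))) _ _.
      - by [].
      - by rewrite mul0r add0r mulr1.
    move=> s hs; have [_ E1] := est _ _ K0 hs; have [_ E2] := est _ _ K1 hs.
    by rewrite !ler_norml in E1 E2 *; lra.
  have LE : `|L x0 y0 W Hh| <= 2 * e * (W + Hh) ^+ 2.
    have -> : 2 * e * (W + Hh) ^+ 2 = 2 * e * (W + Hh) * (x0 + W - x0) +
       2 * e * (W + Hh) * (y0 + Hh - y0) by ring.
    apply: le_trans (lerD EP EQ).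
    apply: le_trans (ler_normD _ _).
    rewrite le_eqVlt; apply/orP; left; apply/eqP; congr (`|_|); rewrite /L; ring.
  move=> /le_trans /(_ LE).
  (* The sides have been halved [n] times, which cancels the factor [4^-n] of [Ln] exactly. *)
  have -> : (W + Hh) ^+ 2 = 4^-1 ^+ n * (w0 + h0) ^+ 2.
    rewrite /W /Hh /wn /hn -mulrDl exprMn mulrC; congr (_ * _).
    rewrite -exprVn -exprM mulnC exprM; congr (_ ^+ _); by field.
  by rewrite mulrCA ler_pM2l ?exprn_gt0// invr_gt0.
apply/eqP; rewrite -normr_le0; apply/ler_addgt0Pr => e e0; rewrite add0r.
have C0 : 0 < 2 * ((w0 + h0) ^+ 2 + 1) by rewrite mulr_gt0// ltr_wpDl// sqr_ge0.
apply: (le_trans (main (e / (2 * ((w0 + h0) ^+ 2 + 1))) _)); first by rewrite divr_gt0.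
set k := (w0 + h0) ^+ 2 in C0 *; have k0 : 0 <= k by exact: sqr_ge0.
have -> : 2 * (e / (2 * (k + 1))) * k = e * (k / (k + 1)) by field; rewrite gt_eqF// ltr_wpDl.
by rewrite ler_piMr ?(ltW e0)// ler_pdivrMr ?mul1r ?lerDl// ltr_wpDl.
Qed.

End Goursat.

(** * Primitives of closed forms and of holomorphic functions *)

Section Primitive.
Variable R : realType.
Local Notation C := (Cplx R).

Lemma antiderivative (f : R -> R) (a b : R) : continuous f ->
  exists F : R -> R, forall x, a < x < b -> is_derive x 1 F (f x).
Proof.
move=> cf; exists (fun x => \int[@lebesgue_measure R]_(t in `[a, x]) f t)%R.
move=> x /andP[ax xb].
have [|H1 H2] := @continuous_FTC1_closed R f a x b xb _ ax (cf x).
  apply: continuous_compact_integrable; first exact: segment_compact.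
  exact: continuous_subspaceT.
by apply: DeriveDef; [exact: H1|rewrite -derive1E; exact: H2].
Qed.

(** Integrating along the bottom side and then upwards, or up the left side and then across, gives
    the same value by Goursat. The first path exhibits the derivative in [y], the second the one in
    [x]. *)
Lemma closed_form_primitive (p q : R -> R -> R) (a b w : R) : 0 < w ->
  (forall y, continuous (p^~ y)) -> (forall x, continuous (q x)) ->
  (forall x y, a <= x <= a + w -> b <= y <= b + w -> exists A B D : R, forall e : R, 0 < e ->
    exists2 d : R, 0 < d & forall x' y', a <= x' <= a + w -> b <= y' <= b + w ->
      `|x' - x| < d -> `|y' - y| < d ->
      `|p x' y' - p x y - A * (x' - x) - B * (y' - y)| <= e * (`|x' - x| + `|y' - y|) /\
      `|q x' y' - q x y - B * (x' - x) - D * (y' - y)| <= e * (`|x' - x| + `|y' - y|)) ->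
  exists G : R -> R -> R, forall x y, a < x < a + w -> b < y < b + w ->
    is_derive x 1 (G^~ y) (p x y) /\ is_derive y 1 (G x) (q x y).
Proof.
move=> w0 cp cq dpq.
have [P dP] := choice (fun y => @antiderivative (p^~ y) (a - 1) (a + w + 1) (cp y)).
have [Q dQ] := choice (fun x => @antiderivative (q x) (b - 1) (b + w + 1) (cq x)).
exists (fun x y => P b x - P b a + (Q x y - Q x b)).
have GE x y : a < x < a + w -> b < y < b + w ->
    P b x - P b a + (Q x y - Q x b) = P y x - P y a + (Q a y - Q a b).
  move=> /andP[x1 x2] /andP[y1 y2].
  have := @goursat_rectangle R P Q p q a b (x - a) (y - b).
  have -> : a + (x - a) = x by ring.
  have -> : b + (y - b) = y by ring.
  move=> H; apply/eqP; rewrite -subr_eq0; apply/eqP.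
  rewrite -[RHS]H.
  - ring.
  - by rewrite subr_ge0 ltW.
  - by rewrite subr_ge0 ltW.
  - by move=> x' y' /andP[/andP[? ?] _]; apply: dP; lra.
  - by move=> x' y' /andP[_ /andP[? ?]]; apply: dQ; lra.
  - move=> x' y' /andP[/andP[? ?] /andP[? ?]].
    have [A [B [D H']]] := dpq x' y' ltac:(lra) ltac:(lra).
    exists A, B, D => e e0; have [d d0 {}H'] := H' e e0; exists d => // x'' y''.
    by move=> /andP[/andP[? ?] /andP[? ?]]; apply: H'; lra.
move=> x y hx hy; split.
  have hx' := hx; move/andP: hx' => [x1 x2].
  apply: (@rder_local R (fun s => P y s - P y a + (Q a y - Q a b)) _ _ _ (Num.min (x - a) (a + w - x))).
  - by rewrite lt_min; lra.
  - move=> s; rewrite lt_min !ltr_norml => /andP[/andP[? ?] /andP[? ?]].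
    by rewrite GE//; lra.
  - apply: (rder_ext (rderD (rderB (dP y x _) (rder_cst (P y a) _)) (rder_cst (Q a y - Q a b) _))) => //.
      by lra.
    by rewrite subr0 addr0.
move/andP: hy => [y1 y2].
apply: (rder_ext (rderD (rder_cst (P b x - P b a) _) (rderB (dQ x y _) (rder_cst (Q x b) _)))) => //.
  by lra.
by rewrite subr0 add0r.
Qed.

(** The real and imaginary parts of [f dz] are [Re f dx - Im f dy] and [Im f dx + Re f dy]; complex
    differentiability of [f] is exactly what makes both closed. *)
Lemma local_primitive (f : C -> C) (z0 : C) (r : R) : 0 < r ->
  (forall z, cabs (z - z0) < r -> exists l, der_at f z l) ->
  exists (F : C -> C) (d : R), 0 < d /\ forall x y, cabs (toC (x, y) - z0) < d ->
    cder1 (fun s => F (toC (s, y))) x (f (toC (x, y))) /\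
    cder1 (fun s => F (toC (x, s))) y (iC R * f (toC (x, y))).
Proof.
move=> r0 df; pose w := r / 2; pose a := cre z0 - r / 4; pose b := cim z0 - r / 4.
(* Clamping the coordinates to a square inside the disc extends [f] to a function continuous in each
   variable on the whole line, as [closed_form_primitive] demands. *)
pose cl (a x : R) := Num.max a (Num.min x (a + w)).
have w0 : 0 < w by rewrite divr_gt0.
have clin c x : c <= cl c x <= c + w.
  by rewrite /cl le_max lexx /= ge_max ge_min lexx orbT andbT lerDl ltW.
have clid c x : c <= x <= c + w -> cl c x = x.
  by move=> /andP[h1 h2]; rewrite /cl (min_idPl h2) (max_idPr h1).
have clc c : continuous (cl c).
  move=> x; apply: (@continuous_max _ _ (fun=> c) (fun x => Num.min x (c + w)) x).
    exact: cvg_cst.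
  by apply: (@continuous_min _ _ id (fun=> c + w) x); [exact: cvg_id|exact: cvg_cst].
have inD x y : a <= x <= a + w -> b <= y <= b + w -> cabs (toC (x, y) - z0) < r.
  rewrite /a /b /w => /andP[? ?] /andP[? ?]; apply: (le_lt_trans (cabs_le _)).
  rewrite !cE/= -[`|x - _|]/(`|x - cre z0|).
  have h1 : `|x - cre z0| <= r / 4 by rewrite ler_norml; lra.
  have h2 : `|y - cim z0| <= r / 4 by rewrite ler_norml; lra.
  by lra.
pose g x y := f (toC (cl a x, cl b y)).
have cg1 y : continuous (fun x => g x y).
  move=> x; have [l /der_at_cont cfl] := df _ (inD _ _ (clin a x) (clin b y)).
  have c1 : {for x, continuous (fun x => toC (cl a x, cl b y) : C)}.
    exact: (@continuous_comp R R C (cl a) (fun x => toC (x, cl b y)) x (clc a x) (@cont_toCx R _ _)).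
  exact: (@cont_compRC R (fun x => toC (cl a x, cl b y)) f x c1 cfl).
have cg2 x : continuous (fun y => g x y).
  move=> y; have [l /der_at_cont cfl] := df _ (inD _ _ (clin a x) (clin b y)).
  have c1 : {for y, continuous (fun y => toC (cl a x, cl b y) : C)}.
    exact: (@continuous_comp R R C (cl b) (fun y => toC (cl a x, y)) y (clc b y) (@cont_toCy R _ _)).
  exact: (@cont_compRC R (fun y => toC (cl a x, cl b y)) f y c1 cfl).
have dg x y : a <= x <= a + w -> b <= y <= b + w -> exists l : C, forall e : R, 0 < e ->
    exists2 d : R, 0 < d & forall x' y', a <= x' <= a + w -> b <= y' <= b + w ->
      `|x' - x| < d -> `|y' - y| < d ->
      cabs (g x' y' - g x y - l * toC (x' - x, y' - y)) <= e * (`|x' - x| + `|y' - y|).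
  move=> hx hy; have [l H] := df _ (inD _ _ hx hy); exists l => e e0.
  have [d d0 {}H] := H e e0; exists (d / 2); first by rewrite divr_gt0.
  move=> x' y' hx' hy' dx' dy'; rewrite /g !clid//.
  have E : toC (x' - x, y' - y) = toC (x', y') - toC (x, y) :> C.
    by apply: cplx_eq; rewrite !cE.
  have B : cabs (toC (x', y') - toC (x, y)) <= `|x' - x| + `|y' - y|.
    by apply: (le_trans (cabs_le _)); rewrite !cE.
  rewrite E; apply: (le_trans (H _ _)); last by rewrite ler_wpM2l ?(ltW e0).
  by apply: (le_lt_trans B); lra.
have [G1 H1] : exists G : R -> R -> R, forall x y, a < x < a + w -> b < y < b + w ->
    is_derive x 1 (G^~ y) (cre (g x y)) /\ is_derive y 1 (G x) (- cim (g x y)).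
  apply: (@closed_form_primitive (fun x y => cre (g x y)) (fun x y => - cim (g x y))) => //.
  - by move=> y x; exact: (@cont_compRR R (g^~ y) (@cre R) x (cg1 y x) (@cont_cre R _)).
  - by move=> x y; exact: (@cont_compRR R (g x) (fun z => - cim z) y (cg2 x y) (@cont_ncim R _)).
  - move=> x y hx hy; have [l Hl] := dg x y hx hy.
    exists (cre l), (- cim l), (- cre l) => e e0; have [d d0 H] := Hl e e0.
    exists d => // x' y' hx' hy' dx' dy'; have {}H := H _ _ hx' hy' dx' dy'.
    split; [apply: (le_trans _ (le_trans (cre_le _) H))|apply: (le_trans _ (le_trans (cim_le _) H))].
      by rewrite !cE/= le_eqVlt; apply/orP; left; apply/eqP; congr (`|_|); ring.
    rewrite -normrN.
    by rewrite !cE/= le_eqVlt; apply/orP; left; apply/eqP; congr (`|_|); ring.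
have [G2 H2] : exists G : R -> R -> R, forall x y, a < x < a + w -> b < y < b + w ->
    is_derive x 1 (G^~ y) (cim (g x y)) /\ is_derive y 1 (G x) (cre (g x y)).
  apply: (@closed_form_primitive (fun x y => cim (g x y)) (fun x y => cre (g x y))) => //.
  - by move=> y x; exact: (@cont_compRR R (g^~ y) (@cim R) x (cg1 y x) (@cont_cim R _)).
  - by move=> x y; exact: (@cont_compRR R (g x) (@cre R) y (cg2 x y) (@cont_cre R _)).
  - move=> x y hx hy; have [l Hl] := dg x y hx hy.
    exists (cim l), (cre l), (- cim l) => e e0; have [d d0 H] := Hl e e0.
    exists d => // x' y' hx' hy' dx' dy'; have {}H := H _ _ hx' hy' dx' dy'.
    split; [apply: (le_trans _ (le_trans (cim_le _) H))|apply: (le_trans _ (le_trans (cre_le _) H))].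
      by rewrite !cE/= le_eqVlt; apply/orP; left; apply/eqP; congr (`|_|); ring.
    by rewrite !cE/= le_eqVlt; apply/orP; left; apply/eqP; congr (`|_|); ring.
exists (fun z => toC (G1 (cre z) (cim z), G2 (cre z) (cim z))), (r / 4); split.
  by rewrite divr_gt0.
move=> x y xyd.
have := le_lt_trans (cre_le _) xyd; have := le_lt_trans (cim_le _) xyd.
rewrite !cE/= !ltr_norml => /andP[i1 i2] /andP[i3 i4].
have hx : a < x < a + w by rewrite /a /w; lra.
have hy : b < y < b + w by rewrite /b /w; lra.
have gE : g x y = f (toC (x, y)).
  have hx' : a <= x <= a + w by move/andP: hx => [? ?]; lra.
  have hy' : b <= y <= b + w by move/andP: hy => [? ?]; lra.
  by rewrite /g !clid.
have [d1 d2] := H1 x y hx hy; have [d3 d4] := H2 x y hx hy.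
rewrite -gE; split; split => //=.
- by apply: (rder_ext d2) => //; rewrite !cE; ring.
- by apply: (rder_ext d4) => //; rewrite !cE; ring.
Qed.

End Primitive.

(** * Wirtinger derivatives *)

Section Wirtinger.
Variable R : realType.
Local Notation C := (Cplx R).
Implicit Types (z w a b : C) (F G : C -> C).

(** [a] and [b] are the derivatives in [z] and in [conj z]: the partials are [G_x = a + b] and
    [G_y = i (a - b)]. Only partial derivatives are involved, which is all that Fubini needs. *)
Definition wirt G z a b :=
  cder1 (fun s => G (toC (s, cim z))) (cre z) (a + b) /\
  cder1 (fun s => G (toC (cre z, s))) (cim z) (iC R * (a - b)).

Lemma toC_reim z : toC (cre z, cim z) = z. Proof. exact: toCK. Qed.

Lemma iC2 : iC R * iC R = -1.
Proof. by apply: cplx_eq; rewrite !cE; ring. Qed.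
Lemma cconj_iC : cconj (iC R) = - iC R.
Proof. by apply: cplx_eq; rewrite !cE; ring. Qed.

Lemma cder1_toCx (y : R) (x : R) : cder1 (fun s => toC (s, y) : C) x 1.
Proof. by split => /=; [exact: rder_id|exact: rder_cst]. Qed.
Lemma cder1_toCy (x : R) (y : R) : cder1 (fun s => toC (x, s) : C) y (iC R).
Proof. by split => /=; [exact: rder_cst|exact: rder_id]. Qed.

Lemma wirt_eq G z a b a' b' : wirt G z a b -> a = a' -> b = b' -> wirt G z a' b'.
Proof. by move=> + <- <-. Qed.

Lemma wirt_ext F G z a b a' b' : wirt F z a b -> (forall w, F w = G w) ->
  a = a' -> b = b' -> wirt G z a' b'.
Proof. by move=> + /funext <- <- <-. Qed.

Lemma wirt_local F G z a b (r : R) : 0 < r ->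
  (forall w, cabs (w - z) < r -> F w = G w) -> wirt F z a b -> wirt G z a b.
Proof.
move=> r0 FG [H1 H2]; split.
  apply: (cder1_local r0) H1.
  move=> s sr; apply: FG; rewrite -{2}(toC_reim z).
  have -> : toC (s, cim z) - toC (cre z, cim z) = RtoC (s - cre z) :> C by apply: cplx_eq; rewrite !cE/=; ring.
  by rewrite cabsR.
apply: (cder1_local r0) H2.
move=> s sr; apply: FG; rewrite -{2}(toC_reim z).
have -> : toC (cre z, s) - toC (cre z, cim z) = iC R * RtoC (s - cim z) :> C by apply: cplx_eq; rewrite !cE/=; ring.
by rewrite cabsM cabsI mul1r cabsR.
Qed.

Lemma wirt_cst w z : wirt (fun=> w) z 0 0.
Proof. by split; apply: cder1_eq (cder1_cst _ _) _; rewrite ?subrr ?addr0 ?mulr0. Qed.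
Lemma wirtD F G z a b a' b' : wirt F z a b -> wirt G z a' b' ->
  wirt (fun w => F w + G w) z (a + a') (b + b').
Proof.
move=> [F1 F2] [G1 G2]; split.
  by apply: (cder1_eq (cder1D F1 G1)); ring.
by apply: (cder1_eq (cder1D F2 G2)); ring.
Qed.
Lemma wirtN F z a b : wirt F z a b -> wirt (fun w => - F w) z (- a) (- b).
Proof.
move=> [F1 F2]; split.
  by apply: (cder1_eq (cder1N F1)); ring.
by apply: (cder1_eq (cder1N F2)); ring.
Qed.
Lemma wirtB F G z a b a' b' : wirt F z a b -> wirt G z a' b' ->
  wirt (fun w => F w - G w) z (a - a') (b - b').
Proof. by move=> h1 h2; exact: wirtD h1 (wirtN h2). Qed.
Lemma wirtM F G z a b a' b' : wirt F z a b -> wirt G z a' b' ->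
  wirt (fun w => F w * G w) z (a * G z + F z * a') (b * G z + F z * b').
Proof.
move=> [F1 F2] [G1 G2]; split.
  by apply: (cder1_eq (cder1M F1 G1)); rewrite toC_reim; ring.
by apply: (cder1_eq (cder1M F2 G2)); rewrite toC_reim; ring.
Qed.
Lemma wirt_conj F z a b : wirt F z a b -> wirt (fun w => cconj (F w)) z (cconj b) (cconj a).
Proof.
move=> [F1 F2]; split.
  by apply: (cder1_eq (cder1conj F1)); rewrite cconjD; ring.
by apply: (cder1_eq (cder1conj F2)); rewrite cconjM cconjD cconjN cconj_iC; ring.
Qed.
Lemma wirt_comp F G z a b l : der_at F (G z) l -> wirt G z a b ->
  wirt (fun w => F (G w)) z (l * a) (l * b).
Proof.
move=> HF [G1 G2]; rewrite -(toC_reim z) in HF; split.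
  by apply: (cder1_eq (@cder1_comp _ F (fun s => G (toC (s, cim z))) _ _ _ HF G1)); ring.
by apply: (cder1_eq (@cder1_comp _ F (fun s => G (toC (cre z, s))) _ _ _ HF G2)); ring.
Qed.
Lemma wirt_id z : wirt id z 1 0.
Proof.
split; first by apply: cder1_eq (cder1_toCx _ _) _; rewrite addr0.
by apply: cder1_eq (cder1_toCy _ _) _; rewrite subr0 mulr1.
Qed.
Lemma wirt_holo F z l : der_at F z l -> wirt F z l 0.
Proof. by move=> h; apply: wirt_eq (wirt_comp h (wirt_id z)) _ _; ring. Qed.
Lemma wirtV G z a b : G z != 0 -> wirt G z a b ->
  wirt (fun w => (G w)^-1) z (- a / G z ^+ 2) (- b / G z ^+ 2).
Proof.
move=> G0 h; apply: wirt_eq (wirt_comp (der_at_inv G0) h) _ _;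
by rewrite mulNr mulNr mulrC.
Qed.
Lemma wirt_real (f : R -> R) (k : C -> R) z a b l :
  is_derive (k z) 1 f l -> wirt (fun w => RtoC (k w)) z a b ->
  wirt (fun w => RtoC (f (k w))) z (RtoC l * a) (RtoC l * b).
Proof.
move=> fl [[G1 G1'] [G2 G2']].
(* The differentiated function is real-valued, so uniqueness of derivatives forces both of its
   partials to be real. *)
have E1 : cim (a + b) = 0 by case: G1' => _ <-; rewrite derive_cst.
have E2 : cim (iC R * (a - b)) = 0 by case: G2' => _ <-; rewrite derive_cst.
split.
  have := rder_comp (f := f) (a := l) _ G1; rewrite /= toC_reim => /(_ fl) H.
  split; first by apply: rder_ext H _ _ => // ; rewrite -mulrDr !cE !mul0r subr0.
  by rewrite -mulrDr cimM /= E1 mulr0 mul0r addr0; exact: rder_cst.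
have := rder_comp (f := f) (a := l) _ G2; rewrite /= toC_reim => /(_ fl) H.
have -> : iC R * (RtoC l * a - RtoC l * b) = RtoC l * (iC R * (a - b)) by ring.
split; first by apply: rder_ext H _ _ => // ; rewrite !cE !mul0r subr0.
by rewrite cimM /= E2 mulr0 mul0r addr0; exact: rder_cst.
Qed.

(** The means by which a computation with the Wirtinger rules is turned into the value of a complex
    derivative. *)
Lemma der_at_wirt_uniq F z l a b : der_at F z l -> wirt F z a b -> l = a.
Proof.
move=> /wirt_holo [[H1 H2] [H3 H4]] [[K1 K2] [K3 K4]].
have e1 : cre (l + 0) = cre (a + b) by case: H1 => _ <-; case: K1 => _ <-.
have e2 : cim (l + 0) = cim (a + b) by case: H2 => _ <-; case: K2 => _ <-.
have e3 : cre (iC R * (l - 0)) = cre (iC R * (a - b)) by case: H3 => _ <-; case: K3 => _ <-.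
have e4 : cim (iC R * (l - 0)) = cim (iC R * (a - b)) by case: H4 => _ <-; case: K4 => _ <-.
move: e1 e2 e3 e4; rewrite !cE => e1 e2 e3 e4.
by apply: cplx_eq; lra.
Qed.

Definition CJ (G : C -> C) : C := toC (J (fun z => cre (G z)), J (fun z => cim (G z))).

Lemma ccont_re G : ccont G -> rcont (fun z => cre (G z)).
Proof. by move=> cG z; exact: ct_re. Qed.
Lemma ccont_im G : ccont G -> rcont (fun z => cim (G z)).
Proof. by move=> cG z; exact: ct_im. Qed.
Lemma ccont_cabs G : ccont G -> rcont (fun z => cabs (G z)).
Proof. by move=> cG z; exact: ct_abs. Qed.

Lemma CJ_D F G : ccont F -> ccont G -> CJ (fun z => F z + G z) = CJ F + CJ G.
Proof.
move=> cF cG; have cF1 := ccont_re cF; have cF2 := ccont_im cF.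
have cG1 := ccont_re cG; have cG2 := ccont_im cG.
by apply: cplx_eq; rewrite !cE /CJ /= -J_D//; apply: J_ext => z; rewrite !cE.
Qed.
Lemma CJ_Z w G : ccont G -> CJ (fun z => w * G z) = w * CJ G.
Proof.
move=> cG; have cG1 := ccont_re cG; have cG2 := ccont_im cG.
have cZ (x : R) (k : C -> R) : rcont k -> rcont (fun z => x * k z).
  by move=> ck z; apply: rt_M; [exact: rt_cst|exact: ck].
apply: cplx_eq; rewrite !cE /CJ /= -!J_Z// -?J_B -?J_D//; try exact: cZ.
- by apply: J_ext => z; rewrite !cE.
- by apply: J_ext => z; rewrite !cE.
Qed.
Lemma CJ_B F G : ccont F -> ccont G -> CJ (fun z => F z - G z) = CJ F - CJ G.
Proof.
move=> cF cG.
have cN : ccont (fun z => -1 * G z).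
  by move=> z; apply: ct_M; [exact: ct_cst|exact: cG].
have -> : CJ F - CJ G = CJ F + CJ (fun z => -1 * G z) by rewrite CJ_Z// mulN1r.
by rewrite -CJ_D//; congr CJ; apply/funext => z; rewrite mulN1r.
Qed.
Lemma CJ_ext F G : (forall z, F z = G z) -> CJ F = CJ G.
Proof. by move=> /funext ->. Qed.
Lemma CJ_le G (k : C -> R) : ccont G -> rcont k ->
  (forall q, box q -> cabs (G (toC q)) <= k (toC q)) -> cabs (CJ G) <= 2 * J k.
Proof.
move=> cG ck Gk; have cG1 := ccont_re cG; have cG2 := ccont_im cG.
apply: (le_trans (cabs_le _)); rewrite /CJ /= mulr_natl mulr2n lerD//; apply: J_norm_le => // q bq.
  exact: (le_trans (cre_le _)) (Gk _ bq).
exact: (le_trans (cim_le _)) (Gk _ bq).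
Qed.

(** Stokes' formula for compact support. The two integrations by parts kill the integrals of
    [Gz + Gb] and of [i (Gz - Gb)], hence those of [Gz] and [Gb]. Two radii are used because [G] is
    regular only on a disc, while its support has to stay strictly inside. *)
Lemma wirt_int0 G Gz Gb (z0 : C) (r0 r : R) : r < r0 -> cabs z0 + r < 1 ->
  (forall z, cabs (z - z0) < r0 ->
    [/\ wirt G z (Gz z) (Gb z), cct Gz z & cct Gb z]) ->
  (forall z, r < cabs (z - z0) -> [/\ G z = 0, Gz z = 0 & Gb z = 0]) ->
  [/\ ccont Gz, ccont Gb, CJ Gz = 0 & CJ Gb = 0].
Proof.
move=> rr0 z0r H1 H2.
have cloc (k : C -> C) : (forall z, cabs (z - z0) < r0 -> cct k z) ->
    (forall z, r < cabs (z - z0) -> k z = 0) -> ccont k.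
  move=> h1 h2 z; have [zr|zr] := ltP (cabs (z - z0)) r0; first exact: h1.
  have rz : r < cabs (z - z0) by exact: lt_le_trans zr.
  apply/cctE => e e0; exists (cabs (z - z0) - r); first by rewrite subr_gt0.
  move=> w wz; rewrite !h2 ?subrr ?cabs0//.
  have := cabs_triangle (z - z0) (w - z0).
  have -> : z - z0 - (w - z0) = z - w by ring.
  by rewrite (cabs_sub z w); lra.
have cz : ccont Gz by apply: cloc => z hz; [have [] := H1 z hz|have [] := H2 z hz].
have cb : ccont Gb by apply: cloc => z hz; [have [] := H1 z hz|have [] := H2 z hz].
have wG z : wirt G z (Gz z) (Gb z).
  have [zr|zr] := ltP (cabs (z - z0)) r0; first by have [] := H1 z zr.
  have rz : r < cabs (z - z0) by exact: lt_le_trans zr.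
  have [G0 -> ->] := H2 _ rz.
  apply: (@wirt_local (fun=> 0) _ _ _ _ (cabs (z - z0) - r)); rewrite ?subr_gt0//; last exact: wirt_cst.
  move=> w wz; apply/esym; have [] // := H2 w.
  have := cabs_triangle (z - z0) (w - z0).
  have -> : z - z0 - (w - z0) = z - w by ring.
  by rewrite (cabs_sub z w); lra.
(* The supporting disc lies in the unit disk, so [G] vanishes wherever a coordinate has modulus
   1. *)
have out z : cabs z < 1 \/ G z = 0.
  have [|h] := ltP (cabs z) 1; [by left|right].
  have [] // := H2 z; have := cabs_triangle z z0; lra.
have cs : ccont (fun z => Gz z + Gb z).
  by move=> z; apply: ct_D; [exact: cz|exact: cb].
have cd : ccont (fun z => iC R * (Gz z - Gb z)).
  move=> z; apply: ct_M; first exact: ct_cst.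
  by apply: ct_B; [exact: cz|exact: cb].
have vx (k : C -> R) : (k = @cre R \/ k = @cim R) -> forall z, `|cre z| = 1 -> k (G z) = 0.
  move=> hk z z1; case: (out z) => [h|->]; last by case: hk => ->.
  by have := cre_le z; rewrite z1; lra.
have vy (k : C -> R) : (k = @cre R \/ k = @cim R) -> forall z, `|cim z| = 1 -> k (G z) = 0.
  move=> hk z z1; case: (out z) => [h|->]; last by case: hk => ->.
  by have := cim_le z; rewrite z1; lra.
have Es : CJ (fun z => Gz z + Gb z) = 0.
  apply: cplx_eq; rewrite /CJ /=.
    apply: (@ibp_x R (fun z => cre (G z))); [exact: ccont_re| |by apply: vx; left].
    by move=> x y; have [[] ] := wG (toC (x, y)).
  apply: (@ibp_x R (fun z => cim (G z))); [exact: ccont_im| |by apply: vx; right].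
  by move=> x y; have [[] ] := wG (toC (x, y)).
have Ed : CJ (fun z => iC R * (Gz z - Gb z)) = 0.
  apply: cplx_eq; rewrite /CJ /=.
    apply: (@ibp_y R (fun z => cre (G z))); [exact: ccont_re| |by apply: vy; left].
    by move=> x y; have [_ [] ] := wG (toC (x, y)).
  apply: (@ibp_y R (fun z => cim (G z))); [exact: ccont_im| |by apply: vy; right].
  by move=> x y; have [_ [] ] := wG (toC (x, y)).
rewrite CJ_D// in Es; rewrite CJ_Z in Ed; last first.
  by move=> z; apply: ct_B; [exact: cz|exact: cb].
rewrite CJ_B// in Ed.
have {}Ed : CJ Gz - CJ Gb = 0.
  have : iC R * (iC R * (CJ Gz - CJ Gb)) = 0 by rewrite Ed mulr0.
  by rewrite mulrA iC2 mulN1r => /eqP; rewrite oppr_eq0 => /eqP.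
have E2 : (2 : C) != 0 by rewrite pnatr_eq0.
split => //; apply: (mulfI E2); rewrite mulr0.
  by rewrite -[RHS](addr0 0) -{1}Es -Ed; ring.
by rewrite -[RHS](subr0 0) -{1}Es -Ed; ring.
Qed.

End Wirtinger.

(** * Smooth bumps *)

Section PositivePart.
Variable R : realType.
Local Notation C := (Cplx R).
Implicit Types (x y : R).

Definition pos x : R := Num.max 0 x.
Lemma pos_ge0 x : 0 <= pos x. Proof. by rewrite /pos le_max lexx. Qed.
Lemma pos_id x : 0 <= x -> pos x = x. Proof. by move=> h; rewrite /pos; exact/max_idPr. Qed.
Lemma pos_0 x : x <= 0 -> pos x = 0. Proof. by move=> h; rewrite /pos; exact/max_idPl. Qed.
Lemma pos_le x y : 0 <= y -> x <= y -> pos x <= y.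
Proof. by move=> h1 h2; rewrite /pos ge_max h1. Qed.
Lemma pos_ge x : x <= pos x. Proof. by rewrite /pos le_max lexx orbT. Qed.
Lemma pos_lip x y : `|pos y - pos x| <= `|y - x|.
Proof.
have := ler_norm (y - x); have := ler_norm (- (y - x)); rewrite normrN.
have [hx|/ltW hx] := leP 0 x; have [hy|/ltW hy] := leP 0 y;
  rewrite ?(pos_id hx) ?(pos_id hy) ?(pos_0 hx) ?(pos_0 hy) !ler_norml; lra.
Qed.
Lemma pos2_taylor x y : `|pos y ^+ 2 - pos x ^+ 2 - 2 * pos x * (y - x)| <= (y - x) ^+ 2.
Proof.
have [hx|/ltW hx] := leP 0 x; have [hy|/ltW hy] := leP 0 y;
  rewrite ?(pos_id hx) ?(pos_id hy) ?(pos_0 hx) ?(pos_0 hy) ler_norml.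
- have -> : y ^+ 2 - x ^+ 2 - 2 * x * (y - x) = (y - x) ^+ 2 by ring.
  by have := sqr_ge0 (y - x); lra.
- have h2 : 0 <= x * - y by rewrite mulr_ge0// oppr_ge0.
  have := sqr_ge0 x; have := sqr_ge0 y; rewrite !expr2; lra.
- have h2 : 0 <= - x * y by rewrite mulr_ge0// oppr_ge0.
  have := sqr_ge0 x; have := sqr_ge0 y; rewrite !expr2; lra.
- by rewrite expr0n /=; have := sqr_ge0 (y - x); lra.
Qed.
(** For nonnegative arguments the remainder is [(y - x)^2 (y + 2 x)], hence the 6. Bumps never
    exceed 1; the bound 2 leaves them a full neighbourhood for differentiation. *)
Lemma pos3_taylor x y : x <= 2 -> y <= 2 ->
  `|pos y ^+ 3 - pos x ^+ 3 - 3 * pos x ^+ 2 * (y - x)| <= 6 * (y - x) ^+ 2.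
Proof.
move=> x1 y1; have [hx|/ltW hx] := leP 0 x; have [hy|/ltW hy] := leP 0 y;
  rewrite ?(pos_id hx) ?(pos_id hy) ?(pos_0 hx) ?(pos_0 hy) ler_norml.
- have -> : y ^+ 3 - x ^+ 3 - 3 * x ^+ 2 * (y - x) = (y - x) ^+ 2 * (y + 2 * x) by ring.
  by have := sqr_ge0 (y - x); nra.
- have -> : 0 ^+ 3 - x ^+ 3 - 3 * x ^+ 2 * (y - x) = x ^+ 2 * (2 * x) + 3 * x * (x * - y) by ring.
  have h1 : 0 <= x ^+ 2 * (2 * x) <= 4 * x ^+ 2 by have := sqr_ge0 x; nra.
  have h2 : 0 <= x * - y by rewrite mulr_ge0// oppr_ge0.
  have h3 : 0 <= 3 * x * (x * - y) <= 6 * (x * - y) by nra.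
  have := sqr_ge0 y.
  by move: h1 h2 h3 => /andP[? ?] ? /andP[? ?] ?; nra.
- have h : 0 <= y ^+ 3 <= 2 * y ^+ 2 by have := sqr_ge0 y; nra.
  have : y ^+ 2 <= (y - x) ^+ 2 by nra.
  have := sqr_ge0 y.
  by rewrite !expr0n /= ; lra.
- by rewrite !expr0n /= ; have := sqr_ge0 (y - x); lra.
Qed.
Lemma pos2_der x : is_derive x 1 (fun s => pos s ^+ 2) (2 * pos x).
Proof.
apply/rderP => e e0; exists e => // s hs; apply: (le_trans (pos2_taylor _ _)).
by rewrite -real_normK ?num_real// expr2 ler_wpM2r// ltW.
Qed.
Lemma pos3_der x : x < 2 -> is_derive x 1 (fun s => pos s ^+ 3) (3 * pos x ^+ 2).
Proof.
move=> x1; apply/rderP => e e0; exists (Num.min (e / 6) (2 - x)).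
  by rewrite lt_min subr_gt0 x1 andbT divr_gt0.
move=> s; rewrite lt_min => /andP[s1 s2].
have sle1 : s <= 2 by have := ler_norm (s - x); lra.
apply: (le_trans (pos3_taylor (ltW x1) sle1)).
by rewrite -real_normK ?num_real// expr2 mulrA ler_wpM2r//; lra.
Qed.
Lemma pos_cont : continuous pos.
Proof.
move=> x; apply/cvgrPdist_lt => e e0; apply/nbhs_ballP; exists e => //= y.
by rewrite /ball/=; apply: le_lt_trans; rewrite pos_lip.
Qed.

End PositivePart.

(** * Radial bumps and integration by parts against holomorphic functions *)

Section Kernel.
Variable R : realType.
Local Notation C := (Cplx R).
Implicit Types (z w : C) (F f : C -> C) (s r : R).

(** Its positive part is supported in the disc of radius [s^(-1/2)]; the recurring condition
    [1 <= s * r ^+ 2] says that this disc has radius at most [r]. A polynomial profile lets [ring]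
    and Taylor bounds replace estimates of exponentials. *)
Definition bump s z0 z : R := 1 - s * cabs (z - z0) ^+ 2.

Lemma bump_le1 s z0 z : 0 <= s -> bump s z0 z <= 1.
Proof. by move=> s0; rewrite /bump gerBl mulr_ge0// sqr_ge0. Qed.
Lemma bump_out s z0 z r : 0 < r -> 1 <= s * r ^+ 2 -> r < cabs (z - z0) -> pos (bump s z0 z) = 0.
Proof.
move=> r0 sr rz; apply: pos_0; rewrite /bump subr_le0 (le_trans sr)//.
have s0 : 0 < s by rewrite -(pmulr_lgt0 _ (exprn_gt0 2 r0)) (lt_le_trans _ sr).
by rewrite ler_pM2l// ler_sqr ?nnegrE ?cabs_ge0 ?ltW.
Qed.
Lemma bump_cont s z0 : rcont (bump s z0).
Proof.
move=> z; apply: rt_B; first exact: rt_cst.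
apply: rt_M; first exact: rt_cst.
apply: rt_X; apply: ct_abs; apply: ct_B; [exact: ct_id|exact: ct_cst].
Qed.
Lemma posbump_cont s z0 n : rcont (fun z => pos (bump s z0 z) ^+ n).
Proof.
move=> z; apply: rt_X; apply: rt_comp; [exact: bump_cont|exact: pos_cont].
Qed.
Lemma bump_wirt s z0 z : wirt (fun w => RtoC (bump s z0 w)) z
  (- RtoC s * cconj (z - z0)) (- RtoC s * (z - z0)).
Proof.
have wz : wirt (fun w => w - z0) z (1 - 0) (0 - 0) by apply: wirtB; [exact: wirt_id|exact: wirt_cst].
have := wirtB (wirt_cst 1 z) (wirtM (wirt_cst (RtoC s) z) (wirtM wz (wirt_conj wz))).
move=> H; apply: (wirt_ext H) => [w||].
- by rewrite mulcconj /bump RtoCD RtoCN RtoCM.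
- by rewrite !subr0 -RtoC0 cconjR RtoC0; ring.
- by rewrite !subr0 cconj1; ring.
Qed.
Lemma kap3_wirt s z0 z : 0 <= s -> wirt (fun w => RtoC (pos (bump s z0 w) ^+ 3)) z
  (RtoC (3 * pos (bump s z0 z) ^+ 2) * (- RtoC s * cconj (z - z0)))
  (RtoC (3 * pos (bump s z0 z) ^+ 2) * (- RtoC s * (z - z0))).
Proof.
move=> s0; apply: (wirt_real (f := fun x => pos x ^+ 3)); last exact: bump_wirt.
by apply: pos3_der; rewrite (le_lt_trans (bump_le1 _ _ s0))// ltr1n.
Qed.
Lemma kap2_wirt s z0 z : wirt (fun w => RtoC (pos (bump s z0 w) ^+ 2)) z
  (RtoC (2 * pos (bump s z0 z)) * (- RtoC s * cconj (z - z0)))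
  (RtoC (2 * pos (bump s z0 z)) * (- RtoC s * (z - z0))).
Proof. apply: (wirt_real (f := fun x => pos x ^+ 2)); [exact: pos2_der|exact: bump_wirt]. Qed.

(* [F] is C^1 with dF/dz = f and dF/dzbar = 0 on the disc of radius r0 about z0. *)
Definition chol F f z0 r0 := forall z, cabs (z - z0) < r0 ->
  [/\ wirt F z (f z) 0, cct F z & cct f z].

(** Stokes' formula for [F K]. As [F] has no [conj z]-derivative, in that direction the derivative
    falls on the kernel alone. *)
Lemma holo_ibp F f K Kz Kb z0 r0 r : chol F f z0 r0 -> r < r0 -> cabs z0 + r < 1 ->
  (forall z, wirt K z (Kz z) (Kb z)) -> ccont K -> ccont Kz -> ccont Kb ->
  (forall z, r < cabs (z - z0) -> [/\ K z = 0, Kz z = 0 & Kb z = 0]) ->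
  [/\ ccont (fun z => F z * Kb z), CJ (fun z => F z * Kb z) = 0,
     ccont (fun z => f z * K z + F z * Kz z) & CJ (fun z => f z * K z + F z * Kz z) = 0].
Proof.
move=> HF rr0 z0r wK cK cKz cKb out.
have [] := @wirt_int0 R (fun z => F z * K z) (fun z => f z * K z + F z * Kz z)
  (fun z => F z * Kb z) z0 r0 r rr0 z0r.
- move=> z /HF [wF cF cf]; split.
  + by apply: wirt_eq (wirtM wF (wK z)) _ _ => //; rewrite mul0r add0r.
  + by apply: ct_D; apply: ct_M.
  + by apply: ct_M.
- by move=> z /out [-> -> ->]; rewrite !mulr0 addr0.
by move=> *; split.
Qed.

Lemma cont_supp F (K : C -> C) z0 r0 r : r < r0 -> (forall z, cabs (z - z0) < r0 -> cct F z) ->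
  ccont K -> (forall z, r < cabs (z - z0) -> K z = 0) -> ccont (fun z => F z * K z).
Proof.
move=> rr0 cF cK out z; have [zr|zr] := ltP (cabs (z - z0)) r0.
  by apply: ct_M; [exact: cF|exact: cK].
have rz : r < cabs (z - z0) by exact: lt_le_trans zr.
apply/cctE => e e0; exists (cabs (z - z0) - r); first by rewrite subr_gt0.
move=> w wz; rewrite !out ?mulr0 ?subrr ?cabs0//.
have := cabs_triangle (z - z0) (w - z0).
have -> : z - z0 - (w - z0) = z - w by ring.
by rewrite (cabs_sub z w); lra.
Qed.

Lemma chol1 z0 r0 : chol (fun=> 1) (fun=> 0) z0 r0.
Proof. by move=> z _; split; [exact: wirt_cst|exact: ct_cst|exact: ct_cst]. Qed.

Lemma in_box z : cabs z <= 1 -> box (ofC z).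
Proof.
move=> z1; split; rewrite /= in_itv/= -ler_norml; [exact: le_trans (cre_le _) z1|exact: le_trans (cim_le _) z1].
Qed.

Lemma box_cabs q : @box R q -> cabs (toC q) <= 2.
Proof.
case: q => x y [] /=; rewrite !in_itv/= -!ler_norml => h1 h2.
have := cabs_le (toC (x, y) : C); rewrite /= => h3; apply: (le_trans h3); lra.
Qed.

Lemma CJ_bound G (M : R) : ccont G -> (forall z, cabs z <= 2 -> cabs (G z) <= M) ->
  cabs (CJ G) <= 8 * M.
Proof.
move=> cG GM; apply: (le_trans (@CJ_le _ G (fun=> M) cG _ _)).
- by move=> z; exact: rt_cst.
- by move=> q /box_cabs; exact: GM.
- by rewrite J_cst; lra.
Qed.

(** [F] times a bump of intermediate radius is continuous on the plane and bounded on the box; on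
    the smaller disc the bump stays above [d], by which one divides. *)
Lemma bounded_ball F z0 r0 r : 0 < r -> r < r0 -> cabs z0 + r < 1 ->
  (forall z, cabs (z - z0) < r0 -> cct F z) ->
  exists2 B : R, 0 < B & forall z, cabs (z - z0) <= r -> cabs (F z) <= B.
Proof.
move=> rgt0 rr0 z0r cF; pose r1 := (r + r0) / 2.
have r1r : r < r1 by rewrite /r1; lra.
have r1r0 : r1 < r0 by rewrite /r1; lra.
have r10 : 0 < r1 by lra.
pose s := r1 ^- 2.
have s1 : 1 <= s * r1 ^+ 2 by rewrite /s mulVf// expf_neq0// gt_eqF.
have cG : ccont (fun z => F z * RtoC (pos (bump s z0 z))).
  apply: (cont_supp r1r0 cF).
    by move=> z; apply: ct_RtoC; apply: rt_comp; [exact: bump_cont|exact: pos_cont].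
  by move=> z hz; rewrite (bump_out r10 s1 hz).
have [M HM] := bounded_box (ccont_cabs cG).
pose d := 1 - s * r ^+ 2.
have d0 : 0 < d.
  rewrite /d subr_gt0 /s mulrC ltr_pdivrMr ?exprn_gt0// mul1r ltr_sqr ?nnegrE ?ltW//.
have dn0 : 0 <= s by rewrite /s invr_ge0 exprn_ge0 ?ltW.
exists (`|M| / d + 1) => [|z zr]; first by rewrite ltr_wpDl// divr_ge0// ltW.
have bz : box (ofC z).
  apply: in_box; have := cabs_triangle z z0; lra.
have := HM _ bz; rewrite toCK cabsM cabsR normrM normr_id.
rewrite (ger0_norm (cabs_ge0 _)) => HMz.
have db : d <= pos (bump s z0 z).
  apply: le_trans (pos_ge _); rewrite /d /bump lerD2l lerN2 ler_wpM2l//.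
  by rewrite ler_sqr ?nnegrE ?cabs_ge0 ?(ltW rgt0).
rewrite (@le_trans _ _ (`|M| / d))// ?lerDl// ler_pdivlMr//.
apply: le_trans (ler_norm M); apply: le_trans HMz.
by rewrite ler_wpM2l ?cabs_ge0// (le_trans db)// ler_norm.
Qed.

End Kernel.

(** * The mean value property *)

Section MeanValue.
Variable R : realType.
Local Notation C := (Cplx R).
Implicit Types (z w h : C) (F f : C -> C) (s t r : R).

(** A quadratic modulus of continuity makes the derivative vanish; concretely, [n + 1] equal steps
    add up to [K (b - a)^2 / (n + 1)]. It replaces differentiation under the integral sign. *)
Lemma quad_const (M : R -> C) (a b K : R) : a <= b ->
  (forall s t, a <= s <= b -> a <= t <= b -> cabs (M t - M s) <= K * (t - s) ^+ 2) ->
  M a = M b.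
Proof.
move=> ab H; apply/eqP; rewrite -subr_eq0 -cabs_eq0 cabs_sub.
have main n : cabs (M b - M a) <= K * (b - a) ^+ 2 / n.+1%:R.
  pose d := (b - a) / n.+1%:R.
  have d0 : 0 <= d by rewrite divr_ge0// subr_ge0.
  have nd : n.+1%:R * d = b - a by rewrite /d mulrC divfK.
  have {nd} nd' m : (m <= n.+1)%N -> a <= a + m%:R * d <= b.
    move=> mn; apply/andP; split; first by rewrite lerDl mulr_ge0.
    have : m%:R * d <= n.+1%:R * d by rewrite ler_wpM2r// ler_nat.
    by rewrite nd; lra.
  have step m : (m <= n.+1)%N -> cabs (M (a + m%:R * d) - M a) <= m%:R * (K * d ^+ 2).
    elim: m => [|m IH] mn; first by rewrite !mul0r addr0 subrr cabs0.
    have := H _ _ (nd' m (ltnW mn)) (nd' m.+1 mn).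
    have -> : a + m.+1%:R * d - (a + m%:R * d) = d by rewrite -(addn1 m) natrD; ring.
    move=> H1; have H2 := IH (ltnW mn).
    have -> : M (a + m.+1%:R * d) - M a = (M (a + m.+1%:R * d) - M (a + m%:R * d)) + (M (a + m%:R * d) - M a) by ring.
    apply: (le_trans (cabsD _ _)); apply: (le_trans (lerD H1 H2)).
    by rewrite -(addn1 m) natrD; lra.
  have := step n.+1 (leqnn _).
  have -> : a + n.+1%:R * d = b by rewrite /d mulrC divfK//; ring.
  move=> H1; apply: (le_trans H1); rewrite le_eqVlt; apply/orP; left; apply/eqP.
  by rewrite /d; move: (pnatr_eq0 R n.+1) => /= /negbT; move: (n.+1%:R : R) => x x0; field.
rewrite eq_le cabs_ge0 andbT; apply/ler_addgt0Pr => e e0; rewrite add0r.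
pose N := Num.bound `|K * (b - a) ^+ 2 / e|.
have HN : `|K * (b - a) ^+ 2 / e| < N%:R by exact: archi_boundP.
apply: (le_trans (main N)); rewrite ler_pdivrMr// -ler_pdivrMl// mulrC.
apply: (le_trans (ler_norm _)); apply: (le_trans (ltW HN)).
by rewrite ler_nat.
Qed.

Lemma CJ_RtoC (k : C -> R) : CJ (fun z => RtoC (k z)) = RtoC (J k).
Proof.
apply: cplx_eq; rewrite /CJ /=; first exact: J_ext.
by rewrite (J_ext (k2 := fun=> 0)) ?J_cst ?mulr0// => z; rewrite cimR.
Qed.

Lemma bump_le2 s z0 z : 0 <= s -> bump s z0 z <= 2.
Proof. by move=> s0; apply: (le_trans (bump_le1 _ _ s0)); rewrite ler1n. Qed.

Lemma r_lt1 z0 r : cabs z0 + r < 1 -> r < 1.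
Proof. by have := cabs_ge0 z0; lra. Qed.

Lemma kap_cont F z0 zc r0 r r1 s n : (forall z, cabs (z - zc) < r0 -> cct F z) ->
  0 < r -> 1 <= s * r ^+ 2 -> cabs (z0 - zc) + r <= r1 -> r1 < r0 -> (0 < n)%N ->
  ccont (fun z => F z * RtoC (pos (bump s z0 z) ^+ n)).
Proof.
move=> cF r00 sr zr r1r n0; apply: (cont_supp r1r cF).
  by move=> z; apply: ct_RtoC; exact: posbump_cont.
move=> z zr1; rewrite (bump_out r00 sr) ?expr0n ?gtn_eqF//.
have := cabs_triangle (z - zc) (z0 - zc).
have -> : z - zc - (z0 - zc) = z - z0 by ring.
by lra.
Qed.

(** The [s]-derivative of [s pos(bump)^3] is [pos(bump)^3 - 3 s |z - z0|^2 pos(bump)^2], which is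
    the [conj z]-derivative of [conj(z - z0) pos(bump)^3]. Its integral against a holomorphic [F] is
    zero, so only second order terms in [t - s] remain. *)
Lemma MV_const F f z0 r0 r s1 s2 : chol F f z0 r0 -> 0 < r -> r < r0 -> cabs z0 + r < 1 ->
  1 <= s1 * r ^+ 2 -> s1 <= s2 ->
  RtoC s1 * CJ (fun z => F z * RtoC (pos (bump s1 z0 z) ^+ 3)) =
  RtoC s2 * CJ (fun z => F z * RtoC (pos (bump s2 z0 z) ^+ 3)).
Proof.
move=> HF rgt0 rr0 z0r s1r s12.
have cF z : cabs (z - z0) < r0 -> cct F z by move=> /HF [].
have [B B0 HB] := bounded_ball rgt0 rr0 z0r cF.
have s10 : 0 < s1 by rewrite -(pmulr_lgt0 _ (exprn_gt0 2 rgt0)) (lt_le_trans _ s1r).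
have rle1 := r_lt1 z0r.
(* The 8 is the constant of [CJ_bound], [6 * s2] bounds the Taylor remainder of the cube, and 3 the
   second order term of the product with [t]. *)
apply: (@quad_const (fun s => RtoC s * CJ (fun z => F z * RtoC (pos (bump s z0 z) ^+ 3)))
  s1 s2 (8 * (B * (6 * s2 + 3)))) => // s t /andP[ss1 ss2] /andP[ts1 ts2].
have sr : 1 <= s * r ^+ 2 by rewrite (le_trans s1r)// ler_wpM2r// exprn_ge0 ?ltW.
have tr : 1 <= t * r ^+ 2 by rewrite (le_trans s1r)// ler_wpM2r// exprn_ge0 ?ltW.
have sge0 : 0 <= s by lra.
pose K z := cconj (z - z0) * RtoC (pos (bump s z0 z) ^+ 3).
pose Kz z := cconj (z - z0) * (RtoC (3 * pos (bump s z0 z) ^+ 2) * (- RtoC s * cconj (z - z0))).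
pose Kb z := RtoC (pos (bump s z0 z) ^+ 3) +
  cconj (z - z0) * (RtoC (3 * pos (bump s z0 z) ^+ 2) * (- RtoC s * (z - z0))).
have czz : ccont (fun z => z - z0) by move=> z; apply: ct_B; [exact: ct_id|exact: ct_cst].
have czc : ccont (fun z => cconj (z - z0)) by move=> z; apply: ct_conj; exact: czz.
have c3 : ccont (fun z => RtoC (3 * pos (bump s z0 z) ^+ 2)).
  by move=> z; apply: ct_RtoC; apply: rt_M; [exact: rt_cst|exact: posbump_cont].
have ck : ccont (fun z => RtoC (pos (bump s z0 z) ^+ 3)).
  by move=> z; apply: ct_RtoC; exact: posbump_cont.
have [] := @holo_ibp R F f K Kz Kb z0 r0 r HF rr0 z0r.
- move=> z.
  have wz : wirt (fun w => w - z0) z (1 - 0) (0 - 0) by apply: wirtB; [exact: wirt_id|exact: wirt_cst].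
  apply: (wirt_eq (wirtM (wirt_conj wz) (kap3_wirt z0 z sge0))); rewrite !subr0.
    by rewrite -RtoC0 cconjR RtoC0 /Kz; ring.
  by rewrite cconj1 /Kb; ring.
- by move=> z; apply: ct_M; [exact: czc|exact: ck].
- by move=> z; apply: ct_M; [exact: czc|apply: ct_M; [exact: c3|apply: ct_M; [exact: ct_cst|exact: czc]]].
- move=> z; apply: ct_D; first exact: ck.
  by apply: ct_M; [exact: czc|apply: ct_M; [exact: c3|apply: ct_M; [exact: ct_cst|exact: czz]]].
- by move=> z hz; rewrite /K /Kz /Kb (bump_out rgt0 sr hz) !expr0n /= !mulr0 RtoC0 !mul0r !mulr0 addr0.
move=> cFKb IFKb _ _.
have zz0 : cabs (z0 - z0) + r <= r by rewrite subrr cabs0 add0r.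
have cs := kap_cont (n := 3) cF rgt0 sr zz0 rr0 isT.
have ct := kap_cont (n := 3) cF rgt0 tr zz0 rr0 isT.
have cZ (x : R) G : ccont G -> ccont (fun z => RtoC x * G z).
  by move=> cG z; apply: ct_M; [exact: ct_cst|exact: cG].
have cst1 := cZ t _ ct; have css1 := cZ s _ cs; have cKb1 := cZ (t - s) _ cFKb.
have -> : RtoC t * CJ (fun z => F z * RtoC (pos (bump t z0 z) ^+ 3)) -
   RtoC s * CJ (fun z => F z * RtoC (pos (bump s z0 z) ^+ 3)) =
   CJ (fun z => RtoC t * (F z * RtoC (pos (bump t z0 z) ^+ 3)) -
     RtoC s * (F z * RtoC (pos (bump s z0 z) ^+ 3)) - RtoC (t - s) * (F z * Kb z)).
  have c12 : ccont (fun z => RtoC t * (F z * RtoC (pos (bump t z0 z) ^+ 3)) -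
     RtoC s * (F z * RtoC (pos (bump s z0 z) ^+ 3))).
    by move=> z; apply: ct_B; [exact: cst1|exact: css1].
  by rewrite (CJ_B c12 cKb1) (CJ_B cst1 css1) !CJ_Z// IFKb mulr0 subr0.
rewrite -mulrA; apply: CJ_bound.
  by move=> z; apply: ct_B; [apply: ct_B; [exact: cst1|exact: css1]|exact: cKb1].
move=> z _; set q := cabs (z - z0) ^+ 2.
have q0 : 0 <= q by exact: sqr_ge0.
have -> : RtoC t * (F z * RtoC (pos (bump t z0 z) ^+ 3)) -
     RtoC s * (F z * RtoC (pos (bump s z0 z) ^+ 3)) - RtoC (t - s) * (F z * Kb z) =
  F z * RtoC (t * pos (bump t z0 z) ^+ 3 - s * pos (bump s z0 z) ^+ 3
     - (t - s) * (pos (bump s z0 z) ^+ 3 - 3 * s * q * pos (bump s z0 z) ^+ 2)).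
  rewrite /Kb; have -> : cconj (z - z0) * (RtoC (3 * pos (bump s z0 z) ^+ 2) * (- RtoC s * (z - z0)))
    = - (RtoC (3 * pos (bump s z0 z) ^+ 2) * RtoC s * ((z - z0) * cconj (z - z0))) by ring.
  by rewrite mulcconj -/q !(RtoCD, RtoCN, RtoCM); ring.
rewrite cabsM cabsR.
have [zr|zr] := leP (cabs (z - z0)) r; last first.
  rewrite (bump_out rgt0 sr zr) (bump_out rgt0 tr zr) !expr0n /= !mulr0 !subr0 !mulr0 subr0 normr0 mulr0.
  by apply: mulr_ge0; [apply: mulr_ge0; [exact: ltW|lra]|exact: sqr_ge0].
rewrite -[leRHS]mulrA; apply: ler_pM; rewrite ?cabs_ge0 ?HB//.
have qle1 : q <= 1 by rewrite /q -[leRHS](expr1n _ 2) ler_sqr ?nnegrE ?cabs_ge0//; lra.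
set bt := bump t z0 z; set bs := bump s z0 z.
have btE : bt - bs = - (t - s) * q by rewrite /bt /bs /bump -/q; ring.
have tge0 : 0 <= t by lra.
have := @pos3_taylor R bs bt (bump_le2 _ _ sge0)
   (bump_le2 _ _ tge0).
rewrite btE => T3.
have -> : t * pos bt ^+ 3 - s * pos bs ^+ 3 - (t - s) * (pos bs ^+ 3 - 3 * s * q * pos bs ^+ 2) =
   t * (pos bt ^+ 3 - pos bs ^+ 3 - 3 * pos bs ^+ 2 * (- (t - s) * q)) - 3 * q * pos bs ^+ 2 * (t - s) ^+ 2 by ring.
apply: (le_trans (ler_normB _ _)); rewrite [leRHS]mulrDl; apply: lerD.
  rewrite normrM (ger0_norm tge0).
  apply: (le_trans (ler_wpM2l tge0 T3)).
  have -> : t * (6 * (- (t - s) * q) ^+ 2) = (6 * t * q ^+ 2) * (t - s) ^+ 2 by ring.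
  apply: ler_wpM2r; first exact: sqr_ge0.
  have : q ^+ 2 <= 1 by rewrite expr_le1.
  by have := sqr_ge0 q; nra.
rewrite normrM (ger0_norm (sqr_ge0 _)); apply: ler_wpM2r; first exact: sqr_ge0.
have p1 : pos bs <= 1 by apply: pos_le => //; exact: bump_le1.
have p0 := pos_ge0 bs.
have p2 : 0 <= pos bs ^+ 2 <= 1 by rewrite exprn_ge0//= expr_le1.
by move/andP: p2 => [? ?]; rewrite ger0_norm; nra.
Qed.

(** Enlarging [s] changes neither side by [MV_const] and concentrates the bump where [F] is close to
    [F z0]. *)
Lemma MV_raw F f z0 r0 r s : chol F f z0 r0 -> 0 < r -> r < r0 -> cabs z0 + r < 1 ->
  1 <= s * r ^+ 2 ->
  RtoC s * CJ (fun z => F z * RtoC (pos (bump s z0 z) ^+ 3)) =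
  F z0 * RtoC (s * J (fun z => pos (bump s z0 z) ^+ 3)).
Proof.
move=> HF rgt0 rr0 z0r sr.
have cF z : cabs (z - z0) < r0 -> cct F z by move=> /HF [].
have s0 : 0 < s by rewrite -(pmulr_lgt0 _ (exprn_gt0 2 rgt0)) (lt_le_trans _ sr).
apply/eqP; rewrite -subr_eq0 -cabs_eq0 eq_le cabs_ge0 andbT.
set N := s * J _.
have N0 : 0 <= N.
  by rewrite mulr_ge0// ?(ltW s0)//; apply: J_ge0 => z; rewrite exprn_ge0// pos_ge0.
apply/ler_addgt0Pr => e e0; rewrite add0r.
have e'0 : 0 < e / (2 * N + 1) by rewrite divr_gt0// ltr_wpDl// mulr_ge0.
have z0in : cabs (z0 - z0) < r0 by rewrite subrr cabs0; lra.
have [d d0 Hd] := (cctE _ _).1 (cF _ z0in) _ e'0.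
(* Large enough to confine the bump to radius [d / 2], and at least [s] as [MV_const] requires. *)
pose s2 := Num.max s ((d / 2) ^- 2).
have d20 : 0 < d / 2 by rewrite divr_gt0.
have s2d : 1 <= s2 * (d / 2) ^+ 2.
  rewrite -[leLHS](mulVf (x := (d / 2) ^+ 2)) ?expf_neq0 ?gt_eqF//.
  by rewrite ler_wpM2r ?exprn_ge0 ?(ltW d20)// /s2 le_max lexx orbT.
have ss2 : s <= s2 by rewrite /s2 le_max lexx.
have s20 : 0 < s2 by lra.
have s2r : 1 <= s2 * r ^+ 2 by rewrite (le_trans sr)// ler_wpM2r// exprn_ge0 ?ltW.
rewrite (MV_const HF rgt0 rr0 z0r sr ss2).
have NE : N = s2 * J (fun z => pos (bump s2 z0 z) ^+ 3).
  have := MV_const (@chol1 R z0 r0) rgt0 rr0 z0r sr ss2.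
  have E x : CJ (fun z => (1 : C) * RtoC (pos (bump x z0 z) ^+ 3)) = RtoC (J (fun z => pos (bump x z0 z) ^+ 3)).
    by rewrite -CJ_RtoC; apply: CJ_ext => z; rewrite mul1r.
  by rewrite !E -!RtoCM => /(congr1 (@cre R)); rewrite !creR.
have zz0 : cabs (z0 - z0) + r <= r by rewrite subrr cabs0 add0r.
have c2 := kap_cont (n := 3) cF rgt0 s2r zz0 rr0 isT.
have ck : ccont (fun z => RtoC (pos (bump s2 z0 z) ^+ 3)).
  by move=> z; apply: ct_RtoC; exact: posbump_cont.
have cFk : ccont (fun z => F z0 * RtoC (pos (bump s2 z0 z) ^+ 3)).
  by move=> z; apply: ct_M; [exact: ct_cst|exact: ck].
have -> : RtoC s2 * CJ (fun z => F z * RtoC (pos (bump s2 z0 z) ^+ 3)) - F z0 * RtoC N =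
  RtoC s2 * CJ (fun z => F z * RtoC (pos (bump s2 z0 z) ^+ 3) - F z0 * RtoC (pos (bump s2 z0 z) ^+ 3)).
  by rewrite CJ_B// CJ_Z// CJ_RtoC NE RtoCM; ring.
rewrite cabsM cabsR (gtr0_norm s20).
have crk : rcont (fun z => e / (2 * N + 1) * pos (bump s2 z0 z) ^+ 3).
  by move=> z; apply: rt_M; [exact: rt_cst|exact: posbump_cont].
have := @CJ_le R (fun z => F z * RtoC (pos (bump s2 z0 z) ^+ 3) - F z0 * RtoC (pos (bump s2 z0 z) ^+ 3)) _ _ crk.
move=> /(_ _ _) H.
apply: (le_trans (ler_wpM2l (ltW s20) (H _ _))).
- by move=> z; apply: ct_B; [exact: c2|exact: cFk].
- move=> q _; rewrite -mulrBl cabsM cabsR ger0_norm ?exprn_ge0 ?pos_ge0//.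
  have [hz|hz] := leP (cabs (toC q - z0)) (d / 2); last first.
    by rewrite (bump_out d20 s2d hz) expr0n /= !mulr0.
  by rewrite ler_wpM2r ?exprn_ge0 ?pos_ge0// ltW//; apply: Hd; lra.
rewrite J_Z; last by move=> z; exact: posbump_cont.
have -> : s2 * (2 * (e / (2 * N + 1) * J (fun z => pos (bump s2 z0 z) ^+ 3))) =
  e * ((2 * N) / (2 * N + 1)) by rewrite [X in _ = e * (2 * X / _)]NE; field; rewrite gt_eqF// ltr_wpDl// mulr_ge0.
rewrite ler_piMr ?(ltW e0)// ler_pdivrMr ?mul1r ?lerDl// ltr_wpDl// mulr_ge0//.
Qed.

Lemma bump_shift s z h w : bump s (z + h) w - bump s z w =
  s * (2 * cre (cconj (w - z) * h) - cabs h ^+ 2).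
Proof. by rewrite /bump !cabs2 !cE; ring. Qed.

Lemma cre_cconj_abs z w : `|cre (cconj z * w)| <= cabs z * cabs w.
Proof. by apply: (le_trans (cre_le _)); rewrite cabsM cabsconj. Qed.

Lemma bump_shift_le s z h w : 0 <= s -> cabs (w - z) <= 3 -> cabs h <= 2 ->
  `|bump s (z + h) w - bump s z w| <= 8 * s * cabs h.
Proof.
move=> s0 wz h2; rewrite bump_shift normrM (ger0_norm s0).
have := cre_cconj_abs (w - z) h; have := cabs_ge0 h => h0 H1.
have H2 : cabs (w - z) * cabs h <= 3 * cabs h by rewrite ler_wpM2r.
have H3 : cabs h ^+ 2 <= 2 * cabs h by rewrite expr2 ler_wpM2r.
have H4 := sqr_ge0 (cabs h).
have : `|2 * cre (cconj (w - z) * h) - cabs h ^+ 2| <= 8 * cabs h.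
  by move: H1; rewrite !ler_norml => /andP[? ?]; lra.
by move=> H5; rewrite [8 * s]mulrC -mulrA ler_wpM2l.
Qed.

Lemma pos_bump01 s z w : 0 <= s -> 0 <= pos (bump s z w) <= 1.
Proof. by move=> s0; rewrite pos_ge0 pos_le// bump_le1. Qed.

(** Moving the centre changes the bump by an exact quadratic polynomial in [h]. What remains is the
    Taylor remainder of the cube, [6 (8 s |h|)^2 = 384 s^2 |h|^2], and the [|h|^2] part of the first
    order term. *)
Lemma kap3_shift s z h w : 0 <= s -> cabs (w - z) <= 3 -> cabs h <= 2 ->
  `|pos (bump s (z + h) w) ^+ 3 - pos (bump s z w) ^+ 3
    - 6 * s * pos (bump s z w) ^+ 2 * cre (cconj (w - z) * h)| <= (384 * s ^+ 2 + 3 * s) * cabs h ^+ 2.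
Proof.
move=> s0 wz h2; have D := bump_shift_le s0 wz h2.
have T := @pos3_taylor R (bump s z w) (bump s (z + h) w) (bump_le2 _ _ s0)
   (bump_le2 _ _ s0).
have D2 : (bump s (z + h) w - bump s z w) ^+ 2 <= 64 * s ^+ 2 * cabs h ^+ 2.
  rewrite -real_normK ?num_real//; apply: (le_trans (lerXn2r 2 _ _ D)); rewrite ?nnegrE//.
    by rewrite !mulr_ge0 ?cabs_ge0.
  by rewrite !exprMn -natrX.
have /andP[p0 p1] := pos_bump01 z w s0.
have p2 : 0 <= pos (bump s z w) ^+ 2 <= 1 by rewrite exprn_ge0//= expr_le1.
rewrite bump_shift in T.
have -> : pos (bump s (z + h) w) ^+ 3 - pos (bump s z w) ^+ 3
    - 6 * s * pos (bump s z w) ^+ 2 * cre (cconj (w - z) * h) =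
  (pos (bump s (z + h) w) ^+ 3 - pos (bump s z w) ^+ 3 - 3 * pos (bump s z w) ^+ 2 *
    (s * (2 * cre (cconj (w - z) * h) - cabs h ^+ 2))) - 3 * s * cabs h ^+ 2 * pos (bump s z w) ^+ 2 by ring.
apply: (le_trans (ler_normB _ _)); rewrite [leRHS]mulrDl; apply: lerD.
  by apply: (le_trans T); rewrite -bump_shift; lra.
rewrite ger0_norm; last by apply: mulr_ge0; [rewrite mulr_ge0 ?sqr_ge0// mulr_ge0|case/andP: p2].
by apply: ler_piMr; [rewrite mulr_ge0 ?sqr_ge0// mulr_ge0|case/andP: p2].
Qed.

Lemma kap2_shift s z h w : 0 <= s -> cabs (w - z) <= 3 -> cabs h <= 2 ->
  `|pos (bump s (z + h) w) ^+ 2 - pos (bump s z w) ^+ 2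
    - 4 * s * pos (bump s z w) * cre (cconj (w - z) * h)| <= (64 * s ^+ 2 + 2 * s) * cabs h ^+ 2.
Proof.
move=> s0 wz h2; have D := bump_shift_le s0 wz h2.
have T := pos2_taylor (bump s z w) (bump s (z + h) w).
have D2 : (bump s (z + h) w - bump s z w) ^+ 2 <= 64 * s ^+ 2 * cabs h ^+ 2.
  rewrite -real_normK ?num_real//; apply: (le_trans (lerXn2r 2 _ _ D)); rewrite ?nnegrE//.
    by rewrite !mulr_ge0 ?cabs_ge0.
  by rewrite !exprMn -natrX.
have /andP[p0 p1] := pos_bump01 z w s0.
rewrite bump_shift in T.
have -> : pos (bump s (z + h) w) ^+ 2 - pos (bump s z w) ^+ 2
    - 4 * s * pos (bump s z w) * cre (cconj (w - z) * h) =
  (pos (bump s (z + h) w) ^+ 2 - pos (bump s z w) ^+ 2 - 2 * pos (bump s z w) *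
    (s * (2 * cre (cconj (w - z) * h) - cabs h ^+ 2))) - 2 * s * cabs h ^+ 2 * pos (bump s z w) by ring.
apply: (le_trans (ler_normB _ _)); rewrite [leRHS]mulrDl; apply: lerD.
  by apply: (le_trans T); rewrite -bump_shift.
rewrite ger0_norm; last by apply: mulr_ge0; [rewrite mulr_ge0 ?sqr_ge0// mulr_ge0|].
by apply: ler_piMr; [rewrite mulr_ge0 ?sqr_ge0// mulr_ge0|].
Qed.

Lemma RtoC_2re z : RtoC (2 * cre z) = z + cconj z.
Proof. by apply: cplx_eq; rewrite !cE; ring. Qed.

(* First variation of the smoothed value of [F] when the centre of the bump moves. *)
Lemma kap_move F f zc r0 r1 z r s B h : chol F f zc r0 -> r1 < r0 -> cabs zc + r1 < 1 ->
  (forall w, cabs (w - zc) <= r1 -> cabs (F w) <= B) ->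
  0 < r -> 1 <= s * r ^+ 2 -> cabs (z - zc) + r <= r1 -> cabs (z + h - zc) + r <= r1 ->
  cabs (CJ (fun w => F w * RtoC (pos (bump s (z + h) w) ^+ 3))
    - CJ (fun w => F w * RtoC (pos (bump s z w) ^+ 3))
    - h * (RtoC (3 * s) * CJ (fun w => F w * (cconj (w - z) * RtoC (pos (bump s z w) ^+ 2)))))
  <= 8 * (B * (384 * s ^+ 2 + 3 * s)) * cabs h ^+ 2.
Proof.
move=> HF r1r0 zcr HB rgt0 sr zr zhr.
have cF w : cabs (w - zc) < r0 -> cct F w by move=> /HF [].
have s0 : 0 < s by rewrite -(pmulr_lgt0 _ (exprn_gt0 2 rgt0)) (lt_le_trans _ sr).
have r1lt := r_lt1 zcr; have zc0 := cabs_ge0 zc.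
have B0 : 0 <= B.
  apply: (le_trans (cabs_ge0 (F zc))); apply: HB; rewrite subrr cabs0.
  by have := cabs_ge0 (z - zc); lra.
have Bk0 : 0 <= B * (384 * s ^+ 2 + 3 * s) * cabs h ^+ 2.
  apply: mulr_ge0; last exact: sqr_ge0.
  exact: (mulr_ge0 B0 (addr_ge0 (mulr_ge0 (ler0n _ 384) (sqr_ge0 s)) (mulr_ge0 (ler0n _ 3) (ltW s0)))).
have hle2 : cabs h <= 2.
  have -> : h = (z + h - zc) - (z - zc) by ring.
  by apply: (le_trans (cabsB _ _)); have := cabs_ge0 (z - zc); have := cabs_ge0 (z + h - zc); lra.
have out w : r1 < cabs (w - zc) -> r < cabs (w - z).
  move=> wr; have := cabs_triangle (w - zc) (z - zc).
  by have -> : w - zc - (z - zc) = w - z by [ring]; lra.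
have czz : ccont (fun w => w - z) by move=> w; apply: ct_B; [exact: ct_id|exact: ct_cst].
have czc : ccont (fun w => cconj (w - z)) by move=> w; apply: ct_conj; exact: czz.
have c3 : ccont (fun w => RtoC (3 * pos (bump s z w) ^+ 2)).
  by move=> w; apply: ct_RtoC; apply: rt_M; [exact: rt_cst|exact: posbump_cont].
have ck : ccont (fun w => RtoC (pos (bump s z w) ^+ 3)).
  by move=> w; apply: ct_RtoC; exact: posbump_cont.
have [] := @holo_ibp R F f (fun w => RtoC (pos (bump s z w) ^+ 3))
  (fun w => RtoC (3 * pos (bump s z w) ^+ 2) * (- RtoC s * cconj (w - z)))
  (fun w => RtoC (3 * pos (bump s z w) ^+ 2) * (- RtoC s * (w - z))) zc r0 r1 HF r1r0 zcr.
- by move=> w; apply: kap3_wirt; exact: ltW.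
- exact: ck.
- by move=> w; apply: ct_M; [exact: c3|apply: ct_M; [exact: ct_cst|exact: czc]].
- by move=> w; apply: ct_M; [exact: c3|apply: ct_M; [exact: ct_cst|exact: czz]].
- by move=> w /out hw; rewrite (bump_out rgt0 sr hw) !expr0n /= !mulr0 RtoC0 !mul0r.
move=> cb Ib _ _.
have c1 := kap_cont (n := 3) cF rgt0 sr zhr r1r0 isT.
have c2 := kap_cont (n := 3) cF rgt0 sr zr r1r0 isT.
have cL : ccont (fun w => F w * (cconj (w - z) * RtoC (pos (bump s z w) ^+ 2))).
  apply: (cont_supp r1r0 cF).
    by move=> w; apply: ct_M; [exact: czc|apply: ct_RtoC; exact: posbump_cont].
  by move=> w /out hw; rewrite (bump_out rgt0 sr hw) expr0n /= RtoC0 mulr0.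
have cL' : ccont (fun w => (h * RtoC (3 * s)) * (F w * (cconj (w - z) * RtoC (pos (bump s z w) ^+ 2)))).
  by move=> w; apply: ct_M; [exact: ct_cst|exact: cL].
have cb' : ccont (fun w => cconj h * (F w * (RtoC (3 * pos (bump s z w) ^+ 2) * (- RtoC s * (w - z))))).
  by move=> w; apply: ct_M; [exact: ct_cst|exact: cb].
have c12 : ccont (fun w => F w * RtoC (pos (bump s (z + h) w) ^+ 3) - F w * RtoC (pos (bump s z w) ^+ 3)).
  by move=> w; apply: ct_B; [exact: c1|exact: c2].
have c123 : ccont (fun w => F w * RtoC (pos (bump s (z + h) w) ^+ 3) - F w * RtoC (pos (bump s z w) ^+ 3)
  - (h * RtoC (3 * s)) * (F w * (cconj (w - z) * RtoC (pos (bump s z w) ^+ 2)))).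
  by move=> w; apply: ct_B; [exact: c12|exact: cL'].
have -> : CJ (fun w => F w * RtoC (pos (bump s (z + h) w) ^+ 3))
    - CJ (fun w => F w * RtoC (pos (bump s z w) ^+ 3))
    - h * (RtoC (3 * s) * CJ (fun w => F w * (cconj (w - z) * RtoC (pos (bump s z w) ^+ 2)))) =
  CJ (fun w => F w * RtoC (pos (bump s (z + h) w) ^+ 3) - F w * RtoC (pos (bump s z w) ^+ 3)
    - (h * RtoC (3 * s)) * (F w * (cconj (w - z) * RtoC (pos (bump s z w) ^+ 2)))
    + cconj h * (F w * (RtoC (3 * pos (bump s z w) ^+ 2) * (- RtoC s * (w - z))))).
  rewrite (CJ_D c123 cb') (CJ_B c12 cL') (CJ_B c1 c2) (CJ_Z _ cb) Ib mulr0 addr0 (CJ_Z _ cL).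
  by rewrite mulrA.
rewrite -mulrA; apply: CJ_bound.
  by move=> w; apply: ct_D; [exact: c123|exact: cb'].
move=> w w2.
have -> : F w * RtoC (pos (bump s (z + h) w) ^+ 3) - F w * RtoC (pos (bump s z w) ^+ 3)
    - (h * RtoC (3 * s)) * (F w * (cconj (w - z) * RtoC (pos (bump s z w) ^+ 2)))
    + cconj h * (F w * (RtoC (3 * pos (bump s z w) ^+ 2) * (- RtoC s * (w - z)))) =
  F w * RtoC (pos (bump s (z + h) w) ^+ 3 - pos (bump s z w) ^+ 3
    - 6 * s * pos (bump s z w) ^+ 2 * cre (cconj (w - z) * h)).
  have -> : 6 * s * pos (bump s z w) ^+ 2 * cre (cconj (w - z) * h) =
    3 * s * pos (bump s z w) ^+ 2 * (2 * cre (cconj (w - z) * h)) by ring.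
  rewrite !(RtoCD, RtoCN) [RtoC (3 * s * _ * _)]RtoCM RtoC_2re cconjM cconjK !RtoCM; ring.
rewrite cabsM cabsR.
have [wr|wr] := leP (cabs (w - zc)) r1; last first.
  have out' : r < cabs (w - (z + h)).
    have := cabs_triangle (w - zc) (z + h - zc).
    by have -> : w - zc - (z + h - zc) = w - (z + h) by [ring]; lra.
  rewrite (bump_out rgt0 sr (out _ wr)) (bump_out rgt0 sr out') !expr0n /= !mulr0 !mul0r !subrr normr0 mulr0.
  exact: Bk0.
rewrite -[leRHS]mulrA; apply: ler_pM; rewrite ?cabs_ge0 ?HB//.
apply: kap3_shift => //; first exact: ltW.
have -> : w - z = (w - zc) - (z - zc) by ring.
by apply: (le_trans (cabsB _ _)); lra.
Qed.

Fact c0_def : {x : R | x = 4 * J (fun z => pos (bump 4 0 z) ^+ 3)}.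
Proof. by exists (4 * J (fun z => pos (bump 4 0 z) ^+ 3)). Qed.
(* The mass of the normalised bump, behind a [Qed] so that rewriting cannot unfold it. *)
Definition c0 : R := sval c0_def.
Lemma c0E : c0 = 4 * J (fun z => pos (bump 4 0 z) ^+ 3).
Proof. exact: svalP c0_def. Qed.

(** The centre slides along the segment from 0 to [z0], with [F = 1] in [kap_move]; the scale is
    then compared through [MV_const], again with [F = 1]. The mean value formula thus has the same
    constant at all points and scales. *)
Lemma J_kap z0 r s : 0 < r -> cabs z0 + r < 1 -> 1 <= s * r ^+ 2 ->
  s * J (fun z => pos (bump s z0 z) ^+ 3) = c0.
Proof.
move=> rgt0 z0r sr.
have s0 : 0 < s by rewrite -(pmulr_lgt0 _ (exprn_gt0 2 rgt0)) (lt_le_trans _ sr).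
have rlt1 := r_lt1 z0r.
have E1 x y : CJ (fun z => (1 : C) * RtoC (pos (bump x y z) ^+ 3)) = RtoC (J (fun z => pos (bump x y z) ^+ 3)).
  by rewrite -CJ_RtoC; apply: CJ_ext => z; rewrite mul1r.
transitivity (s * J (fun z => pos (bump s 0 z) ^+ 3)).
  congr (_ * _).
  pose M (t : R) : C := CJ (fun w => (1 : C) * RtoC (pos (bump s (RtoC t * z0) w) ^+ 3)).
  suff : M 0 = M 1 by rewrite /M !E1 RtoC0 mul0r RtoC1 mul1r => /(congr1 (@cre R)); rewrite !creR.
  (* The linear term of the variation is itself an exact derivative. *)
  apply: (@quad_const M 0 1 (8 * (1 * (384 * s ^+ 2 + 3 * s)) * cabs z0 ^+ 2)) => // t t' /andP[t0 t1] /andP[t'0 t'1].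
  have r1 : cabs z0 + r < 1 by [].
  have tin x : 0 <= x -> x <= 1 -> cabs (RtoC x * z0 - 0) + r <= cabs z0 + r.
    by move=> x0 x1; rewrite subr0 lerD2r cabsM cabsR ger0_norm// ler_piMl// cabs_ge0.
  have hE : RtoC t' * z0 = RtoC t * z0 + RtoC (t' - t) * z0 by rewrite RtoCD RtoCN; ring.
  have c01 : cabs (0 : C) + (cabs z0 + r) < 1 by rewrite cabs0 add0r.
  have t'in := tin _ t'0 t'1; rewrite hE in t'in.
  have := @kap_move (fun=> 1) (fun=> 0) 0 1 (cabs z0 + r) (RtoC t * z0) r s 1 (RtoC (t' - t) * z0)
    (@chol1 R 0 1) z0r c01 _ rgt0 sr (tin _ t0 t1) t'in.
  move=> /(_ (fun w _ => _)) H; rewrite /M hE.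
  have {}H := H ltac:(by rewrite cabs1).
  have Z : CJ (fun w => (1 : C) * (cconj (w - RtoC t * z0) * RtoC (pos (bump s (RtoC t * z0) w) ^+ 2))) = 0.
    pose zt := RtoC t * z0.
    have out w : cabs z0 + r < cabs (w - 0) -> r < cabs (w - zt).
      move=> wr; have := cabs_triangle (w - 0) (zt - 0).
      have -> : w - 0 - (zt - 0) = w - zt by ring.
      by have := tin _ t0 t1; rewrite -/zt; lra.
    have czc : ccont (fun w => cconj (w - zt)).
      by move=> w; apply: ct_conj; apply: ct_B; [exact: ct_id|exact: ct_cst].
    have cd : ccont (fun w => RtoC (3 * pos (bump s zt w) ^+ 2) * (- RtoC s * cconj (w - zt))).
      move=> w; apply: ct_M.
        by apply: ct_RtoC; apply: rt_M; [exact: rt_cst|exact: posbump_cont].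
      by apply: ct_M; [exact: ct_cst|exact: czc].
    have cdb : ccont (fun w => RtoC (3 * pos (bump s zt w) ^+ 2) * (- RtoC s * (w - zt))).
      move=> w; apply: ct_M.
        by apply: ct_RtoC; apply: rt_M; [exact: rt_cst|exact: posbump_cont].
      by apply: ct_M; [exact: ct_cst|apply: ct_B; [exact: ct_id|exact: ct_cst]].
    have [] := @holo_ibp R (fun=> 1) (fun=> 0) (fun w => RtoC (pos (bump s zt w) ^+ 3))
      (fun w => RtoC (3 * pos (bump s zt w) ^+ 2) * (- RtoC s * cconj (w - zt)))
      (fun w => RtoC (3 * pos (bump s zt w) ^+ 2) * (- RtoC s * (w - zt))) 0 1 (cabs z0 + r)
      (@chol1 R 0 1) z0r c01.
    - by move=> w; apply: kap3_wirt; exact: ltW.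
    - by move=> w; apply: ct_RtoC; exact: posbump_cont.
    - exact: cd.
    - exact: cdb.
    - by move=> w /out hw; rewrite (bump_out rgt0 sr hw) !expr0n /= !mulr0 RtoC0 !mul0r.
    move=> _ _ _ I.
    have cc : ccont (fun w => (1 : C) * (cconj (w - zt) * RtoC (pos (bump s zt w) ^+ 2))).
      move=> w; apply: ct_M; first exact: ct_cst.
      by apply: ct_M; [exact: czc|apply: ct_RtoC; exact: posbump_cont].
    have n0 : RtoC (3 * - s) != 0.
      by rewrite -cabs_eq0 cabsR normr_eq0 mulf_neq0// oppr_eq0 gt_eqF.
    apply: (mulfI n0); rewrite mulr0 -CJ_Z// -[RHS]I; apply: CJ_ext => w.
    by rewrite !RtoCM RtoCN; ring.
  rewrite Z mulr0 mulr0 subr0 cabsM cabsR exprMn real_normK ?num_real// in H.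
  by apply: (le_trans H); rewrite le_eqVlt; apply/orP; left; apply/eqP; ring.
(* [MV_const] only passes to larger parameters, so [s] and 4 are both reached from their minimum;
   [r'] is large enough to contain the corresponding support. *)
pose r' := Num.max r (1 / 2).
have r'0 : 0 < r' by rewrite /r' lt_max rgt0.
have r'1 : r' < 1 by rewrite /r' gt_max rlt1; lra.
pose s' := Num.min s 4.
have s'r : 1 <= s' * r' ^+ 2.
  rewrite /s'; case: (leP s 4) => _.
    by rewrite (le_trans sr)// (ler_wpM2l (ltW s0))// ler_sqr ?nnegrE ?(ltW rgt0) ?(ltW r'0)// /r' le_max lexx.
  have : (1 / 2) ^+ 2 <= r' ^+ 2 by rewrite ler_sqr ?nnegrE ?(ltW r'0)// /r' le_max lexx orbT.
  by rewrite expr2; lra.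
have c01 : cabs (0 : C) + r' < 1 by rewrite cabs0 add0r.
have s's : s' <= s by rewrite /s' ge_min lexx.
have s'4 : s' <= 4 by rewrite /s' ge_min lexx orbT.
have Ha := MV_const (@chol1 R 0 1) r'0 r'1 c01 s'r s's.
have Hb := MV_const (@chol1 R 0 1) r'0 r'1 c01 s'r s'4.
move: Ha; rewrite Hb !E1 -!RtoCM => /(congr1 (@cre R)); rewrite !creR => <-.
by rewrite c0E.
Qed.

(** [x^3 - x] vanishes for [x = 1] and [x = -1], hence its derivative [3 x^2 - 1] has integral zero
    over the square. *)
Lemma J_x2 : J (fun z : C => cre z ^+ 2) = 4 / 3.
Proof.
have : J (fun z : C => 3 * cre z ^+ 2 - 1) = 0.
  apply: (@ibp_x R (fun z => cre z ^+ 3 - cre z)).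
  - by move=> z; apply: rt_B; [apply: rt_M; [exact: rt_cst|apply: rt_X; apply: ct_re; exact: ct_id]|exact: rt_cst].
  - move=> x y /=; apply: (rder_ext (rderB (rderX 2 (rder_id x)) (rder_id x))) => //.
    by rewrite mulr1.
  - move=> z; have [h|h] := leP 0 (cre z).
      by rewrite ger0_norm// => ->; rewrite expr1n subrr.
    by rewrite ltr0_norm// => e; have -> : cre z = -1 by [lra]; ring.
have c2 : rcont (fun z : C => cre z ^+ 2) by move=> z; apply: rt_X; apply: ct_re; exact: ct_id.
rewrite J_B; [|by move=> z; apply: rt_M; [exact: rt_cst|exact: c2]|by move=> z; exact: rt_cst].
by rewrite J_Z// J_cst; lra.
Qed.
Lemma J_y2 : J (fun z : C => cim z ^+ 2) = 4 / 3.
Proof.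
have : J (fun z : C => 3 * cim z ^+ 2 - 1) = 0.
  apply: (@ibp_y R (fun z => cim z ^+ 3 - cim z)).
  - by move=> z; apply: rt_B; [apply: rt_M; [exact: rt_cst|apply: rt_X; apply: ct_im; exact: ct_id]|exact: rt_cst].
  - move=> x y /=; apply: (rder_ext (rderB (rderX 2 (rder_id y)) (rder_id y))) => //.
    by rewrite mulr1.
  - move=> z; have [h|h] := leP 0 (cim z).
      by rewrite ger0_norm// => ->; rewrite expr1n subrr.
    by rewrite ltr0_norm// => e; have -> : cim z = -1 by [lra]; ring.
have c2 : rcont (fun z : C => cim z ^+ 2) by move=> z; apply: rt_X; apply: ct_im; exact: ct_id.
rewrite J_B; [|by move=> z; apply: rt_M; [exact: rt_cst|exact: c2]|by move=> z; exact: rt_cst].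
by rewrite J_Z// J_cst; lra.
Qed.

(** The integral need not be evaluated: the tangent line reduces it to the second moments of the
    square, and [4 * 0.104 - 0.132 * 8 / 3] is positive. The values of [s] and [r] only have to
    satisfy [r < 1] and [1 <= s * r ^+ 2]. *)
Lemma c0_gt0 : 0 < c0.
Proof.
pose r : R := 96 / 100; pose s : R := 11 / 10.
have rgt0 : 0 < r by rewrite /r; lra.
have c01 : cabs (0 : C) + r < 1 by rewrite cabs0 add0r /r; lra.
have sr : 1 <= s * r ^+ 2 by rewrite /s /r expr2; lra.
rewrite -(J_kap rgt0 c01 sr) mulr_gt0//; first by rewrite /s; lra.
have cb : rcont (fun z : C => cre z ^+ 2) by move=> z; apply: rt_X; apply: ct_re; exact: ct_id.
have cb' : rcont (fun z : C => cim z ^+ 2) by move=> z; apply: rt_X; apply: ct_im; exact: ct_id.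
(* tangent line of the cube at 1/5 *)
have : J (fun z : C => 104 / 1000 - (132 / 1000) * (cre z ^+ 2 + cim z ^+ 2)) <=
   J (fun z => pos (bump s 0 z) ^+ 3).
  apply: J_le.
  - move=> z; apply: rt_B; first exact: rt_cst.
    by apply: rt_M; [exact: rt_cst|apply: rt_D; [exact: cb|exact: cb']].
  - by move=> z; exact: posbump_cont.
  - move=> z; have hb := pos_ge (bump s 0 z); have := pos_ge0 (bump s 0 z).
    rewrite {1}/bump subr0 cabs2 in hb; move: hb; rewrite /s.
    set x := pos _ => hb x0.
    have : 0 <= (x - 5^-1) ^+ 2 * (x + 2 / 5) by rewrite mulr_ge0 ?sqr_ge0//; lra.
    rewrite !exprS expr0; lra.
apply: lt_le_trans.
rewrite J_B; [|by move=> z; exact: rt_cst|by move=> z; apply: rt_M; [exact: rt_cst|apply: rt_D; [exact: cb|exact: cb']]].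
rewrite (@J_Z R _ (fun z => cre z ^+ 2 + cim z ^+ 2)); last by move=> z; apply: rt_D; [exact: cb|exact: cb'].
by rewrite (J_D cb cb') J_x2 J_y2 J_cst; lra.
Qed.

Lemma MV F f z0 r0 r s : chol F f z0 r0 -> 0 < r -> r < r0 -> cabs z0 + r < 1 ->
  1 <= s * r ^+ 2 ->
  RtoC s * CJ (fun z => F z * RtoC (pos (bump s z0 z) ^+ 3)) = RtoC c0 * F z0.
Proof.
move=> HF rgt0 rr0 z0r sr; rewrite (MV_raw HF rgt0 rr0 z0r sr) (J_kap rgt0 z0r sr).
by rewrite mulrC.
Qed.

End MeanValue.

(** * Analyticity and Cauchy estimates *)

Section Analytic.
Variable R : realType.
Local Notation C := (Cplx R).
Implicit Types (z w h : C) (F f : C -> C) (s t r : R).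

Lemma pos_bump_shift s z h w : 0 <= s -> cabs (w - z) <= 3 -> cabs h <= 2 ->
  `|pos (bump s (z + h) w) - pos (bump s z w)| <= 8 * s * cabs h.
Proof. by move=> *; apply: (le_trans (pos_lip _ _)); exact: bump_shift_le. Qed.

Lemma cre_RtoCM (x : R) z : cre (RtoC x * z) = x * cre z.
Proof. by rewrite !cE mul0r subr0. Qed.

Lemma quad_der F z l (d K : R) : 0 < d ->
  (forall h, cabs h < d -> cabs (F (z + h) - F z - h * l) <= K * cabs h ^+ 2) -> der_at F z l.
Proof.
move=> d0 H e e0.
have K0 : 0 < `|K| + 1 by rewrite ltr_wpDl.
exists (Num.min d (e / (`|K| + 1))); first by rewrite lt_min d0 divr_gt0.
move=> w; rewrite lt_min => /andP[w1 w2].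
have := H _ w1; have -> : z + (w - z) = w by ring.
rewrite [l * _]mulrC => /le_trans; apply.
rewrite expr2 mulrA ler_wpM2r ?cabs_ge0//.
apply: (@le_trans _ _ ((`|K| + 1) * cabs (w - z))).
  by rewrite ler_wpM2r ?cabs_ge0// (le_trans (ler_norm _))// lerDl.
by rewrite mulrC -ler_pdivlMr// ltW.
Qed.

Lemma slice_lip (c : R -> C) (dc : R -> C) (B x y : R) :
  (forall t, Num.min x y <= t <= Num.max x y -> cder1 c t (dc t)) ->
  (forall t, Num.min x y <= t <= Num.max x y -> cabs (dc t) <= B) ->
  cabs (c y - c x) <= 2 * B * `|y - x|.
Proof.
have main a b : a <= b -> (forall t, a <= t <= b -> cder1 c t (dc t)) ->
    (forall t, a <= t <= b -> cabs (dc t) <= B) -> cabs (c b - c a) <= 2 * B * (b - a).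
  move=> ab H1 H2.
  have h1 := @mean_value_ineq R (fun t => cre (c t)) (fun t => cre (dc t)) a b B ab
    (fun t ht => (H1 t ht).1) (fun t ht => le_trans (cre_le _) (H2 t ht)).
  have h2 := @mean_value_ineq R (fun t => cim (c t)) (fun t => cim (dc t)) a b B ab
    (fun t ht => (H1 t ht).2) (fun t ht => le_trans (cim_le _) (H2 t ht)).
  by apply: (le_trans (cabs_le _)); rewrite creB cimB; lra.
have [xy|/ltW yx] := leP x y => H1 H2.
  by rewrite ger0_norm ?subr_ge0//; apply: main.
by rewrite cabs_sub distrC ger0_norm ?subr_ge0//; apply: main.
Qed.

Lemma cabs_toC_le (a b a' b' : R) : `|a| <= `|a'| -> `|b| <= `|b'| ->
  cabs (toC (a, b) : C) <= cabs (toC (a', b') : C).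
Proof.
move=> h1 h2; rewrite !cabsE ler_wsqrtr//= lerD//.
  by rewrite -[a ^+ 2]real_normK ?num_real// -[a' ^+ 2]real_normK ?num_real// ler_sqr ?nnegrE.
by rewrite -[b ^+ 2]real_normK ?num_real// -[b' ^+ 2]real_normK ?num_real// ler_sqr ?nnegrE.
Qed.

(** A primitive obtained from [local_primitive] comes with partial derivatives only. These are
    continuous, hence locally bounded, and one horizontal plus one vertical segment gives a
    Lipschitz bound. *)
Lemma slices_cont F f z0 (d : R) z : (forall z, cabs (z - z0) < d -> wirt F z (f z) 0) ->
  (forall z, cabs (z - z0) < d -> cct f z) -> cabs (z - z0) < d -> cct F z.
Proof.
move=> HF cf zd.
have [e1 e10 He1] := (cctE _ _).1 (cf z zd) 1 ltr01.
pose B := cabs (f z) + 1.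
have B0 : 0 < B by rewrite ltr_wpDl// cabs_ge0.
apply/cctE => e e0.
(* Each segment contributes [2 * B], together [4 * B]; the 5 makes the inequality strict. *)
exists (Num.min (Num.min e1 (d - cabs (z - z0))) (e / (5 * B))).
  by rewrite !lt_min e10 subr_gt0 zd divr_gt0// mulr_gt0.
move=> w; rewrite !lt_min => /andP[/andP[w1 w2] w3].
have near v : cabs (v - z) <= cabs (w - z) -> cabs (v - z0) < d /\ cabs (f v) <= B.
  move=> vw; split.
    have -> : v - z0 = (v - z) + (z - z0) by ring.
    by apply: (le_lt_trans (cabsD _ _)); lra.
  have := He1 v (le_lt_trans vw w1); have := cabs_triangle (f v) (f z); rewrite /B; lra.
have inb (x y t : R) : Num.min x y <= t <= Num.max x y -> `|t - x| <= `|y - x|.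
  have := ler_norm (y - x); have := ler_norm (- (y - x)); rewrite normrN => ? ?.
  by case: (leP x y) => ? /andP[? ?]; rewrite ler_norml; lra.
have wE : w - z = toC (cre w - cre z, cim w - cim z) :> C by apply: cplx_eq; rewrite !cE.
have h1 : cabs (F (toC (cre w, cim z)) - F (toC (cre z, cim z))) <= 2 * B * `|cre w - cre z|.
  apply: (@slice_lip (fun s => F (toC (s, cim z))) (fun s => f (toC (s, cim z)))).
    move=> t ht; have [|tn _] := near (toC (t, cim z)).
      have -> : toC (t, cim z) - z = toC (t - cre z, 0) :> C by apply: cplx_eq; rewrite !cE//=; ring.
      by rewrite wE; apply: cabs_toC_le; rewrite ?normr0//; exact: inb.
    by have [+ _] := HF _ tn; rewrite addr0.
  move=> t ht; have [|_] // := near (toC (t, cim z)).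
  have -> : toC (t, cim z) - z = toC (t - cre z, 0) :> C by apply: cplx_eq; rewrite !cE//=; ring.
  by rewrite wE; apply: cabs_toC_le; rewrite ?normr0//; exact: inb.
have h2 : cabs (F (toC (cre w, cim w)) - F (toC (cre w, cim z))) <= 2 * B * `|cim w - cim z|.
  apply: (@slice_lip (fun s => F (toC (cre w, s))) (fun s => iC R * f (toC (cre w, s)))).
    move=> t ht; have [|tn _] := near (toC (cre w, t)).
      have -> : toC (cre w, t) - z = toC (cre w - cre z, t - cim z) :> C by apply: cplx_eq; rewrite !cE.
      by rewrite wE; apply: cabs_toC_le => //; exact: inb.
    by have [_ +] := HF _ tn; rewrite subr0.
  move=> t ht; rewrite cabsM cabsI mul1r; have [|_] // := near (toC (cre w, t)).
  have -> : toC (cre w, t) - z = toC (cre w - cre z, t - cim z) :> C by apply: cplx_eq; rewrite !cE.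
  by rewrite wE; apply: cabs_toC_le => //; exact: inb.
rewrite !toC_reim in h1 h2.
have -> : F w - F z = (F w - F (toC (cre w, cim z))) + (F (toC (cre w, cim z)) - F z) by ring.
apply: (le_lt_trans (cabsD _ _)); apply: (le_lt_trans (lerD h2 h1)).
have r1 : `|cre w - cre z| <= cabs (w - z) by rewrite -creB cre_le.
have r2 : `|cim w - cim z| <= cabs (w - z) by rewrite -cimB cim_le.
apply: (@le_lt_trans _ _ (4 * B * cabs (w - z))).
  have -> : 4 * B * cabs (w - z) = 2 * B * cabs (w - z) + 2 * B * cabs (w - z) by ring.
  by apply: lerD; apply: ler_wpM2l => //; rewrite mulr_ge0// ltW.
apply: (@le_lt_trans _ _ (4 * B * (e / (5 * B)))).
  by apply: ler_wpM2l; [rewrite mulr_ge0// ltW|exact: ltW].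
have -> : 4 * B * (e / (5 * B)) = e * (4 / 5) by field; rewrite gt_eqF.
by rewrite gtr_pMr//; lra.
Qed.

(** The analogue of [kap_move] one order higher: [L] represents the derivative of [F] up to a
    factor, so its complex differentiability, together with the Lipschitz bound on [L2], yields a
    continuous second derivative. *)
Lemma kap2_move F f zc r0 r1 z r s B h : chol F f zc r0 -> r1 < r0 -> cabs zc + r1 < 1 ->
  (forall w, cabs (w - zc) <= r1 -> cabs (F w) <= B) ->
  0 < r -> 1 <= s * r ^+ 2 -> cabs (z - zc) + r <= r1 -> cabs (z + h - zc) + r <= r1 ->
  let L z := CJ (fun w => F w * (cconj (w - z) * RtoC (pos (bump s z w) ^+ 2))) in
  let L2 z := CJ (fun w => F w * (cconj (w - z) ^+ 2 * RtoC (pos (bump s z w)))) in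
  cabs (L (z + h) - L z - h * (RtoC (2 * s) * L2 z))
    <= 8 * (B * (3 * (64 * s ^+ 2 + 2 * s) + 16 * s)) * cabs h ^+ 2 /\
  cabs (L2 (z + h) - L2 z) <= 8 * (B * (72 * s + 6)) * cabs h.
Proof.
move=> HF r1r0 zcr HB rgt0 sr zr zhr.
have cF w : cabs (w - zc) < r0 -> cct F w by move=> /HF [].
have s0 : 0 < s by rewrite -(pmulr_lgt0 _ (exprn_gt0 2 rgt0)) (lt_le_trans _ sr).
have r1lt := r_lt1 zcr; have zc0 := cabs_ge0 zc.
have B0 : 0 <= B.
  apply: (le_trans (cabs_ge0 (F zc))); apply: HB; rewrite subrr cabs0.
  by have := cabs_ge0 (z - zc); lra.
have k0 : 0 <= 3 * (64 * s ^+ 2 + 2 * s) + 16 * s.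
  exact: (addr_ge0 (mulr_ge0 (ler0n _ 3) (addr_ge0 (mulr_ge0 (ler0n _ 64) (sqr_ge0 s)) (mulr_ge0 (ler0n _ 2) (ltW s0)))) (mulr_ge0 (ler0n _ 16) (ltW s0))).
have k0' : 0 <= 72 * s + 6 by exact: (addr_ge0 (mulr_ge0 (ler0n _ 72) (ltW s0)) (ler0n _ 6)).
have Bk0 := mulr_ge0 (mulr_ge0 B0 k0) (sqr_ge0 (cabs h)).
have Bk0' := mulr_ge0 (mulr_ge0 B0 k0') (cabs_ge0 h).
have hle2 : cabs h <= 2.
  have -> : h = (z + h - zc) - (z - zc) by ring.
  by apply: (le_trans (cabsB _ _)); have := cabs_ge0 (z - zc); have := cabs_ge0 (z + h - zc); lra.
have out w : r1 < cabs (w - zc) -> r < cabs (w - z).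
  move=> wr; have := cabs_triangle (w - zc) (z - zc).
  by have -> : w - zc - (z - zc) = w - z by [ring]; lra.
have out' w : r1 < cabs (w - zc) -> r < cabs (w - (z + h)).
  move=> wr; have := cabs_triangle (w - zc) (z + h - zc).
  by have -> : w - zc - (z + h - zc) = w - (z + h) by [ring]; lra.
have wz3 w : cabs (w - zc) <= r1 -> cabs (w - z) <= 3 /\ cabs (w - (z + h)) <= 3.
  move=> wr; split.
    have -> : w - z = (w - zc) - (z - zc) by ring.
    by apply: (le_trans (cabsB _ _)); lra.
  have -> : w - (z + h) = (w - zc) - (z + h - zc) by ring.
  by apply: (le_trans (cabsB _ _)); lra.
have czz v : ccont (fun w => w - v) by move=> w; apply: ct_B; [exact: ct_id|exact: ct_cst].
have czc v : ccont (fun w => cconj (w - v)) by move=> w; apply: ct_conj; exact: czz.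
have cp1 v : ccont (fun w => RtoC (pos (bump s v w))).
  by move=> w; apply: ct_RtoC; apply: rt_comp; [exact: bump_cont|exact: pos_cont].
have cp2 v : ccont (fun w => RtoC (pos (bump s v w) ^+ 2)).
  by move=> w; apply: ct_RtoC; exact: posbump_cont.
have c2 : ccont (fun w => RtoC (2 * pos (bump s z w))).
  by move=> w; apply: ct_RtoC; apply: rt_M; [exact: rt_cst|apply: rt_comp; [exact: bump_cont|exact: pos_cont]].
have cL v : (forall w, r1 < cabs (w - zc) -> r < cabs (w - v)) ->
    ccont (fun w => F w * (cconj (w - v) * RtoC (pos (bump s v w) ^+ 2))).
  move=> ov; apply: (cont_supp r1r0 cF).
    by move=> w; apply: ct_M; [exact: czc|exact: cp2].
  by move=> w /ov hw; rewrite (bump_out rgt0 sr hw) expr0n /= RtoC0 mulr0.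
have cL2 v : (forall w, r1 < cabs (w - zc) -> r < cabs (w - v)) ->
    ccont (fun w => F w * (cconj (w - v) ^+ 2 * RtoC (pos (bump s v w)))).
  move=> ov; apply: (cont_supp r1r0 cF).
    by move=> w; apply: ct_M; [apply: ct_X; exact: czc|exact: cp1].
  by move=> w /ov hw; rewrite (bump_out rgt0 sr hw) RtoC0 mulr0.
have cLz := cL z out; have cLz' := cL (z + h) out'.
have cL2z := cL2 z out; have cL2z' := cL2 (z + h) out'.
split; last first.
  rewrite -(CJ_B cL2z' cL2z) -mulrA; apply: CJ_bound.
    by move=> w; apply: ct_B; [exact: cL2z'|exact: cL2z].
  move=> w _; rewrite -mulrBr cabsM.
  have [wr|wr] := leP (cabs (w - zc)) r1; last first.
    rewrite (bump_out rgt0 sr (out _ wr)) (bump_out rgt0 sr (out' _ wr)) RtoC0 !mulr0 subrr cabs0 mulr0.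
    exact: Bk0'.
  have [w3 w3'] := wz3 w wr.
  rewrite -[leRHS]mulrA; apply: ler_pM; [exact: cabs_ge0|exact: cabs_ge0|exact: HB|].
  have -> : cconj (w - (z + h)) ^+ 2 * RtoC (pos (bump s (z + h) w)) - cconj (w - z) ^+ 2 * RtoC (pos (bump s z w))
    = cconj (w - (z + h)) ^+ 2 * RtoC (pos (bump s (z + h) w) - pos (bump s z w))
      - cconj h * (cconj (w - (z + h)) + cconj (w - z)) * RtoC (pos (bump s z w)).
    rewrite RtoCD RtoCN; have -> : w - (z + h) = (w - z) - h by ring.
    by rewrite cconjD cconjN; ring.
  apply: (le_trans (cabsB _ _)); rewrite [leRHS]mulrDl; apply: lerD.
    rewrite cabsM cabsX cabsconj cabsR.
    have a1 : cabs (w - (z + h)) ^+ 2 <= 9.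
      by have := cabs_ge0 (w - (z + h)); rewrite expr2; nra.
    have := pos_bump_shift (ltW s0) w3 hle2 => a2.
    apply: (@le_trans _ _ (9 * (8 * s * cabs h))); last by rewrite le_eqVlt; apply/orP; left; apply/eqP; ring.
    by apply: ler_pM => //; exact: sqr_ge0.
  rewrite !cabsM cabsconj cabsR.
  have /andP[p0 p1] := pos_bump01 z w (ltW s0); rewrite (ger0_norm p0).
  apply: (@le_trans _ _ (cabs h * 6 * 1)); last by rewrite mulr1 mulrC.
  apply: ler_pM => //; first by rewrite mulr_ge0 ?cabs_ge0.
  apply: ler_wpM2l; first exact: cabs_ge0.
  by apply: (le_trans (cabsD _ _)); rewrite !cabsconj; lra.
have [] := @holo_ibp R F f (fun w => cconj (w - z) * RtoC (pos (bump s z w) ^+ 2))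
  (fun w => cconj (w - z) * (RtoC (2 * pos (bump s z w)) * (- RtoC s * cconj (w - z))))
  (fun w => RtoC (pos (bump s z w) ^+ 2) + cconj (w - z) * (RtoC (2 * pos (bump s z w)) * (- RtoC s * (w - z))))
  zc r0 r1 HF r1r0 zcr.
- move=> w.
  have wz : wirt (fun w => w - z) w (1 - 0) (0 - 0) by apply: wirtB; [exact: wirt_id|exact: wirt_cst].
  apply: (wirt_eq (wirtM (wirt_conj wz) (kap2_wirt s z w))); rewrite !subr0.
    by rewrite -RtoC0 cconjR RtoC0; ring.
  by rewrite cconj1; ring.
- by move=> w; apply: ct_M; [exact: czc|exact: cp2].
- by move=> w; apply: ct_M; [exact: czc|apply: ct_M; [exact: c2|apply: ct_M; [exact: ct_cst|exact: czc]]].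
- move=> w; apply: ct_D; first exact: cp2.
  by apply: ct_M; [exact: czc|apply: ct_M; [exact: c2|apply: ct_M; [exact: ct_cst|exact: czz]]].
- by move=> w /out hw; rewrite (bump_out rgt0 sr hw) !expr0n /= !mulr0 RtoC0 !mul0r !mulr0 addr0.
move=> cb Ib _ _.
set Kb := (fun w => RtoC (pos (bump s z w) ^+ 2) + cconj (w - z) * (RtoC (2 * pos (bump s z w)) * (- RtoC s * (w - z)))) in cb Ib.
have cL' : ccont (fun w => (h * RtoC (2 * s)) * (F w * (cconj (w - z) ^+ 2 * RtoC (pos (bump s z w))))).
  by move=> w; apply: ct_M; [exact: ct_cst|exact: cL2z].
have cb' : ccont (fun w => cconj h * (F w * Kb w)).
  by move=> w; apply: ct_M; [exact: ct_cst|exact: cb].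
pose G12 w := F w * (cconj (w - (z + h)) * RtoC (pos (bump s (z + h) w) ^+ 2))
   - F w * (cconj (w - z) * RtoC (pos (bump s z w) ^+ 2)).
have c12 : ccont G12 by move=> w; apply: ct_B; [exact: cLz'|exact: cLz].
pose G123 w := G12 w - (h * RtoC (2 * s)) * (F w * (cconj (w - z) ^+ 2 * RtoC (pos (bump s z w)))).
have c123 : ccont G123 by move=> w; apply: ct_B; [exact: c12|exact: cL'].
rewrite -(CJ_B cLz' cLz) mulrA -(CJ_Z _ cL2z) -(CJ_B c12 cL').
(* A vanishing integral is added to cancel the part of the first variation that is linear in
   [conj h]; here holomorphy of [F] enters. *)
have -> : CJ G123 = CJ (fun w => G123 w + cconj h * (F w * Kb w)).
  by rewrite (CJ_D c123 cb') (CJ_Z _ cb) Ib mulr0 addr0.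
rewrite -mulrA; apply: CJ_bound.
  by move=> w; apply: ct_D; [exact: c123|exact: cb'].
move=> w _.
have -> : G123 w + cconj h * (F w * Kb w) = F w * (cconj (w - z) * RtoC (pos (bump s (z + h) w) ^+ 2 - pos (bump s z w) ^+ 2
    - 4 * s * pos (bump s z w) * cre (cconj (w - z) * h))
    - cconj h * RtoC (pos (bump s (z + h) w) ^+ 2 - pos (bump s z w) ^+ 2)).
  have -> : 4 * s * pos (bump s z w) * cre (cconj (w - z) * h) =
    2 * s * pos (bump s z w) * (2 * cre (cconj (w - z) * h)) by ring.
  rewrite /G123 /G12 /Kb !(RtoCD, RtoCN) [RtoC (2 * s * _ * _)]RtoCM RtoC_2re cconjM cconjK !RtoCM.
  have -> : w - (z + h) = (w - z) - h by ring.
  by rewrite [cconj (w - z - h)]cconjD cconjN; ring.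
rewrite cabsM.
have [wr|wr] := leP (cabs (w - zc)) r1; last first.
  rewrite (bump_out rgt0 sr (out _ wr)) (bump_out rgt0 sr (out' _ wr)) !expr2 !mulr0 !mul0r !subrr !mulr0 subrr cabs0 mulr0.
  exact: Bk0.
have [w3 w3'] := wz3 w wr.
rewrite -[leRHS]mulrA; apply: ler_pM; [exact: cabs_ge0|exact: cabs_ge0|exact: HB|].
apply: (le_trans (cabsB _ _)); rewrite [leRHS]mulrDl; apply: lerD.
  rewrite cabsM cabsconj cabsR -[leRHS]mulrA; apply: ler_pM; [exact: cabs_ge0|exact: normr_ge0|exact: w3|].
  by apply: kap2_shift; [exact: ltW|exact: w3|exact: hle2].
rewrite cabsM cabsconj cabsR subr_sqr normrM.
have a2 := pos_bump_shift (ltW s0) w3 hle2.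
have /andP[p0 p1] := pos_bump01 z w (ltW s0).
have /andP[q0 q1] := pos_bump01 (z + h) w (ltW s0).
rewrite (ger0_norm (addr_ge0 q0 p0)).
have -> : 16 * s * cabs h ^+ 2 = cabs h * ((8 * s * cabs h) * 2) by ring.
apply: ler_wpM2l; first exact: cabs_ge0.
by apply: ler_pM; [exact: normr_ge0|exact: addr_ge0|exact: a2|lra].
Qed.

(** By the mean value formula [F] is an average whose centre moves with the point, so it inherits
    the differentiability of the kernel. Centre and kernel radius [r0 / 4] keep every average inside
    the disc of radius [r0 / 2]. *)
Lemma chol_holo F f zc r0 : 0 < r0 -> cabs zc + r0 <= 1 -> chol F f zc r0 ->
  exists (D : C -> C) (d : R), [/\ 0 < d, d <= r0 & forall z, cabs (z - zc) < d ->
    [/\ der_at F z (f z), der_at f z (D z) & cct D z]].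
Proof.
move=> r00 zcr HF; pose r1 := r0 / 2; pose r := r1 / 2.
have r1r0 : r1 < r0 by rewrite /r1; lra.
have r10 : 0 < r1 by rewrite /r1; lra.
have rgt0 : 0 < r by rewrite /r; lra.
have zcr1 : cabs zc + r1 < 1 by lra.
have cF z : cabs (z - zc) < r0 -> cct F z by move=> /HF [].
have [B B0 HB] := bounded_ball r10 r1r0 zcr1 cF.
pose s := r ^- 2.
have sr : 1 <= s * r ^+ 2 by rewrite /s mulVf// expf_neq0// gt_eqF.
have s0 : 0 < s by rewrite /s invr_gt0 exprn_gt0.
pose L z := CJ (fun w => F w * (cconj (w - z) * RtoC (pos (bump s z w) ^+ 2))).
pose L2 z := CJ (fun w => F w * (cconj (w - z) ^+ 2 * RtoC (pos (bump s z w)))).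
have cn : RtoC (c0 R) != 0 by rewrite -cabs_eq0 cabsR normr_eq0 gt_eqF// c0_gt0.
have MVz z : cabs (z - zc) < r ->
    RtoC (c0 R) * F z = RtoC s * CJ (fun w => F w * RtoC (pos (bump s z w) ^+ 3)).
  move=> zr; have zt := cabs_triangle z zc.
  have HFz : chol F f z (r0 - cabs (z - zc)).
    move=> w wz; apply: HF; have -> : w - zc = (w - z) + (z - zc) by ring.
    by apply: (le_lt_trans (cabsD _ _)); lra.
  by rewrite (MV HFz rgt0 _ _ sr)//; rewrite /r /r1 in zr *; lra.
have inb z h : cabs (z - zc) < r -> cabs h < r - cabs (z - zc) -> cabs (z + h - zc) < r.
  move=> zr hr; have -> : z + h - zc = (z - zc) + h by ring.
  by apply: (le_lt_trans (cabsD _ _)); lra.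
have rr z : cabs (z - zc) < r -> cabs (z - zc) + r <= r1 by rewrite /r /r1; lra.
(* [c0 F] equals [s] times the average, whose derivative is [3 s L] by [kap_move]. *)
pose k : C := RtoC (3 * s ^+ 2 / c0 R).
have d1 z : cabs (z - zc) < r -> der_at F z (k * L z).
  move=> zr; have rz : 0 < r - cabs (z - zc) by rewrite subr_gt0.
  apply: (quad_der (K := s / c0 R * (8 * (B * (384 * s ^+ 2 + 3 * s)))) rz) => h hr.
  have zhr := inb z h zr hr.
  have := kap_move HF r1r0 zcr1 HB rgt0 sr (rr _ zr) (rr _ zhr) => M.
  have -> : F (z + h) - F z - h * (k * L z) = RtoC (s / c0 R) *
    (CJ (fun w => F w * RtoC (pos (bump s (z + h) w) ^+ 3))
    - CJ (fun w => F w * RtoC (pos (bump s z w) ^+ 3))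
    - h * (RtoC (3 * s) * L z)).
    apply: (mulfI cn); rewrite mulrBr mulrBr !MVz// /k !RtoCM RtoCV.
    by field.
  rewrite cabsM cabsR ger0_norm; last exact: (divr_ge0 (ltW s0) (ltW (c0_gt0 R))).
  rewrite -[leRHS]mulrA; apply: ler_wpM2l; last exact: M.
  exact: (divr_ge0 (ltW s0) (ltW (c0_gt0 R))).
have fE z : cabs (z - zc) < r -> f z = k * L z.
  move=> zr; have zr0 : cabs (z - zc) < r0 by rewrite /r /r1 in zr; lra.
  by have [wF _ _] := HF z zr0; rewrite (der_at_wirt_uniq (d1 z zr) wF).
exists (fun z => k * (RtoC (2 * s) * L2 z)), r; split => //; first by rewrite /r /r1; lra.
move=> z zr; have rz : 0 < r - cabs (z - zc) by rewrite subr_gt0.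
split; first by rewrite fE//; exact: d1.
  apply: (quad_der (K := cabs k * (8 * (B * (3 * (64 * s ^+ 2 + 2 * s) + 16 * s)))) rz) => h hr.
  have zhr := inb z h zr hr.
  have [M _] := kap2_move HF r1r0 zcr1 HB rgt0 sr (rr _ zr) (rr _ zhr).
  rewrite !fE//; have -> : k * L (z + h) - k * L z - h * (k * (RtoC (2 * s) * L2 z)) =
    k * (L (z + h) - L z - h * (RtoC (2 * s) * L2 z)) by ring.
  by rewrite cabsM -mulrA; apply: ler_wpM2l; [exact: cabs_ge0|exact: M].
have c2 : cct L2 z.
  pose K := 8 * (B * (72 * s + 6)).
  have K0 : 0 < `|K| + 1 by rewrite ltr_wpDl.
  apply/cctE => e e0; exists (Num.min (r - cabs (z - zc)) (e / (`|K| + 1))).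
    by rewrite lt_min rz divr_gt0.
  move=> w; rewrite lt_min => /andP[w1 w2].
  have wE : z + (w - z) = w by ring.
  have zwr := inb z (w - z) zr w1.
  have [_] := kap2_move HF r1r0 zcr1 HB rgt0 sr (rr _ zr) (rr _ zwr).
  rewrite wE => H; apply: (le_lt_trans H); rewrite -/K.
  apply: (@le_lt_trans _ _ ((`|K| + 1) * cabs (w - z))).
    by rewrite ler_wpM2r ?cabs_ge0// (le_trans (ler_norm _))// lerDl.
  by rewrite mulrC -ltr_pdivlMr.
by apply: ct_M; [exact: ct_cst|apply: ct_M; [exact: ct_cst|exact: c2]].
Qed.

Lemma analytic_der F z : analytic_on_disk F -> disk z -> der_at F z (cder F z).
Proof. by move=> aF dz; apply: derivable_der_at; exact: aF. Qed.

(** [chol_holo] is used twice. Applied to a Goursat primitive of [F], it shows that [cder F] is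
    continuous; this makes [F] itself admissible, and the second application differentiates
    [cder F]. *)
Lemma analytic_cder F : analytic_on_disk F -> analytic_on_disk (cder F) /\
  forall z, disk z -> cct (cder F) z.
Proof.
move=> aF; have main z0 : disk z0 -> derivable (cder F) z0 1 /\ cct (cder F) z0.
  move=> dz0; pose r := 1 - cabs z0.
  have r0 : 0 < r by rewrite subr_gt0.
  have din z : cabs (z - z0) < r -> disk z.
    by move=> zr; rewrite /disk/=; have := cabs_triangle z z0; rewrite /r in zr; lra.
  have [G [d [d0 HG]]] := @local_primitive R F z0 r r0 (fun z zr => ex_intro _ _ (analytic_der aF (din z zr))).
  pose r1 := Num.min d r.
  have r10 : 0 < r1 by rewrite lt_min d0.
  have r1d : r1 <= d by rewrite ge_min lexx.
  have r1r : r1 <= r by rewrite ge_min lexx orbT.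
  have cF z : cabs (z - z0) < r1 -> cct F z.
    by move=> zr; apply: ct_der; apply: analytic_der => //; apply: din; lra.
  have wG z : cabs (z - z0) < r1 -> wirt G z (F z) 0.
    move=> zr; have [] := HG (cre z) (cim z); first by rewrite toC_reim; lra.
    by rewrite toC_reim => h1 h2; split; rewrite ?addr0 ?subr0.
  have HGF : chol G F z0 r1.
    move=> z zr; split; [exact: wG| |exact: cF].
    exact: (slices_cont wG cF zr).
  have z0r1 : cabs z0 + r1 <= 1 by rewrite /r in r1r; lra.
  have [D [d' [d'0 d'r H]]] := chol_holo r10 z0r1 HGF.
  have cderE z : cabs (z - z0) < d' -> D z = cder F z.
    by move=> zd; have [_ h _] := H z zd; rewrite (der_at_cder h).
  have z0in x : 0 < x -> cabs (z0 - z0) < x by rewrite subrr cabs0.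
  have cct_loc z : cabs (z - z0) < d' -> cct (cder F) z.
    move=> zd; have [_ _ /cctE hD] := H z zd; apply/cctE => e e0.
    have [e1 e10 He] := hD e e0; exists (Num.min e1 (d' - cabs (z - z0))).
      by rewrite lt_min e10 subr_gt0.
    move=> w; rewrite lt_min => /andP[w1 w2]; rewrite -!cderE//; first exact: He.
    have -> : w - z0 = (w - z) + (z - z0) by ring.
    by apply: (le_lt_trans (cabsD _ _)); lra.
  have HF : chol F (cder F) z0 d'.
    move=> z zd; split; last exact: cct_loc.
      by apply: wirt_holo; apply: analytic_der => //; apply: din; lra.
    by apply: cF; lra.
  have z0d' : cabs z0 + d' <= 1 by rewrite /r in r1r; lra.
  have [D' [d'' [d''0 _ H']]] := chol_holo d'0 z0d' HF.
  have [_ h _] := H' z0 (z0in _ d''0).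
  by split; [exact: der_at_derivable h|exact: cct_loc (z0in _ d'0)].
by split => z /main [].
Qed.

Lemma analytic_chol F z0 r0 : analytic_on_disk F -> cabs z0 + r0 <= 1 -> chol F (cder F) z0 r0.
Proof.
move=> aF zr z hz; have dz : disk z by rewrite /disk/=; have := cabs_triangle z z0; lra.
have d := analytic_der aF dz; split; first exact: wirt_holo.
  exact: ct_der d.
by have [_ +] := analytic_cder aF; apply.
Qed.

(* Jensen: expand the nonnegative weighted integral of [(Re (cconj (F z0) * F) - |F z0|^2)^2]. *)
Lemma L2_mean_value F z0 r s : analytic_on_disk F -> 0 < r -> cabs z0 + r < 1 ->
  1 <= s * r ^+ 2 ->
  c0 R * cabs (F z0) ^+ 2 <= s * J (fun z => cabs (F z) ^+ 2 * pos (bump s z0 z) ^+ 3).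
Proof.
move=> aF r0 zr sr; pose r0' := 1 - cabs z0.
have HF : chol F (cder F) z0 r0' by apply: analytic_chol => //; rewrite /r0'; lra.
have rr0 : r < r0' by rewrite /r0'; lra.
have s0 : 0 < s by rewrite -(pmulr_lgt0 _ (exprn_gt0 2 r0)) (lt_le_trans _ sr).
have cF z : cabs (z - z0) < r0' -> cct F z by move=> /HF [].
have zz0 : cabs (z0 - z0) + r <= r by rewrite subrr cabs0 add0r.
set A := cabs (F z0) ^+ 2; pose u := cconj (F z0).
pose k z := pos (bump s z0 z) ^+ 3.
have [A0|A0] := eqVneq A 0.
  rewrite A0 mulr0 mulr_ge0 ?(ltW s0)//; apply: J_ge0 => z.
  by rewrite mulr_ge0 ?sqr_ge0// exprn_ge0// pos_ge0.
have Agt0 : 0 < A by rewrite lt_def A0 sqr_ge0.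
have k0 z : 0 <= k z by rewrite exprn_ge0// pos_ge0.
have ck : rcont k by exact: posbump_cont.
have cFk : ccont (fun z => F z * RtoC (k z)) by exact: (kap_cont cF r0 sr zz0 rr0).
have supp (G : C -> C) : (forall z, cabs (z - z0) < r0' -> cct G z) -> ccont (fun z => G z * RtoC (k z)).
  by move=> cG; exact: (kap_cont cG r0 sr zz0 rr0).
have rsupp (l : C -> R) : (forall z, cabs (z - z0) < r0' -> rct l z) -> rcont (fun z => l z * k z).
  move=> cl; have /ccont_re h : ccont (fun z => RtoC (l z) * RtoC (k z)).
    by apply: supp => z zr'; apply: ct_RtoC; exact: cl.
  by move=> z; apply: rt_ext (h z) => w; rewrite -RtoCM creR.
have cuF z : cabs (z - z0) < r0' -> rct (fun z => cre (u * F z)) z.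
  by move=> zr'; apply: ct_re; apply: ct_M; [exact: ct_cst|exact: cF].
have c1 : rcont (fun z => cre (u * F z) ^+ 2 * k z) by apply: rsupp => z zr'; apply: rt_X; exact: cuF.
have c2 : rcont (fun z => cre (u * F z) * k z) by apply: rsupp.
have c3 : rcont (fun z => cabs (F z) ^+ 2 * k z).
  by apply: rsupp => z zr'; apply: rt_X; apply: ct_abs; exact: cF.
have mv : s * J (fun z => cre (u * F z) * k z) = c0 R * A.
  have := MV HF r0 rr0 zr sr => /(congr1 (fun x => cre (u * x))).
  rewrite [in RHS]mulrCA [u * F z0]mulrC mulcconj -/A -RtoCM creR => <-.
  rewrite mulrCA -(CJ_Z u cFk) cre_RtoCM; congr (_ * _); rewrite /CJ /=.
  by apply: J_ext => z; rewrite mulrA !cE; ring.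
have jk : s * J k = c0 R by exact: (J_kap r0 zr sr).
have H : 0 <= J (fun z => (cre (u * F z) - A) ^+ 2 * k z).
  by apply: J_ge0 => z; rewrite mulr_ge0// sqr_ge0.
have cA2 : rcont (fun z => 2 * A * (cre (u * F z) * k z)).
  by move=> z; apply: rt_M; [exact: rt_cst|exact: c2].
have cA3 : rcont (fun z => A ^+ 2 * k z) by move=> z; apply: rt_M; [exact: rt_cst|exact: ck].
have cAk : rcont (fun z => A * (cabs (F z) ^+ 2 * k z)).
  by move=> z; apply: rt_M; [exact: rt_cst|exact: c3].
have E : J (fun z => (cre (u * F z) - A) ^+ 2 * k z) =
   J (fun z => cre (u * F z) ^+ 2 * k z) - 2 * A * J (fun z => cre (u * F z) * k z) + A ^+ 2 * J k.
  have c12 : rcont (fun z => cre (u * F z) ^+ 2 * k z - 2 * A * (cre (u * F z) * k z)).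
    by move=> z; apply: rt_B; [exact: c1|exact: cA2].
  rewrite -(J_Z _ c2) -(J_Z _ ck) -(J_B c1 cA2) -(J_D c12 cA3).
  by apply: J_ext => z; ring.
have le1 : J (fun z => cre (u * F z) ^+ 2 * k z) <= A * J (fun z => cabs (F z) ^+ 2 * k z).
  rewrite -(J_Z _ c3); apply: J_le => // z; rewrite mulrA ler_wpM2r//.
  rewrite /A -(cabsconj (F z0)) -/u -exprMn -cabsM -real_normK ?num_real//.
  by rewrite ler_sqr ?nnegrE ?normr_ge0 ?cabs_ge0// cre_le.
rewrite E in H.
have H2 : 0 <= s * (A * J (fun z => cabs (F z) ^+ 2 * k z) - 2 * A * J (fun z => cre (u * F z) * k z) + A ^+ 2 * J k).
  by rewrite mulr_ge0 ?(ltW s0)//; lra.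
have H3 : s * (A * J (fun z => cabs (F z) ^+ 2 * k z) - 2 * A * J (fun z => cre (u * F z) * k z) + A ^+ 2 * J k)
  = A * (s * J (fun z => cabs (F z) ^+ 2 * k z)) - 2 * A * (s * J (fun z => cre (u * F z) * k z)) + A ^+ 2 * (s * J k) by ring.
rewrite H3 mv jk in H2.
rewrite -(ler_pM2l Agt0); move: H2; rewrite expr2; lra.
Qed.

(** The mean value formula for the derivative, integrated by parts, expresses it through [F] and the
    gradient of the bump. In 96 are collected the 2 of [CJ_le], the 24 of the comparison below and
    the 2 in the mass [2 c0 / s] of the wider bump. *)
Lemma cauchy_estimate F z0 r M : analytic_on_disk F -> 0 < r -> cabs z0 + 2 * r < 1 ->
  (forall z, cabs (z - z0) <= r -> cabs (F z) <= M) -> cabs (cder F z0) <= 96 * M / r.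
Proof.
move=> aF r0 zr HM; pose r0' := 1 - cabs z0.
have HF : chol F (cder F) z0 r0' by apply: analytic_chol => //; rewrite /r0'; lra.
have rr0 : r < r0' by rewrite /r0'; lra.
pose s := r ^- 2.
have sr1 : s * r ^+ 2 = 1 by rewrite /s mulVf// expf_neq0// gt_eqF.
have sr : 1 <= s * r ^+ 2 by rewrite sr1.
have s0 : 0 < s by rewrite /s invr_gt0 exprn_gt0.
have M0 : 0 <= M by apply: (le_trans (cabs_ge0 (F z0))); apply: HM; rewrite subrr cabs0 ltW.
have cF z : cabs (z - z0) < r0' -> cct F z by move=> /HF [].
have zr1 : cabs z0 + r < 1 by lra.
have czz : ccont (fun w => w - z0) by move=> w; apply: ct_B; [exact: ct_id|exact: ct_cst].
have czc : ccont (fun w => cconj (w - z0)) by move=> w; apply: ct_conj; exact: czz.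
have c3 : ccont (fun w => RtoC (3 * pos (bump s z0 w) ^+ 2)).
  by move=> w; apply: ct_RtoC; apply: rt_M; [exact: rt_cst|exact: posbump_cont].
have HF' : chol (cder F) (cder (cder F)) z0 r0'.
  by apply: analytic_chol; [exact: (analytic_cder aF).1|rewrite /r0'; lra].
have [] := @holo_ibp R F (cder F) (fun w => RtoC (pos (bump s z0 w) ^+ 3))
  (fun w => RtoC (3 * pos (bump s z0 w) ^+ 2) * (- RtoC s * cconj (w - z0)))
  (fun w => RtoC (3 * pos (bump s z0 w) ^+ 2) * (- RtoC s * (w - z0))) z0 r0' r HF rr0 zr1.
- by move=> w; apply: kap3_wirt; exact: ltW.
- by move=> w; apply: ct_RtoC; exact: posbump_cont.
- by move=> w; apply: ct_M; [exact: c3|apply: ct_M; [exact: ct_cst|exact: czc]].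
- by move=> w; apply: ct_M; [exact: c3|apply: ct_M; [exact: ct_cst|exact: czz]].
- by move=> w hw; rewrite (bump_out r0 sr hw) !expr0n /= !mulr0 RtoC0 !mul0r.
move=> _ _ cc Ic.
have cf z : cabs (z - z0) < r0' -> cct (cder F) z by move=> /HF [].
have zz0 : cabs (z0 - z0) + r <= r by rewrite subrr cabs0 add0r.
have ck1 := kap_cont (n := 3) cf r0 sr zz0 rr0 isT.
pose G z := F z * (RtoC (3 * pos (bump s z0 z) ^+ 2) * (- RtoC s * cconj (z - z0))).
have cG : ccont G.
  move=> z; apply: (ct_ext _ (ct_B (cc z) (ck1 z))) => w; rewrite /G; ring.
have IG : CJ (fun z => cder F z * RtoC (pos (bump s z0 z) ^+ 3)) = - CJ G.
  by apply/eqP; rewrite -addr_eq0 -(CJ_D ck1 cG) Ic.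
have := MV HF' r0 rr0 zr1 sr; rewrite IG => E.
have cc0 := c0_gt0 R.
(* Where the bump of parameter [s] is positive, the one of parameter [s / 2] is at least 1/2 and its
   cube at least 1/8, so [24 s r] times that cube dominates the gradient [3 s r]. The wider bump
   fits into radius [2 * r], whence the hypothesis. *)
pose s2 := s / 2.
have r20 : 0 < 2 * r by rewrite mulr_gt0.
have s2r : 1 <= s2 * (2 * r) ^+ 2.
  have -> : s2 * (2 * r) ^+ 2 = 2 * (s * r ^+ 2) by rewrite /s2; field.
  by rewrite sr1; lra.
have JE : J (fun z => pos (bump s2 z0 z) ^+ 3) = 2 * c0 R / s.
  by rewrite -(J_kap r20 zr s2r) /s2; field; rewrite gt_eqF.
have cbd : rcont (fun z => M * (24 * s * r) * pos (bump s2 z0 z) ^+ 3).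
  by move=> z; apply: rt_M; [exact: rt_cst|exact: posbump_cont].
have GB : cabs (CJ G) <= 2 * (M * (24 * s * r) * (2 * c0 R / s)).
  rewrite -JE -(J_Z _ (posbump_cont s2 z0 3)); apply: CJ_le => // q _.
  move: (toC q) => z; rewrite /G cabsM -[leRHS]mulrA.
  have p20 : 0 <= pos (bump s2 z0 z) ^+ 3 by rewrite exprn_ge0// pos_ge0.
  have kk : 0 <= 24 * s * r by rewrite !mulr_ge0// ltW.
  have [zr'|zr'] := leP (cabs (z - z0)) r; last first.
    have -> : RtoC (3 * pos (bump s z0 z) ^+ 2) = 0 by rewrite (bump_out r0 sr zr') expr2 !mulr0.
    rewrite mul0r cabs0 mulr0.
    exact: (mulr_ge0 M0 (mulr_ge0 kk p20)).
  apply: ler_pM; [exact: cabs_ge0|exact: cabs_ge0|exact: HM|].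
  rewrite !cabsM cabsN !cabsR cabsconj (gtr0_norm s0).
  have /andP[p0 p1] := pos_bump01 z0 z (ltW s0).
  rewrite ger0_norm; last by rewrite mulr_ge0// exprn_ge0.
  have b2 : 1 / 2 <= pos (bump s2 z0 z).
    apply: le_trans (pos_ge _); rewrite /bump /s2.
    have : s * cabs (z - z0) ^+ 2 <= 1.
      by rewrite -sr1 ler_wpM2l ?(ltW s0)// ler_sqr ?nnegrE ?cabs_ge0 ?(ltW r0).
    by lra.
  have b8 : 8^-1 <= pos (bump s2 z0 z) ^+ 3.
    apply: (@le_trans _ _ ((1 / 2) ^+ 3)); first by rewrite !exprS expr0; lra.
    by apply: lerXn2r => //; rewrite nnegrE ?pos_ge0//; lra.
  apply: (@le_trans _ _ (3 * (s * r))).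
    apply: ler_pM.
    - by rewrite mulr_ge0// exprn_ge0.
    - by rewrite mulr_ge0 ?cabs_ge0// ltW.
    - by rewrite ler_piMr// expr_le1.
    - by rewrite ler_wpM2l// ltW.
  apply: (@le_trans _ _ (24 * s * r * 8^-1)); last by rewrite ler_wpM2l.
  by rewrite le_eqVlt; apply/orP; left; apply/eqP; field.
have E2 : c0 R * cabs (cder F z0) = s * cabs (CJ G).
  have := congr1 (@cabs R) E; rewrite !cabsM cabsN !cabsR.
  by rewrite (gtr0_norm s0) (gtr0_norm cc0) => ->.
have : c0 R * cabs (cder F z0) <= c0 R * (96 * M / r).
  rewrite E2; apply: (le_trans (ler_wpM2l (ltW s0) GB)).
  rewrite le_eqVlt; apply/orP; left; apply/eqP.
  have rn : r != 0 by rewrite gt_eqF.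
  by rewrite /s; field.
by rewrite ler_pM2l.
Qed.

End Analytic.

(** * Moebius weights: Caccioppoli and Hardy inequalities *)

Section Weights.
Variable R : realType.
Local Notation C := (Cplx R).
Implicit Types (z w : C) (F f : C -> C).

Lemma powR_small (q e : R) : 0 < q -> 0 < e -> exists2 d : R, 0 < d &
  forall s, 0 <= s -> s < d -> s `^ q < e.
Proof.
move=> q0 e0; exists (e `^ q^-1); first by rewrite powR_gt0.
move=> s s0 sd; have : s `^ q < (e `^ q^-1) `^ q.
  by rewrite gt0_ltr_powR// nnegrE// powR_ge0.
by rewrite -powRrM mulVf ?gt_eqF// powRr1// ltW.
Qed.

Lemma pospow_cont (q : R) : 0 < q -> continuous (fun x : R => pos x `^ q).
Proof.
move=> q0 x; have [x0|x0|->] := ltgtP x 0.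
- apply/cvgrPdist_lt => e e0; apply/nbhs_ballP; exists (- x); first by rewrite /= oppr_gt0.
  move=> y; rewrite /ball/= => xy.
  have y0 : y <= 0 by have := ler_norm (- (x - y)); rewrite normrN; lra.
  by rewrite (pos_0 y0) (pos_0 (ltW x0)) subrr normr0.
- apply: (@continuous_comp _ _ _ (@pos R) (fun x => x `^ q)); first exact: pos_cont.
  apply: differentiable_continuous; apply/derivable1_diffP.
  by apply: derivable_powR; rewrite in_itv/= andbT pos_id ?ltW.
- rewrite /continuous_at pos_id// powR0 ?gt_eqF//.
  apply/cvgrPdist_lt => e e0; have [d d0 H] := powR_small q0 e0.
  apply/nbhs_ballP; exists d => //= y; rewrite /ball/= !sub0r !normrN => yd.
  rewrite ger0_norm ?powR_ge0//; apply: H; first exact: pos_ge0.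
  apply: le_lt_trans yd; apply: pos_le => //; exact: ler_norm.
Qed.

(** With an exponent above 1 the power is differentiable across 0. The weight has exponent [p <= 1],
    so it is differentiated only inside products where the total exponent is [1 + p] or [2 + p]. *)
Lemma pospow_der (q x : R) : 1 < q ->
  is_derive x 1 (fun s => pos s `^ q) (q * pos x `^ (q - 1)).
Proof.
move=> q1; have q10 : 0 < q - 1 by rewrite subr_gt0.
have q0 : 0 < q by lra.
have [x0|x0|->] := ltgtP x 0.
- rewrite (pos_0 (ltW x0)) powR0 ?gt_eqF// mulr0.
  apply: (@rder_local R (fun=> 0) _ x 0 (- x)); first by rewrite oppr_gt0.
  move=> s sx; have := ler_norm (s - x) => h.
  by rewrite pos_0 ?powR0 ?gt_eqF//; lra.
- rewrite (pos_id (ltW x0)).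
  apply: (@rder_local R (fun s => s `^ q) _ x _ x) => //; last exact: is_derive1_powR.
  move=> s sx; have := ler_norm (- (s - x)); rewrite normrN => h.
  by rewrite pos_id//; lra.
- rewrite pos_id// powR0 ?gt_eqF// mulr0; apply/rderP => e e0.
  have [d d0 H] := powR_small q10 e0; exists d => // s; rewrite !subr0 mul0r subr0 => sd.
  rewrite (@pos_id _ 0)// powR0 ?gt_eqF// subr0.
  have [s0|s0] := leP s 0.
    by rewrite pos_0// powR0 ?gt_eqF// normr0 mulr_ge0// ltW.
  rewrite (pos_id (ltW s0)) (gtr0_norm s0) ger0_norm ?powR_ge0//.
  have -> : s `^ q = s `^ (q - 1) * s.
    rewrite -{3}(powRr1 (ltW s0)) -powRD; last by apply/implyP => _; rewrite gt_eqF.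
    by congr (_ `^ _); ring.
  rewrite ler_pM2r// ltW//; apply: H; [exact: ltW|].
  by rewrite gtr0_norm in sd.
Qed.

Lemma rcont_supp (k : C -> R) r : r < 1 -> (forall z, cabs z < 1 -> rct k z) ->
  (forall z, r < cabs z -> k z = 0) -> rcont k.
Proof.
move=> r1 ck out z; have [z1|z1] := ltP (cabs z) 1; first exact: ck.
apply/rctE => e e0; exists (cabs z - r); first by lra.
move=> w wz; have := cabs_triangle z w; rewrite cabs_sub => h.
by rewrite !out ?subrr ?normr0//; lra.
Qed.

Variables (a : C) (m p : R).
Hypotheses (a1 : cabs a < 1) (m0 : 0 < m) (m1 : m < 1) (p0 : 0 < p) (p1 : p <= 1).

Let t z : C := 1 - cconj a * z.
Let N z : R := cabs (t z) ^+ 2.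
Let P z : R := m - cabs z ^+ 2.
Let c : R := 1 - cabs a ^+ 2.
(** For [m = 1] this is [1 - |phi_a(z)|^2]; for [m < 1] it is negative outside the closed disk
    [|z|^2 <= m], so that its positive part has compact support in the unit disk. *)
Definition wbase z : R := (1 - cabs a ^+ 2) * (m - cabs z ^+ 2) / cabs (1 - cconj a * z) ^+ 2.
Definition wgt z : R := pos (wbase z) `^ p.

Let c0 : 0 < c.
Proof. by rewrite /c subr_gt0 expr_lt1// cabs_ge0. Qed.
Let r : R := Num.sqrt m.
Let r0 : 0 < r. Proof. by rewrite /r sqrtr_gt0. Qed.
Let r2 : r ^+ 2 = m. Proof. by rewrite /r sqr_sqrtr// ltW. Qed.
Let r1 : r < 1. Proof. by rewrite -sqrtr1 /r ltr_sqrt. Qed.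

Lemma t_neq0 z : cabs z <= 1 -> t z != 0.
Proof.
move=> z1; rewrite -cabs_gt0 /t.
have := cabs_triangle 1 (cconj a * z); rewrite cabs1 cabsM cabsconj.
have : cabs a * cabs z <= cabs a by rewrite ler_piMr ?cabs_ge0.
by have := a1; lra.
Qed.
Let N_gt0 z : cabs z <= 1 -> 0 < N z.
Proof. by move=> z1; rewrite /N exprn_gt0// cabs_gt0 t_neq0. Qed.

Let P_out z : r < cabs z -> P z < 0.
Proof.
move=> h; rewrite /P -r2 subr_lt0 ltr_sqr ?nnegrE ?cabs_ge0//; exact: ltW.
Qed.
Lemma wbase_out z : r < cabs z -> pos (wbase z) = 0.
Proof.
move=> /P_out Pz; apply: pos_0; rewrite /wbase -/(c) -/(P z) -mulrA mulr_ge0_le0 ?(ltW c0)//.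
by rewrite mulr_le0_ge0 ?(ltW Pz)// invr_ge0 sqr_ge0.
Qed.
Lemma wgt_out z : r < cabs z -> wgt z = 0.
Proof. by move=> /wbase_out; rewrite /wgt => ->; rewrite powR0// gt_eqF. Qed.
Lemma wgt_ge0 z : 0 <= wgt z. Proof. exact: powR_ge0. Qed.

Lemma wbase_rct z : cabs z < 1 -> rct wbase z.
Proof.
move=> z1; apply: rt_M.
  apply: rt_M; first exact: rt_cst.
  by apply: rt_B; [exact: rt_cst|apply: rt_X; apply: ct_abs; exact: ct_id].
apply: rt_V; first by rewrite gt_eqF// N_gt0// ltW.
by apply: rt_X; apply: ct_abs; apply: ct_B; [exact: ct_cst|apply: ct_M; [exact: ct_cst|exact: ct_id]].
Qed.
Lemma pospow_rct q z : 0 < q -> cabs z < 1 -> rct (fun z => pos (wbase z) `^ q) z.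
Proof.
move=> q0 z1; apply: (rt_comp (f := fun x => pos x `^ q)); first exact: wbase_rct.
exact: pospow_cont.
Qed.

Let b1 z : C := RtoC c * (- cconj z / RtoC (N z) + RtoC (P z) * cconj a * cconj (t z) / RtoC (N z) ^+ 2).
Let b2 z : C := RtoC c * (- z / RtoC (N z) + RtoC (P z) * a * t z / RtoC (N z) ^+ 2).

Let cconj0 : cconj (0 : C) = 0. Proof. by rewrite -RtoC0 cconjR. Qed.

Let wirt_t z : wirt t z (- cconj a) 0.
Proof.
apply: wirt_eq (wirtB (wirt_cst 1 z) (wirtM (wirt_cst (cconj a) z) (wirt_id z))) _ _; ring.
Qed.
Let NE z : RtoC (N z) = t z * cconj (t z). Proof. by rewrite mulcconj. Qed.
Let PE z : RtoC (P z) = RtoC m - z * cconj z. Proof. by rewrite mulcconj RtoCD RtoCN. Qed.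
Let wirt_N z : wirt (fun w => RtoC (N w)) z (- cconj a * cconj (t z)) (- a * t z).
Proof.
apply: (wirt_ext (wirtM (wirt_t z) (wirt_conj (wirt_t z)))) => [w||].
- by rewrite NE.
- by rewrite cconj0; ring.
- by rewrite cconjN cconjK; ring.
Qed.
Let wirt_P z : wirt (fun w => RtoC (P w)) z (- cconj z) (- z).
Proof.
apply: (wirt_ext (wirtB (wirt_cst (RtoC m) z) (wirtM (wirt_id z) (wirt_conj (wirt_id z))))) => [w||].
- by rewrite PE.
- by rewrite cconj0; ring.
- by rewrite cconj1; ring.
Qed.
Let wirt_b z : cabs z < 1 -> wirt (fun w => RtoC (wbase w)) z (b1 z) (b2 z).
Proof.
move=> z1; have N0 : RtoC (N z) != 0 by rewrite -cabs_eq0 cabsR normr_eq0 gt_eqF// N_gt0// ltW.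
have := wirtM (wirtM (wirt_cst (RtoC c) z) (wirt_P z)) (wirtV N0 (wirt_N z)) => H.
apply: (wirt_ext H) => [w||].
- by rewrite /wbase -/(c) -/(P w) -/(t w) -/(N w) -RtoCV -!RtoCM.
- by rewrite /b1; field.
- by rewrite /b2; field.
Qed.

Let wirt_pow q z : 1 < q -> cabs z < 1 -> wirt (fun w => RtoC (pos (wbase w) `^ q)) z
  (RtoC (q * pos (wbase z) `^ (q - 1)) * b1 z) (RtoC (q * pos (wbase z) `^ (q - 1)) * b2 z).
Proof.
move=> q1 z1; apply: (wirt_real (f := fun x => pos x `^ q)); [exact: pospow_der|exact: wirt_b].
Qed.

(** [- tau / P] is the logarithmic [z]-derivative of [wbase]. The bound [|tau|^2 <= m] is a
    Schwarz-Pick type identity: [m |t|^2 - |conj z - m conj a|^2 = P (1 - m |a|^2)]. *)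
Let tau z : C := (cconj z - RtoC m * cconj a) / t z.
Let tau_le z : cabs z <= r -> cabs (tau z) ^+ 2 <= m.
Proof.
move=> zr; have z1 : cabs z <= 1 by apply: (le_trans zr); exact: ltW.
have := t_neq0 z1 => t0; rewrite /tau cabsM cabsV exprMn exprVn ler_pdivrMr ?N_gt0//.
have id : m * cabs (t z) ^+ 2 - cabs (cconj z - RtoC m * cconj a) ^+ 2 =
   (m - cabs z ^+ 2) * (1 - m * cabs a ^+ 2).
  by rewrite /t !cabs2 !cE; ring.
have zm : cabs z ^+ 2 <= m by rewrite -r2 ler_sqr ?nnegrE ?cabs_ge0// ltW.
have am : m * cabs a ^+ 2 <= 1.
  by rewrite mulr_ile1 ?sqr_ge0 ?(ltW m0) ?(ltW m1)// expr_le1 ?cabs_ge0// ltW.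
have : 0 <= (m - cabs z ^+ 2) * (1 - m * cabs a ^+ 2) by rewrite mulr_ge0// subr_ge0.
by rewrite -id /N; lra.
Qed.
Let tau_le1 z : cabs z <= r -> cabs (tau z) <= 1.
Proof.
move=> /tau_le h; rewrite -(@expr_le1 _ 2) ?cabs_ge0//; apply: (le_trans h); exact: ltW.
Qed.

Let pb z : cabs z <= r -> pos (wbase z) = c * P z / N z.
Proof.
move=> zr; have z1 : cabs z <= 1 by apply: (le_trans zr); exact: ltW.
have P0 : 0 <= P z by rewrite /P subr_ge0 -r2 ler_sqr ?nnegrE ?cabs_ge0// ltW.
by apply: pos_id; rewrite divr_ge0 ?(ltW (N_gt0 z1))// mulr_ge0// ltW.
Qed.

Let powS q z : 0 < q -> pos (wbase z) `^ (1 + q) = pos (wbase z) * pos (wbase z) `^ q.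
Proof.
move=> q0; have b0 := pos_ge0 (wbase z).
rewrite powRD ?powRr1//; apply/implyP => /eqP h; have := q0; lra.
Qed.

Let Rn0 (x : R) : x != 0 -> RtoC x != 0.
Proof. by move=> x0; rewrite -cabs_eq0 cabsR normr_eq0. Qed.

Let lin0 (x y : C) : x * 0 + y * 0 = 0. Proof. by rewrite !mulr0 addr0. Qed.

(* Caccioppoli: integrate [dbar (conj f * f' * P^2 * W)], where [|dbar (P^2 W)| <= 3 P W]. *)
Lemma caccioppoli f : analytic_on_disk f ->
  J (fun z => cabs (cder f z) ^+ 2 * ((m - cabs z ^+ 2) ^+ 2 * wgt z)) <=
  9 * J (fun z => cabs (f z) ^+ 2 * wgt z).
Proof.
move=> af; have [af' cf'] := analytic_cder af; have [af'' cf''] := analytic_cder af'.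
have dz1 z : cabs z < 1 -> disk z by [].
have cf z : cabs z < 1 -> cct f z by move=> h; apply: ct_der; apply: analytic_der.
(* This is [P^2] times the weight on the disk [|z|^2 <= m], rewritten with the power [2 + p] of the
   positive part, which is continuously differentiable across the boundary. *)
pose K z := (RtoC (N z) / RtoC c) ^+ 2 * RtoC (pos (wbase z) `^ (2 + p)).
pose Kz z := 2 * (RtoC (N z) / RtoC c) * ((- cconj a * cconj (t z)) / RtoC c) * RtoC (pos (wbase z) `^ (2 + p))
  + (RtoC (N z) / RtoC c) ^+ 2 * (RtoC ((2 + p) * pos (wbase z) `^ (1 + p)) * b1 z).
pose Kb z := 2 * (RtoC (N z) / RtoC c) * ((- a * t z) / RtoC c) * RtoC (pos (wbase z) `^ (2 + p))
  + (RtoC (N z) / RtoC c) ^+ 2 * (RtoC ((2 + p) * pos (wbase z) `^ (1 + p)) * b2 z).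
have cn : RtoC c != 0 by apply: Rn0; rewrite gt_eqF.
have p20 : 0 < 2 + p by have := p0; lra.
have p21 : 1 < 2 + p by have := p0; lra.
have p10 : 0 < 1 + p by have := p0; lra.
have p11 : 1 < 1 + p by have := p0; lra.
have wK z : cabs z < 1 -> wirt K z (Kz z) (Kb z).
  move=> z1; have wNc := wirtM (wirt_N z) (wirt_cst (RtoC c)^-1 z).
  have := wirtM (wirtM wNc wNc) (wirt_pow (q := 2 + p) p21 z1) => H.
  have E : 2 + p - 1 = 1 + p by ring.
  rewrite E in H; apply: (wirt_ext H) => [w||]; first by rewrite /K expr2.
    by rewrite /Kz; ring.
  by rewrite /Kb; ring.
have KbE z : cabs z <= r -> Kb z = - (RtoC (P z * wgt z) * (2 * z + RtoC p * cconj (tau z))).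
  move=> zr; have z1 : cabs z <= 1 by apply: (le_trans zr); exact: ltW.
  have E2 : pos (wbase z) `^ (2 + p) = (c * P z / N z) ^+ 2 * wgt z.
    have -> : 2 + p = 1 + (1 + p) by ring.
    by rewrite !powS// pb// /wgt pb// expr2 mulrA.
  have E1 : pos (wbase z) `^ (1 + p) = (c * P z / N z) * wgt z by rewrite -(pb zr) powS.
  have tn := t_neq0 z1.
  have tcn : cconj (t z) != 0 by rewrite -cabs_eq0 cabsconj cabs_eq0.
  rewrite /Kb E2 E1 /b2 /tau !cconjM cconjD cconjN cconjM !cconjK cconjR.
  have -> : cconj (t z)^-1 = (cconj (t z))^-1.
    by apply: (mulfI tcn); rewrite divff// -cconjM divff// cconj1.
  have X2 (x y q s : R) : RtoC ((x * y / q) ^+ 2 * s) = (RtoC x * RtoC y / RtoC q) ^+ 2 * RtoC s.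
    by rewrite RtoCM RtoCX !RtoCM RtoCV.
  have X1 (x y q s v : R) : RtoC ((2 + v) * (x * y / q * s)) =
      (RtoC 2 + RtoC v) * (RtoC x * RtoC y / RtoC q * RtoC s).
    by rewrite !RtoCM RtoCV RtoCD.
  rewrite X2 X1 (RtoCM (P z)) NE.
  have -> : z - RtoC m * a = z * cconj (t z) - a * RtoC (P z).
    by rewrite PE /t cconjD cconjN cconjM cconjK cconj1; ring.
  rewrite (RtoC_nat _ 2).
  by field; rewrite tn tcn cn.
have K0 z : r < cabs z -> [/\ K z = 0, Kz z = 0 & Kb z = 0].
  move=> zr; rewrite /K /Kz /Kb (wbase_out zr) !powR0 ?gt_eqF//.
  by rewrite !(mulr0, RtoC0, mul0r, addr0).
have z01 : cabs (0 : C) + r < 1 by rewrite cabs0 add0r.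
have ctt z : cct t z.
  by apply: ct_B; [exact: ct_cst|apply: ct_M; [exact: ct_cst|exact: ct_id]].
have cN z : cct (fun z => RtoC (N z)) z by apply: ct_RtoC; apply: rt_X; apply: ct_abs.
have cP z : cct (fun z => RtoC (P z)) z.
  by apply: ct_RtoC; apply: rt_B; [exact: rt_cst|apply: rt_X; apply: ct_abs; exact: ct_id].
have cpw q z : 0 < q -> cabs z < 1 -> cct (fun z => RtoC (pos (wbase z) `^ q)) z.
  by move=> q0 z1; apply: ct_RtoC; exact: pospow_rct.
have cb2 z : cabs z < 1 -> cct b2 z.
  move=> z1; have nn : RtoC (N z) != 0 by apply: Rn0; rewrite gt_eqF// N_gt0// ltW.
  apply: ct_M; first exact: ct_cst.
  apply: ct_D.
    by apply: ct_M; [apply: ct_N; exact: ct_id|apply: ct_V].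
  apply: ct_M; last by apply: ct_V; [rewrite expf_neq0|apply: ct_X].
  by apply: ct_M; [apply: ct_M; [exact: cP|exact: ct_cst]|exact: ctt].
have cb1 z : cabs z < 1 -> cct b1 z.
  move=> z1; have nn : RtoC (N z) != 0 by apply: Rn0; rewrite gt_eqF// N_gt0// ltW.
  apply: ct_M; first exact: ct_cst.
  apply: ct_D.
    by apply: ct_M; [apply: ct_N; apply: ct_conj; exact: ct_id|apply: ct_V].
  apply: ct_M; last by apply: ct_V; [rewrite expf_neq0|apply: ct_X].
  by apply: ct_M; [apply: ct_M; [exact: cP|exact: ct_cst]|apply: ct_conj; exact: ctt].
have cNc z : cct (fun z => RtoC (N z) / RtoC c) z by apply: ct_M; [exact: cN|exact: ct_cst].
have cK z : cabs z < 1 -> cct K z.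
  by move=> z1; apply: ct_M; [apply: ct_X; exact: cNc|exact: cpw].
have cpd z : cabs z < 1 -> cct (fun z => RtoC ((2 + p) * pos (wbase z) `^ (1 + p))) z.
  by move=> z1; apply: ct_RtoC; apply: rt_M; [exact: rt_cst|exact: pospow_rct].
have cKb z : cabs z < 1 -> cct Kb z.
  move=> z1; apply: ct_D.
    apply: ct_M; last exact: cpw.
    apply: ct_M; first by apply: ct_M; [exact: ct_cst|exact: cNc].
    by apply: ct_M; [apply: ct_M; [exact: ct_cst|exact: ctt]|exact: ct_cst].
  by apply: ct_M; [apply: ct_X; exact: cNc|apply: ct_M; [exact: cpd|exact: cb2]].
have cKz z : cabs z < 1 -> cct Kz z.
  move=> z1; apply: ct_D.
    apply: ct_M; last exact: cpw.
    apply: ct_M; first by apply: ct_M; [exact: ct_cst|exact: cNc].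
    by apply: ct_M; [apply: ct_M; [exact: ct_cst|apply: ct_conj; exact: ctt]|exact: ct_cst].
  by apply: ct_M; [apply: ct_X; exact: cNc|apply: ct_M; [exact: cpd|exact: cb1]].
have [] := @wirt_int0 R (fun z => cconj (f z) * cder f z * K z)
  (fun z => cconj (f z) * cder (cder f) z * K z + cconj (f z) * cder f z * Kz z)
  (fun z => cconj (cder f z) * cder f z * K z + cconj (f z) * cder f z * Kb z) 0 1 r r1 z01.
- move=> z; rewrite subr0 => z1; have cfz := cf z z1; have cf'z := cf' z z1.
  have wf := wirt_holo (analytic_der af (dz1 z z1)).
  have wf' := wirt_holo (analytic_der af' (dz1 z z1)).
  split.
  + have H := wirtM (wirtM (wirt_conj wf) wf') (wK z z1).
    move: H; rewrite cconj0 => H.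
    apply: (wirt_ext H) => [w||].
    * by [].
    * move: (K z) (Kz z) (Kb z) (cconj (f z)) (cconj (cder f z)) (cder (cder f) z) (cder f z) => k kz kb x1 x2 x3 x4.
      ring.
    * move: (K z) (Kz z) (Kb z) (cconj (f z)) (cconj (cder f z)) (cder (cder f) z) (cder f z) => k kz kb x1 x2 x3 x4.
      ring.
  + apply: ct_D; (apply: ct_M; last by [exact: cK|exact: cKz]);
      (apply: ct_M; first by apply: ct_conj); [exact: cf''|exact: cf'].
  + apply: ct_D; (apply: ct_M; last by [exact: cK|exact: cKb]);
      (apply: ct_M; first by apply: ct_conj); exact: cf'.
- move=> z; rewrite subr0 => /K0 [e1 e2 e3].
  split.
  + by rewrite e1; exact: mulr0.
  + by rewrite e1 e2; exact: lin0.
  + by rewrite e1 e3; exact: lin0.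
move=> _ cG _ /(congr1 (@cre R)); rewrite /CJ /= => IG.
have cW z : cabs z < 1 -> rct wgt z by move=> z1; exact: pospow_rct.
have cPr z : rct P z by apply: rt_B; [exact: rt_cst|apply: rt_X; apply: ct_abs; exact: ct_id].
have k1 : rcont (fun z => cabs (cder f z) ^+ 2 * (P z ^+ 2 * wgt z)).
  apply: (rcont_supp r1) => [z z1|z /wgt_out ->]; last by rewrite !mulr0.
  apply: rt_M; first by apply: rt_X; apply: ct_abs; exact: cf'.
  by apply: rt_M; [apply: rt_X; exact: cPr|exact: cW].
have k2 : rcont (fun z => cabs (f z) ^+ 2 * wgt z).
  apply: (rcont_supp r1) => [z z1|z /wgt_out ->]; last by rewrite !mulr0.
  by apply: rt_M; [apply: rt_X; apply: ct_abs; exact: cf|exact: cW].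
have k1' : rcont (fun z => 2^-1 * (cabs (cder f z) ^+ 2 * (P z ^+ 2 * wgt z))).
  by move=> z; apply: rt_M; [exact: rt_cst|exact: k1].
have k2' : rcont (fun z => (9 / 2) * (cabs (f z) ^+ 2 * wgt z)).
  by move=> z; apply: rt_M; [exact: rt_cst|exact: k2].
have k12 : rcont (fun z => 2^-1 * (cabs (cder f z) ^+ 2 * (P z ^+ 2 * wgt z)) - (9 / 2) * (cabs (f z) ^+ 2 * wgt z)).
  by move=> z; apply: rt_B; [exact: k1'|exact: k2'].
have : J (fun z => 2^-1 * (cabs (cder f z) ^+ 2 * (P z ^+ 2 * wgt z)) - (9 / 2) * (cabs (f z) ^+ 2 * wgt z))
   <= J (fun z => cre (cconj (cder f z) * cder f z * K z + cconj (f z) * cder f z * Kb z)).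
  apply: J_le => //; first by move=> z; apply: ct_re; exact: cG.
  move=> z; have [zr|zr] := leP (cabs z) r; last first.
    by have [-> _ ->] := K0 _ zr; rewrite (wgt_out zr) !mulr0 addr0 subr0.
  have z1 : cabs z <= 1 by apply: (le_trans zr); exact: ltW.
  have KE : K z = RtoC (P z ^+ 2 * wgt z).
    have -> : P z ^+ 2 * wgt z = (N z / c) ^+ 2 * pos (wbase z) `^ (2 + p).
      have -> : 2 + p = 1 + (1 + p) by ring.
      rewrite !powS// pb// /wgt pb//; field.
      by rewrite !gt_eqF// N_gt0.
    by rewrite /K RtoCM RtoCX RtoCM RtoCV.
  rewrite creD; set X := cabs (cder f z); set Y := cabs (f z).
  have P0 : 0 <= P z by rewrite /P subr_ge0 -r2 ler_sqr ?nnegrE ?cabs_ge0// ltW.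
  have W0 := wgt_ge0 z.
  have -> : cre (cconj (cder f z) * cder f z * K z) = X ^+ 2 * (P z ^+ 2 * wgt z).
    by rewrite KE [cconj _ * _]mulrC mulcconj -RtoCM creR.
  have B : `|cre (cconj (f z) * cder f z * Kb z)| <= Y * X * (3 * (P z * wgt z)).
    apply: (le_trans (cre_le _)); rewrite !cabsM cabsconj -/X -/Y.
    apply: ler_wpM2l; first by rewrite mulr_ge0 ?cabs_ge0.
    rewrite KbE// cabsN cabsM cabsR ger0_norm ?mulr_ge0// mulrC ler_wpM2r ?mulr_ge0//.
    apply: (le_trans (cabsD _ _)); rewrite !cabsM cabsconj cabsR -(RtoC_nat R 2) cabsR.
    have := tau_le1 zr; have := cabs_ge0 (tau z); rewrite !ger0_norm ?(ltW p0)// => h1 h2.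
    have : p * cabs (tau z) <= 1 by rewrite mulr_ile1// ltW.
    by lra.
  have : - (Y * X * (3 * (P z * wgt z))) <= cre (cconj (f z) * cder f z * Kb z).
    by rewrite lerNl (le_trans _ B)// -normrN ler_norm.
  (* Completing the square: [X^2 P^2 - 3 X Y P] is at least [X^2 P^2 / 2 - 9 Y^2 / 2], which
     produces the constant 9. *)
  have : 0 <= (X * P z - 3 * Y) ^+ 2 * wgt z by rewrite mulr_ge0// sqr_ge0.
  rewrite sqrrB !exprMn; lra.
rewrite IG (J_B k1' k2') (J_Z _ k1) (J_Z _ k2); lra.
Qed.

(** The divergence term of [hardy] with [z], [conj z] and [a], [conj a] replaced by independent
    letters. Conjugation then merely permutes the letters, and the cancellation becomes a rational
    identity within reach of [field]. *)
Definition hk (x y A B q M W k : C) : C :=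
  (1 + q) * W * (k * (- y / ((1 - B * x) * (1 - A * y)) + (M - x * y) * B * (1 - A * y) / ((1 - B * x) * (1 - A * y)) ^+ 2))
   * ((1 - B * x) * (1 - A * y) * (x - q / 2 * ((x - M * A) / (1 - A * y)))) +
  k * (M - x * y) / ((1 - B * x) * (1 - A * y)) * W *
   ((1 - B * x) * (1 - A * y) + x * (- B * (1 - A * y)) - q / 2 * (1 - B * x + (x - M * A) * - B)).

Let hk_sum x y A B q M W k : 1 - B * x != 0 -> 1 - A * y != 0 ->
  hk x y A B q M W k + hk y x B A q M W k =
  - (2 * (k * (W * (x * y - (M - x * y) + q * M / 2
      - q ^+ 2 / 2 * ((y - M * B) / (1 - B * x) * ((x - M * A) / (1 - A * y))))))).
Proof. by move=> h1 h2; rewrite /hk; field; rewrite h1 h2. Qed.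

Let cconjV (x : C) : cconj x^-1 = (cconj x)^-1.
Proof.
have [->|x0] := eqVneq x 0; first by rewrite invr0 cconj0 invr0.
have cx0 : cconj x != 0 by rewrite -cabs_eq0 cabsconj cabs_eq0.
by apply: (mulfI cx0); rewrite divff// -cconjM divff// cconj1.
Qed.

Let hk_conj x y A B q M W k : cconj (hk x y A B q M W k) =
  hk (cconj x) (cconj y) (cconj A) (cconj B) (cconj q) (cconj M) (cconj W) (cconj k).
Proof.
have c2 : cconj (2 : C) = 2 by rewrite -(RtoC_nat R 2) cconjR.
by rewrite /hk !(cconjD, cconjM, cconjN, cconjV, expr2, cconj1, c2).
Qed.

(* Hardy: integrate [div (|u|^2 X)] with [X = - P W (z - (p/2) conj tau)]; the terms of
   indefinite sign in [div X] cancel exactly because of the factor [p/2]. *)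
Lemma hardy u : analytic_on_disk u ->
  J (fun z => cabs (u z) ^+ 2 * wgt z * (2 * cabs z ^+ 2 - m)) <=
  J (fun z => 3 / 2 * (cabs (u z) * cabs (cder u z) * ((m - cabs z ^+ 2) * wgt z))).
Proof.
move=> af; have [af' cf'] := analytic_cder af.
have dz1 z : cabs z < 1 -> disk z by [].
have cf z : cabs z < 1 -> cct u z by move=> h; apply: ct_der; apply: analytic_der.
(* [N] times the field [z - (p/2) conj tau]. Clearing denominators makes it polynomial, and the
   factor [pos (wbase z)] to the power [1 + p] supplies [P W / N] up to the constant [c]. *)
pose NZ z := z * (t z * cconj (t z)) - RtoC (p / 2) * ((z - RtoC m * a) * t z).
pose NZz z := t z * cconj (t z) + z * (- cconj a * cconj (t z))
   - RtoC (p / 2) * (t z + (z - RtoC m * a) * - cconj a).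
pose NZb z := z * (t z * - a).
have wNZ z : wirt NZ z (NZz z) (NZb z).
  have wN' := wirtM (wirt_t z) (wirt_conj (wirt_t z)).
  have wl := wirtB (wirt_id z) (wirt_cst (RtoC m * a) z).
  have := wirtB (wirtM (wirt_id z) wN') (wirtM (wirt_cst (RtoC (p / 2)) z) (wirtM wl (wirt_t z))) => H.
  apply: (wirt_ext H) => // ; first by rewrite /NZz cconj0; ring.
  by rewrite /NZb cconjN cconjK; ring.
pose K z := RtoC (pos (wbase z) `^ (1 + p)) * NZ z.
pose Kz z := RtoC ((1 + p) * wgt z) * b1 z * NZ z + RtoC (pos (wbase z) `^ (1 + p)) * NZz z.
pose Kb z := RtoC ((1 + p) * wgt z) * b2 z * NZ z + RtoC (pos (wbase z) `^ (1 + p)) * NZb z.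
have cn : RtoC c != 0 by apply: Rn0; rewrite gt_eqF.
have p10 : 0 < 1 + p by have := p0; lra.
have p11 : 1 < 1 + p by have := p0; lra.
have wK z : cabs z < 1 -> wirt K z (Kz z) (Kb z).
  move=> z1; have := wirtM (wirt_pow (q := 1 + p) p11 z1) (wNZ z).
  by have -> : 1 + p - 1 = p by ring.
have K0 z : r < cabs z -> [/\ K z = 0, Kz z = 0 & Kb z = 0].
  move=> zr; rewrite /K /Kz /Kb (wgt_out zr) (wbase_out zr) !powR0 ?gt_eqF//.
  by rewrite mulr0 RtoC0 !mul0r addr0.
have z01 : cabs (0 : C) + r < 1 by rewrite cabs0 add0r.
have ctt z : cct t z.
  by apply: ct_B; [exact: ct_cst|apply: ct_M; [exact: ct_cst|exact: ct_id]].
have cN z : cct (fun z => RtoC (N z)) z by apply: ct_RtoC; apply: rt_X; apply: ct_abs.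
have cP z : cct (fun z => RtoC (P z)) z.
  by apply: ct_RtoC; apply: rt_B; [exact: rt_cst|apply: rt_X; apply: ct_abs; exact: ct_id].
have cpw q z : 0 < q -> cabs z < 1 -> cct (fun z => RtoC (pos (wbase z) `^ q)) z.
  by move=> q0 z1; apply: ct_RtoC; exact: pospow_rct.
have cb2 z : cabs z < 1 -> cct b2 z.
  move=> z1; have nn : RtoC (N z) != 0 by apply: Rn0; rewrite gt_eqF// N_gt0// ltW.
  apply: ct_M; first exact: ct_cst.
  apply: ct_D.
    by apply: ct_M; [apply: ct_N; exact: ct_id|apply: ct_V].
  apply: ct_M; last by apply: ct_V; [rewrite expf_neq0|apply: ct_X].
  by apply: ct_M; [apply: ct_M; [exact: cP|exact: ct_cst]|exact: ctt].
have cb1 z : cabs z < 1 -> cct b1 z.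
  move=> z1; have nn : RtoC (N z) != 0 by apply: Rn0; rewrite gt_eqF// N_gt0// ltW.
  apply: ct_M; first exact: ct_cst.
  apply: ct_D.
    by apply: ct_M; [apply: ct_N; apply: ct_conj; exact: ct_id|apply: ct_V].
  apply: ct_M; last by apply: ct_V; [rewrite expf_neq0|apply: ct_X].
  by apply: ct_M; [apply: ct_M; [exact: cP|exact: ct_cst]|apply: ct_conj; exact: ctt].
have ctc z : cct (fun z => cconj (t z)) z by apply: ct_conj; exact: ctt.
have cl z : cct (fun z => z - RtoC m * a) z by apply: ct_B; [exact: ct_id|exact: ct_cst].
have cNZ z : cct NZ z.
  apply: ct_B; first by apply: ct_M; [exact: ct_id|apply: ct_M; [exact: ctt|exact: ctc]].
  by apply: ct_M; [exact: ct_cst|apply: ct_M; [exact: cl|exact: ctt]].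
have cNZz z : cct NZz z.
  apply: ct_B.
    apply: ct_D; first by apply: ct_M; [exact: ctt|exact: ctc].
    by apply: ct_M; [exact: ct_id|apply: ct_M; [exact: ct_cst|exact: ctc]].
  apply: ct_M; first exact: ct_cst.
  by apply: ct_D; [exact: ctt|apply: ct_M; [exact: cl|exact: ct_cst]].
have cNZb z : cct NZb z by apply: ct_M; [exact: ct_id|apply: ct_M; [exact: ctt|exact: ct_cst]].
have cK z : cabs z < 1 -> cct K z by move=> z1; apply: ct_M; [exact: cpw|exact: cNZ].
have cpd z : cabs z < 1 -> cct (fun z => RtoC ((1 + p) * wgt z)) z.
  by move=> z1; apply: ct_RtoC; apply: rt_M; [exact: rt_cst|exact: pospow_rct].
have cKb z : cabs z < 1 -> cct Kb z.
  move=> z1; apply: ct_D.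
    by apply: ct_M; [apply: ct_M; [exact: cpd|exact: cb2]|exact: cNZ].
  by apply: ct_M; [exact: cpw|exact: cNZb].
have cKz z : cabs z < 1 -> cct Kz z.
  move=> z1; apply: ct_D.
    by apply: ct_M; [apply: ct_M; [exact: cpd|exact: cb1]|exact: cNZ].
  by apply: ct_M; [exact: cpw|exact: cNZz].
have [] := @wirt_int0 R (fun z => cconj (u z) * u z * K z)
  (fun z => cconj (u z) * cder u z * K z + cconj (u z) * u z * Kz z)
  (fun z => cconj (cder u z) * u z * K z + cconj (u z) * u z * Kb z) 0 1 r r1 z01.
- move=> z; rewrite subr0 => z1; have cfz := cf z z1; have cf'z := cf' z z1.
  have wf := wirt_holo (analytic_der af (dz1 z z1)).
  split.
  + have H := wirtM (wirtM (wirt_conj wf) wf) (wK z z1).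
    move: H; rewrite cconj0 => H.
    apply: (wirt_ext H) => [w||].
    * by [].
    * move: (K z) (Kz z) (Kb z) (cconj (u z)) (cconj (cder u z)) (cder u z) (u z) => k kz kb x1 x2 x3 x4.
      ring.
    * move: (K z) (Kz z) (Kb z) (cconj (u z)) (cconj (cder u z)) (cder u z) (u z) => k kz kb x1 x2 x3 x4.
      ring.
  + by apply: ct_D; (apply: ct_M; [apply: ct_M; [exact: ct_conj|]|by [exact: cK|exact: cKz]]).
  + by apply: ct_D; (apply: ct_M; [apply: ct_M; [exact: ct_conj|]|by [exact: cK|exact: cKb]]).
- move=> z; rewrite subr0 => /K0 [e1 e2 e3].
  split.
  + by rewrite e1; exact: mulr0.
  + by rewrite e1 e2; exact: lin0.
  + by rewrite e1 e3; exact: lin0.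
move=> cG _ /(congr1 (@cre R)); rewrite /CJ /= => IG _.
have cW z : cabs z < 1 -> rct wgt z by move=> z1; exact: pospow_rct.
have cz2 z : rct (fun z : C => cabs z ^+ 2) z by apply: rt_X; apply: ct_abs; exact: ct_id.
have cPr z : rct P z by apply: rt_B; [exact: rt_cst|exact: cz2].
have k1 : rcont (fun z => cabs (u z) ^+ 2 * wgt z * (2 * cabs z ^+ 2 - m)).
  apply: (rcont_supp r1) => [z z1|z /wgt_out ->]; last by rewrite mulr0 mul0r.
  apply: rt_M; first by apply: rt_M; [apply: rt_X; apply: ct_abs; exact: cf|exact: cW].
  by apply: rt_B; [apply: rt_M; [exact: rt_cst|exact: cz2]|exact: rt_cst].
have k2 : rcont (fun z => 3 / 2 * (cabs (u z) * cabs (cder u z) * (P z * wgt z))).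
  apply: (rcont_supp r1) => [z z1|z /wgt_out ->]; last by rewrite !mulr0.
  apply: rt_M; first exact: rt_cst.
  apply: rt_M; last by apply: rt_M; [exact: cPr|exact: cW].
  by apply: rt_M; apply: ct_abs; [exact: cf|exact: cf'].
have k12 : rcont (fun z => cabs (u z) ^+ 2 * wgt z * (2 * cabs z ^+ 2 - m) -
   3 / 2 * (cabs (u z) * cabs (cder u z) * (P z * wgt z))).
  by move=> z; apply: rt_B; [exact: k1|exact: k2].
pose G z := cconj (u z) * cder u z * K z + cconj (u z) * u z * Kz z.
have kG : rcont (fun z => - (1 / c) * cre (G z)).
  by move=> z; apply: rt_M; [exact: rt_cst|apply: ct_re; exact: cG].
rewrite -subr_le0 -(J_B k1 k2).
have -> : 0 = J (fun z => - (1 / c) * cre (G z)).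
  by rewrite J_Z ?[J _]IG ?mulr0// => z; apply: ct_re; exact: cG.
apply: J_le => // z; have [zr|zr] := leP (cabs z) r; last first.
  by rewrite /G; have [-> -> _] := K0 _ zr; rewrite (wgt_out zr) !mulr0 mul0r addr0 subr0 cre0 mulr0.
have z1 : cabs z <= 1 by apply: (le_trans zr); exact: ltW.
have tn := t_neq0 z1.
have tcn : cconj (t z) != 0 by rewrite -cabs_eq0 cabsconj cabs_eq0.
have P0 : 0 <= P z by rewrite /P subr_ge0 -r2 ler_sqr ?nnegrE ?cabs_ge0// ltW.
have W0 := wgt_ge0 z.
have E1 : pos (wbase z) `^ (1 + p) = (c * P z / N z) * wgt z by rewrite -(pb zr) powS.
pose Z z : C := z - RtoC (p / 2) * cconj (tau z).
have tauE : cconj (tau z) = (z - RtoC m * a) / cconj (t z).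
  rewrite /tau cconjM cconjD cconjN cconjM !cconjK cconjR; congr (_ * _).
  by apply: (mulfI tcn); rewrite divff// -cconjM divff// cconj1.
have NZE : NZ z = t z * cconj (t z) * Z z.
  by rewrite /NZ /Z tauE; field.
have KE : K z = RtoC c * (RtoC (P z * wgt z) * Z z).
  rewrite /K E1 NZE !RtoCM RtoCV NE; field; by rewrite tn tcn.
have Zle : cabs (Z z) <= 3 / 2.
  apply: (le_trans (cabsB _ _)); rewrite cabsM cabsR cabsconj ger0_norm ?divr_ge0 ?ltW//.
  have := tau_le1 zr; have := cabs_ge0 (tau z) => h1 h2.
  have : p / 2 * cabs (tau z) <= 1 / 2.
    rewrite -[leRHS]mulr1; apply: ler_pM; [by rewrite divr_ge0// ltW|exact: h1|have := p1; lra|exact: h2].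
  by have := r1; lra.
pose Dv := cabs z ^+ 2 - P z + p * m / 2 - p ^+ 2 / 2 * cabs (tau z) ^+ 2.
have KzE : cre (Kz z) = - (c * (wgt z * Dv)).
  have H2 : Kz z + cconj (Kz z) = - RtoC (2 * (c * (wgt z * Dv))).
    have nn : RtoC (N z) != 0 by apply: Rn0; rewrite gt_eqF// N_gt0.
    have Kh : Kz z = hk z (cconj z) a (cconj a) (RtoC p) (RtoC m) (RtoC (wgt z)) (RtoC c).
      rewrite /Kz E1 NZE /Z /b1 /NZz tauE /hk.
      have X1 (x y q s : R) : RtoC (x * y / q * s) = RtoC x * RtoC y / RtoC q * RtoC s.
        by rewrite !RtoCM RtoCV.
      have X2 (x y : R) : RtoC ((1 + x) * y) = (1 + RtoC x) * RtoC y.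
        by rewrite RtoCM RtoCD RtoC1.
      have X3 (x : R) : RtoC (x / 2) = RtoC x / 2 by rewrite RtoCM RtoCV RtoC_nat.
      rewrite X1 X2 !X3 NE PE /t !(cconjD, cconjN, cconjM, cconjK, cconj1).
      by [].
    rewrite Kh hk_conj !cconjK !cconjR hk_sum.
    - have tau2 : RtoC (cabs (tau z) ^+ 2) = (cconj z - RtoC m * cconj a) / t z * ((z - RtoC m * a) / cconj (t z)).
        by rewrite -mulcconj tauE.
      have X4 (x y q s v e g : R) : RtoC (2 * (x * (y * (q - s + v * e / 2 - v ^+ 2 / 2 * g)))) =
          2 * (RtoC x * (RtoC y * (RtoC q - RtoC s + RtoC v * RtoC e / 2 - RtoC v ^+ 2 / 2 * RtoC g))).
        by rewrite expr2 !(RtoCM, RtoCD, RtoCN, RtoCV, RtoC_nat) expr2.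
      by rewrite /Dv X4 tau2 PE -mulcconj /t !(cconjD, cconjN, cconjM, cconjK, cconj1).
    - exact: tn.
    - by move: tcn; rewrite /t !(cconjD, cconjN, cconjM, cconjK, cconj1).
  have := congr1 (@cre R) H2; rewrite creN creR creD creconj; lra.
have tau1 := tau_le zr.
have U0 := cabs_ge0 (u z); have U1 := cabs_ge0 (cder u z).
have PW : 0 <= P z * wgt z by rewrite mulr_ge0.
have -> : - (1 / c) * cre (G z) =
    - (P z * wgt z * cre (cconj (u z) * cder u z * Z z)) + cabs (u z) ^+ 2 * (wgt z * Dv).
  rewrite /G KE (mulrC (cconj (u z)) (u z)) mulcconj creD.
  have -> : cconj (u z) * cder u z * (RtoC c * (RtoC (P z * wgt z) * Z z)) =
     RtoC (c * (P z * wgt z)) * (cconj (u z) * cder u z * Z z) by rewrite (RtoCM c); move: (RtoC c) (RtoC (P z * wgt z)) (Z z) => x1 x2 x3; ring.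
  by rewrite !cre_RtoCM KzE; field; rewrite gt_eqF.
have L : cre (cconj (u z) * cder u z * Z z) <= cabs (u z) * cabs (cder u z) * (3 / 2).
  apply: (le_trans (ler_norm _)); apply: (le_trans (cre_le _)); rewrite !cabsM cabsconj ler_wpM2l// mulr_ge0//.
have L2 := ler_wpM2l PW L.
have D0 : 2 * cabs z ^+ 2 - m <= Dv.
  rewrite /Dv /P; have : p ^+ 2 * cabs (tau z) ^+ 2 <= p * m.
    rewrite expr2 -mulrA ler_wpM2l ?(ltW p0)//; apply: le_trans tau1; exact: (ler_piMl (sqr_ge0 _) p1).
  by lra.
have L3 : cabs (u z) ^+ 2 * (wgt z * (2 * cabs z ^+ 2 - m)) <= cabs (u z) ^+ 2 * (wgt z * Dv).
  by rewrite ler_wpM2l ?sqr_ge0// ler_wpM2l.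
by lra.
Qed.

End Weights.

(** * Weighted smallness at the boundary *)

Section Asym.
Variable R : realType.
Local Notation C := (Cplx R).
Implicit Types (z : C) (F K : C -> C).
Variable p : R.
Hypotheses (p0 : 0 < p) (p1 : p <= 1).

Definition small (n : nat) F := forall e : R, 0 < e -> exists2 r : R, r < 1 &
  forall z, r < cabs z -> cabs z < 1 -> cabs (F z) * (1 - cabs z) ^+ n <= e.
(** The radius is independent of [m], which allows the passage to [m = 1] at the end. [K] may depend
    on [m] because the Schwarzian is paired with [(m - |z|^2)^2]. *)
Definition smallJ (K : R -> C -> R) := forall e : R, 0 < e -> exists2 r : R, r < 1 &
  forall a m, r < cabs a -> cabs a < 1 -> 0 < m -> m < 1 ->
  J (fun z => K m z * wgt a m p z) <= e.

Lemma Kwgt_rcont (K : C -> R) a m : cabs a < 1 -> 0 < m -> m < 1 ->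
  (forall z, cabs z < 1 -> rct K z) -> rcont (fun z => K z * wgt a m p z).
Proof.
move=> a1 m0 m1 cK; have r1 : Num.sqrt m < 1 by rewrite -sqrtr1 ltr_sqrt.
apply: (rcont_supp r1) => [z z1|z /(wgt_out a1 m0 p0) ->]; last by rewrite mulr0.
by apply: rt_M; [exact: cK|exact: pospow_rct].
Qed.

(** Write [d = 1 - |a|]. On the disc of radius [d / 2] about [a], the choice [m = 1 - d / 4] keeps
    [m - |z|^2] above [d / 2], while [|1 - conj a z| <= 5 d / 2]; so [wbase] is at least 2/25, more
    than 1/36. As [p <= 1], the power [p] of 1/36 is no smaller than 1/36. *)
Lemma wgt_low (a z : C) : cabs a < 1 -> cabs (z - a) <= (1 - cabs a) / 2 ->
  36^-1 <= wgt a (1 - (1 - cabs a) / 4) p z /\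
  (1 - cabs a) / 2 <= 1 - (1 - cabs a) / 4 - cabs z ^+ 2.
Proof.
move=> a1 za; have A0 := cabs_ge0 a; have Z0 := cabs_ge0 z.
have zle := cabs_triangle z a.
set d := 1 - cabs a in za *.
have d0 : 0 < d by rewrite /d subr_gt0.
have z2 : cabs z ^+ 2 <= (1 - d / 2) ^+ 2.
  by rewrite ler_sqr ?nnegrE//; rewrite /d in za *; lra.
have dd : d ^+ 2 <= d by rewrite expr2 ler_piMl// ?(ltW d0)// /d; lra.
have P0 : d / 2 <= 1 - d / 4 - cabs z ^+ 2 by move: z2; rewrite sqrrB; lra.
split=> //.
have z1 : cabs z <= 1 by rewrite /d in za; lra.
have t0 := t_neq0 a1 z1.
have N0 : 0 < cabs (1 - cconj a * z) by rewrite cabs_gt0.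
have aa : cabs a ^+ 2 <= cabs a by rewrite expr2 ler_piMl// ltW.
have c0 : d <= 1 - cabs a ^+ 2 by rewrite /d; lra.
have c2 : 1 - cabs a ^+ 2 <= 2 * d.
  have : 0 <= (1 - cabs a) ^+ 2 by exact: sqr_ge0.
  by rewrite sqrrB /d; lra.
have N1 : cabs (1 - cconj a * z) <= 5 / 2 * d.
  have -> : 1 - cconj a * z = RtoC (1 - cabs a ^+ 2) - cconj a * (z - a).
    by rewrite RtoCD RtoCN -mulcconj RtoC1; ring.
  apply: (le_trans (cabsB _ _)); rewrite cabsR cabsM cabsconj ger0_norm; last by lra.
  have : cabs a * cabs (z - a) <= cabs (z - a) by rewrite ler_piMl ?cabs_ge0// ltW.
  by lra.
have N2 : cabs (1 - cconj a * z) ^+ 2 <= (5 / 2 * d) ^+ 2 by rewrite ler_sqr ?nnegrE//; lra.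
have b36 : 36^-1 <= wbase a (1 - d / 4) z.
  rewrite /wbase ler_pdivlMr ?exprn_gt0//.
  have : d * (d / 2) <= (1 - cabs a ^+ 2) * (1 - d / 4 - cabs z ^+ 2) by apply: ler_pM => //; lra.
  have := sqr_ge0 d; move: N2; rewrite exprMn; lra.
have b0 : 0 <= wbase a (1 - d / 4) z by apply: le_trans b36.
rewrite /wgt pos_id//.
have h1 : (36^-1 : R) `^ p <= (wbase a (1 - d / 4) z) `^ p.
  by apply: ge0_ler_powR => //; [exact: ltW|rewrite nnegrE].
apply: le_trans h1; rewrite -[leLHS](powRr1 (a := 36^-1))//.
by apply: ger_powR => //; apply/andP; split => //; lra.
Qed.

(** The bridge from weighted integrals to mean values: a bump centred at [a] lies under a multiple
    of the weight attached to the same [a]. *)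
Lemma J_bump_wgt (K : C -> R) a r : (forall z, cabs z < 1 -> rct K z) -> (forall z, 0 <= K z) ->
  cabs a < 1 -> 0 < r -> r <= (1 - cabs a) / 2 ->
  J (fun z => K z * pos (bump (r ^- 2) a z) ^+ 3) <=
  36 * J (fun z => K z * wgt a (1 - (1 - cabs a) / 4) p z) /\
  rcont (fun z => K z * pos (bump (r ^- 2) a z) ^+ 3).
Proof.
move=> cK K0 a1 r0 rd; have A0 := cabs_ge0 a.
have sr : 1 <= r ^- 2 * r ^+ 2 by rewrite mulVf// expf_neq0// gt_eqF.
have ar : cabs a + r < 1 by lra.
have c1 : rcont (fun z => K z * pos (bump (r ^- 2) a z) ^+ 3).
  apply: (rcont_supp ar) => [z z1|z zr].
    by apply: rt_M; [exact: cK|exact: posbump_cont].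
  rewrite (bump_out r0 sr) ?expr0n ?mulr0//.
  by have := cabs_triangle z a; lra.
have m0 : 0 < 1 - (1 - cabs a) / 4 by lra.
have m1 : 1 - (1 - cabs a) / 4 < 1 by lra.
have c2 := Kwgt_rcont a1 m0 m1 cK.
split => //; rewrite -(J_Z _ c2); apply: J_le => //.
  by move=> z; apply: rt_M; [exact: rt_cst|exact: c2].
move=> z; rewrite (mulrCA 36); apply: ler_wpM2l; first exact: K0.
have [zr|zr] := leP (cabs (z - a)) r; last first.
  by rewrite (bump_out r0 sr)// expr0n mulr_ge0// wgt_ge0.
have [h _] := wgt_low a1 (le_trans zr rd).
have : pos (bump (r ^- 2) a z) ^+ 3 <= 1.
  by rewrite expr_le1// ?pos_ge0// pos_le// bump_le1// invr_ge0 sqr_ge0.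
by lra.
Qed.

(** The quadratic mean value inequality on the disc of radius [d / 2] about [a]. In 144 the factor
    36 is the loss from bump to weight and 4 comes from [(d / 2)^-2]. *)
Lemma smallJ_small F : analytic_on_disk F -> smallJ (fun _ z => cabs (F z) ^+ 2) -> small 1 F.
Proof.
move=> aF H e e0; have c0g := c0_gt0 R.
have e'0 : 0 < c0 R * e ^+ 2 / 144 by rewrite divr_gt0 ?mulr_gt0 ?exprn_gt0.
have [r r1 Hr] := H _ e'0; exists r => // a ra a1; have A0 := cabs_ge0 a.
set d := 1 - cabs a; have d0 : 0 < d by rewrite subr_gt0.
have d20 : 0 < d / 2 by lra.
have ar : cabs a + d / 2 < 1 by rewrite /d; lra.
have sr : 1 <= (d / 2) ^- 2 * (d / 2) ^+ 2 by rewrite mulVf// expf_neq0// gt_eqF.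
have h1 := L2_mean_value aF d20 ar sr.
have cF z : cabs z < 1 -> rct (fun z => cabs (F z) ^+ 2) z.
  by move=> z1; apply: rt_X; apply: ct_abs; apply: ct_der; apply: analytic_der.
have [h2 _] := J_bump_wgt cF (fun z => sqr_ge0 _) a1 d20 (lexx _).
have h3 := Hr a (1 - d / 4) ra a1 ltac:(rewrite /d; lra) ltac:(rewrite /d; lra).
have h4 : J (fun z => cabs (F z) ^+ 2 * pos (bump ((d / 2) ^- 2) a z) ^+ 3) <= 36 * (c0 R * e ^+ 2 / 144).
  by apply: (le_trans h2); rewrite ler_wpM2l.
have i0 : 0 <= (d / 2) ^- 2 by rewrite invr_ge0 sqr_ge0.
have h5 := le_trans h1 (ler_wpM2l i0 h4).
have Fd : 0 <= cabs (F a) * d by rewrite mulr_ge0 ?cabs_ge0// ltW.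
rewrite expr1 -ler_sqr ?nnegrE// ?(ltW e0)// exprMn.
rewrite -(ler_pM2l c0g) mulrA -ler_pdivlMr ?exprn_gt0//; apply: (le_trans h5).
rewrite le_eqVlt; apply/orP; left; apply/eqP; field; by rewrite gt_eqF.
Qed.

(** Cauchy's estimate on radius [d / 3], where [1 - |z|] lies between [2 d / 3] and [4 d / 3]; 432
    is [96 * 3 * 3 / 2]. *)
Lemma small_der F : analytic_on_disk F -> small 1 F -> small 2 (cder F).
Proof.
move=> aF H e e0; have e'0 : 0 < e / 432 by lra.
have [r r1 Hr] := H _ e'0; exists (1 - 3 / 4 * (1 - r)); first by lra.
move=> a ra a1; have A0 := cabs_ge0 a.
set d := 1 - cabs a; have d0 : 0 < d by rewrite subr_gt0.
have d3 : 0 < d / 3 by lra.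
have ar : cabs a + 2 * (d / 3) < 1 by rewrite /d; lra.
have B z : cabs (z - a) <= d / 3 -> cabs (F z) <= (e / 432) * (3 / 2) / d.
  move=> za; have t1 := cabs_triangle z a; have t2 := cabs_triangle a z.
  rewrite (cabs_sub a z) in t2.
  have := Hr z ltac:(rewrite /d in za; lra) ltac:(rewrite /d in za; lra); rewrite expr1 => h.
  rewrite ler_pdivlMr//.
  have : cabs (F z) * (2 / 3 * d) <= cabs (F z) * (1 - cabs z).
    by apply: ler_wpM2l; [exact: cabs_ge0|move: za; rewrite /d; lra].
  by lra.
have := cauchy_estimate aF d3 ar B => h.
rewrite -ler_pdivlMr ?exprn_gt0//; apply: (le_trans h).
rewrite le_eqVlt; apply/orP; left; apply/eqP; field; by rewrite gt_eqF.
Qed.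

End Asym.

(** * Pointwise bounds for the Schwarzian of h *)

Section SchwarzBound.
Variable R : realType.
Local Notation C := (Cplx R).
Implicit Types (z : C).

Lemma sq4 (a b c d : R) : (a + b + c + d) ^+ 2 <= 4 * (a ^+ 2 + b ^+ 2 + c ^+ 2 + d ^+ 2).
Proof.
have := sqr_ge0 (a - b); have := sqr_ge0 (a - c); have := sqr_ge0 (a - d).
have := sqr_ge0 (b - c); have := sqr_ge0 (b - d); have := sqr_ge0 (c - d).
by rewrite !expr2; lra.
Qed.

Lemma ball_radii (a z t rho r1 r2 : R) : a < 1 -> 1 - 2 / 3 * (1 - r1) < a ->
  1 - 2 / 3 * (1 - r2) < a -> rho <= (1 - a) / 2 -> t <= rho -> z <= t + a -> a <= t + z ->
  [/\ (1 - a) / 2 <= 1 - z, z < 1, r1 < z & r2 < z].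
Proof. by move=> *; split; lra. Qed.

Lemma sh_arith (L eps D B uu w1 w2 S P2 : R) : 0 <= L -> 0 <= eps -> eps <= 1 -> 0 <= D ->
  0 <= B -> 0 <= uu -> uu <= B -> 0 <= w1 -> w1 <= eps * (2 * D) -> 0 <= w2 ->
  w2 <= eps * (4 * D ^+ 2) -> 0 <= S -> 1 <= 4 * D ^+ 2 * P2 ->
  4 * (S + (L * (w1 * uu)) ^+ 2 + (L * w2) ^+ 2 + (3 / 2 * (L * w1) ^+ 2) ^+ 2) <=
  16 * D ^+ 2 * (S * P2) + eps * (4 * ((L * (2 * (B * D))) ^+ 2 + (L * (4 * D ^+ 2)) ^+ 2 +
    (3 / 2 * (L * (2 * D)) ^+ 2) ^+ 2)).
Proof.
move=> l0 ep0 eps1 D0' B0 u0 u1 w0 i1 w20 i2 S0 Pm.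
have BD : 0 <= 2 * (B * D) by rewrite mulr_ge0// mulr_ge0.
have e2 : eps ^+ 2 <= eps by rewrite expr2 ler_piMl.
have e4 : eps ^+ 4 <= eps.
  by rewrite (exprM eps 2 2) expr2; apply: (le_trans _ e2); rewrite ler_piMl ?sqr_ge0// (le_trans e2).
have j0 : S <= 4 * D ^+ 2 * (S * P2).
  by rewrite mulrCA -[leLHS]mulr1; apply: ler_wpM2l.
  have j1 : (L * (w1 * uu)) ^+ 2 <= eps * (L * (2 * (B * D))) ^+ 2.
  apply: (@le_trans _ _ ((eps * (L * (2 * (B * D)))) ^+ 2)); last first.
    by rewrite exprMn; apply: ler_wpM2r => //; exact: sqr_ge0.
  rewrite ler_sqr ?nnegrE; [|exact: mulr_ge0 l0 (mulr_ge0 w0 u0)|exact: mulr_ge0 ep0 (mulr_ge0 l0 BD)].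
  have -> : eps * (L * (2 * (B * D))) = L * (eps * (2 * D) * B) by ring.
  by apply: ler_wpM2l => //; apply: ler_pM.
have j2 : (L * w2) ^+ 2 <= eps * (L * (4 * D ^+ 2)) ^+ 2.
  have D2 : 0 <= 4 * D ^+ 2 by rewrite mulr_ge0 ?sqr_ge0.
  apply: (@le_trans _ _ ((eps * (L * (4 * D ^+ 2))) ^+ 2)); last first.
    by rewrite exprMn; apply: ler_wpM2r => //; exact: sqr_ge0.
  rewrite ler_sqr ?nnegrE; [|exact: mulr_ge0 l0 w20|exact: mulr_ge0 ep0 (mulr_ge0 l0 D2)].
  by rewrite mulrCA; apply: ler_wpM2l.
have j3 : (3 / 2 * (L * w1) ^+ 2) ^+ 2 <= eps * (3 / 2 * (L * (2 * D)) ^+ 2) ^+ 2.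
  have D2 : 0 <= 2 * D by rewrite mulr_ge0.
  apply: (@le_trans _ _ (eps ^+ 4 * (3 / 2 * (L * (2 * D)) ^+ 2) ^+ 2)); last first.
    by apply: ler_wpM2r => //; exact: sqr_ge0.
  have -> : eps ^+ 4 * (3 / 2 * (L * (2 * D)) ^+ 2) ^+ 2 = (3 / 2 * (L * (eps * (2 * D))) ^+ 2) ^+ 2 by ring.
  have h32 : 0 <= 3 / 2 :> R by rewrite divr_ge0.
  rewrite ler_sqr ?nnegrE; [|exact: mulr_ge0 h32 (sqr_ge0 _)|exact: mulr_ge0 h32 (sqr_ge0 _)].
  apply: ler_wpM2l => //.
  rewrite ler_sqr ?nnegrE; [|exact: mulr_ge0 l0 w0|exact: mulr_ge0 l0 (mulr_ge0 ep0 D2)].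
  exact: ler_wpM2l.
by move: j0 j1 j2 j3; lra.
Qed.

Lemma sh_arith2 (x L eps e r D B : R) : 0 <= x -> 0 <= L -> 0 <= eps ->
  eps * (x + 80 * L ^+ 2 + 144 * L ^+ 4) <= e ->
  eps * (x * (r * D) ^+ 2 + 4 * ((L * (2 * (B * D))) ^+ 2 + (L * (4 * D ^+ 2)) ^+ 2 +
    (3 / 2 * (L * (2 * D)) ^+ 2) ^+ 2)) <= e * ((r * D) ^+ 2 + (B * D) ^+ 2 + D ^+ 4).
Proof.
move=> x0 L0 eps0 epsT.
have -> : 4 * ((L * (2 * (B * D))) ^+ 2 + (L * (4 * D ^+ 2)) ^+ 2 + (3 / 2 * (L * (2 * D)) ^+ 2) ^+ 2) =
  16 * L ^+ 2 * (B * D) ^+ 2 + (64 * L ^+ 2 + 144 * L ^+ 4) * D ^+ 4 by field.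
have W0 : 0 <= D ^+ 4 by rewrite (exprM D 2 2) sqr_ge0.
move: (sqr_ge0 (r * D)) (sqr_ge0 (B * D)) W0 (sqr_ge0 L) (exprn_ge0 4 L0) epsT.
move: ((r * D) ^+ 2) ((B * D) ^+ 2) (D ^+ 4) (L ^+ 2) (L ^+ 4) => X Y W y2 y3 X0 Y0 W0 y20 y30 epsT.
apply: (@le_trans _ _ (eps * (x + 80 * y2 + 144 * y3) * (X + Y + W))); last first.
  by apply: ler_wpM2r => //; rewrite !addr_ge0.
rewrite -[leRHS]mulrA; apply: ler_wpM2l => //.
have := mulr_ge0 x0 Y0; have := mulr_ge0 x0 W0; have := mulr_ge0 y20 X0; have := mulr_ge0 y20 Y0.
have := mulr_ge0 y20 W0; have := mulr_ge0 y30 X0; have := mulr_ge0 y30 Y0; have := mulr_ge0 y30 W0.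
by lra.
Qed.

Lemma an_B (f g : C -> C) : analytic_on_disk f -> analytic_on_disk g ->
  analytic_on_disk (fun z => f z - g z).
Proof. by move=> hf hg z z1; exact: (derivableB (hf z z1) (hg z z1)). Qed.
Lemma an_D (f g : C -> C) : analytic_on_disk f -> analytic_on_disk g ->
  analytic_on_disk (fun z => f z + g z).
Proof. by move=> hf hg z z1; exact: (derivableD (hf z z1) (hg z z1)). Qed.
Lemma an_M (f g : C -> C) : analytic_on_disk f -> analytic_on_disk g ->
  analytic_on_disk (fun z => f z * g z).
Proof. by move=> hf hg z z1; exact: (derivableM (hf z z1) (hg z z1)). Qed.
Lemma an_cst (c : C) : analytic_on_disk (fun=> c).
Proof. by move=> z z1; exact: derivable_cst. Qed.
Lemma an_V (f : C -> C) : (forall z, disk z -> f z != 0) -> analytic_on_disk f ->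
  analytic_on_disk (fun z => (f z)^-1).
Proof. by move=> f0 hf z z1; exact: (derivableV (f0 z z1) (hf z z1)). Qed.

Definition Aw (w : C -> C) z : C := cconj (w z) / (1 - w z * cconj (w z)).
Definition Sh (u : C -> C) z : C := cder u z - u z ^+ 2 / 2.
(** The explicit formula for the Schwarzian. All estimates are made for a pair of analytic functions
    [u], [w]; [schwarzianE] connects them with [h] and [g] afterwards. *)
Definition Sfw (u w : C -> C) z : C :=
  Sh u z + Aw w z * (cder w z * u z - cder (cder w) z) - 3 / 2 * (Aw w z * cder w z) ^+ 2.

Lemma an_Sh u : analytic_on_disk u -> analytic_on_disk (Sh u).
Proof.
move=> au; have [au' _] := analytic_cder au.
have := an_B au' (an_M (an_M au au) (@an_cst 2^-1)).
by rewrite /Sh; congr (analytic_on_disk _); apply/funext => z; rewrite expr2.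
Qed.

Variables (p : R) (u w : C -> C) (k : R).
Hypotheses (p0 : 0 < p) (p1 : p <= 1).
Hypotheses (au : analytic_on_disk u) (aw : analytic_on_disk w).
Hypotheses (k1 : k < 1) (wk : forall z, cabs z < 1 -> cabs (w z) <= k).

Let k0 : 0 <= k.
Proof. by apply: le_trans (wk (z := 0) _); rewrite ?cabs0// cabs_ge0. Qed.
Definition Lk : R := (1 - k ^+ 2)^-1.
Let kk : 0 < 1 - k ^+ 2.
Proof. by rewrite subr_gt0 expr_lt1. Qed.
Lemma Lk_gt0 : 0 < Lk. Proof. by rewrite invr_gt0 kk. Qed.

Lemma Aw_den z : 1 - w z * cconj (w z) = RtoC (1 - cabs (w z) ^+ 2).
Proof. by rewrite mulcconj RtoCD RtoCN RtoC1. Qed.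

Lemma w_lt1 z : cabs z < 1 -> 1 - k ^+ 2 <= 1 - cabs (w z) ^+ 2.
Proof. by move=> z1; rewrite lerD2l lerN2 ler_sqr ?nnegrE ?cabs_ge0 ?wk. Qed.

Lemma Aw_le z : cabs z < 1 -> cabs (Aw w z) <= Lk.
Proof.
move=> z1; have h := w_lt1 z1; have h0 : 0 < 1 - cabs (w z) ^+ 2 by apply: lt_le_trans h.
rewrite /Aw Aw_den cabsM cabsV cabsR cabsconj gtr0_norm//.
have w1 : cabs (w z) <= 1 by apply: (le_trans (wk z1)); exact: ltW.
rewrite /Lk -[leRHS]mul1r; apply: ler_pM => //; first exact: cabs_ge0.
  by rewrite invr_ge0 ltW.
by rewrite lef_pV2.
Qed.

Lemma Aw_den_neq0 z : cabs z < 1 -> 1 - w z * cconj (w z) != 0.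
Proof.
move=> z1; have h := lt_le_trans kk (w_lt1 z1).
by rewrite Aw_den -cabs_eq0 cabsR normr_eq0 gt_eqF.
Qed.

Lemma Aw_cct z : cabs z < 1 -> cct (Aw w) z.
Proof.
move=> z1; have cw : cct w z by apply: ct_der; apply: analytic_der.
apply: ct_M; first exact: ct_conj.
apply: ct_V; first exact: Aw_den_neq0.
by apply: ct_B; [exact: ct_cst|apply: ct_M => //; exact: ct_conj].
Qed.

Lemma Sh_cct z : cabs z < 1 -> cct (Sh u) z.
Proof.
move=> z1; have [_ c] := analytic_cder au.
apply: ct_B; first exact: c.
by apply: ct_M; [apply: ct_X; apply: ct_der; apply: analytic_der|exact: ct_cst].
Qed.

Lemma Sfw_cct z : cabs z < 1 -> cct (Sfw u w) z.
Proof.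
move=> z1; have [aw' c] := analytic_cder aw; have [_ c'] := analytic_cder aw'.
have cA := Aw_cct z1.
apply: ct_B.
  apply: ct_D; first exact: Sh_cct.
  apply: ct_M => //; apply: ct_B; last exact: c'.
  by apply: ct_M; [exact: c|apply: ct_der; apply: analytic_der].
by apply: ct_M; [exact: ct_cst|apply: ct_X; apply: ct_M => //; exact: c].
Qed.

Lemma Sh_le z : cabs z < 1 -> cabs (Sh u z) ^+ 2 <= 4 * (cabs (Sfw u w z) ^+ 2 +
  (Lk * (cabs (cder w z) * cabs (u z))) ^+ 2 + (Lk * cabs (cder (cder w) z)) ^+ 2 +
  (3 / 2 * (Lk * cabs (cder w z)) ^+ 2) ^+ 2).
Proof.
move=> z1; apply: le_trans (sq4 _ _ _ _); have L0 := Lk_gt0; have A1 := Aw_le z1.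
have w0 := cabs_ge0 (cder w z); have u0 := cabs_ge0 (u z).
have w20 := cabs_ge0 (cder (cder w) z); have A0 := cabs_ge0 (Aw w z).
rewrite ler_sqr ?nnegrE ?cabs_ge0//; last first.
  have X1 := mulr_ge0 (ltW L0) (mulr_ge0 w0 u0); have X2 := mulr_ge0 (ltW L0) w20.
  have X3 := sqr_ge0 (Lk * cabs (cder w z)); have X4 := cabs_ge0 (Sfw u w z).
  apply: addr_ge0; [apply: addr_ge0; [apply: addr_ge0|]|]; [exact: X4|exact: X1|exact: X2|].
  by apply: mulr_ge0; [rewrite divr_ge0|exact: X3].
have -> : Sh u z = Sfw u w z - Aw w z * (cder w z * u z) + Aw w z * cder (cder w) z +
   3 / 2 * (Aw w z * cder w z) ^+ 2.
  rewrite /Sfw; move: (Sh u z) (Aw w z) (cder w z) (u z) (cder (cder w) z) => x1 x2 x3 x4 x5.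
  by ring.
apply: (le_trans (cabsD _ _)); apply: lerD.
  apply: (le_trans (cabsD _ _)); apply: lerD.
    apply: (le_trans (cabsB _ _)); apply: lerD => //.
    by rewrite (cabsM (Aw w z)) (cabsM (cder w z)); exact: (ler_wpM2r (mulr_ge0 w0 u0) A1).
  by rewrite (cabsM (Aw w z)); exact: (ler_wpM2r w20 A1).
have -> : (3 / 2 : C) = RtoC (3 / 2) by rewrite RtoCM RtoCV !RtoC_nat.
rewrite cabsM cabsR cabsX (cabsM (Aw w z)) ger0_norm ?divr_ge0//; apply: ler_wpM2l; first by rewrite divr_ge0.
rewrite ler_sqr ?nnegrE; [|exact: mulr_ge0 A0 w0|exact: mulr_ge0 (ltW L0) w0].
exact: (ler_wpM2r w0 A1).
Qed.

Hypothesis HS : smallJ p (fun m z => cabs (Sfw u w z) ^+ 2 * (m - cabs z ^+ 2) ^+ 2).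
Hypothesis HW : smallJ p (fun _ z => cabs (cder w z) ^+ 2).

(** [Sh u] is analytic although [Sfw u w] is not, so the quadratic mean value inequality applies to
    it after solving for it. The radius [rho] and the bound [B] stay free because the estimate
    serves twice: at the rescaling scale and at scale [1 - |z0|]. *)
Lemma Sh_bound (e : R) : 0 < e -> exists2 r : R, r < 1 & forall z0 rho B,
  r < cabs z0 -> cabs z0 < 1 -> 0 < rho -> rho <= (1 - cabs z0) / 2 -> 0 <= B ->
  (forall z, cabs (z - z0) <= rho -> cabs (u z) <= B) ->
  cabs (Sh u z0) ^+ 2 <= e * ((rho^-1 * (1 - cabs z0)^-1) ^+ 2 +
     (B * (1 - cabs z0)^-1) ^+ 2 + (1 - cabs z0)^-1 ^+ 4).
Proof.
move=> e0; have c0g := c0_gt0 R; have L0 := Lk_gt0.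
(* 576 is [16 * 36], from the splitting of the square and from the weight; the powers of [Lk] come
   from the three terms containing [w'] or [w'']. *)
pose T : R := 576 / c0 R + 80 * Lk ^+ 2 + 144 * Lk ^+ 4.
have T0 : 0 < T.
  have X : 0 < 576 / c0 R by exact: divr_gt0 (ltr0Sn R 575) c0g.
  have L2 := exprn_gt0 2 L0; have L4 := exprn_gt0 4 L0.
  by rewrite /T; move: X L2 L4; move: (576 / c0 R) (Lk ^+ 2) (Lk ^+ 4) => x y v; lra.
pose eps := Num.min 1 (e / T).
have eps0 : 0 < eps by rewrite lt_min ltr01 divr_gt0.
have eps1 : eps <= 1 by rewrite ge_min lexx.
have epsT : eps * T <= e by rewrite -ler_pdivlMr// ge_min lexx orbT.
have [aw' cw'] := analytic_cder aw; have [aw'' cw''] := analytic_cder aw'.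
have s1 := smallJ_small p0 p1 aw' HW; have s2 := small_der aw' s1.
have [r1 r11 H1] := s1 _ eps0; have [r2 r21 H2] := s2 _ eps0; have [r3 r31 H3] := HS eps0.
(* Points within [d / 2] of [z0] satisfy [1 - |z| <= 3 d / 2]; the factor 2/3 keeps them beyond [r1]
   and [r2]. *)
exists (Num.max r3 (Num.max (1 - 2 / 3 * (1 - r1)) (1 - 2 / 3 * (1 - r2)))).
  by rewrite !gt_max r31; apply/andP; split => //; apply/andP; split; lra.
move=> z0 rho B; rewrite !gt_max => /andP[z0r3 /andP[z0r1 z0r2]] z01 rho0 rhod B0 HB.
have A0 := cabs_ge0 z0.
set d := 1 - cabs z0 in rhod *; have d0 : 0 < d by rewrite subr_gt0.
have d20 := divr_ge0 (ltW d0) (ler0n R 2).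
set D := d^-1; have D0 : 0 < D by rewrite invr_gt0.
have dD : d * D = 1 by rewrite divff// gt_eqF.
have sr : 1 <= rho ^- 2 * rho ^+ 2 by rewrite mulVf// expf_neq0// gt_eqF.
have ar : cabs z0 + rho < 1 by rewrite /d in rhod; lra.
pose m := 1 - d / 4.
have m1 : m < 1 by rewrite gtrBl divr_gt0.
have m0 : 0 < m by rewrite /m /d; lra.
have cSf z : cabs z < 1 -> rct (fun z => cabs (Sfw u w z) ^+ 2 * (m - cabs z ^+ 2) ^+ 2) z.
  move=> z1; apply: rt_M; apply: rt_X; first by apply: ct_abs; exact: Sfw_cct.
  by apply: rt_B; [exact: rt_cst|apply: rt_X; apply: ct_abs; exact: ct_id].
have Sf0 z : 0 <= cabs (Sfw u w z) ^+ 2 * (m - cabs z ^+ 2) ^+ 2 by rewrite mulr_ge0 ?sqr_ge0.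
have [g1 c1] := J_bump_wgt p0 p1 cSf Sf0 z01 rho0 rhod.
have g2 := H3 z0 m z0r3 z01 m0 m1.
set b := fun z => pos (bump (rho ^- 2) z0 z) ^+ 3 in c1 g1.
have cb : rcont b by exact: posbump_cont.
have aF := an_Sh au.
have mv := L2_mean_value aF rho0 ar sr; rewrite -/(b _) in mv.
pose Q : R := 4 * ((Lk * (2 * (B * D))) ^+ 2 + (Lk * (4 * D ^+ 2)) ^+ 2 + (3 / 2 * (Lk * (2 * D)) ^+ 2) ^+ 2).
have Q0 : 0 <= Q by rewrite mulr_ge0// !addr_ge0 ?sqr_ge0.
have pw z : cabs (Sh u z) ^+ 2 * b z <=
  16 * D ^+ 2 * (cabs (Sfw u w z) ^+ 2 * (m - cabs z ^+ 2) ^+ 2 * b z) + eps * Q * b z.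
  have b0 : 0 <= b z by rewrite exprn_ge0// pos_ge0.
  have [zr|zr] := leP (cabs (z - z0)) rho; last first.
    by rewrite /b (bump_out rho0 sr zr) expr0n /= !mulr0 addr0.
  have t1 := cabs_triangle z z0; have t2 := cabs_triangle z0 z.
  rewrite (cabs_sub z0 z) in t2.
  have [dz z1 zr1 zr2] := ball_radii z01 z0r1 z0r2 rhod zr t1 t2; rewrite -/d in dz.
  rewrite (mulrA (16 * D ^+ 2) _ (b z)) -mulrDl; apply: ler_wpM2r; first exact: b0.
  apply: (le_trans (Sh_le z1)).
  have [_ P0] := wgt_low p0 p1 z01 (le_trans zr rhod).
  have i1 : cabs (cder w z) <= eps * (2 * D).
    have := H1 z zr1 z1; rewrite expr1 => h.
    have : cabs (cder w z) * (d / 2) <= eps by apply: le_trans h; rewrite ler_wpM2l ?cabs_ge0.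
    by rewrite -ler_pdivlMr ?divr_gt0// invf_div mulrA.
  have i2 : cabs (cder (cder w) z) <= eps * (4 * D ^+ 2).
    have h := H2 z zr2 z1.
    have h2 : cabs (cder (cder w) z) * (d / 2) ^+ 2 <= eps.
      apply: le_trans h; apply: ler_wpM2l; first exact: cabs_ge0.
      by rewrite ler_sqr ?nnegrE; [exact: dz|exact: d20|exact: le_trans dz].
    have -> : eps * (4 * D ^+ 2) = eps / (d / 2) ^+ 2 by rewrite /D; field; rewrite gt_eqF.
    by rewrite ler_pdivlMr// exprn_gt0// divr_gt0.
  have u1 := HB z zr; have u0 := cabs_ge0 (u z).
  have w0 := cabs_ge0 (cder w z); have w20 := cabs_ge0 (cder (cder w) z).
  have Pm : 1 <= 4 * D ^+ 2 * (m - cabs z ^+ 2) ^+ 2.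
    have E1 : 1 = 4 * D ^+ 2 * (d / 2) ^+ 2 :> R by rewrite /D; field; rewrite gt_eqF.
    have P1 : d / 2 <= m - cabs z ^+ 2 := P0.
    rewrite [leLHS]E1; apply: ler_wpM2l; first exact: (mulr_ge0 (ler0n _ 4) (sqr_ge0 _)).
    by rewrite ler_sqr ?nnegrE; [exact: P1|exact: d20|exact: le_trans P1].
  have S0 := sqr_ge0 (cabs (Sfw u w z)).
  exact: (sh_arith (ltW L0) (ltW eps0) eps1 (ltW D0) B0 u0 u1 w0 i1 w20 i2 S0 Pm).
have cSh : rcont (fun z => cabs (Sh u z) ^+ 2 * b z).
  apply: (rcont_supp ar) => [z z1|z zr].
    by apply: rt_M; [apply: rt_X; apply: ct_abs; exact: Sh_cct|exact: cb].
  rewrite /b (bump_out rho0 sr) ?expr0n ?mulr0//.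
  by move: (lt_le_trans zr (cabs_triangle z z0)); rewrite addrC ltrD2r.
have c2 : rcont (fun z => 16 * D ^+ 2 * (cabs (Sfw u w z) ^+ 2 * (m - cabs z ^+ 2) ^+ 2 * b z)).
  by move=> z; apply: rt_M; [exact: rt_cst|exact: c1].
have c3 : rcont (fun z => eps * Q * b z) by move=> z; apply: rt_M; [exact: rt_cst|exact: cb].
have c23 : rcont (fun z => 16 * D ^+ 2 * (cabs (Sfw u w z) ^+ 2 * (m - cabs z ^+ 2) ^+ 2 * b z) + eps * Q * b z).
  by move=> z; apply: rt_D; [exact: c2|exact: c3].
have := J_le cSh c23 pw; rewrite (J_D c2 c3) (J_Z _ c1) (J_Z _ cb) => g3.
have kap := J_kap rho0 ar sr.
have g4 := le_trans g1 (ler_wpM2l (ler0n _ 36) g2).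
rewrite -/b in kap; move: g4 g3 mv kap.
move: (J _) (J (fun z => cabs (Sh u z) ^+ 2 * b z)) (J b) => J1 J2 J3 g4 g3 mv kap.
have i0 : 0 <= rho ^- 2 by rewrite invr_ge0 sqr_ge0.
have D20 : 0 <= 16 * D ^+ 2 by rewrite mulr_ge0 ?sqr_ge0.
have g5 : c0 R * cabs (Sh u z0) ^+ 2 <= rho ^- 2 * (16 * D ^+ 2 * (36 * eps) + eps * Q * J3).
  apply: (le_trans mv); apply: ler_wpM2l => //; apply: (le_trans g3).
  by rewrite lerD2r; apply: ler_wpM2l.
have -> : e * ((rho^-1 * D) ^+ 2 + (B * D) ^+ 2 + D ^+ 4) = (c0 R)^-1 * (c0 R * (e * ((rho^-1 * D) ^+ 2 + (B * D) ^+ 2 + D ^+ 4))).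
  by rewrite mulKf// gt_eqF.
rewrite ler_pdivlMl//; apply: (le_trans g5).
have -> : rho ^- 2 * (16 * D ^+ 2 * (36 * eps) + eps * Q * J3) = c0 R * (eps * (576 / c0 R * (rho^-1 * D) ^+ 2 + Q)).
  have c0n : c0 R != 0 by rewrite gt_eqF.
  have rn : rho != 0 by rewrite gt_eqF.
  transitivity (576 * eps * (rho^-1 * D) ^+ 2 + (rho ^- 2 * J3) * (eps * Q)).
    by move: (D) (Q) => D' Q'; field; exact: rn.
  by rewrite kap; move: (rho^-1) (D) (Q) => r' D' Q'; field; exact: c0n.
apply: ler_wpM2l; first exact: ltW.
have x0 : 0 <= 576 / c0 R := divr_ge0 (ler0n R 576) (ltW c0g).
rewrite /Q; apply: (sh_arith2 rho^-1 D B x0 (ltW L0) (ltW eps0)); exact: epsT.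
Qed.
End SchwarzBound.

(** * Zalcman rescaling *)

Section Blowup.
Variable R : realType.
Local Notation C := (Cplx R).
Implicit Types (z : C).

Lemma rder_nonincr (f df : R -> R) (a b : R) : a < b ->
  (forall t : R, a <= t -> t <= b -> is_derive t 1 f (df t)) ->
  (forall t : R, a <= t -> t <= b -> df t <= 0) -> f b <= f a.
Proof.
move=> ab fd dn.
have fd' (x : R) : x \in `]a, b[%R -> is_derive x 1 f (df x).
  by rewrite in_itv/= => /andP[h1 h2]; exact: fd (ltW h1) (ltW h2).
have cf : {within `[a, b], continuous f}.
  apply: continuous_in_subspaceT => x; rewrite inE/= in_itv/= => /andP[h1 h2].
  by have [d _] := fd _ h1 h2; apply: differentiable_continuous; exact/derivable1_diffP.
have [c] := MVT ab fd' cf.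
rewrite in_itv/= => /andP[h1 h2] E.
by rewrite -subr_le0 E mulr_le0_ge0 ?subr_ge0 ?(ltW ab)// dn// ltW.
Qed.

(** The exact solution is [1 / (1 - t / 2)]. The defect [G = q (1 - t / 2) - 1] starts at 0 and
    satisfies [G' = (q / 2) G] up to an error [eta]; since [|q| <= 4], Gronwall with the factor
    [exp(-5 t)] keeps it small up to time 2. But [G(2) = -1]. *)
Lemma riccati_blowup (q qd : R -> C) (eta : R) : 0 <= eta -> 2 * eta ^+ 2 < expR (- 10) ->
  (forall t : R, 0 <= t -> t <= 2 -> cder1 q t (qd t)) ->
  (forall t : R, 0 <= t -> t <= 2 -> cabs (qd t - q t ^+ 2 / 2) <= eta) ->
  (forall t : R, 0 <= t -> t <= 2 -> cabs (q t) <= 4) ->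
  q 0 = 1 -> False.
Proof.
move=> eta0 etas dq qq q4 q0.
pose G t := q t * RtoC (1 - t / 2) - 1.
pose Gd t := qd t * RtoC (1 - t / 2) + q t * RtoC (- 2^-1).
have dG (t : R) : 0 <= t -> t <= 2 -> cder1 G t (Gd t).
  move=> t0 t2; have hl : is_derive t 1 (fun s : R => 1 - s / 2) (- 2^-1).
    apply: (rder_ext (rderB (rder_cst 1 t) (rderM (rder_id t) (rder_cst (2^-1) t)))) => //.
    by rewrite mul1r mulr0 addr0 sub0r.
  apply: (cder1_ext (cder1B (cder1M (dq t t0 t2) (cder1R hl)) (cder1_cst 1 t))) => //.
  by rewrite subr0.
have GdE t : Gd t = q t / 2 * G t + (qd t - q t ^+ 2 / 2) * RtoC (1 - t / 2).
  rewrite /Gd /G RtoCN RtoCV RtoC_nat; move: (q t) (qd t) (RtoC (1 - t / 2)) => x y v.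
  by field.
pose f t := cre (G t * cconj (G t)) * expR (- 5 * t) - eta ^+ 2 * t.
pose df t := cre (Gd t * cconj (G t) + G t * cconj (Gd t)) * expR (- 5 * t) +
   cre (G t * cconj (G t)) * (expR (- 5 * t) * - 5) - eta ^+ 2.
have dfP (t : R) : 0 <= t -> t <= 2 -> is_derive t 1 f (df t).
  move=> t0 t2; have d1 := dG t t0 t2.
  have d2 := cder1_re (cder1M d1 (cder1conj d1)).
  have d3 : is_derive t 1 (fun s : R => expR (- 5 * s)) (expR (- 5 * t) * - 5).
    apply: (@rder_comp R expR (fun s => -5 * s) t (expR (- 5 * t)) (-5)).
    apply: (rder_ext (rderM (rder_cst (-5) t) (rder_id t))) => //.
    by rewrite mul0r add0r mulr1.
  have d4 : is_derive t 1 (fun s : R => eta ^+ 2 * s) (eta ^+ 2).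
    apply: (rder_ext (rderM (rder_cst (eta ^+ 2) t) (rder_id t))) => //.
    by rewrite mul0r add0r mulr1.
  exact: rder_ext (rderB (rderM d2 d3) d4) _ _.
have dfN (t : R) : 0 <= t -> t <= 2 -> df t <= 0.
  move=> t0 t2; have E0 := expR_gt0 (- 5 * t).
  have E1 : expR (- 5 * t) <= 1 by rewrite -[leRHS]expR0 ler_expR; lra.
  have -> : df t = (cre (Gd t * cconj (G t) + G t * cconj (Gd t)) - 5 * cabs (G t) ^+ 2) * expR (- 5 * t) - eta ^+ 2.
    by rewrite /df mulcconj creR; ring.
  have key : cre (Gd t * cconj (G t) + G t * cconj (Gd t)) - 5 * cabs (G t) ^+ 2 <= eta ^+ 2.
    have -> : cre (Gd t * cconj (G t) + G t * cconj (Gd t)) = 2 * cre (Gd t * cconj (G t)).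
      by rewrite !cE; ring.
    have -> : Gd t * cconj (G t) = q t / 2 * (G t * cconj (G t)) + (qd t - q t ^+ 2 / 2) * RtoC (1 - t / 2) * cconj (G t).
      by rewrite GdE; ring.
    have a1 := cre_le ((qd t - q t ^+ 2 / 2) * RtoC (1 - t / 2) * cconj (G t)).
    have a1' := le_trans (ler_norm _) a1.
    have a2 := le_trans (ler_norm _) (cre_le (q t)).
    have a3 := q4 t t0 t2; have a4 := qq t t0 t2.
    rewrite creD mulcconj.
    have -> : cre (q t / 2 * RtoC (cabs (G t) ^+ 2)) = 2^-1 * cre (q t) * cabs (G t) ^+ 2.
      by rewrite -(RtoC_nat R 2) -RtoCV !cE; ring.
    have g0 := cabs_ge0 (G t).
    have b1 : cabs ((qd t - q t ^+ 2 / 2) * RtoC (1 - t / 2) * cconj (G t)) <= eta * cabs (G t).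
      rewrite (cabsM _ (cconj _)) (cabsM _ (RtoC _)) cabsconj cabsR; apply: ler_wpM2r => //.
      rewrite -[leRHS]mulr1; apply: ler_pM => //; [exact: cabs_ge0|].
      by rewrite ger0_norm; lra.
    have b2 : cre (q t) * cabs (G t) ^+ 2 <= 4 * cabs (G t) ^+ 2.
      by apply: ler_wpM2r; [exact: sqr_ge0|exact: le_trans a3].
    have b3 := sqr_ge0 (cabs (G t) - eta).
    move: b3; rewrite sqrrB; move: a1' b1 b2.
    move: (cre _) (cabs _) (cre (q t)) (cabs (G t)) => y1 y2 y3 y4.
    by lra.
  have e20 := sqr_ge0 eta.
  have : (cre (Gd t * cconj (G t) + G t * cconj (Gd t)) - 5 * cabs (G t) ^+ 2) * expR (- 5 * t) <= eta ^+ 2 * expR (- 5 * t).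
    by apply: ler_wpM2r => //; exact: ltW.
  have : eta ^+ 2 * expR (- 5 * t) <= eta ^+ 2 by rewrite ler_piMr.
  by lra.
have := @rder_nonincr f df 0 2 ltac:(lra) dfP dfN.
have -> : f 0 = 0.
  have G0 : G 0 = 0 by rewrite /G q0 mul0r subr0 RtoC1 mulr1 subrr.
  by rewrite /f G0 mul0r -RtoC0 creR mul0r mulr0 subr0.
have -> : f 2 = expR (- 10) - 2 * eta ^+ 2.
  rewrite /f /G divff// subrr RtoC0 mulr0 sub0r mulcconj creR cabsN cabs1 expr1n mul1r.
  by rewrite (mulrC _ 2); congr (expR _ - _); ring.
by lra.
Qed.

(** The conclusion of [Sh_bound], isolated so that the rescaling and the ray argument speak of [u]
    alone. *)
Definition sh_control (u : C -> C) := forall e : R, 0 < e -> exists2 r : R, r < 1 & forall z0 rho B,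
  r < cabs z0 -> cabs z0 < 1 -> 0 < rho -> rho <= (1 - cabs z0) / 2 -> 0 <= B ->
  (forall z, cabs (z - z0) <= rho -> cabs (u z) <= B) ->
  cabs (Sh u z0) ^+ 2 <= e * ((rho^-1 * (1 - cabs z0)^-1) ^+ 2 +
     (B * (1 - cabs z0)^-1) ^+ 2 + (1 - cabs z0)^-1 ^+ 4).

(* A point where a function is at least half as large as anywhere on the set stands in for a
   maximum point and needs no compactness. *)
Lemma near_max (T : Type) (A : set T) (v : T -> R) (x0 : T) (M : R) : A x0 -> 0 < v x0 ->
  (forall x, A x -> v x <= M) ->
  exists x, [/\ A x, v x0 < 2 * v x & forall y, A y -> v y <= 2 * v x].
Proof.
move=> Ax0 v0 vM; pose S : set R := [set v x | x in A].
have hS : has_sup S.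
  by split; [exists (v x0), x0|exists M => _ [x Ax <-]; exact: vM].
have ub y : A y -> v y <= sup S by move=> Ay; apply: sup_upper_bound => //; exists y.
have s0 : 0 < sup S by apply: lt_le_trans (ub _ Ax0).
have [_ [x Ax <-] h] := sup_adherent (divr_gt0 s0 (ltr0n R 2)) hS.
exists x; split => // [|y Ay]; first by have := ub _ Ax0; lra.
by have := ub _ Ay; lra.
Qed.

(** The three terms are at most 1/256, 1/4 and 1/4096 of [M^4]. *)
Lemma zalcman_arith (M D x : R) : 0 <= M -> 0 <= D -> D <= M / 8 -> 0 <= x -> x <= M / 2 ->
  (x * D) ^+ 2 + (4 * M * D) ^+ 2 + D ^+ 4 <= (M ^+ 2) ^+ 2.
Proof.
move=> M0 D0 D2 i40 i4; have M8 : 0 <= M / 8 by lra.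
have k1 : (x * D) ^+ 2 <= (M / 2 * (M / 8)) ^+ 2.
  by rewrite ler_sqr ?nnegrE; [exact: ler_pM|exact: mulr_ge0|apply: mulr_ge0; lra].
have M40 : 0 <= 4 * M by lra.
have k2 : (4 * M * D) ^+ 2 <= (4 * M * (M / 8)) ^+ 2.
  by rewrite ler_sqr ?nnegrE; [exact: ler_wpM2l|exact: mulr_ge0|exact: mulr_ge0].
have k3 : D ^+ 4 <= (M / 8) ^+ 4 by apply: lerXn2r.
have E1 : (M / 2 * (M / 8)) ^+ 2 = M ^+ 4 / 256 by field.
have E2 : (4 * M * (M / 8)) ^+ 2 = M ^+ 4 / 4 by field.
have E3 : (M / 8) ^+ 4 = M ^+ 4 / 4096 by field.
have := exprn_ge0 4 M0; rewrite -exprM; move: k1 k2 k3; rewrite E1 E2 E3; lra.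
Qed.

Lemma zalcman_radii (M Rs d : R) : 0 < M -> 0 < Rs -> 8 < Rs * M -> Rs <= d ->
  [/\ 2 / M <= Rs / 4, 0 <= (Rs / 4)^-1, (Rs / 4)^-1 <= M / 2, 0 <= d^-1 & d^-1 <= M / 8].
Proof.
move=> M0 R0 v8 Rd; have d0 : 0 < d := lt_le_trans R0 Rd.
split; first by rewrite ler_pdivrMr//; lra.
- by rewrite invr_ge0; lra.
- by rewrite invf_div ler_pdivrMr//; lra.
- by rewrite invr_ge0; lra.
apply: (@le_trans _ _ Rs^-1); first by rewrite lef_pV2.
by rewrite -[leLHS]mul1r ler_pdivrMr//; lra.
Qed.

Variable u : C -> C.
Hypothesis au : analytic_on_disk u.

(* The rescaled function solves the Riccati equation [q' = q^2/2] approximately, whose solution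
   blows up at time 2. *)
Lemma zalcman_rescaled (z1 : C) (Rs eta : R) : 0 < eta -> 2 * eta ^+ 2 < expR (- 10) ->
  0 < Rs -> 8 < Rs * cabs (u z1) ->
  (forall z, cabs (z - z1) <= Rs / 4 -> Rs <= 1 - cabs z) ->
  (forall z, cabs (z - z1) <= Rs / 2 -> cabs (u z) <= 4 * cabs (u z1)) ->
  (forall z, cabs (z - z1) <= Rs / 4 -> cabs (Sh u z) ^+ 2 <= eta ^+ 2 *
     (((Rs / 4)^-1 * (1 - cabs z)^-1) ^+ 2 + (4 * cabs (u z1) * (1 - cabs z)^-1) ^+ 2 +
      (1 - cabs z)^-1 ^+ 4)) -> False.
Proof.
move=> eta0 etas R0; set M := cabs (u z1) => v8 Rd u4 HS.
have M0 : 0 <= M by exact: cabs_ge0.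
have Mgt : 0 < M by rewrite lt_neqAle M0 andbT; apply/eqP => h; move: v8; rewrite -h mulr0 ltrn0.
have [RsM _ _ _ _] := zalcman_radii Mgt R0 v8 (lexx _).
(* The unimodular direction for which the rescaled function starts at 1. Up to time 2 the point
   moves by at most [2 / M], hence stays within [Rs / 4]. *)
pose w := cconj (u z1) / RtoC M.
have w1 : cabs w = 1 by rewrite /w cabsM cabsconj cabsV cabsR gtr0_norm// divff// gt_eqF.
pose zt (t : R) := z1 + RtoC (t / M) * w.
have ztd (t : R) : 0 <= t -> t <= 2 -> cabs (zt t - z1) <= Rs / 4.
  move=> t0 t2; rewrite /zt addrC addKr cabsM w1 mulr1 cabsR ger0_norm ?divr_ge0//.
  by apply: le_trans RsM; rewrite ler_pM2r ?invr_gt0.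
have R42 : Rs / 4 <= Rs / 2 by rewrite ler_pM2l// lef_pV2 ?posrE// ler_nat.
have Mn : RtoC M != 0 by rewrite -cabs_eq0 cabsR normr_eq0 gt_eqF.
pose q t := w / RtoC M * u (zt t).
pose qd t := w / RtoC M * (cder u (zt t) * (RtoC M^-1 * w)).
apply: (@riccati_blowup q qd eta (ltW eta0) etas).
- move=> t t0 t2.
  have zd : disk (zt t) by rewrite /disk/= -subr_gt0; exact: lt_le_trans (Rd _ (ztd t t0 t2)).
  have hl : is_derive t 1 (fun s : R => s / M) M^-1.
    apply: (rder_ext (rderM (rder_id t) (rder_cst (M^-1) t))) => //.
    by rewrite mul1r mulr0 addr0.
  have dz : cder1 zt t (RtoC M^-1 * w).
    apply: (cder1_ext (cder1D (cder1_cst z1 t) (cder1M (cder1R hl) (cder1_cst w t)))) => //.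
    by rewrite mulr0 addr0 add0r.
  have du := cder1_comp (analytic_der au zd) dz.
  apply: (cder1_ext (cder1M (cder1_cst (w / RtoC M) t) du)) => //.
  by rewrite mul0r add0r.
- move=> t t0 t2; have zR := ztd t t0 t2.
  have -> : qd t - q t ^+ 2 / 2 = (w / RtoC M) ^+ 2 * Sh u (zt t).
    rewrite /qd /q /Sh RtoCV; move: (u (zt t)) (cder u (zt t)) => x y; by field.
  have [_ i40 i4 D0 D2] := zalcman_radii Mgt R0 v8 (Rd _ zR).
  rewrite cabsM cabsX cabsM w1 cabsV cabsR gtr0_norm// mul1r exprVn mulrC ler_pdivrMr ?exprn_gt0//.
  have e0 := ltW eta0.
  rewrite -ler_sqr ?nnegrE; [|exact: cabs_ge0|exact: mulr_ge0 e0 (sqr_ge0 M)].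
  apply: (le_trans (HS _ zR)); rewrite (exprMn 2 eta (M ^+ 2)); apply: ler_wpM2l; first exact: sqr_ge0.
  exact: zalcman_arith M0 D0 D2 i40 i4.
- move=> t t0 t2; rewrite /q (cabsM _ (u _)) (cabsM w) w1 mul1r cabsV cabsR gtr0_norm// mulrC ler_pdivrMr//.
  by apply: u4; exact: le_trans (ztd t t0 t2) R42.
rewrite /q /zt mul0r RtoC0 mul0r addr0 /w.
have -> : cconj (u z1) / RtoC M / RtoC M * u z1 = (u z1 * cconj (u z1)) / RtoC M ^+ 2 by field.
by rewrite mulcconj -/M RtoCX divff// expf_neq0.
Qed.

Lemma near_radii (a1 z1 dz t0 t1 r : R) : (2 * r + 1) / 3 < a1 -> 0 <= t0 -> t0 <= (1 - a1) / 2 ->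
  t1 <= dz + t0 -> dz <= ((1 - a1) / 2 - t0) / 4 -> z1 <= t1 + a1 -> a1 <= t1 + z1 ->
  r < z1 /\ (1 - a1) / 2 - t0 <= 1 - z1.
Proof. by move=> *; split; lra. Qed.

Hypothesis cu : sh_control u.

(** The function [(Ra - |z - a|) |u(z)|] vanishes on the rim of the disc, so a near maximum [z1] has
    room around it: within half its distance [Rs] to the rim, [|u| <= 4 |u(z1)|]. *)
Lemma u_bound : exists K r : R, [/\ r < 1, 0 < K &
  forall a, r < cabs a -> cabs a < 1 -> cabs (u a) * (1 - cabs a) <= K].
Proof.
pose E : R := expR (- 10); have E0 : 0 < E by exact: expR_gt0.
have E1 : E <= 1 by rewrite /E -[leRHS]expR0 ler_expR; lra.
pose eta := E / 2; have eta0 : 0 < eta by rewrite divr_gt0.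
have etas : 2 * eta ^+ 2 < expR (- 10).
  rewrite -/E /eta exprMn; have : E ^+ 2 <= E by rewrite expr2 ler_piMl// ltW.
  by lra.
have [r r1 Hr] := cu (exprn_gt0 2 eta0).
(* A value above 32 at [a] becomes 16 through [Ra = (1 - |a|) / 2] and 8 through the near maximum,
   the threshold of [zalcman_rescaled]. The radius keeps the disc about [a] beyond [r]. *)
exists 32, ((2 * r + 1) / 3); split => // [|a ra a1]; first by lra.
rewrite leNgt; apply/negP => big.
pose Ra := (1 - cabs a) / 2; have Ra0 : 0 < Ra by rewrite /Ra; lra.
have aR : cabs a + Ra < 1 by rewrite /Ra; lra.
have ca z : cabs (z - a) < 1 - cabs a -> cct u z.
  move=> za; apply: ct_der; apply: analytic_der au _.
  by have := cabs_triangle z a; rewrite /disk/=; lra.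
have RR : Ra < 1 - cabs a by rewrite /Ra; lra.
have [B B0 HB] := bounded_ball Ra0 RR aR ca.
pose v z := (Ra - cabs (z - a)) * cabs (u z).
have va : v a = Ra * cabs (u a) by rewrite /v subrr cabs0 subr0.
have [] := @near_max C [set z | cabs (z - a) <= Ra] v a (Ra * B).
- by rewrite /= subrr cabs0 ltW.
- by rewrite va /Ra; lra.
- move=> z /= za; rewrite /v; apply: ler_pM; [by rewrite subr_ge0|exact: cabs_ge0| |exact: HB].
  by rewrite gerBl cabs_ge0.
move=> z1 [/= z1a]; rewrite va => v1 vmax.
have v16 : 16 < Ra * cabs (u a) by rewrite /Ra; lra.
have v8 : 8 < (Ra - cabs (z1 - a)) * cabs (u z1) by move: v1; rewrite /v; lra.
move: (cabs_ge0 (z1 - a)) (cabs_ge0 (u z1)) => t0 M0.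
have Rgt : 0 < Ra - cabs (z1 - a).
  rewrite lt_neqAle subr_ge0 z1a andbT; apply/eqP => h.
  by move: v8; rewrite -h mul0r ltrn0.
have near z : cabs (z - z1) <= (Ra - cabs (z1 - a)) / 4 -> r < cabs z /\ Ra - cabs (z1 - a) <= 1 - cabs z.
  move=> zz; have t1 : cabs (z - a) <= cabs (z - z1) + cabs (z1 - a).
    by have := cabsD (z - z1) (z1 - a); rewrite addrA subrK.
  have t4 := cabs_triangle a z; rewrite (cabs_sub a) in t4.
  exact: near_radii ra t0 z1a t1 zz (cabs_triangle z a) t4.
have u4 z : cabs (z - z1) <= (Ra - cabs (z1 - a)) / 2 -> cabs (u z) <= 4 * cabs (u z1).
  move=> zz; have t1 : cabs (z - a) <= cabs (z - z1) + cabs (z1 - a).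
    by have := cabsD (z - z1) (z1 - a); rewrite addrA subrK.
  have za : cabs (z - a) <= Ra.
    by apply: (le_trans t1); rewrite -lerBrDr; apply: (le_trans zz); rewrite ler_pdivrMr// ler_pMr ?ler1n.
  have h := vmax z za; rewrite /v in h.
  have : (Ra - cabs (z1 - a)) / 2 * cabs (u z) <= (Ra - cabs (z - a)) * cabs (u z).
    by apply: ler_wpM2r; [exact: cabs_ge0|move: zz t1; lra].
  move=> h2; have h3 := le_trans h2 h.
  by rewrite -(ler_pM2l (divr_gt0 Rgt (ltr0n R 2))); move: h3; lra.
apply: (zalcman_rescaled eta0 etas Rgt v8 _ u4) => z zz; first by have [] := near z zz.
have [n1 n2] := near z zz; have d0 := lt_le_trans Rgt n2.
apply: Hr => //.
- by rewrite -subr_gt0.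
- by rewrite divr_gt0.
- by move: n2 Rgt d0; lra.
- by rewrite mulr_ge0.
move=> y zy; apply: u4; have t1 := cabsD (y - z) (z - z1); rewrite addrA subrK in t1.
by move: t1 zy zz; lra.
Qed.

(** Once [d |u| <= K] near the circle, [sh_control] is used with [rho = d / 2] and [B = 2 K / d];
    the bracket is then [(4 + 4 K^2 + 1) / d^4], which explains the denominator of [e']. *)
Lemma small_Sh : small 2 (Sh u).
Proof.
have [K [r0 [r01 K0 HK]]] := u_bound.
move=> e e0; pose e' := e ^+ 2 / (5 + 4 * K ^+ 2).
have K2 := sqr_ge0 K.
have dn : 0 < 5 + 4 * K ^+ 2 by lra.
have e'0 : 0 < e' by rewrite divr_gt0 ?exprn_gt0.
have [r r1 Hr] := cu e'0; exists (Num.max r (1 - 2 / 3 * (1 - r0))).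
  by rewrite gt_max r1; lra.
move=> z0; rewrite gt_max => /andP[zr zr0] z1.
set d := 1 - cabs z0; have d0 : 0 < d by rewrite subr_gt0.
have B0 : 0 <= 2 * K / d by rewrite divr_ge0 ?(ltW d0)//; lra.
have HB z : cabs (z - z0) <= d / 2 -> cabs (u z) <= 2 * K / d.
  move=> zz; have t1 := cabs_triangle z z0; have t2 := cabs_triangle z0 z.
  rewrite (cabs_sub z0 z) in t2.
  have := HK z ltac:(rewrite /d in zz; lra) ltac:(rewrite /d in zz d0; lra) => h.
  have : cabs (u z) * (d / 2) <= cabs (u z) * (1 - cabs z).
    by apply: ler_wpM2l; [exact: cabs_ge0|rewrite /d in zz *; lra].
  by rewrite ler_pdivlMr//; lra.
have h := Hr z0 (d / 2) (2 * K / d) zr z1 ltac:(lra) (lexx _) B0 HB.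
have S0 := cabs_ge0 (Sh u z0); have d20 := sqr_ge0 d.
rewrite -ler_sqr ?nnegrE; [|exact: mulr_ge0|exact: ltW].
have -> : e ^+ 2 = e' * (((d / 2)^-1 * d^-1) ^+ 2 + (2 * K / d * d^-1) ^+ 2 + d^-1 ^+ 4) * d ^+ 4.
  rewrite /e'; field; by rewrite !gt_eqF.
by rewrite exprMn -exprM; apply: ler_wpM2r h; exact: exprn_ge0 (ltW d0).
Qed.

End Blowup.

(** * Decay of the pre-Schwarzian along rays *)

Section Ray.
Variable R : realType.
Local Notation C := (Cplx R).
Implicit Types (z : C).

(** Without the error [(e1, e2)] the expression is [- X / 2 - (3/2) eta^2 Z]. A point cannot be
    close to both 0 and -1, so [X + Z >= 1/2], and the resulting margin of order [eta^2] absorbs an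
    error of size [eta^2 / 8]. *)
Lemma ray_arith (a b e1 e2 eta eps : R) : eta ^+ 2 <= 1 / 4 -> 0 <= eps -> eps <= eta ^+ 2 / 8 ->
  e1 ^+ 2 + e2 ^+ 2 <= eps ^+ 2 ->
  forall X Z : R, X = a ^+ 2 + b ^+ 2 -> Z = (1 + a) ^+ 2 + b ^+ 2 ->
  - 2 * X - 2 * (a * e1 + b * e2) + 2 * eta ^+ 2 * ((1 + a) * e1 + b * e2) +
   3 / 2 * (X - eta ^+ 2 * Z) <= 0.
Proof.
move=> eta1 eps0 epse E X Z XE ZE; have h0 := sqr_ge0 eta.
have s1 := sqr_ge0 (a / 2 + 2 * e1); have s2 := sqr_ge0 (b / 2 + 2 * e2).
have s3 : 0 <= eta ^+ 2 * ((1 + a - 2 * e1) ^+ 2 + (b - 2 * e2) ^+ 2).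
  by rewrite mulr_ge0// addr_ge0 ?sqr_ge0.
have XZ : 1 / 2 <= X + Z.
  by have := sqr_ge0 (a + 1 / 2); have := sqr_ge0 b; rewrite XE ZE; rewrite !sqrrD; lra.
have X0 : 0 <= X by rewrite XE addr_ge0 ?sqr_ge0.
have Z0 : 0 <= Z by rewrite ZE addr_ge0 ?sqr_ge0.
have eps2 : eps ^+ 2 <= eps * (eta ^+ 2 / 8) by rewrite expr2 ler_wpM2l.
have eps3 : eps * (eta ^+ 2 / 8) <= (1 / 32) * (eta ^+ 2 / 8) by apply: ler_wpM2r; lra.
have k1 : eta ^+ 2 * X <= 1 / 4 * X by apply: ler_wpM2r.
have k2 : eta ^+ 2 * (1 / 2) <= eta ^+ 2 * (X + Z) by apply: ler_wpM2l.
have k3 : eta ^+ 2 * (e1 ^+ 2 + e2 ^+ 2) <= 1 / 4 * (e1 ^+ 2 + e2 ^+ 2).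
  by apply: ler_wpM2r => //; rewrite addr_ge0 ?sqr_ge0.
move: s1 s2 s3 XZ X0 Z0 k1 k2 k3; rewrite XE ZE; move: (eta ^+ 2) h0 eta1 epse eps2 eps3 => y h0 eta1 epse eps2 eps3.
rewrite !expr2 in E eps2 *; lra.
Qed.

Lemma cre_sym (a b : C) : cre (a * cconj b + b * cconj a) = 2 * cre (a * cconj b).
Proof. by rewrite !cE; ring. Qed.

Lemma ray_deriv (s e : R) (a b : C) :
  s * (cre (a * cconj b + b * cconj a) - e * cre (a * cconj (1 + b) + (1 + b) * cconj a)) =
  2 * cre (RtoC s * a * cconj b) - e * (2 * cre (RtoC s * a * cconj (1 + b))).
Proof.
rewrite !cre_sym -!mulrA !cre_RtoCM.
by move: (cre _) (cre _) => x y; ring.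
Qed.

Lemma ray_expand (e : R) (y E : C) :
  2 * cre ((- y - y ^+ 2 - E) * cconj y) - e * (2 * cre ((- y - y ^+ 2 - E) * cconj (1 + y))) -
    (cabs y ^+ 2 - e * cabs (1 + y) ^+ 2) * (- 2 * cre y) +
    3 / 2 * (cabs y ^+ 2 - e * cabs (1 + y) ^+ 2) =
  - 2 * (cre y ^+ 2 + cim y ^+ 2) - 2 * (cre y * cre E + cim y * cim E) +
    2 * e * ((1 + cre y) * cre E + cim y * cim E) +
    3 / 2 * (cre y ^+ 2 + cim y ^+ 2 - e * ((1 + cre y) ^+ 2 + cim y ^+ 2)).
Proof.
rewrite !cabs2 !cE; move: (cre y) (cim y) (cre E) (cim E) => a b c d; ring.
Qed.

Variables (u k : C -> C) (Ck : R).
Hypotheses (au : analytic_on_disk u) (ak : analytic_on_disk k).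
Hypotheses (k0 : forall z, disk z -> k z != 0) (ku : forall z, disk z -> cder k z = u z * k z).
Hypotheses (kC : forall z, disk z -> cabs (k z) * (1 - cabs z) <= Ck).
Hypothesis sS : small 2 (Sh u).

Lemma powR_half_inv (x : R) : 0 <= x -> (x ^+ 2) `^ (- 2^-1) = x^-1.
Proof.
move=> x0; rewrite -powR_mulrn// -powRrM.
have -> : 2%:R * - 2^-1 = -1 :> R by field.
by rewrite powRN powRr1.
Qed.

Definition rayY (zeta : C) (t : R) : C := RtoC (- ((1 - t) / 2)) * zeta * u (RtoC t * zeta).
(** Its sign compares [|y / (1 + y)|] with [eta]; this quotient is the coordinate in which the
    logistic flow [y' = - y (1 + y)] is linear. *)
Definition rayA (zeta : C) (eta t : R) : R :=
  cabs (rayY zeta t) ^+ 2 - eta ^+ 2 * cabs (1 + rayY zeta t) ^+ 2.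
Definition rayF (zeta : C) (eta t : R) : R :=
  rayA zeta eta t * (cabs (k (RtoC t * zeta)))^-1 * (1 - t) `^ (- (3 / 2)).

(** When [Sh u] vanishes, [1 - t] times the logarithmic derivative of [k] cancels the cubic terms
    and leaves exactly [- 2 |y|^2 + (3/2) A]. Monotonicity allows an exponent of [1 - t] up to 2,
    the contradiction in [small_u] needs more than 1; 3/2 lies between. *)
Lemma ray_monotone (zeta : C) (eta r0 r1 : R) : cabs zeta = 1 -> 0 < eta -> eta ^+ 2 <= 1 / 4 ->
  0 < r0 -> r0 < r1 -> r1 < 1 ->
  (forall z, r0 <= cabs z -> cabs z < 1 -> cabs (Sh u z) * (1 - cabs z) ^+ 2 <= eta ^+ 2 / 4) ->
  rayF zeta eta r1 <= rayF zeta eta r0.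
Proof.
move=> z1 eta0 eta1 r00 r01 r11 HS.
pose Y := rayY zeta; pose A := rayA zeta eta; pose F := rayF zeta eta.
have [au' _] := analytic_cder au.
have dk (t : R) : r0 <= t -> t <= r1 -> disk (RtoC t * zeta).
  by move=> h1 h2; rewrite /disk/= cabsM z1 cabsR ger0_norm; lra.
pose Yd (t : R) := RtoC (2^-1) * zeta * u (RtoC t * zeta) +
   RtoC (- ((1 - t) / 2)) * zeta * (cder u (RtoC t * zeta) * zeta).
have dray (t : R) : cder1 (fun s : R => RtoC s * zeta) t zeta.
  apply: (cder1_ext (cder1M (cder1R (rder_id t)) (cder1_cst zeta t))) => //.
  by rewrite RtoC1 mul1r mulr0 addr0.
have dY (t : R) : r0 <= t -> t <= r1 -> cder1 Y t (Yd t).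
  move=> h1 h2.
  have hl : is_derive t 1 (fun s : R => - ((1 - s) / 2)) (2^-1).
    apply: (rder_ext (rderN (rderM (rderB (rder_cst 1 t) (rder_id t)) (rder_cst (2^-1) t)))) => //.
    by ring.
  have du := cder1_comp (analytic_der au (dk t h1 h2)) (dray t).
  apply: (cder1_ext (cder1M (cder1M (cder1R hl) (cder1_cst zeta t)) du)) => //.
  by rewrite mulr0 addr0.
pose N (t : R) := cabs (k (RtoC t * zeta)) ^+ 2.
pose Re (t : R) := cre (u (RtoC t * zeta) * zeta).
have N0 (t : R) : r0 <= t -> t <= r1 -> 0 < N t.
  by move=> h1 h2; rewrite /N exprn_gt0// cabs_gt0 k0//; exact: dk.
have dN (t : R) : r0 <= t -> t <= r1 -> is_derive t 1 N (2 * N t * Re t).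
  move=> h1 h2; have hk := cder1_comp (analytic_der ak (dk t h1 h2)) (dray t).
  have := cder1_re (cder1M hk (cder1conj hk)) => h.
  apply: (rder_ext h) => [s|]; first by rewrite mulcconj creR.
  rewrite (ku (dk t h1 h2)) /N /Re; move: (k _) (u _) => x y.
  by rewrite cabs2 !cE; ring.
pose H (t : R) := N t `^ (- 2^-1) * (1 - t) `^ (- (3 / 2)).
pose Ad (t : R) := cre (Yd t * cconj (Y t) + Y t * cconj (Yd t)) -
   eta ^+ 2 * cre (Yd t * cconj (1 + Y t) + (1 + Y t) * cconj (Yd t)).
pose dF (t : R) := (Ad t - A t * Re t + 3 / 2 * A t / (1 - t)) * H t.
have FE (t : R) : F t = A t * H t.
  by rewrite /F /rayF /H /N powR_half_inv ?cabs_ge0// mulrA.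
have dFP (t : R) : r0 <= t -> t <= r1 -> is_derive t 1 F (dF t).
  move=> h1 h2; have d0 : 0 < 1 - t by lra.
  have y1 := dY t h1 h2; have y2 := cder1D (cder1_cst 1 t) y1; rewrite add0r in y2.
  have a1 := cder1_re (cder1M y1 (cder1conj y1)).
  have a2 := cder1_re (cder1M y2 (cder1conj y2)).
  have dA := rderB a1 (rderM (rder_cst (eta ^+ 2) t) a2).
  have p1 : is_derive (N t) 1 (fun x : R => x `^ (- 2^-1)) (- 2^-1 * N t `^ (- 2^-1 - 1)).
    by apply: is_derive1_powR; exact: N0.
  have p2 : is_derive (1 - t) 1 (fun x : R => x `^ (- (3 / 2))) (- (3 / 2) * (1 - t) `^ (- (3 / 2) - 1)).
    exact: is_derive1_powR.
  have q1 := @rder_comp R _ N t _ _ p1 (dN t h1 h2).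
  have q2 := @rder_comp R _ (fun s => 1 - s) t _ _ p2 (rderB (rder_cst 1 t) (rder_id t)).
  apply: (rder_ext (rderM dA (rderM q1 q2))) => [s|].
    by rewrite FE /A /rayA /H !mulcconj !creR.
  have E1 : N t `^ (- 2^-1 - 1) = N t `^ (- 2^-1) / N t.
    by rewrite powRB ?powRr1 ?(ltW (N0 _ h1 h2))//; apply/implyP => _; rewrite gt_eqF ?N0.
  have E2 : (1 - t) `^ (- (3 / 2) - 1) = (1 - t) `^ (- (3 / 2)) / (1 - t).
    by rewrite powRB ?powRr1 ?(ltW d0)//; apply/implyP => _; rewrite gt_eqF.
  have AE : cabs (Y t) ^+ 2 - eta ^+ 2 * cabs (1 + Y t) ^+ 2 = A t by [].
  rewrite E1 E2 /dF /H /Ad !mulcconj !creR AE.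
  move: (N0 t h1 h2) d0 (N t `^ _) ((1 - t) `^ _) (cre _) (cre _) (A t) (Re t) => n0 d0 x1 x2 x3 x4 x5 x6.
  by field; rewrite !gt_eqF.
apply: (@rder_nonincr R F dF) => // t h1 h2.
have d0 : 0 < 1 - t by lra.
rewrite /dF mulr_le0_ge0//; last by rewrite mulr_ge0// powR_ge0.
rewrite -(pmulr_rle0 _ d0).
(* The inhomogeneity of the logistic equation: [u' = u^2 / 2 + Sh u] multiplied by
   [zeta^2 (1 - t)^2 / 2]. *)
pose E := RtoC ((1 - t) ^+ 2 / 2) * zeta ^+ 2 * Sh u (RtoC t * zeta).
have YE : RtoC (1 - t) * Yd t = - (Y t) - Y t ^+ 2 - E.
  rewrite /Yd /E /Y /rayY /Sh !(RtoCM, RtoCN, RtoCX, RtoCV, RtoC_nat).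
  move: (RtoC (1 - t)) (u _) (cder u _) => d x y; by field.
have RE : (1 - t) * Re t = - 2 * cre (Y t).
  rewrite /Re /Y /rayY -mulrA cre_RtoCM (mulrC zeta); by field.
have cE1 : cabs E <= eta ^+ 2 / 8.
  have tz : cabs (RtoC t * zeta) = t by rewrite cabsM z1 cabsR ger0_norm; lra.
  have := HS (RtoC t * zeta) ltac:(rewrite tz//) ltac:(rewrite tz; lra); rewrite tz => h.
  rewrite /E cabsM (cabsM (RtoC _)) cabsX z1 cabsR ger0_norm; last by rewrite divr_ge0 ?sqr_ge0.
  by rewrite expr1n mulr1 mulrC mulrA; lra.
have E2 : cre E ^+ 2 + cim E ^+ 2 <= (eta ^+ 2 / 8) ^+ 2.
  by rewrite -cabs2 ler_sqr ?nnegrE ?cabs_ge0// divr_ge0 ?sqr_ge0.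
have := ray_arith (a := cre (Y t)) (b := cim (Y t)) eta1 (divr_ge0 (sqr_ge0 eta) (ler0n R 8)) (lexx _) E2 erefl erefl.
move=> key; apply: le_trans key; rewrite le_eqVlt; apply/orP; left; apply/eqP.
have -> : (1 - t) * (Ad t - A t * Re t + 3 / 2 * A t / (1 - t)) = (1 - t) * Ad t - A t * ((1 - t) * Re t) + 3 / 2 * A t.
  by field; rewrite gt_eqF.
by rewrite /Ad ray_deriv RE YE; exact: ray_expand.
Qed.

Lemma cabs_rayY (zeta : C) (t : R) : cabs zeta = 1 -> t <= 1 ->
  cabs (rayY zeta t) = (1 - t) / 2 * cabs (u (RtoC t * zeta)).
Proof.
move=> z1 t1; rewrite /rayY cabsM (cabsM (RtoC _)) z1 mulr1 cabsR normrN ger0_norm//.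
by rewrite divr_ge0// subr_ge0.
Qed.

(** From [|1 + y|^2 <= 2 + 2 |y|^2] follows [|y|^2 <= 3 eta^2 + |y|^2 / 2]. *)
Lemma rayA_small (zeta : C) (eta t : R) : eta ^+ 2 <= 1 / 4 -> rayA zeta eta t < eta ^+ 2 ->
  cabs (rayY zeta t) ^+ 2 <= 6 * eta ^+ 2.
Proof.
rewrite /rayA; have := cabsD 1 (rayY zeta t); rewrite cabs1.
move: (cabs (1 + _)) (cabs_ge0 (1 + rayY zeta t)) (cabs _) (cabs_ge0 (rayY zeta t)).
move: (eta ^+ 2) (sqr_ge0 eta) => e2 e0 x x0 y y0 xy e1 h.
have h1 : x ^+ 2 <= (1 + y) ^+ 2 by rewrite ler_sqr ?nnegrE// addr_ge0.
have h2 : x ^+ 2 <= 2 + 2 * y ^+ 2 by have := sqr_ge0 (1 - y); move: h1; rewrite sqrrD sqrrB; lra.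
have h3 := ler_wpM2l e0 h2; have h4 := ler_wpM2r (sqr_ge0 y) e1.
by move: h h3 h4; move: (x ^+ 2) (y ^+ 2) => X Y; lra.
Qed.

Lemma small_u : small 1 u.
Proof.
(* The aim is [d |u| = 2 |y|], at most [2 sqrt(6) eta < 5 eta <= e]. *)
move=> e e0; pose eta := Num.min (1 / 2) (e / 5).
have h2 : 0 < 1 / 2 :> R by rewrite divr_gt0.
have eta0 : 0 < eta by rewrite lt_min h2 divr_gt0.
have eta2 : eta <= 1 / 2 by rewrite ge_min lexx.
have etae : 5 * eta <= e by have : eta <= e / 5 by [rewrite ge_min lexx orbT]; lra.
have eta1 : eta ^+ 2 <= 1 / 4.
  have -> : 1 / 4 = (1 / 2) ^+ 2 :> R by field.
  by rewrite ler_sqr ?nnegrE ?(ltW h2) ?(ltW eta0).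
have e20 : 0 < eta ^+ 2 by rewrite exprn_gt0.
have [r r1 HS] := sS (divr_gt0 e20 (ltr0n R 4)).
pose r0 := (1 + Num.max r 0) / 2.
have m1 : Num.max r 0 < 1 by rewrite gt_max r1 ltr01.
have m0 : 0 <= Num.max r 0 by rewrite le_max lexx orbT.
have mr : r <= Num.max r 0 by rewrite le_max lexx.
have r00 : 0 < r0 by rewrite /r0; lra.
have r01 : r0 < 1 by rewrite /r0; lra.
have rr0 : r < r0 by rewrite /r0; lra.
have z01 : cabs (0 : C) + r0 < 1 by rewrite cabs0 add0r.
have cu z : cabs (z - 0) < 1 -> cct u z.
  by rewrite subr0 => z1; apply: ct_der; exact: analytic_der.
have ck z : cabs (z - 0) < 1 -> cct (fun z => (k z)^-1) z.
  rewrite subr0 => z1; apply: ct_V; first exact: k0.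
  by apply: ct_der; exact: analytic_der.
have [B1 B10 HB1] := bounded_ball r00 r01 z01 cu.
have [B2 B20 HB2] := bounded_ball r00 r01 z01 ck.
(* A bound for [rayF] at the starting radius that holds in every direction, so the final radius does
   not depend on [zeta]. *)
pose G1 := B1 ^+ 2 * B2 * (1 - r0) `^ (- (3 / 2)).
have G10 : 0 <= G1 by rewrite mulr_ge0 ?powR_ge0// mulr_ge0 ?sqr_ge0// ltW.
have c01 : cabs (0 : C) < 1 by rewrite cabs0.
have d0 : disk (0 : C) := c01.
have Ck0 : 0 < Ck.
  by apply: lt_le_trans (kC d0); rewrite cabs0 subr0 mulr1 cabs_gt0 k0.
have CG : 0 < Ck * G1 + 1 by rewrite ltr_wpDl// mulr_ge0// ltW.
have [dd dd0 Hdd] := powR_small h2 (divr_gt0 e20 CG).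
exists (Num.max r0 (1 - dd)); first by rewrite gt_max r01; lra.
move=> z; rewrite gt_max => /andP[zr zd] z1.
set t := cabs z in zr zd z1 *.
have t0 : 0 < t by exact: lt_trans zr.
have tn : RtoC t != 0 by rewrite -cabs_eq0 cabsR normr_eq0 gt_eqF.
pose zeta := z / RtoC t.
have zeta1 : cabs zeta = 1 by rewrite /zeta cabsM cabsV cabsR gtr0_norm// divff// gt_eqF.
have tz : RtoC t * zeta = z by rewrite /zeta mulrC divfK.
have HS' w : r0 <= cabs w -> cabs w < 1 -> cabs (Sh u w) * (1 - cabs w) ^+ 2 <= eta ^+ 2 / 4.
  by move=> h; apply: HS; exact: lt_le_trans h.
have mono := ray_monotone zeta1 eta0 eta1 r00 zr z1 HS'.
have F0 : rayF zeta eta r0 <= G1.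
  have rz : cabs (RtoC r0 * zeta - 0) <= r0 by rewrite subr0 cabsM zeta1 cabsR mulr1 gtr0_norm.
  have b1 := HB1 _ rz; have b2 := HB2 _ rz; rewrite cabsV in b2.
  rewrite /rayF /G1; apply: ler_wpM2r; first exact: powR_ge0.
  have i0 : 0 <= (cabs (k (RtoC r0 * zeta)))^-1 by rewrite invr_ge0 cabs_ge0.
  have Y1 : cabs (rayY zeta r0) <= B1.
    rewrite cabs_rayY ?(ltW r01)//; apply: le_trans b1; rewrite -[leRHS]mul1r; apply: ler_wpM2r; first exact: cabs_ge0.
    by rewrite ler_pdivrMr// mul1r lerBlDr (le_trans (ler1n _ 2)) // lerDl ltW.
  have A1 : rayA zeta eta r0 <= B1 ^+ 2.
    apply: (@le_trans _ _ (cabs (rayY zeta r0) ^+ 2)).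
      by rewrite /rayA gerBl mulr_ge0 ?sqr_ge0.
    by rewrite ler_sqr ?nnegrE ?cabs_ge0 ?(ltW B10).
  apply: (@le_trans _ _ (B1 ^+ 2 * (cabs (k (RtoC r0 * zeta)))^-1)).
    by apply: ler_wpM2r.
  by apply: ler_wpM2l => //; exact: sqr_ge0.
have Ft := le_trans mono F0.
pose d := 1 - t; have dgt : 0 < d by rewrite subr_gt0.
(* Otherwise the bound on [k] makes [rayF] at [t] at least [eta^2 / (Ck d^(1/2))], beyond [G1] as
   soon as [d < dd]. *)
have At : rayA zeta eta t < eta ^+ 2.
  rewrite ltNge; apply/negP => Age.
  have kz : 0 < cabs (k z) by rewrite cabs_gt0 k0.
  have kd : d / Ck <= (cabs (k z))^-1.
    by rewrite ler_pdivrMr// mulrC ler_pdivlMr// mulrC; exact: kC.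
  have p0 := powR_gt0 (- (3 / 2)) dgt.
  have h3 : eta ^+ 2 * (d / Ck) * d `^ (- (3 / 2)) <= G1.
    apply: le_trans Ft; rewrite /rayF tz; apply: ler_wpM2r; first exact: ltW.
    apply: ler_pM => //; [exact: ltW|by rewrite divr_ge0// ltW].
  have E : d `^ (- (3 / 2)) = (d * d `^ (1 / 2))^-1.
    rewrite -{2}(powRr1 (ltW dgt)) -powRD; last by apply/implyP => _; rewrite gt_eqF.
    by rewrite -powRN; congr (_ `^ _); field.
  have q0 : 0 < d `^ (1 / 2) by exact: powR_gt0.
  have E2 : eta ^+ 2 * (d / Ck) * d `^ (- (3 / 2)) = eta ^+ 2 / (Ck * d `^ (1 / 2)).
    by rewrite E; field; rewrite !gt_eqF.
  move: h3; rewrite E2 ler_pdivrMr ?mulr_gt0// => h3.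
  have := Hdd d (ltW dgt) (_ : d < dd); rewrite ltrBlDr -ltrBlDl => /(_ zd); rewrite ltr_pdivlMr// => h4.
  have : G1 * (Ck * d `^ (1 / 2)) <= d `^ (1 / 2) * (Ck * G1 + 1).
    have -> : d `^ (1 / 2) * (Ck * G1 + 1) = G1 * (Ck * d `^ (1 / 2)) + d `^ (1 / 2).
      by move: (G1) => g; ring.
    by rewrite lerDl ltW.
  by move=> h5; have := le_lt_trans (le_trans h3 h5) h4; rewrite ltxx.
have Y2 := rayA_small eta1 At.
rewrite expr1 -/d.
have -> : cabs (u z) * d = 2 * cabs (rayY zeta t).
  by rewrite cabs_rayY ?(ltW z1)// tz -/d; field.
apply: le_trans etae; have e50 : 0 <= 5 * eta by rewrite mulr_ge0// ltW.
rewrite -ler_sqr ?nnegrE; [|exact: mulr_ge0 (ler0n _ 2) (cabs_ge0 _)|exact: e50].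
rewrite exprMn [leRHS]exprMn; apply: (le_trans (ler_wpM2l (sqr_ge0 2) Y2)).
by rewrite mulrA ler_wpM2r ?sqr_ge0// -!natrX -natrM ler_nat.
Qed.

End Ray.

(** * Absorption *)

Section Absorb.
Variable R : realType.
Local Notation C := (Cplx R).
Implicit Types (z : C).
Variable p : R.
Hypotheses (p0 : 0 < p) (p1 : p <= 1).

(** On a fixed compact disk [|1 - conj a z| >= 1 - r0], so the weight is at most the power [p] of
    [(1 - |a|^2) / (1 - r0)^2], whatever [m] is. *)
Lemma wgt_center (r0 e : R) : 0 <= r0 -> r0 < 1 -> 0 < e -> exists2 r : R, r < 1 &
  forall a m z, r < cabs a -> cabs a < 1 -> 0 < m -> m < 1 -> cabs z <= r0 -> wgt a m p z <= e.
Proof.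
move=> r00 r01 e0; have [d d0 Hd] := powR_small p0 e0.
have s0 : 0 < 1 - r0 by lra.
have ds : 0 < d * (1 - r0) ^+ 2 by rewrite mulr_gt0 ?exprn_gt0.
exists (1 - d * (1 - r0) ^+ 2 / 2); first by lra.
move=> a m z ra a1 m0 m1 zr; apply: ltW; apply: Hd; first exact: pos_ge0.
have A0 := cabs_ge0 a.
have aa : 0 <= 1 - cabs a ^+ 2 by rewrite subr_ge0 expr_le1// ltW.
have a2 : 1 - cabs a ^+ 2 < d * (1 - r0) ^+ 2.
  have := sqr_ge0 (1 - cabs a); rewrite sqrrB; lra.
have z1 : cabs z <= 1 by lra.
have t1 : 1 - r0 <= cabs (1 - cconj a * z).
  have := cabs_triangle 1 (cconj a * z); rewrite cabs1 cabsM cabsconj.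
  have : cabs a * cabs z <= cabs z by rewrite ler_piMl ?cabs_ge0// ltW.
  by lra.
have N1 : (1 - r0) ^+ 2 <= cabs (1 - cconj a * z) ^+ 2.
  by rewrite ler_sqr ?nnegrE ?cabs_ge0// ltW.
have N0 : 0 < cabs (1 - cconj a * z) ^+ 2 by apply: lt_le_trans N1; rewrite exprn_gt0.
have [h|h] := leP (wbase a m z) 0; first by rewrite pos_0.
rewrite pos_id ?(ltW h)// /wbase ltr_pdivrMr//.
have c1 : (1 - cabs a ^+ 2) * (m - cabs z ^+ 2) <= 1 - cabs a ^+ 2.
  by rewrite ler_piMr//; have := sqr_ge0 (cabs z); lra.
have c2 : d * (1 - r0) ^+ 2 <= d * cabs (1 - cconj a * z) ^+ 2 by rewrite ler_pM2l.
by lra.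
Qed.

Lemma small_bounded (F : C -> C) : (forall z, cabs z < 1 -> cct F z) -> small 1 F ->
  exists2 K : R, 0 < K & forall z, cabs z < 1 -> cabs (F z) * (1 - cabs z) <= K.
Proof.
move=> cF sF; have [r r1 H] := sF _ ltr01.
pose r0 := (1 + Num.max r 0) / 2.
have m1 : Num.max r 0 < 1 by rewrite gt_max r1 ltr01.
have m0 : 0 <= Num.max r 0 by rewrite le_max lexx orbT.
have mr : r <= Num.max r 0 by rewrite le_max lexx.
have r00 : 0 < r0 by rewrite /r0; lra.
have r01 : r0 < 1 by rewrite /r0; lra.
have z01 : cabs (0 : C) + r0 < 1 by rewrite cabs0 add0r.
have cu z : cabs (z - 0) < 1 -> cct F z by rewrite subr0; exact: cF.
have [B B0 HB] := bounded_ball r00 r01 z01 cu.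
exists (B + 1); first by lra.
move=> z z1; have [zr|zr] := leP (cabs z) r0.
  have h := HB z ltac:(rewrite subr0//).
  apply: (@le_trans _ _ (cabs (F z))); last by lra.
  by rewrite ler_piMr ?cabs_ge0//; have := cabs_ge0 z; lra.
have := H z ltac:(rewrite /r0 in zr; lra) z1; rewrite expr1; lra.
Qed.

(** After absorption [1/2 - 3/16 = 5/16] of [x1] is left, against [3/20 + 1/8] of [e]. *)
Lemma absorb_lin (x1 x2 x3 x4 e : R) : 0 < e ->
  1 / 2 * x1 + x2 <= x3 + 3 / 16 * x1 + 9 / 2 * x4 + 4 * (e / 32) ->
  x4 <= e / 30 -> x3 <= x2 -> x1 <= e.
Proof. by lra. Qed.

Lemma weight_bounds (m x : R) : m < 1 -> 0 <= x -> x <= 1 -> 0 <= m - x ->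
  [/\ m - x <= 1, -1 <= 2 * x - m, 2 * x - m <= 1 &
      (9 / 10) ^+ 2 <= x -> 1 / 2 <= 2 * x - m].
Proof. by move=> *; split; rewrite ?expr2; lra. Qed.

Lemma P_le m z : m < 1 -> cabs z < 1 -> m - cabs z ^+ 2 <= 2 * (1 - cabs z).
Proof. by move=> m1 z1; have := sqr_ge0 (1 - cabs z); rewrite sqrrB; lra. Qed.

Section Main.
Variables (u w : C -> C) (k : R).
Hypotheses (au : analytic_on_disk u) (aw : analytic_on_disk w).
Hypotheses (k1 : k < 1) (wk : forall z, cabs z < 1 -> cabs (w z) <= k).
Hypothesis HS : smallJ p (fun m z => cabs (Sfw u w z) ^+ 2 * (m - cabs z ^+ 2) ^+ 2).
Hypothesis HW : smallJ p (fun _ z => cabs (cder w z) ^+ 2).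
Hypothesis su : small 1 u.

Lemma sh_weight_arith (Sh2 S w1 w2 uu P L K1 K2 : R) :
  0 <= P -> 0 <= w1 -> 0 <= uu -> uu * P <= K1 -> w1 * P <= K2 ->
  Sh2 <= 4 * (S + (L * (w1 * uu)) ^+ 2 + (L * w2) ^+ 2 + (3 / 2 * (L * w1) ^+ 2) ^+ 2) ->
  Sh2 * P ^+ 2 <= 4 * (S * P ^+ 2) +
    (4 * L ^+ 2 * K1 ^+ 2 + 9 * L ^+ 4 * K2 ^+ 2) * w1 ^+ 2 + 4 * L ^+ 2 * (w2 ^+ 2 * P ^+ 2).
Proof.
move=> P0 w0 u0 h1 h2 h.
have q1 : (uu * P) ^+ 2 <= K1 ^+ 2.
  by rewrite ler_sqr ?nnegrE// ?mulr_ge0// (le_trans _ h1)// mulr_ge0.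
have q2 : (w1 * P) ^+ 2 <= K2 ^+ 2.
  by rewrite ler_sqr ?nnegrE// ?mulr_ge0// (le_trans _ h2)// mulr_ge0.
have h' := ler_wpM2r (sqr_ge0 P) h.
have t1 : 4 * L ^+ 2 * w1 ^+ 2 * (uu * P) ^+ 2 <= 4 * L ^+ 2 * w1 ^+ 2 * K1 ^+ 2.
  by apply: ler_wpM2l q1; exact: mulr_ge0 (mulr_ge0 (ler0n R 4) (sqr_ge0 L)) (sqr_ge0 w1).
have t2 : 9 * (L ^+ 2 * w1) ^+ 2 * (w1 * P) ^+ 2 <= 9 * (L ^+ 2 * w1) ^+ 2 * K2 ^+ 2.
  by apply: ler_wpM2l q2; exact: mulr_ge0 (ler0n R 9) (sqr_ge0 _).
apply: (le_trans h').
have -> : 4 * (S + (L * (w1 * uu)) ^+ 2 + (L * w2) ^+ 2 + (3 / 2 * (L * w1) ^+ 2) ^+ 2) * P ^+ 2 =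
  4 * (S * P ^+ 2) + 4 * L ^+ 2 * w1 ^+ 2 * (uu * P) ^+ 2 + 9 * (L ^+ 2 * w1) ^+ 2 * (w1 * P) ^+ 2
  + 4 * L ^+ 2 * (w2 ^+ 2 * P ^+ 2) by field.
have -> : (4 * L ^+ 2 * K1 ^+ 2 + 9 * L ^+ 4 * K2 ^+ 2) * w1 ^+ 2 =
  4 * L ^+ 2 * w1 ^+ 2 * K1 ^+ 2 + 9 * (L ^+ 2 * w1) ^+ 2 * K2 ^+ 2 by ring.
by lra.
Qed.

(** Multiplied by [P = m - |z|^2], both [u] and [w'] are bounded, so the mixed and the quartic term
    cost only the weighted norm of [w']; the term in [w''] is brought back to [w'] by
    [caccioppoli]. *)
Lemma smallJ_Sh : smallJ p (fun m z => cabs (Sh u z) ^+ 2 * (m - cabs z ^+ 2) ^+ 2).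
Proof.
have [aw' cw'] := analytic_cder aw; have [aw'' cw''] := analytic_cder aw'.
have cu z : cabs z < 1 -> cct u z by move=> z1; apply: ct_der; exact: analytic_der.
have s1 := smallJ_small p0 p1 aw' HW.
have [Ku Ku0 HKu] := small_bounded cu su; have [Kw Kw0 HKw] := small_bounded cw' s1.
pose L := Lk k; pose A : R := 4 * L ^+ 2 * (2 * Ku) ^+ 2 + 9 * L ^+ 4 * (2 * Kw) ^+ 2.
have A0 : 0 <= A.
  have L40 : 0 <= L ^+ 4 by rewrite (exprM L 2 2) sqr_ge0.
  have a1 := mulr_ge0 (mulr_ge0 (ler0n R 4) (sqr_ge0 L)) (sqr_ge0 (2 * Ku)).
  have a2 := mulr_ge0 (mulr_ge0 (ler0n R 9) L40) (sqr_ge0 (2 * Kw)).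
  exact: addr_ge0.
(* The total of the coefficients; 36 is 4 times the constant 9 of [caccioppoli]. *)
pose T := 4 + A + 36 * L ^+ 2; have T0 : 0 < T by have := sqr_ge0 L; rewrite /T; lra.
move=> e e0; have eT : 0 < e / T by rewrite divr_gt0.
have [r1 r11 H1] := HS eT; have [r2 r21 H2] := HW eT.
exists (Num.max r1 r2); first by rewrite gt_max r11.
move=> a m; rewrite gt_max => /andP[ar1 ar2] a1 m0 m1.
have g1 := H1 a m ar1 a1 m0 m1; have g2 := H2 a m ar2 a1 m0 m1.
have g3 := caccioppoli a1 m0 m1 p0 p1 aw'.
have cP z : rct (fun z : C => (m - cabs z ^+ 2) ^+ 2) z.
  by apply: rt_X; apply: rt_B; [exact: rt_cst|apply: rt_X; apply: ct_abs; exact: ct_id].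
have c1 := Kwgt_rcont p0 a1 m0 m1 (K := fun z => cabs (Sfw u w z) ^+ 2 * (m - cabs z ^+ 2) ^+ 2)
  (fun z hz => rt_M (rt_X 2 (ct_abs (Sfw_cct au aw k1 wk hz))) (cP z)).
have c2 := Kwgt_rcont p0 a1 m0 m1 (K := fun z => cabs (cder w z) ^+ 2)
  (fun z hz => rt_X 2 (ct_abs (cw' z hz))).
have c3 := Kwgt_rcont p0 a1 m0 m1 (K := fun z => cabs (cder (cder w) z) ^+ 2 * (m - cabs z ^+ 2) ^+ 2)
  (fun z hz => rt_M (rt_X 2 (ct_abs (cw'' z hz))) (cP z)).
have c4 := Kwgt_rcont p0 a1 m0 m1 (K := fun z => cabs (Sh u z) ^+ 2 * (m - cabs z ^+ 2) ^+ 2)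
  (fun z hz => rt_M (rt_X 2 (ct_abs (Sh_cct au hz))) (cP z)).
have d1 : rcont (fun z => 4 * (cabs (Sfw u w z) ^+ 2 * (m - cabs z ^+ 2) ^+ 2 * wgt a m p z)).
  by move=> z; apply: rt_M; [exact: rt_cst|exact: c1].
have d2 : rcont (fun z => A * (cabs (cder w z) ^+ 2 * wgt a m p z)).
  by move=> z; apply: rt_M; [exact: rt_cst|exact: c2].
have d3 : rcont (fun z => 4 * L ^+ 2 * (cabs (cder (cder w) z) ^+ 2 * (m - cabs z ^+ 2) ^+ 2 * wgt a m p z)).
  by move=> z; apply: rt_M; [exact: rt_cst|exact: c3].
have d12 : rcont (fun z => 4 * (cabs (Sfw u w z) ^+ 2 * (m - cabs z ^+ 2) ^+ 2 * wgt a m p z)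
   + A * (cabs (cder w z) ^+ 2 * wgt a m p z)) by move=> z; apply: rt_D; [exact: d1|exact: d2].
have d123 : rcont (fun z => 4 * (cabs (Sfw u w z) ^+ 2 * (m - cabs z ^+ 2) ^+ 2 * wgt a m p z)
   + A * (cabs (cder w z) ^+ 2 * wgt a m p z)
   + 4 * L ^+ 2 * (cabs (cder (cder w) z) ^+ 2 * (m - cabs z ^+ 2) ^+ 2 * wgt a m p z)).
  by move=> z; apply: rt_D; [exact: d12|exact: d3].
have lin4 (x1 x2 x3 y1 y2 y3 v : R) : (y1 * x1 + y2 * x2 + y3 * x3) * v =
    y1 * (x1 * v) + y2 * (x2 * v) + y3 * (x3 * v) by ring.
have zero4 (x1 x2 x3 x4 y1 y2 y3 : R) : x1 * 0 <= y1 * (x2 * 0) + y2 * (x3 * 0) + y3 * (x4 * 0).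
  by rewrite !mulr0 !addr0.
have pw z : cabs (Sh u z) ^+ 2 * (m - cabs z ^+ 2) ^+ 2 * wgt a m p z <=
   4 * (cabs (Sfw u w z) ^+ 2 * (m - cabs z ^+ 2) ^+ 2 * wgt a m p z)
   + A * (cabs (cder w z) ^+ 2 * wgt a m p z)
   + 4 * L ^+ 2 * (cabs (cder (cder w) z) ^+ 2 * (m - cabs z ^+ 2) ^+ 2 * wgt a m p z).
  have [zr|zr] := leP (cabs z) (Num.sqrt m); last first.
    by rewrite (wgt_out a1 m0 p0 zr); exact: zero4.
  have s1' : Num.sqrt m < 1 by rewrite -sqrtr1 ltr_sqrt.
  have z1 := le_lt_trans zr s1'.
  have P0 : 0 <= m - cabs z ^+ 2.
    by rewrite subr_ge0 -[leRHS](sqr_sqrtr (ltW m0)) ler_sqr ?nnegrE ?cabs_ge0 ?sqrtr_ge0.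
  have P2 := P_le m1 z1.
  have b1 : cabs (u z) * (m - cabs z ^+ 2) <= 2 * Ku.
    have := ler_wpM2l (cabs_ge0 (u z)) P2; have := HKu z z1; lra.
  have b2 : cabs (cder w z) * (m - cabs z ^+ 2) <= 2 * Kw.
    have := ler_wpM2l (cabs_ge0 (cder w z)) P2; have := HKw z z1; lra.
  have := sh_weight_arith P0 (cabs_ge0 (cder w z)) (cabs_ge0 (u z)) b1 b2 (Sh_le u k1 wk z1) => h.
  rewrite -lin4; exact: (ler_wpM2r (wgt_ge0 a m p z) h).
have := J_le c4 d123 pw; rewrite (J_D d12 d3) (J_D d1 d2) (J_Z _ c1) (J_Z _ c2) (J_Z _ c3) => h.
apply: (le_trans h).
have E3 : J (fun z => cabs (cder (cder w) z) ^+ 2 * (m - cabs z ^+ 2) ^+ 2 * wgt a m p z) <= 9 * (e / T).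
  have -> : J (fun z => cabs (cder (cder w) z) ^+ 2 * (m - cabs z ^+ 2) ^+ 2 * wgt a m p z) =
    J (fun z => cabs (cder (cder w) z) ^+ 2 * ((m - cabs z ^+ 2) ^+ 2 * wgt a m p z)).
    by apply: J_ext => z; exact: esym (mulrA _ _ _).
  by apply: (le_trans g3); apply: ler_wpM2l.
have L2 : 0 <= 4 * L ^+ 2 by rewrite mulr_ge0 ?sqr_ge0.
have k3 := ler_wpM2l L2 E3; have k2 := ler_wpM2l A0 g2; have k4 := ler_wpM2l (ler0n R 4) g1.
have -> : e = 4 * (e / T) + A * (e / T) + 4 * L ^+ 2 * (9 * (e / T)).
  have : e / T * T = e by rewrite divfK// gt_eqF.
  by rewrite {2}/T; move: (e / T) => x <-; ring.
by apply: lerD => //; apply: lerD.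
Qed.

(** Two regimes. In the centre, smallness of the weight turns everything into a constant error. Near
    the circle [V P <= 1/12], and [V U1 P <= V^2 / 24 + V^2 / 12 + 3 S^2 P^2]; multiplied by 3/2
    this gives 3/16 and 9/2. *)
Lemma absorb_arith (V W U1 S P q B kap : R) :
  0 <= V -> 0 <= W -> 0 <= U1 -> 0 <= S -> 0 <= P -> P <= 1 -> 0 <= B -> 0 <= kap -> -1 <= q -> q <= 1 ->
  U1 <= V ^+ 2 / 2 + S ->
  (W <= kap /\ V <= B) \/ (1 / 2 <= q /\ V * P <= 1 / 12) ->
  1 / 2 * (V ^+ 2 * W) + 3 / 2 * (V * U1 * (P * W)) <=
    V ^+ 2 * W * q + 3 / 16 * (V ^+ 2 * W) + 9 / 2 * (S ^+ 2 * P ^+ 2 * W) + (2 * B ^+ 2 + B ^+ 3) * kap.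
Proof.
move=> V0 W0 U10 S0 P0 P1 B0 k0 q1 q2 HU H.
have V20 := sqr_ge0 V; have VP0 := mulr_ge0 V0 P0.
have h1 : V * U1 * P <= V * P * V ^+ 2 / 2 + V * (S * P).
  have := ler_wpM2l VP0 HU; lra.
have h2 : V * (S * P) <= V ^+ 2 / 12 + 3 * (S * P) ^+ 2.
  by have := sqr_ge0 (V / 6 - (S * P)); rewrite sqrrB; lra.
have B2 : 0 <= 2 * B ^+ 2 + B ^+ 3 by rewrite addr_ge0 ?exprn_ge0// mulr_ge0 ?sqr_ge0.
have -> : V ^+ 2 * W * q + 3 / 16 * (V ^+ 2 * W) + 9 / 2 * (S ^+ 2 * P ^+ 2 * W) + (2 * B ^+ 2 + B ^+ 3) * kap =
  (V ^+ 2 * q + 3 / 16 * V ^+ 2 + 9 / 2 * (S * P) ^+ 2) * W + (2 * B ^+ 2 + B ^+ 3) * kap by ring.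
have -> : 1 / 2 * (V ^+ 2 * W) + 3 / 2 * (V * U1 * (P * W)) = (1 / 2 * V ^+ 2 + 3 / 2 * (V * U1 * P)) * W by ring.
case: H => [[Wk VB]|[q12 VP]].
  have V2B : V ^+ 2 <= B ^+ 2 by rewrite ler_sqr ?nnegrE.
  have h3 : V * P * V ^+ 2 <= B ^+ 3.
    rewrite exprS; apply: ler_pM => //.
    by apply: le_trans VB; rewrite ler_piMr.
  have h4 : 1 / 2 * V ^+ 2 + 3 / 2 * (V * U1 * P) <=
     V ^+ 2 * q + 3 / 16 * V ^+ 2 + 9 / 2 * (S * P) ^+ 2 + (2 * B ^+ 2 + B ^+ 3).
    have := ler_wpM2l V20 q1; have := exprn_ge0 3 B0; lra.
  have := ler_wpM2r W0 h4; rewrite (mulrDl _ (2 * B ^+ 2 + B ^+ 3)) => h5.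
  by have := ler_wpM2l B2 Wk; lra.
have h3 : V * P * V ^+ 2 <= 1 / 12 * V ^+ 2 by apply: ler_wpM2r.
have h4 : 1 / 2 * V ^+ 2 + 3 / 2 * (V * U1 * P) <= V ^+ 2 * q + 3 / 16 * V ^+ 2 + 9 / 2 * (S * P) ^+ 2.
  have := ler_wpM2l V20 q12; lra.
have := ler_wpM2r W0 h4; have := mulr_ge0 B2 k0; lra.
Qed.

(** The factor [2 |z|^2 - m] on the left of [hardy] is bounded below by 1/2 only near the circle. On
    the remaining compact disk it may be negative, but there the weight itself tends to 0 with
    [|a|]. *)
Lemma smallJ_u : smallJ p (fun _ z => cabs (u z) ^+ 2).
Proof.
have [au' cu'] := analytic_cder au.
have cu z : cabs z < 1 -> cct u z by move=> z1; apply: ct_der; exact: analytic_der.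
(* Since [m - |z|^2 <= 2 (1 - |z|)], the bound 1/24 for [|u| (1 - |z|)] becomes the 1/12 of
   [absorb_arith]. *)
move=> e e0; have e24 : 0 < 1 / 24 :> R by rewrite divr_gt0.
have [rs rs1 Hs] := su e24.
pose r0 := Num.max rs (9 / 10).
have r01 : r0 < 1 by rewrite gt_max rs1; lra.
have r09 : 9 / 10 <= r0 by rewrite le_max lexx orbT.
have rsr : rs <= r0 by rewrite le_max lexx.
have r00 : 0 < r0 by lra.
have z01 : cabs (0 : C) + r0 < 1 by rewrite cabs0 add0r.
have cu0 z : cabs (z - 0) < 1 -> cct u z by rewrite subr0; exact: cu.
have [B B0 HB] := bounded_ball r00 r01 z01 cu0.
pose D := 2 * B ^+ 2 + B ^+ 3.
have D0 : 0 < D by rewrite addr_gt0 ?exprn_gt0// mulr_gt0// exprn_gt0.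
(* The constant error is [D * kap = e / 32], and the box has area 4. *)
pose kap := e / (32 * D); have kap0 : 0 < kap by rewrite divr_gt0 ?mulr_gt0.
have [r1 r11 H1] := wgt_center (ltW r00) r01 kap0.
have e300 : 0 < e / 30 by rewrite divr_gt0.
have [r2 r21 H2] := smallJ_Sh e300.
exists (Num.max r1 r2); first by rewrite gt_max r11.
move=> a m; rewrite gt_max => /andP[ar1 ar2] a1 m0 m1.
have g1 := H2 a m ar2 a1 m0 m1.
have g2 := hardy a1 m0 m1 p0 p1 au.
have cz2 z : rct (fun z : C => cabs z ^+ 2) z by apply: rt_X; apply: ct_abs; exact: ct_id.
have cP z : rct (fun z : C => m - cabs z ^+ 2) z by apply: rt_B; [exact: rt_cst|exact: cz2].
have c1 := Kwgt_rcont p0 a1 m0 m1 (K := fun z => cabs (u z) ^+ 2) (fun z hz => rt_X 2 (ct_abs (cu z hz))).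
have c2 := Kwgt_rcont p0 a1 m0 m1 (K := fun z => cabs (Sh u z) ^+ 2 * (m - cabs z ^+ 2) ^+ 2)
  (fun z hz => rt_M (rt_X 2 (ct_abs (Sh_cct au hz))) (rt_X 2 (cP z))).
have c3 : rcont (fun z => cabs (u z) ^+ 2 * wgt a m p z * (2 * cabs z ^+ 2 - m)).
  move=> z; apply: rt_M; first exact: c1.
  by apply: rt_B; [apply: rt_M; [exact: rt_cst|exact: cz2]|exact: rt_cst].
have c4' := Kwgt_rcont p0 a1 m0 m1 (K := fun z => 3 / 2 * (cabs (u z) * cabs (cder u z) * (m - cabs z ^+ 2)))
  (fun z hz => rt_M (rt_cst _ z) (rt_M (rt_M (ct_abs (cu z hz)) (ct_abs (cu' z hz))) (cP z))).
have c4 : rcont (fun z => 3 / 2 * (cabs (u z) * cabs (cder u z) * ((m - cabs z ^+ 2) * wgt a m p z))).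
  by move=> z; apply: rt_ext (c4' z) => y; rewrite !mulrA.
have d1 : rcont (fun z => 1 / 2 * (cabs (u z) ^+ 2 * wgt a m p z)).
  by move=> z; apply: rt_M; [exact: rt_cst|exact: c1].
have d2 : rcont (fun z => 3 / 16 * (cabs (u z) ^+ 2 * wgt a m p z)).
  by move=> z; apply: rt_M; [exact: rt_cst|exact: c1].
have d3 : rcont (fun z => 9 / 2 * (cabs (Sh u z) ^+ 2 * (m - cabs z ^+ 2) ^+ 2 * wgt a m p z)).
  by move=> z; apply: rt_M; [exact: rt_cst|exact: c2].
have d4 : rcont (fun z : C => D * kap) by move=> z; exact: rt_cst.
have d14 : rcont (fun z => 1 / 2 * (cabs (u z) ^+ 2 * wgt a m p z) +
    3 / 2 * (cabs (u z) * cabs (cder u z) * ((m - cabs z ^+ 2) * wgt a m p z))).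
  by move=> z; apply: rt_D; [exact: d1|exact: c4].
have d32 : rcont (fun z => cabs (u z) ^+ 2 * wgt a m p z * (2 * cabs z ^+ 2 - m) +
    3 / 16 * (cabs (u z) ^+ 2 * wgt a m p z)) by move=> z; apply: rt_D; [exact: c3|exact: d2].
have d323 : rcont (fun z => cabs (u z) ^+ 2 * wgt a m p z * (2 * cabs z ^+ 2 - m) +
    3 / 16 * (cabs (u z) ^+ 2 * wgt a m p z) +
    9 / 2 * (cabs (Sh u z) ^+ 2 * (m - cabs z ^+ 2) ^+ 2 * wgt a m p z)).
  by move=> z; apply: rt_D; [exact: d32|exact: d3].
have d3234 : rcont (fun z => cabs (u z) ^+ 2 * wgt a m p z * (2 * cabs z ^+ 2 - m) +
    3 / 16 * (cabs (u z) ^+ 2 * wgt a m p z) +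
    9 / 2 * (cabs (Sh u z) ^+ 2 * (m - cabs z ^+ 2) ^+ 2 * wgt a m p z) + D * kap).
  by move=> z; apply: rt_D; [exact: d323|exact: d4].
have zero4 (x1 x2 x3 x4 x5 x6 x7 x8 y1 y2 y3 : R) : 0 <= y3 ->
    y1 * (x1 * 0) + y2 * (x2 * (x3 * 0)) <= x4 * 0 * x5 + x6 * (x1 * 0) + x7 * (x8 * 0) + y3.
  by move=> h; rewrite !(mulr0, mul0r, addr0, add0r).
have Dk : 0 <= D * kap by rewrite mulr_ge0 ?ltW.
have pw z : 1 / 2 * (cabs (u z) ^+ 2 * wgt a m p z) +
    3 / 2 * (cabs (u z) * cabs (cder u z) * ((m - cabs z ^+ 2) * wgt a m p z)) <=
    cabs (u z) ^+ 2 * wgt a m p z * (2 * cabs z ^+ 2 - m) +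
    3 / 16 * (cabs (u z) ^+ 2 * wgt a m p z) +
    9 / 2 * (cabs (Sh u z) ^+ 2 * (m - cabs z ^+ 2) ^+ 2 * wgt a m p z) + D * kap.
  have [zr|zr] := leP (cabs z) (Num.sqrt m); last first.
    by rewrite (wgt_out a1 m0 p0 zr); exact: zero4.
  have s1' : Num.sqrt m < 1 by rewrite -sqrtr1 ltr_sqrt.
  have z1 := le_lt_trans zr s1'.
  have Z0 := cabs_ge0 z.
  have P0 : 0 <= m - cabs z ^+ 2.
    by rewrite subr_ge0 -[leRHS](sqr_sqrtr (ltW m0)) ler_sqr ?nnegrE ?cabs_ge0 ?sqrtr_ge0.
  have P2 := P_le m1 z1; have Z2 := sqr_ge0 (cabs z).
  have z21 : cabs z ^+ 2 <= 1 by rewrite expr_le1// ltW.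
  have [P1 q1 q2 q3] := weight_bounds m1 Z2 z21 P0.
  have U : cabs (cder u z) <= cabs (u z) ^+ 2 / 2 + cabs (Sh u z).
    have -> : cder u z = u z ^+ 2 * RtoC 2^-1 + Sh u z by rewrite RtoCV RtoC_nat /Sh addrC subrK.
    apply: (le_trans (cabsD _ _)); rewrite (cabsM (u z ^+ 2)) cabsX cabsR ger0_norm// invr_ge0//.
  have H : (wgt a m p z <= kap /\ cabs (u z) <= B) \/ (1 / 2 <= 2 * cabs z ^+ 2 - m /\ cabs (u z) * (m - cabs z ^+ 2) <= 1 / 12).
    have [zr0|zr0] := leP (cabs z) r0; [left|right].
      by split; [exact: H1|apply: HB; rewrite subr0].
    split.
      by apply: q3; rewrite ler_sqr ?nnegrE//; exact: le_trans r09 (ltW zr0).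
    have := Hs z (le_lt_trans rsr zr0) z1; rewrite expr1 => h.
    apply: (le_trans (ler_wpM2l (cabs_ge0 (u z)) P2)); rewrite mulrCA.
    have -> : 1 / 12 = 2 * (1 / 24) :> R by field.
    exact: ler_wpM2l.
  exact: (absorb_arith (cabs_ge0 (u z)) (wgt_ge0 a m p z) (cabs_ge0 (cder u z)) (cabs_ge0 (Sh u z)) P0 P1 (ltW B0) (ltW kap0) q1 q2 U H).
have := J_le d14 d3234 pw; rewrite (J_D d1 c4) (J_D d323 d4) (J_D d32 d3) (J_D c3 d2).
rewrite (J_Z _ c1) (J_Z _ c1) (J_Z _ c2) J_cst => h.
have Dk4 : D * kap = e / 32 by rewrite /kap; field; rewrite gt_eqF.
move: h g1 g2; rewrite Dk4.
exact: absorb_lin e0.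
Qed.

(** The factor 2 stands for [|F_z| + |F_zbar|], two equal terms because [F] is real. *)
Lemma smallJ_uw : smallJ p (fun _ z => (2 * cabs (u z - Aw w z * cder w z)) ^+ 2).
Proof.
have [aw' cw'] := analytic_cder aw.
have cu z : cabs z < 1 -> cct u z by move=> z1; apply: ct_der; exact: analytic_der.
pose L := Lk k; have L0 := sqr_ge0 L.
pose T := 8 + 8 * L ^+ 2; have T0 : 0 < T by rewrite /T; lra.
move=> e e0; have eT : 0 < e / T by rewrite divr_gt0.
have [r1 r11 H1] := smallJ_u eT; have [r2 r21 H2] := HW eT.
exists (Num.max r1 r2); first by rewrite gt_max r11.
move=> a m; rewrite gt_max => /andP[ar1 ar2] a1 m0 m1.
have g1 := H1 a m ar1 a1 m0 m1; have g2 := H2 a m ar2 a1 m0 m1.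
have c1 := Kwgt_rcont p0 a1 m0 m1 (K := fun z => cabs (u z) ^+ 2) (fun z hz => rt_X 2 (ct_abs (cu z hz))).
have c2 := Kwgt_rcont p0 a1 m0 m1 (K := fun z => cabs (cder w z) ^+ 2)
  (fun z hz => rt_X 2 (ct_abs (cw' z hz))).
have c3 := Kwgt_rcont p0 a1 m0 m1 (K := fun z => (2 * cabs (u z - Aw w z * cder w z)) ^+ 2)
  (fun z hz => rt_X 2 (rt_M (rt_cst _ z) (ct_abs (ct_B (cu z hz) (ct_M (Aw_cct aw k1 wk hz) (cw' z hz)))))).
have d1 : rcont (fun z => 8 * (cabs (u z) ^+ 2 * wgt a m p z)).
  by move=> z; apply: rt_M; [exact: rt_cst|exact: c1].
have d2 : rcont (fun z => 8 * L ^+ 2 * (cabs (cder w z) ^+ 2 * wgt a m p z)).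
  by move=> z; apply: rt_M; [exact: rt_cst|exact: c2].
have d12 : rcont (fun z => 8 * (cabs (u z) ^+ 2 * wgt a m p z) + 8 * L ^+ 2 * (cabs (cder w z) ^+ 2 * wgt a m p z)).
  by move=> z; apply: rt_D; [exact: d1|exact: d2].
have pw z : (2 * cabs (u z - Aw w z * cder w z)) ^+ 2 * wgt a m p z <=
   8 * (cabs (u z) ^+ 2 * wgt a m p z) + 8 * L ^+ 2 * (cabs (cder w z) ^+ 2 * wgt a m p z).
  have W0 := wgt_ge0 a m p z.
  have [zr|zr] := leP (cabs z) (Num.sqrt m); last first.
    have z2 (x1 x2 x3 y : R) : x1 * 0 <= 8 * (x2 * 0) + y * (x3 * 0) by rewrite !mulr0 addr0.
    by rewrite (wgt_out a1 m0 p0 zr); exact: z2.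
  have s1' : Num.sqrt m < 1 by rewrite -sqrtr1 ltr_sqrt.
  have z1 := le_lt_trans zr s1'.
  have t1 : cabs (u z - Aw w z * cder w z) <= cabs (u z) + L * cabs (cder w z).
    apply: (le_trans (cabsB _ _)); rewrite lerD2l (cabsM (Aw w z)).
    exact: (ler_wpM2r (cabs_ge0 _) (Aw_le k1 wk z1)).
  have ar (x y v W : R) : 0 <= W -> 0 <= x -> x <= y + L * v ->
      (2 * x) ^+ 2 * W <= 8 * (y ^+ 2 * W) + 8 * L ^+ 2 * (v ^+ 2 * W).
    move=> W0' x0 xy; have : x ^+ 2 <= (y + L * v) ^+ 2 by rewrite ler_sqr ?nnegrE// (le_trans x0).
    have := sqr_ge0 (y - L * v); rewrite sqrrB sqrrD => q1 q2.
    have q3 : (2 * x) ^+ 2 <= 8 * y ^+ 2 + 8 * L ^+ 2 * v ^+ 2 by rewrite exprMn; lra.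
    by have := ler_wpM2r W0' q3; lra.
  exact: ar W0 (cabs_ge0 _) t1.
have := J_le c3 d12 pw; rewrite (J_D d1 d2) (J_Z _ c1) (J_Z _ c2) => h.
apply: (le_trans h).
have L2 : 0 <= 8 * L ^+ 2 by rewrite mulr_ge0.
have k2 := ler_wpM2l L2 g2; have k4 := ler_wpM2l (ler0n R 8) g1.
have -> : e = 8 * (e / T) + 8 * L ^+ 2 * (e / T).
  have : e / T * T = e by rewrite divfK// gt_eqF.
  by rewrite {2}/T; move: (e / T) => x <-; ring.
exact: lerD.
Qed.

End Main.
End Absorb.

(** * Smoothness *)

Section Smooth.
Variable R : realType.
Local Notation C := (Cplx R).
Implicit Types (z : C) (q v : R * R) (f g : R * R -> R).

Lemma is_derive_slice f q v l :
  is_derive q v f l <-> is_derive (0 : R) (1 : R) (fun t : R => f (t *: v + q)) l.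
Proof.
have E : (fun h : R => h^-1 *: ((f \o shift q) (h *: v) - f q)) =
  (fun h : R => h^-1 *: (((fun t : R => f (t *: v + q)) \o shift 0) (h *: (1 : R)) - f ((0 : R) *: v + q))).
  apply/funext => h /=; rewrite scale0r add0r.
  by congr (_ *: (f (_ *: v + q) - _)); rewrite addr0 /GRing.scale/= mulr1.
split=> -[h1 h2]; split.
- by rewrite /derivable -E.
- by rewrite -h2 /derive -E.
- by rewrite /derivable E.
- by rewrite -h2 /derive E.
Qed.

Lemma derive_slice f q v l :
  is_derive (0 : R) (1 : R) (fun t : R => f (t *: v + q)) l -> 'D_v f q = l.
Proof. by move=> /is_derive_slice [_ <-]. Qed.

Lemma wirt_val G z a b : wirt G z a b -> Wz G z = a /\ Wzb G z = b.
Proof.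
move=> [[H1 H2] [H3 H4]].
have sh (f : R -> R) (x l : R) : is_derive x 1 f l -> is_derive (0 : R) 1 (fun t => f (t + x)) l.
  move=> fx; have := @rder_comp R f (fun t => t + x) 0 l 1; rewrite add0r mulr1; apply => //.
  apply: (rder_ext (rderD (rder_id 0) (rder_cst x 0))) => //; exact: addr0.
have sx (t : R) : t *: ((1 : R), (0 : R)) + ofC z = (t + cre z, cim z).
  by transitivity (t * 1 + cre z, t * 0 + cim z); rewrite // mulr1 mulr0 add0r.
have sy (t : R) : t *: ((0 : R), (1 : R)) + ofC z = (cre z, t + cim z).
  by transitivity (t * 0 + cre z, t * 1 + cim z); rewrite // mulr1 mulr0 add0r.
have dxE : dx G z = a + b.
  rewrite /dx; apply: cplx_eq => /=; apply: derive_slice.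
    by apply: rder_ext (sh _ _ _ H1) _ _ => // t; rewrite sx.
  by apply: rder_ext (sh _ _ _ H2) _ _ => // t; rewrite sx.
have dyE : dy G z = iC R * (a - b).
  rewrite /dy; apply: cplx_eq => /=; apply: derive_slice.
    by apply: rder_ext (sh _ _ _ H3) _ _ => // t; rewrite sy.
  by apply: rder_ext (sh _ _ _ H4) _ _ => // t; rewrite sy.
rewrite /Wz /Wzb dxE dyE mulrA iC2; split; by field.
Qed.

(** Subtracting the expected linear part reduces differentiability to this case; the same form
    compares functions that agree only on the disk. *)
Lemma differentiable_null f q :
  (forall e : R, 0 < e -> exists2 d : R, 0 < d & forall h : R * R, `|h| < d ->
     `|f (h + q) - f q| <= e * `|h|) -> differentiable f q.
Proof.
move=> H.
have E : f \o shift q = cst (f q) + (\0 : R * R -> R) +o_ (0 : R * R) id.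
  apply/eqaddoP => e e0; have [d d0 Hd] := H e e0.
  apply/nbhs_ballP; exists d => //= h; rewrite -ball_normE /= sub0r normrN => hd.
  have -> : (f \o shift q - (cst (f q) + \0)) h = f (h + q) - f q.
    by transitivity (f (h + q) - (f q + 0)); rewrite // addr0.
  exact: Hd.
have c0 : continuous (\0 : R * R -> R) by move=> x; exact: cst_continuous.
have dE := diff_unique (df := \0) c0 E.
by apply/diff_locallyP; rewrite dE.
Qed.

Lemma differentiable_lin (a b : R) q : differentiable (fun x : R * R => a * x.1 + b * x.2) q.
Proof.
have d1 : differentiable (fst : R * R -> R) q by apply: linear_differentiable; move=> x; exact: cvg_fst.
have d2 : differentiable (snd : R * R -> R) q by apply: linear_differentiable; move=> x; exact: cvg_snd.
exact: (differentiableD (differentiableM (differentiable_cst a q) d1) (differentiableM (differentiable_cst b q) d2)).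
Qed.

Lemma differentiable_holo_re F z l : der_at F z l -> differentiable (reF F) (ofC z).
Proof.
move=> HF; pose L (x : R * R) := cre l * x.1 + (- cim l) * x.2.
have -> : reF F = (reF F - L) + L by apply/funext => x; rewrite /GRing.add/= /GRing.opp/= subrK.
apply: differentiableD; last exact: differentiable_lin.
apply: differentiable_null => e e0.
have [d d0 H] := HF (e / 2) (divr_gt0 e0 (ltr0n R 2)).
exists (d / 2); first by rewrite divr_gt0.
move=> h hd; have hn : cabs (toC h) <= 2 * `|h|.
  apply: (le_trans (cabs_le _)); rewrite /= mulr2n mulrDl !mul1r.
  by apply: lerD; rewrite /Num.norm/= le_max lexx ?orbT.
have := H (toC h + z) _; rewrite addrK => /(_ _) hh.
have h1 : cabs (toC h) < d by lra.
have h2 := hh h1.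
have -> : (reF F - L) (h + ofC z) - (reF F - L) (ofC z) = cre (F (toC h + z) - F z - l * toC h).
  have -> : toC h + z = toC (h + ofC z) by apply: cplx_eq; rewrite !cE.
  transitivity (cre (F (toC (h + ofC z))) - (cre l * (h.1 + cre z) + - cim l * (h.2 + cim z)) -
    (cre (F (toC (ofC z))) - (cre l * cre z + - cim l * cim z))); first by [].
  rewrite toCK !creD !creN creM /=; ring.
apply: (le_trans (cre_le _)); apply: (le_trans h2).
by have := ler_wpM2l (ltW e0) hn; lra.
Qed.

Lemma disk2_nbhs q : disk2 q -> exists2 d : R, 0 < d & forall h : R * R, `|h| < d -> disk2 (h + q).
Proof.
move=> /disk_open [r r0 H]; exists (r / 2); first by rewrite divr_gt0.
move=> h hd; apply: H.
have -> : toC (h + q) - toC q = toC h :> C by apply: cplx_eq; rewrite !cE /=; ring.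
have hn : cabs (toC h : C) <= 2 * `|h|.
  apply: (le_trans (cabs_le _)); rewrite /= mulr2n mulrDl !mul1r.
  by apply: lerD; rewrite /Num.norm/= le_max lexx ?orbT.
by lra.
Qed.

Lemma disk2_near q : disk2 q -> \forall x \near q, disk2 x.
Proof.
move=> /disk2_nbhs [d d0 H]; apply/nbhs_ballP; exists d => //= x; rewrite -ball_normE /= => h.
by rewrite -(subrK q x); apply: H; rewrite distrC.
Qed.

(** Differentiability of order [n + 1] on the disk. Each directional derivative need only coincide
    there with some [g], so a formula valid on the disk suffices, and closure under the operations
    follows by induction on [n]. *)
Fixpoint Sn n f : Prop := (forall q, disk2 q -> differentiable f q) /\
  match n with
  | 0 => True
  | n'.+1 => forall v, exists2 g, Sn n' g & forall q, disk2 q -> 'D_v f q = g q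
  end.

Lemma Sn_diff n f q : Sn n f -> disk2 q -> differentiable f q.
Proof. by case: n => [|n] [h _]; exact: h. Qed.

Lemma Sn_le n f : Sn n.+1 f -> Sn n f.
Proof.
elim: n f => [|n IH] f [h1 h2]; split => //= v.
by have [g /IH Hg Eg] := h2 v; exists g.
Qed.

Lemma differentiable_agree f g q : (forall x, disk2 x -> f x = g x) -> disk2 q ->
  differentiable f q -> differentiable g q.
Proof.
move=> fg dq df; have -> : g = (g - f) + f by apply/funext => x; exact: esym (subrK _ _).
apply: differentiableD => //; apply: differentiable_null => e e0.
have [d d0 H] := disk2_nbhs dq; exists d => // h /H hd.
have -> : (g - f) (h + q) - (g - f) q = (g (h + q) - f (h + q)) - (g q - f q) by [].
by rewrite !fg// !subrr normr0 mulr_ge0// ltW.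
Qed.

Lemma derive_agree f g q v : (forall x, disk2 x -> f x = g x) -> disk2 q -> 'D_v f q = 'D_v g q.
Proof.
move=> fg /disk2_near dq; apply: near_eq_derive; near=> x.
by apply: fg; near: x.
Unshelve. all: by end_near. Qed.

Lemma Sn_agree n f g : (forall q, disk2 q -> f q = g q) -> Sn n f -> Sn n g.
Proof.
move=> fg; case: n => [|n] [h1 h2]; split => //.
- by move=> q dq; apply: (differentiable_agree fg) => //; exact: h1.
- by move=> q dq; apply: (differentiable_agree fg) => //; exact: h1.
move=> v; have [k Hk Ek] := h2 v; exists k => // q dq.
by rewrite -Ek//; apply: esym; exact: derive_agree.
Qed.

Lemma Sn_iter (vs : seq (R * R)) n f : (size vs <= n)%N -> Sn n f ->
  forall q, disk2 q -> differentiable (Defs.iterD vs f) q.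
Proof.
(* [iterD] applies the last direction of the list first, while [Sn] peels off the derivative taken
   first. *)
elim/last_ind: vs n f => [|vs v IH] n f; first by move=> _ Hf q; exact: Sn_diff Hf.
rewrite size_rcons; case: n => // n sn [_ /(_ v) [g Hg Eg]] q dq.
have -> : Defs.iterD (rcons vs v) f = Defs.iterD vs ('D_v f) by elim: vs {IH sn} => //= x vs ->.
by apply: (IH n) => //; apply: (Sn_agree (f := g)) => // x dx; rewrite Eg.
Qed.

Lemma Sn_smooth f : (forall n, Sn n f) -> smooth2_on (@disk2 R) f.
Proof. by move=> H vs q; exact: (Sn_iter (leqnn (size vs)) (H _)). Qed.

Lemma derive_is f q v : differentiable f q ->
  is_derive (0 : R) (1 : R) (fun t : R => f (t *: v + q)) ('D_v f q).
Proof. by move=> df; apply/is_derive_slice; split => //; exact: diff_derivable. Qed.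

Lemma Sn_cst n (c : R) : Sn n (fun=> c).
Proof.
elim: n c => [|n IH] c; split => // v; exists (fun=> 0) => // q _.
by apply: derive_slice; exact: rder_cst.
Qed.

Lemma Sn_D n f g : Sn n f -> Sn n g -> Sn n (fun q => f q + g q).
Proof.
elim: n f g => [|n IH] f g Hf Hg; (split; first by move=> q dq;
  exact: (differentiableD (Sn_diff Hf dq) (Sn_diff Hg dq))) => // v.
case: (Hf) => _ /(_ v) [f' Hf' Ef]; case: (Hg) => _ /(_ v) [g' Hg' Eg].
exists (fun q => f' q + g' q); first exact: IH.
move=> q dq; apply: derive_slice; rewrite -Ef// -Eg//.
exact: rderD (derive_is v (Sn_diff Hf dq)) (derive_is v (Sn_diff Hg dq)).
Qed.

Lemma Sn_M n f g : Sn n f -> Sn n g -> Sn n (fun q => f q * g q).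
Proof.
elim: n f g => [|n IH] f g Hf Hg; (split; first by move=> q dq;
  exact: (differentiableM (Sn_diff Hf dq) (Sn_diff Hg dq))) => // v.
case: (Hf) => _ /(_ v) [f' Hf' Ef]; case: (Hg) => _ /(_ v) [g' Hg' Eg].
exists (fun q => f' q * g q + f q * g' q).
  by apply: Sn_D; apply: IH => //; exact: Sn_le.
move=> q dq; apply: derive_slice; rewrite -Ef// -Eg//.
apply: (rder_ext (rderM (derive_is v (Sn_diff Hf dq)) (derive_is v (Sn_diff Hg dq)))) => //.
by rewrite scale0r add0r.
Qed.

Lemma Sn_N n f : Sn n f -> Sn n (fun q => - f q).
Proof.
move=> Hf; apply: (Sn_agree (f := fun q => -1 * f q)); first by move=> q _; rewrite mulN1r.
by apply: Sn_M => //; exact: Sn_cst.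
Qed.

(** The outer derivative is asked for one order less. This closes the induction for the reciprocal,
    whose derivative is a polynomial in the reciprocal, and then settles [ln]. *)
Lemma Sn_comp n f (phi dphi : R -> R) : (forall q, disk2 q -> is_derive (f q) (1 : R) phi (dphi (f q))) ->
  Sn n.+1 f -> Sn n (fun q => dphi (f q)) -> Sn n.+1 (fun q => phi (f q)).
Proof.
move=> dp Hf Hd; split.
  move=> q dq; apply: (@differentiable_comp _ _ _ _ f phi); first exact: Sn_diff Hf dq.
  by apply/derivable1_diffP; case: (dp q dq).
move=> v; case: (Hf) => _ /(_ v) [f' Hf' Ef].
exists (fun q => dphi (f q) * f' q); first exact: Sn_M.
move=> q dq; apply: derive_slice; rewrite -Ef//.
have := @rder_comp R phi (fun t => f (t *: v + q)) 0 (dphi (f q)) ('D_v f q).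
by rewrite scale0r add0r => H; apply: H; [exact: dp|exact: derive_is (Sn_diff Hf dq)].
Qed.

Lemma Sn_V n f : (forall q, disk2 q -> f q != 0) -> Sn n f -> Sn n (fun q => (f q)^-1).
Proof.
move=> f0; elim: n => [|n IH] Hf.
  split => // q dq; apply: (@differentiable_comp _ _ _ _ f (fun x => x^-1)).
    exact: Sn_diff Hf dq.
  by apply/derivable1_diffP; case: (rderV (f0 q dq) (rder_id (f q))).
apply: (Sn_comp (dphi := fun x => - (x^-1 * x^-1))) => //.
  move=> q dq; apply: (rder_ext (rderV (f0 q dq) (rder_id (f q)))) => //.
  by rewrite expr2 invfM mulN1r.
by apply: Sn_N; apply: Sn_M; apply: IH; exact: Sn_le.
Qed.

Lemma Sn_ln n f : (forall q, disk2 q -> 0 < f q) -> (forall k, Sn k f) -> Sn n (fun q => ln (f q)).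
Proof.
move=> f0 Hf; suff : Sn n.+1 (fun q => ln (f q)) by exact: Sn_le.
apply: (Sn_comp (dphi := fun x => x^-1)) => //; first by move=> q dq; apply: is_derive1_ln; exact: f0.
by apply: Sn_V => // q dq; rewrite gt_eqF// f0.
Qed.

End Smooth.

(** * The Schwarzian of a harmonic mapping *)

Section LogJ.
Variable R : realType.
Local Notation C := (Cplx R).
Implicit Types (z : C) (F : C -> C).

(** The derivative of [Re F] in the direction [v] is [Re (F' v)], again the real part of an analytic
    function. *)
Lemma Sn_re n F : analytic_on_disk F -> Sn n (reF F).
Proof.
elim: n F => [|n IH] F aF; (split; first by move=> q dq; rewrite -(ofCK q);
  apply: differentiable_holo_re; exact: analytic_der) => // v.
have [aF' _] := analytic_cder aF.
exists (reF (fun z => cder F z * toC v)); first exact: (IH _ (an_M aF' (@an_cst R (toC v)))).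
move=> q dq; apply: derive_slice.
have dc : cder1 (fun t : R => toC (t *: v + q) : C) 0 (toC v).
  have := cder1D (cder1M (cder1R (rder_id (0 : R))) (cder1_cst (toC v) 0)) (cder1_cst (toC q) 0) => H.
  apply: (cder1_ext H) => [t|]; last by rewrite mulr0 !addr0 RtoC1 mul1r.
  apply: cplx_eq; [transitivity (t * v.1 + q.1)|transitivity (t * v.2 + q.2)] => //.
    by rewrite !cE /=; ring.
  by rewrite !cE /=; ring.
have dF : der_at F (toC ((0 : R) *: v + q)) (cder F (toC q)).
  by rewrite scale0r add0r; exact: analytic_der.
exact: cder1_re (cder1_comp dF dc).
Qed.

Lemma Sn_im n F : analytic_on_disk F -> Sn n (imF F).
Proof.
move=> aF; apply: (Sn_agree (f := reF (fun z => - iC R * F z))).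
  by move=> q _; rewrite /reF /imF !cE; ring.
exact: (Sn_re n (an_M (@an_cst R (- iC R)) aF)).
Qed.

Lemma Sn_abs2 n F : analytic_on_disk F -> Sn n (fun q => cabs (F (toC q)) ^+ 2).
Proof.
move=> aF; apply: (Sn_agree (f := fun q => reF F q * reF F q + imF F q * imF F q)).
  by move=> q _; rewrite cabs2 -!expr2.
by apply: Sn_D; apply: Sn_M; [exact: Sn_re|exact: Sn_re|exact: Sn_im|exact: Sn_im].
Qed.

Lemma sub_mulcconj (x y : C) : x * cconj x - y * cconj y = RtoC (cabs x ^+ 2 - cabs y ^+ 2).
Proof. by rewrite !mulcconj RtoCD RtoCN. Qed.
Lemma zeroR2 (x1 x2 y1 y2 : C) : x1 + x2 * 0 - (y1 + y2 * 0) = x1 - y1.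
Proof. by rewrite !mulr0 !addr0. Qed.
Lemma zeroL2 (x1 x2 y1 y2 : C) : 0 * x1 + x2 - (0 * y1 + y2) = x2 - y2.
Proof. by rewrite !mul0r !add0r. Qed.
Lemma logJ_alg (x x' y y' g' : C) (jinv : C) : x != 0 -> cconj x != 0 -> 1 - y * cconj y != 0 ->
  jinv = (x * cconj x * (1 - y * cconj y))^-1 -> g' = y' * x + y * x' ->
  jinv * (x' * cconj x - g' * cconj (y * x)) = x' / x - cconj y / (1 - y * cconj y) * y'.
Proof.
move=> h1 h2 h3 -> ->; rewrite cconjM.
by move: (cconj x) (cconj y) h2 h3 => xc yc h2 h3; field; rewrite h1 h2 h3.
Qed.

Lemma schwarzian_alg (x1 x2 x3 x4 x5 : C) :
  x2 - (x3 ^+ 2 * x4 * x4 + x3 * x5) - (x1 - x3 * x4) ^+ 2 / 2 =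
  x2 - x1 ^+ 2 / 2 + x3 * (x4 * x1 - x5) - 3 / 2 * (x3 * x4) ^+ 2.
Proof. by field. Qed.

Lemma cconj_pair (x y s t : C) : y * cconj x - t * cconj s = cconj (x * cconj y - s * cconj t).
Proof. by rewrite cconjD cconjN !cconjM !cconjK !(mulrC (cconj _)). Qed.

Variables (h g : C -> C).
Hypotheses (ah : analytic_on_disk h) (ag : analytic_on_disk g).
Hypothesis h0 : forall z, disk z -> cder h z != 0.
Hypothesis J0 : forall z, disk z -> 0 < jac h g z.

Lemma logJ_smooth : smooth_on_disk (logJ h g).
Proof.
have [ah' _] := analytic_cder ah; have [ag' _] := analytic_cder ag.
split; apply: Sn_smooth => n; last exact: Sn_cst.
apply: (@Sn_ln R n (fun q => jac h g (toC q))) => [q dq|k]; first exact: J0.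
by apply: Sn_D; [|apply: Sn_N]; exact: Sn_abs2.
Qed.

Let k := cder h.
Let w z := cder g z / cder h z.
Definition preschw (h : C -> C) z : C := cder (cder h) z / cder h z.
Let u := preschw h.

Lemma an_w : analytic_on_disk w.
Proof.
have [ah' _] := analytic_cder ah; have [ag' _] := analytic_cder ag.
exact: (an_M ag' (an_V h0 ah')).
Qed.
Lemma an_u : analytic_on_disk u.
Proof.
have [ah' _] := analytic_cder ah; have [ah'' _] := analytic_cder ah'.
exact: (an_M ah'' (an_V h0 ah')).
Qed.

Lemma sqr_ratio (x y : R) : x != 0 -> x ^+ 2 - y ^+ 2 = x ^+ 2 * (1 - (y / x) ^+ 2).
Proof. by move=> x0; field. Qed.

Lemma jacE z : disk z -> jac h g z = cabs (k z) ^+ 2 * (1 - cabs (w z) ^+ 2).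
Proof.
move=> dz; have kn : cabs (k z) != 0 by rewrite cabs_eq0 h0.
rewrite /jac /w (cabsM (cder g z)) cabsV -/(k z).
exact: sqr_ratio.
Qed.

Lemma den_gt0 z : disk z -> 0 < 1 - cabs (w z) ^+ 2.
Proof.
move=> dz; have := J0 dz; rewrite jacE// pmulr_rgt0//.
by rewrite exprn_gt0// cabs_gt0 h0.
Qed.

Lemma cder_g z : disk z -> cder (cder g) z = cder w z * k z + w z * cder k z.
Proof.
move=> dz; have [ah' _] := analytic_cder ah; have [ag' _] := analytic_cder ag.
have [r r0 Hr] := disk_open dz.
apply: (der_at_wirt_uniq (analytic_der ag' dz) (b := 0 * k z + w z * 0)).
apply: (wirt_local r0 _ (wirtM (wirt_holo (analytic_der an_w dz)) (wirt_holo (analytic_der ah' dz)))).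
by move=> x /Hr dx; rewrite /w /k divfK// h0.
Qed.

Lemma wirt_logJ z : disk z -> wirt (logJ h g) z (u z - Aw w z * cder w z)
  (cconj (u z - Aw w z * cder w z)).
Proof.
move=> dz; have [ah' _] := analytic_cder ah; have [ag' _] := analytic_cder ag.
have wk := wirt_holo (analytic_der ah' dz); have wg := wirt_holo (analytic_der ag' dz).
have wj : wirt (fun z => RtoC (jac h g z)) z
   (cder k z * cconj (k z) - cder (cder g) z * cconj (cder g z))
   (k z * cconj (cder k z) - cder g z * cconj (cder (cder g) z)).
  have c0 : cconj (0 : C) = 0 by rewrite -RtoC0 cconjR.
  have := wirtB (wirtM wk (wirt_conj wk)) (wirtM wg (wirt_conj wg)); rewrite c0 => H.
  apply: (wirt_ext H) => [x||].
  - exact: sub_mulcconj.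
  - exact: zeroR2.
  - exact: zeroL2.
have := wirt_real (is_derive1_ln (J0 dz)) wj => H.
have kn : k z != 0 by exact: h0.
have kcn : cconj (k z) != 0 by rewrite -cabs_eq0 cabsconj cabs_eq0.
have dn : 1 - w z * cconj (w z) != 0.
  by rewrite Aw_den -cabs_eq0 cabsR normr_eq0 gt_eqF// den_gt0.
have gE : cder g z = w z * k z by rewrite /w /k divfK// h0.
have jE : RtoC (jac h g z)^-1 = (k z * cconj (k z) * (1 - w z * cconj (w z)))^-1.
  by rewrite RtoCV jacE// RtoCM -mulcconj Aw_den.
have E1 : RtoC (jac h g z)^-1 * (cder k z * cconj (k z) - cder (cder g) z * cconj (cder g z)) =
   u z - Aw w z * cder w z.
  by rewrite gE; apply: logJ_alg => //; exact: cder_g.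
apply: (wirt_eq H E1); rewrite -E1 cconjM cconjR; congr (_ * _).
exact: cconj_pair.
Qed.

Lemma Wz_logJ z : disk z -> Wz (logJ h g) z = u z - Aw w z * cder w z.
Proof. by move=> /wirt_logJ /wirt_val []. Qed.

Lemma cabs_Wzb_logJ z : disk z -> cabs (Wzb (logJ h g) z) = cabs (Wz (logJ h g) z).
Proof. by move=> /wirt_logJ /wirt_val [-> ->]; rewrite cabsconj. Qed.

Lemma schwarzianE z : disk z -> schwarzian h g z = Sfw u w z.
Proof.
move=> dz; have [r r0 Hr] := disk_open dz.
have [aw' _] := analytic_cder an_w.
have du := wirt_holo (analytic_der an_u dz); have dw := wirt_holo (analytic_der an_w dz).
have dw' := wirt_holo (analytic_der aw' dz).
have dn : 1 - w z * cconj (w z) != 0.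
  by rewrite Aw_den -cabs_eq0 cabsR normr_eq0 gt_eqF// den_gt0.
(* The factor [conj w] has no [z]-derivative; differentiating the denominator alone gives
   [Aw^2 w']. *)
have dA : wirt (Aw w) z (Aw w z ^+ 2 * cder w z)
   (cconj (cder w z) / (1 - w z * cconj (w z)) + cconj (w z) * (w z * cconj (cder w z) / (1 - w z * cconj (w z)) ^+ 2)).
  have c0 : cconj (0 : C) = 0 by rewrite -RtoC0 cconjR.
  have := wirtM (wirt_conj dw) (wirtV (G := fun x => 1 - w x * cconj (w x)) dn (wirtB (wirt_cst 1 z) (wirtM dw (wirt_conj dw)))); rewrite c0 => H.
  apply: (wirt_eq H); rewrite /Aw; move: (w z) (cconj (w z)) (cder w z) (cconj (cder w z)) dn => x1 x2 x3 x4 dn; by field.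
have H := wirtB du (wirtM dA dw').
have E : wirt (Wz (logJ h g)) z
   (cder u z - (Aw w z ^+ 2 * cder w z * cder w z + Aw w z * cder (cder w) z))
   (0 - ((cconj (cder w z) / (1 - w z * cconj (w z)) + cconj (w z) * (w z * cconj (cder w z) / (1 - w z * cconj (w z)) ^+ 2)) * cder w z + Aw w z * 0)).
  by apply: (wirt_local r0 _ H) => x /Hr dx; rewrite Wz_logJ.
have [E1 _] := wirt_val E.
by rewrite /schwarzian E1 Wz_logJ//; exact: schwarzian_alg.
Qed.

End LogJ.

(** * Growth of h' *)

Section DerivBound.
Variable R : realType.
Local Notation C := (Cplx R).
Implicit Types (z : C).

(** Composition with the radial retraction [z / max(1, |z|)] extends [Phi] continuously to the
    plane, where the bound on the box applies. *)
Lemma bounded_cdisk (Phi : C -> C) : {within @cdisk R, continuous Phi} ->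
  exists2 M : R, 0 <= M & forall z, cabs z <= 1 -> cabs (Phi z) <= M.
Proof.
move=> /subspace_continuousP cP.
pose clamp z : C := RtoC (1 + pos (cabs z - 1))^-1 * z.
have p1 z : 0 < 1 + pos (cabs z - 1) by rewrite ltr_pwDl// pos_ge0.
have clamp_in z : cdisk (clamp z).
  rewrite /cdisk/= cabsM cabsR ger0_norm ?invr_ge0 ?(ltW (p1 z))// ler_pdivrMl// mulr1.
  by have := pos_ge (cabs z - 1); lra.
have clampE z : cabs z <= 1 -> clamp z = z.
  by move=> z1; rewrite /clamp pos_0 ?subr_le0// addr0 invr1 RtoC1 mul1r.
have cclamp z : cct clamp z.
  apply: ct_M; last exact: ct_id.
  apply: ct_RtoC; apply: rt_V; first by rewrite gt_eqF.
  apply: rt_D; first exact: rt_cst.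
  apply: (rt_comp (f := @pos R)); last exact: pos_cont.
  by apply: rt_B; [apply: ct_abs; exact: ct_id|exact: rt_cst].
have ck : rcont (fun z => cabs (Phi (clamp z))).
  move=> z; apply: ct_abs; apply/cctE => e e0.
  have : nbhs (Phi (clamp z)) [set x | cabs (x - Phi (clamp z)) < e].
    by apply/nbhsCP; exists e.
  move=> /(cP (clamp z) (clamp_in z)) /nbhsCP [d d0 Hd].
  have /cctE /(_ d d0) [d' d'0 Hd'] := cclamp z.
  by exists d' => // x /Hd' /Hd; apply; exact: clamp_in.
have [M HM] := bounded_box ck.
exists `|M| => // z z1.
have bz := in_box z1.
by have := HM _ bz; rewrite toCK clampE// ger0_norm ?cabs_ge0// => h; apply: (le_trans h); exact: ler_norm.
Qed.

Lemma cabs_perturb (x y lam : C) (k : R) : cabs lam = 1 -> cabs y <= k * cabs x ->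
  (1 - k) * cabs x <= cabs (x + lam * y).
Proof.
move=> lam1 yx; have := cabs_triangle x (- (lam * y)).
by rewrite opprK cabsN cabsM lam1 mul1r; lra.
Qed.

Lemma deriv_arith (x d k M : R) : 0 < d -> 0 < 1 - k -> (1 - k) * x <= 96 * M / (d / 3) ->
  x * d <= 288 * M / (1 - k).
Proof.
move=> d0 k0 h; rewrite ler_pdivlMr//.
have := ler_wpM2r (ltW d0) h; have -> : 96 * M / (d / 3) * d = 288 * M by field; rewrite gt_eqF.
by lra.
Qed.

Lemma cder_bound (h g Phi : C -> C) (lam : C) (k : R) :
  analytic_on_disk h -> analytic_on_disk g -> cabs lam = 1 -> k < 1 ->
  (forall z, disk z -> cder h z != 0) ->
  (forall z, disk z -> cabs (cder g z / cder h z) <= k) ->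
  {within @cdisk R, continuous Phi} ->
  (forall z, disk z -> Phi z = h z + lam * g z) ->
  exists K : R, forall z, disk z -> cabs (cder h z) * (1 - cabs z) <= K.
Proof.
move=> ah ag lam1 k1 h0 wk cPhi PhiE.
have [M M0 HM] := bounded_cdisk cPhi.
pose f z := h z + lam * g z.
have af : analytic_on_disk f by exact: (an_D ah (an_M (@an_cst R lam) ag)).
have dfE z : disk z -> cder f z = cder h z + lam * cder g z.
  move=> dz; apply: (der_at_wirt_uniq (analytic_der af dz)).
  have := wirtD (wirt_holo (analytic_der ah dz)) (wirtM (wirt_cst lam z) (wirt_holo (analytic_der ag dz))).
  by rewrite mul0r add0r; exact.
(* Cauchy's estimate on radius [d / 3], so [96 * 3], divided by the loss [1 - k] in passing from
   [h' + lambda g'] to [h']. *)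
exists (288 * M / (1 - k)) => z dz; have z1 : cabs z < 1 := dz.
set d := 1 - cabs z; have d0 : 0 < d by rewrite subr_gt0.
have d3 : 0 < d / 3 by rewrite divr_gt0.
have dd : cabs z + 2 * (d / 3) < 1 by rewrite /d; lra.
have B w : cabs (w - z) <= d / 3 -> cabs (f w) <= M.
  move=> wz; have := cabs_triangle w z => t1.
  have dw : disk w by rewrite /disk/=; rewrite /d in wz; lra.
  by rewrite /f -PhiE// HM// ltW.
have := cauchy_estimate af d3 dd B; rewrite dfE// => e1.
have e2 : cabs (cder g z) <= k * cabs (cder h z).
  rewrite -ler_pdivrMr ?cabs_gt0 ?h0// -cabsV -cabsM; exact: wk.
have e3 : (1 - k) * cabs (cder h z) <= cabs (cder h z + lam * cder g z).
  exact: (cabs_perturb lam1 e2).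
have e4 := le_trans e3 e1.
have k10 : 0 < 1 - k by rewrite subr_gt0.
exact: (deriv_arith d0 k10 e4).
Qed.

End DerivBound.

(** * Measure densities and integrals over the disk *)

Section Density.
Local Open Scope ereal_scope.
Context d (T : measurableType d) (R : realType).
Import HBNNSimple.

Lemma integral_simple_density (mu : {measure set T -> \bar R}) (D : set T) (g : T -> \bar R)
    (s : {nnsfun T >-> R}) :
  measurable D -> (forall x, 0 <= g x) -> measurable_fun setT g ->
  \int[mu]_(x in D) ((s x)%:E * g x) =
  \sum_(r \in range s) (r%:E * \int[mu]_(x in (s @^-1` [set r]) `&` D) g x).
Proof.
move=> mD g0 mg; pose A r := s @^-1` [set r].
have mA r : measurable (A r) by exact: measurable_sfunP.
have mi r : measurable_fun D (fun x => (\1_(A r) x)%:E * g x).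
  apply: emeasurable_funM; last exact: measurable_funTS.
  by apply/measurable_EFinP; apply: measurable_funTS; exact: measurable_indic.
have i0 r x : 0 <= (\1_(A r) x)%:E * g x by rewrite mule_ge0// lee_fin.
transitivity (\int[mu]_(x in D) \sum_(r \in range s) (r%:E * ((\1_(A r) x)%:E * g x))).
  apply: eq_integral => x _.
  rewrite {1}fimfunE -fsumEFin// ge0_mule_fsuml => [|r]; last exact: nnfun_muleindic_ge0.
  by apply: eq_fsbigr => r _; rewrite EFinM muleA.
rewrite ge0_integral_fsum//.
- apply: eq_fsbigr => r; rewrite inE => -[t _ <-].
  rewrite ge0_integralZl//; last by rewrite lee_fin.
  congr (_ * _); rewrite [RHS]integral_mkcondl; apply: eq_integral => x _.
  by rewrite epatch_indic muleC.
- by move=> r; apply: emeasurable_funM => //; exact: measurable_cst.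
move=> r x Dx; have [rs|rs] := pselect (range s r).
  by case: rs => t _ <-; rewrite mule_ge0// lee_fin.
have -> : \1_(A r) x = 0%R :> R.
  by rewrite indicE memNset// => /= xr; apply: rs; exists x.
by rewrite mul0e mule0.
Qed.

(** For simple functions both sides agree. Monotone convergence is used on the left, while on the
    right each approximant is simply below [f]; this inequality is the direction in which the
    Carleson hypothesis is applied. *)
Lemma integral_density_le (mu nu : {measure set T -> \bar R}) (D : set T) (g f : T -> \bar R) :
  measurable D -> (forall x, 0 <= g x) -> (forall x, g x \is a fin_num) -> measurable_fun setT g ->
  (forall A, measurable A -> nu A = \int[mu]_(x in A) g x) ->
  (forall x, 0 <= f x) -> measurable_fun D f ->
  \int[mu]_(x in D) (f x * g x) <= \int[nu]_(x in D) f x.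
Proof.
move=> mD g0 gf mg nuE f0 mf.
pose s := nnsfun_approx mD mf.
have smono m n x : (m <= n)%N -> (s m x)%:E <= (s n x)%:E.
  by move=> mn; rewrite lee_fin; have /lefP := @nd_nnsfun_approx _ _ _ _ mD _ mf _ _ mn; exact.
have ms n : measurable_fun D (fun x => (s n x)%:E).
  by apply/measurable_EFinP; exact: measurable_funTS.
have sg n : \int[mu]_(x in D) ((s n x)%:E * g x) = \int[nu]_(x in D) (s n x)%:E.
  rewrite integral_simple_density//.
  have := @integral_simple_density nu D (cst 1) (s n) mD (fun=> lee01) (measurable_cst _).
  under eq_integral do rewrite mule1.
  move=> ->; apply: eq_fsbigr => r _; congr (_ * _).
  have mAD : measurable ((s n @^-1` [set r]) `&` D) by apply: measurableI => //; exact: measurable_sfunP.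
  by rewrite integral_cst// mul1e nuE.
have -> : \int[mu]_(x in D) (f x * g x) = limn (fun n => \int[mu]_(x in D) ((s n x)%:E * g x)).
  rewrite -monotone_convergence//.
  - apply: eq_integral => x; rewrite inE => Dx; apply/esym/cvg_lim => //.
    by apply: cvgeZr => //; exact: cvg_nnsfun_approx.
  - by move=> n; apply: emeasurable_funM => //; exact: measurable_funTS.
  - by move=> n x Dx; rewrite mule_ge0// lee_fin.
  - move=> x Dx m n mn; rewrite lee_wpmul2r//; exact: smono.
apply: lime_le.
  apply: ereal_nondecreasing_is_cvgn => m n mn; apply: ge0_le_integral => //.
  - by move=> x Dx; rewrite mule_ge0// lee_fin.
  - by apply: emeasurable_funM => //; exact: measurable_funTS.
  - by apply: emeasurable_funM => //; exact: measurable_funTS.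
  - move=> x Dx; rewrite lee_wpmul2r//; exact: smono.
apply: nearW => n; rewrite sg; apply: ge0_le_integral => //.
- by move=> x _; rewrite lee_fin.
- move=> x Dx; have cs : (s k x)%:E @[k --> \oo] --> f x by exact: cvg_nnsfun_approx.
  rewrite -(cvg_lim _ cs)//; apply: lime_ge; first by apply/cvg_ex; exists (f x).
  by exists n => // k /= nk; exact: smono.
Qed.

End Density.

(** * Integrals over the disk and the passage to [m = 1] *)

Section DiskInt.
Variable R : realType.
Local Notation C := (Cplx R).
Implicit Types (z : C).

Lemma disk2_open : open (@disk2 R : set (R * R)).
Proof. by rewrite openE => q; exact: disk2_near. Qed.
Lemma measurable_disk2 : measurable (@disk2 R : set (plane R)).
Proof. exact: open_measurable_plane disk2_open. Qed.

Lemma measurable_disk2_fun (K : C -> R) : (forall z, cabs z < 1 -> rct K z) ->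
  measurable_fun (@disk2 R : set (plane R)) (fun q : plane R => (K (toC q))%:E).
Proof.
move=> cK; apply/measurable_EFinP; apply: measurable_fun_plane; first exact: disk2_open.
move=> q dq; apply: continuous_comp; [exact: toC_continuous|exact: rctP (cK _ dq)].
Qed.

Lemma disk_int_le (k1 k2 : C -> R) : (forall z, cabs z < 1 -> rct k1 z) ->
  (forall z, cabs z < 1 -> rct k2 z) -> (forall z, cabs z < 1 -> 0 <= k1 z) ->
  (forall z, cabs z < 1 -> k1 z <= k2 z) -> (disk_int k1 <= disk_int k2)%E.
Proof.
move=> c1 c2 k0 k12; apply: ge0_le_integral; first exact: measurable_disk2.
- by move=> q dq; rewrite lee_fin k0.
- exact: measurable_disk2_fun.
- exact: measurable_disk2_fun.
- by move=> q dq; rewrite lee_fin k12.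
Qed.

Lemma disk_int_J (k : C -> R) : rcont k -> (forall z, 1 <= cabs z -> k z = 0) ->
  disk_int k = (J k)%:E.
Proof.
move=> ck k0; rewrite /J /Rintegral fineK; last first.
  by apply: integrable_fin_num; [exact: measurable_box|exact: integrable_box].
rewrite /disk_int (@integral_mkcond _ (plane R) R (@area R) (@disk2 R)) (@integral_mkcond _ (plane R) R (@area R) (@box R)); apply: eq_integral => q _.
rewrite !patchE; case: ifPn => [|nd].
  rewrite inE => dq; rewrite ifT// inE.
  have : box (ofC (toC q : C)) by apply: in_box; exact: ltW.
  by rewrite ofCK.
case: ifP => // _; rewrite k0// leNgt; apply/negP => h; move/negP: nd; apply.
by rewrite inE.
Qed.

Lemma one_sub_sqr_ge0 z : cabs z < 1 -> 0 <= 1 - cabs z ^+ 2.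
Proof. by move=> z1; rewrite subr_ge0 expr_le1 ?cabs_ge0// ltW. Qed.

Variables (a : C) (p : R).
Hypotheses (a1 : cabs a < 1) (p0 : 0 < p).

Lemma phi_abs z : cabs z < 1 -> 1 - cabs (phi a z) ^+ 2 = wbase a 1 z.
Proof.
move=> z1; have t0 : cabs (1 - cconj a * z) != 0 by rewrite cabs_eq0 t_neq0// ltW.
have id : cabs (1 - cconj a * z) ^+ 2 - cabs (a - z) ^+ 2 = (1 - cabs a ^+ 2) * (1 - cabs z ^+ 2).
  by rewrite !cabs2 !cE; ring.
rewrite /phi /wbase cabsM cabsV exprMn exprVn -id.
by move: (cabs (1 - cconj a * z)) (cabs (a - z)) t0 => x y x0; field.
Qed.

Lemma wbase1_ge0 z : cabs z < 1 -> 0 <= wbase a 1 z.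
Proof.
by move=> z1; rewrite divr_ge0 ?sqr_ge0// mulr_ge0// one_sub_sqr_ge0.
Qed.

Lemma wbase_le z (m m' : R) : m <= m' -> wbase a m z <= wbase a m' z.
Proof.
move=> mm; rewrite /wbase; apply: ler_wpM2r; first by rewrite invr_ge0 sqr_ge0.
apply: ler_wpM2l; last by rewrite lerD2r.
exact: one_sub_sqr_ge0.
Qed.

Lemma pos_mono (x y : R) : x <= y -> pos x <= pos y.
Proof. by move=> xy; apply: pos_le; [exact: pos_ge0|exact: le_trans (pos_ge y)]. Qed.

Lemma wgt_le z (m m' : R) : m <= m' -> wgt a m p z <= wgt a m' p z.
Proof.
move=> mm; apply: ge0_ler_powR; rewrite ?nnegrE ?pos_ge0// ?(ltW p0)//.
by apply: pos_mono; exact: wbase_le.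
Qed.

Lemma wgt1E z : cabs z < 1 -> wgt a 1 p z = (1 - cabs (phi a z) ^+ 2) `^ p.
Proof. by move=> z1; rewrite /wgt pos_id ?wbase1_ge0// phi_abs. Qed.

Lemma wgt1_rct z : cabs z < 1 -> rct (wgt a 1 p) z.
Proof. by move=> z1; exact: pospow_rct. Qed.

Lemma J_le_disk_int (K : C -> R) (m : R) : 0 < m -> m < 1 -> (forall z, cabs z < 1 -> rct K z) ->
  (forall z, 0 <= K z) ->
  ((J (fun z => (K z * wgt a m p z)%R))%:E <= disk_int (fun z => (K z * wgt a 1 p z)%R))%E.
Proof.
move=> m0 m1 cK K0; have s1 : Num.sqrt m < 1 by rewrite -sqrtr1 ltr_sqrt.
have c1 := Kwgt_rcont p0 a1 m0 m1 cK.
have kz z : 1 <= cabs z -> K z * wgt a m p z = 0.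
  by move=> z1; rewrite (wgt_out a1 m0 p0 (lt_le_trans s1 z1)) mulr0.
rewrite -(disk_int_J c1 kz).
apply: disk_int_le => [z _|z z1|z z1|z z1]; first exact: c1.
- by apply: rt_M; [exact: cK|exact: wgt1_rct].
- by rewrite mulr_ge0// wgt_ge0.
- by apply: ler_wpM2l => //; apply: wgt_le; exact: ltW.
Qed.

(** The weight increases with [m], so monotone convergence carries a bound uniform in [m] over to
    the true weight. *)
Lemma disk_int_le_lim (K : C -> R) (e : R) : (forall z, cabs z < 1 -> rct K z) ->
  (forall z, 0 <= K z) ->
  (forall m, 0 < m -> m < 1 -> J (fun z => K z * wgt a m p z) <= e) ->
  (disk_int (fun z => (K z * wgt a 1 p z)%R) <= e%:E)%E.
Proof.
(* [harmonic 0] is 1; the factor 1/2 keeps the first value of [m] positive. *)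
move=> cK K0 HJ; pose mm n : R := 1 - 2^-1 * harmonic n.
have h0 n : 0 < harmonic n :> R by rewrite /harmonic invr_gt0.
have h1 n : harmonic n <= 1 :> R by rewrite /harmonic invf_le1// ler1n.
have mm0 n : 0 < mm n by rewrite /mm; have := h1 n; lra.
have mm1 n : mm n < 1 by rewrite /mm; have := h0 n; lra.
have mmle n k : (n <= k)%N -> mm n <= mm k.
  move=> nk; have : harmonic k <= harmonic n :> R by rewrite /harmonic lef_pV2 ?posrE// ler_nat.
  by rewrite /mm; lra.
have mmc : mm n @[n --> \oo] --> (1 : R).
  have c2 : (2^-1 * harmonic n : R) @[n --> \oo] --> (2^-1 * 0 : R).
    exact: (cvgM (cvg_cst _) (@cvg_harmonic R)).
  have -> : (1 : R) = 1 - 2^-1 * 0 by rewrite mulr0 subr0.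
  exact: (cvgB (cvg_cst _) c2).
have s1 n : Num.sqrt (mm n) < 1 by rewrite -sqrtr1 ltr_sqrt.
have cn n := Kwgt_rcont p0 a1 (mm0 n) (mm1 n) cK.
pose g n (q : plane R) := (K (toC q) * wgt a (mm n) p (toC q))%:E.
have gE n : (\int[@area R]_(q in @disk2 R) g n q = (J (fun z => (K z * wgt a (mm n) p z)%R))%:E)%E.
  have kz z : 1 <= cabs z -> K z * wgt a (mm n) p z = 0.
    by move=> z1; rewrite (wgt_out a1 (mm0 n) p0 (lt_le_trans (s1 n) z1)) mulr0.
  exact: (disk_int_J (cn n) kz).
have cw q : disk2 q -> g n q @[n --> \oo] --> (K (toC q) * wgt a 1 p (toC q))%:E.
  move=> dq; apply: cvg_EFin; first by near=> n.
  apply: cvgMr; rewrite /wgt.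
  have cp : continuous (fun m : R => pos (wbase a m (toC q)) `^ p).
    move=> m; apply: (@continuous_comp _ _ _ (fun m => wbase a m (toC q)) (fun x => pos x `^ p)).
      apply: cvgMl; apply: cvgMr; apply: cvgB; [exact: cvg_id|exact: cvg_cst].
    exact: pospow_cont.
  exact: (cvg_comp _ _ mmc (cp 1)).
have -> : disk_int (fun z => K z * wgt a 1 p z) = (\int[@area R]_(q in @disk2 R) limn (g^~ q))%E.
  apply: eq_integral => q; rewrite inE => dq; apply/esym/cvg_lim => //; exact: cw.
rewrite monotone_convergence.
- apply: lime_le.
    apply: ereal_nondecreasing_is_cvgn => n k nk; rewrite !gE lee_fin; apply: J_le => //.
    by move=> z; apply: ler_wpM2l => //; apply: wgt_le; exact: mmle.
  by apply: nearW => n; rewrite gE lee_fin HJ.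
- exact: measurable_disk2.
- by move=> n; apply: (measurable_disk2_fun (K := fun z => K z * wgt a (mm n) p z)) => z _; exact: cn.
- by move=> n q dq; rewrite lee_fin mulr_ge0// wgt_ge0.
- by move=> q dq n k nk; rewrite lee_fin; apply: ler_wpM2l => //; apply: wgt_le; exact: mmle.
Unshelve. all: by end_near. Qed.

Lemma cder_phi z : cabs z < 1 -> cabs (cder (phi a) z) = (1 - cabs a ^+ 2) / cabs (1 - cconj a * z) ^+ 2.
Proof.
move=> z1; have dz : disk z := z1.
have t0 w : disk w -> 1 - cconj a * w != 0 by move=> dw; apply: t_neq0 => //; exact: ltW.
have aid : analytic_on_disk (fun z : C => z) by move=> w _; exact: derivable_id.
have ap : analytic_on_disk (phi a).
  exact: (an_M (an_B (@an_cst R a) aid) (an_V t0 (an_B (@an_cst R 1) (an_M (@an_cst R (cconj a)) aid)))).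
have wt := wirtB (wirt_cst 1 z) (wirtM (wirt_cst (cconj a) z) (wirt_id z)).
have H := wirtM (wirtB (wirt_cst a z) (wirt_id z)) (wirtV (G := fun w => 1 - cconj a * w) (t0 z dz) wt).
have -> : cder (phi a) z = - RtoC (1 - cabs a ^+ 2) / (1 - cconj a * z) ^+ 2.
  rewrite (der_at_wirt_uniq (analytic_der ap dz) H) RtoCD RtoCN -mulcconj RtoC1.
  by move: (cconj a) (t0 z dz) => b h; field.
by rewrite cabsM cabsN cabsV cabsX cabsR ger0_norm// one_sub_sqr_ge0.
Qed.

End DiskInt.

(** * The theorem *)

Section Final.
Variable R : realType.
Local Notation C := (Cplx R).
Implicit Types (z : C).

Lemma disk_int_ext (k1 k2 : C -> R) : (forall z, cabs z < 1 -> k1 z = k2 z) ->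
  disk_int k1 = disk_int k2.
Proof. by move=> E; apply: eq_integral => q; rewrite inE => dq; rewrite E. Qed.

Lemma Qp0_smallJ (p : R) (w : C -> C) : 0 < p -> Qp0 p w ->
  smallJ p (fun _ z => cabs (cder w z) ^+ 2).
Proof.
move=> p0 [aw Hw] e e0; have [_ cw] := analytic_cder aw.
have [r [r1 Hr]] := Hw e e0; exists r => // a m ra a1 m0 m1.
have := J_le_disk_int a1 p0 m0 m1 (fun z hz => rt_X 2 (ct_abs (cw z hz))) (fun z => sqr_ge0 _).
move=> h; rewrite -lee_fin; apply: (le_trans h); apply/ltW; apply: le_lt_trans (Hr a ra a1).
by rewrite le_eqVlt; apply/orP; left; apply/eqP; apply: disk_int_ext => z z1; rewrite wgt1E.
Qed.

(** Pointwise identity: [(1 - |z|^2)^(2+p) |phi_a'|^p = (1 - |z|^2)^2 (1 - |phi_a|^2)^p], since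
    [|phi_a'| = (1 - |a|^2) / |1 - conj a z|^2]. *)
Lemma carleson_ge (p : R) (S : C -> C) (mu : {measure set (plane R) -> \bar R}) (a : C) :
  0 < p -> (forall z, cabs z < 1 -> cct S z) ->
  (forall A : set (plane R), measurable A ->
     mu A = (\int[@area R]_(q in A `&` @disk2 R)
               (cabs (S (toC q)) ^+ 2 * (1 - cabs (toC q : C) ^+ 2) `^ (2 + p))%:E)%E) ->
  cabs a < 1 ->
  (disk_int (fun z => (cabs (S z) ^+ 2 * (1 - cabs z ^+ 2) ^+ 2 * wgt a 1 p z)%R) <= carleson_int mu p a)%E.
Proof.
move=> p0 cS muE a1.
pose D := @disk2 R : set (plane R).
have mD : measurable D by exact: measurable_disk2.
(* The positive part and the restriction to the disk make the density nonnegative, finite and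
   measurable on the whole plane. *)
pose dens z : R := cabs (S z) ^+ 2 * pos (1 - cabs z ^+ 2) `^ (2 + p).
pose g : plane R -> \bar R := (fun q => (dens (toC q))%:E) \_ D.
have c1 z : rct (fun z : C => 1 - cabs z ^+ 2) z.
  by apply: rt_B; [exact: rt_cst|apply: rt_X; apply: ct_abs; exact: ct_id].
have cd z : cabs z < 1 -> rct dens z.
  move=> z1; apply: rt_M; first by apply: rt_X; apply: ct_abs; exact: cS.
  apply: (rt_comp (f := fun x => pos x `^ (2 + p))); first exact: c1.
  by apply: pospow_cont; rewrite addr_gt0.
have d0 z : 0 <= dens z by rewrite mulr_ge0 ?sqr_ge0 ?powR_ge0.
have mg : measurable_fun [set: plane R] g.
  exact: (measurable_restrictT _ mD).1 (measurable_disk2_fun cd).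
have g0 q : (0 <= g q)%E by apply: erestrict_ge0 => x _; rewrite lee_fin.
have gf q : g q \is a fin_num by rewrite /g patchE; case: ifP.
have nuE A : measurable A -> mu A = (\int[@area R]_(q in A) g q)%E.
  move=> mA; rewrite muE// /g -integral_mkcondr; apply: eq_integral => q.
  rewrite inE => -[_ dq]; congr ((_ * _)%:E); rewrite pos_id//.
  exact: one_sub_sqr_ge0.
pose f (q : plane R) : \bar R := ((cabs (cder (phi a) (toC q))) `^ p)%:E.
have f0 q : (0 <= f q)%E by rewrite lee_fin powR_ge0.
(* A continuous closed form for the kernel on the disk, from which measurability is read off. *)
pose K z : R := pos ((1 - cabs a ^+ 2) / cabs (1 - cconj a * z) ^+ 2) `^ p.
have fK z : cabs z < 1 -> (cabs (cder (phi a) z)) `^ p = K z.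
  by move=> z1; rewrite /K -cder_phi// pos_id// cabs_ge0.
have cK z : cabs z < 1 -> rct K z.
  move=> z1; apply: (rt_comp (f := fun x => pos x `^ p)); last exact: pospow_cont.
  apply: rt_M; first exact: rt_cst.
  have t0 : cabs (1 - cconj a * z) ^+ 2 != 0 by rewrite sqrf_eq0 cabs_eq0 t_neq0// ltW.
  apply: rt_V; first exact: t0.
  by apply: rt_X; apply: ct_abs; apply: ct_B; [exact: ct_cst|apply: ct_M; [exact: ct_cst|exact: ct_id]].
have mf : measurable_fun D f.
  apply: (eq_measurable_fun (fun q : plane R => (K (toC q))%:E)); last exact: (measurable_disk2_fun cK).
  by move=> q; rewrite inE => dq; rewrite /f fK.
have := integral_density_le mD g0 gf mg nuE f0 mf; apply: le_trans.
rewrite le_eqVlt; apply/orP; left; apply/eqP; apply: eq_integral => q.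
rewrite inE => dq; have z1 : cabs (toC q : C) < 1 := dq.
have -> : g q = (dens (toC q))%:E by rewrite /g patchE ifT// inE.
rewrite /f -EFinM; congr (_%:E); rewrite cder_phi// /dens /wgt.
set z : C := toC q in z1 *; have P0 := one_sub_sqr_ge0 z1.
rewrite (pos_id P0) pos_id ?wbase1_ge0// /wbase.
rewrite powRD; last by apply/implyP => /eqP h; have := p0; lra.
rewrite powR_mulrn//.
have -> : (1 - cabs a ^+ 2) * (1 - cabs z ^+ 2) / cabs (1 - cconj a * z) ^+ 2 =
   (1 - cabs z ^+ 2) * ((1 - cabs a ^+ 2) / cabs (1 - cconj a * z) ^+ 2) by ring.
rewrite powRM// ?divr_ge0 ?one_sub_sqr_ge0 ?sqr_ge0//; ring.
Qed.

(** Where the weight does not vanish, replacing [m] by 1 enlarges both the factor [(m - |z|^2)^2]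
    and the weight, so the Carleson integral dominates uniformly in [m]. *)
Lemma carleson_smallJ (p : R) (S : C -> C) (mu : {measure set (plane R) -> \bar R}) :
  0 < p -> (forall z, cabs z < 1 -> cct S z) ->
  (forall A : set (plane R), measurable A ->
     mu A = (\int[@area R]_(q in A `&` @disk2 R)
               (cabs (S (toC q)) ^+ 2 * (1 - cabs (toC q : C) ^+ 2) `^ (2 + p))%:E)%E) ->
  vanishes_at_boundary (carleson_int mu p) ->
  smallJ p (fun m z => cabs (S z) ^+ 2 * (m - cabs z ^+ 2) ^+ 2).
Proof.
move=> p0 cS muE Hmu e e0; have [r [r1 Hr]] := Hmu e e0.
exists r => // a m ra a1 m0 m1; rewrite -lee_fin; apply/ltW; apply: le_lt_trans (Hr a ra a1).
apply: le_trans (carleson_ge p0 cS muE a1).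
have cP (x : R) z : rct (fun z : C => (x - cabs z ^+ 2) ^+ 2) z.
  by apply: rt_X; apply: rt_B; [exact: rt_cst|apply: rt_X; apply: ct_abs; exact: ct_id].
have cSP (x : R) z : cabs z < 1 -> rct (fun z : C => cabs (S z) ^+ 2 * (x - cabs z ^+ 2) ^+ 2) z.
  by move=> z1; apply: rt_M; [apply: rt_X; apply: ct_abs; exact: cS|exact: cP].
have SP0 z : 0 <= cabs (S z) ^+ 2 * (1 - cabs z ^+ 2) ^+ 2.
  exact: mulr_ge0 (sqr_ge0 _) (sqr_ge0 _).
apply: le_trans (J_le_disk_int a1 p0 m0 m1 (cSP 1) SP0); rewrite lee_fin.
apply: J_le; [exact: Kwgt_rcont (cSP m)|exact: Kwgt_rcont (cSP 1)|].
move=> z; have [zr|zr] := leP (cabs z) (Num.sqrt m); last first.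
  by rewrite (wgt_out a1 m0 p0 zr) [leLHS]mulr0 [leRHS]mulr0.
apply: ler_wpM2r; first exact: wgt_ge0.
apply: ler_wpM2l; first exact: sqr_ge0.
have P0 : 0 <= m - cabs z ^+ 2.
  by rewrite subr_ge0 -[leRHS](sqr_sqrtr (ltW m0)) ler_sqr ?nnegrE ?cabs_ge0 ?sqrtr_ge0.
have P1 : m - cabs z ^+ 2 <= 1 - cabs z ^+ 2 by rewrite lerD2r ltW.
by rewrite ler_sqr ?nnegrE; [exact: P1|exact: P0|exact: le_trans P1].
Qed.

End Final.

Unset Implicit Arguments.
Theorem theorem5 (R : realType) (p : R) (h g : Cplx R -> Cplx R) :
  0 < p -> p <= 1 ->
  (* f = h + conj g : harmonic, h, g analytic in D, normalized *)
  analytic_on_disk h -> analytic_on_disk g ->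
  h 0 = 0 -> g 0 = 0 ->
  (* locally univalent and sense-preserving: h' <> 0 and J_f > 0 in D *)
  (forall z, disk z -> cder h z != 0) ->
  (forall z, disk z -> 0 < jac h g z) ->
  (* f is univalent in D *)
  univalent_on_disk (harm h g) ->
  (* the dilatation w = g'/h' lies in Q_{p,0} and ||w|| < 1 *)
  Qp0 p (fun z => cder g z / cder h z) ->
  (exists k : R, k < 1 /\
     forall z, disk z -> cabs (cder g z / cder h z) <= k) ->
  (* for some |lambda| = 1, phi = h + lambda g is a conformal map of D whose
     boundary image phi(dD) is a closed Jordan curve *)
  (exists lam : Cplx R, cabs lam = 1 /\
     analytic_on_disk (fun z => h z + lam * g z) /\
     univalent_on_disk (fun z => h z + lam * g z) /\
     exists Phi : Cplx R -> Cplx R,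
       {within @cdisk R, continuous Phi} /\
       (forall z, disk z -> Phi z = h z + lam * g z) /\
       (forall z1 z2, circle z1 -> circle z2 -> Phi z1 = Phi z2 -> z1 = z2)) ->
  (* d mu = |S_f|^2 (1 - |z|^2)^(2+p) dA on D is a vanishing p-Carleson measure *)
  forall mu : {measure set (plane R) -> \bar R},
  (forall A : set (plane R), measurable A ->
     mu A = (\int[@area R]_(q in A `&` @disk2 R)
               (cabs (schwarzian h g (toC q)) ^+ 2
                * (1 - cabs (toC q) ^+ 2) `^ (2 + p))%:E)%E) ->
  vanishing_carleson p mu ->
  (* then F = log J_f belongs to Q~_{p,0} *)
  tQp0 p (logJ h g).
Proof.
move=> p0 p1 ah ag _ _ h0 J0 _ HQ [k [k1 wk]] [lam [lam1 [_ [_ [Phi [cPhi [PhiE _]]]]]]] mu muE [_ Hmu].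
have au := an_u ah h0; have aw := an_w ah ag h0.
set w := (fun z => cder g z / cder h z) in HQ wk aw.
set u := preschw h in au.
have [K kC] := cder_bound ah ag lam1 k1 h0 wk cPhi PhiE.
have wk' z : cabs z < 1 -> cabs (w z) <= k by move=> z1; exact: wk.
have HW := Qp0_smallJ p0 HQ.
have cS z : cabs z < 1 -> cct (Sfw u w) z by exact: (Sfw_cct au aw k1 wk').
have HS : smallJ p (fun m z => cabs (Sfw u w z) ^+ 2 * (m - cabs z ^+ 2) ^+ 2).
  apply: (carleson_smallJ p0 cS _ Hmu) => A mA; rewrite muE//.
  by apply: eq_integral => q; rewrite inE => -[_ dq]; rewrite (schwarzianE ah ag h0 J0).
have cu : sh_control u := Sh_bound p0 p1 au aw k1 wk' HS HW.
have [ah' _] := analytic_cder ah.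
have ku z : disk z -> cder (cder h) z = u z * cder h z by move=> dz; rewrite /u /preschw divfK// h0.
have su : small 1 u := small_u au ah' h0 ku kC (small_Sh au cu).
have HX := smallJ_uw p0 p1 au aw k1 wk' HS HW su.
split; first exact: logJ_smooth.
(* [smallJ] yields a weak inequality and the boundary condition is strict, hence [e / 2]. *)
move=> e e0; have [r r1 Hr] := HX _ (divr_gt0 e0 (ltr0n R 2)).
exists r; split => // a ra a1.
apply: (@le_lt_trans _ _ (e / 2)%:E); last by rewrite lte_fin; lra.
have [aw' cw'] := analytic_cder aw.
have cK z : cabs z < 1 -> rct (fun z => (2 * cabs (u z - Aw w z * cder w z)) ^+ 2) z.
  move=> z1; apply: rt_X; apply: rt_M; first exact: rt_cst.
  apply: ct_abs; apply: ct_B; first by apply: ct_der; exact: analytic_der.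
  by apply: ct_M; [exact: (Aw_cct aw k1 wk')|exact: cw'].
have := disk_int_le_lim a1 p0 cK (fun z => sqr_ge0 _) (fun m m0 m1 => Hr a m ra a1 m0 m1).
apply: le_trans; rewrite le_eqVlt; apply/orP; left; apply/eqP; apply: disk_int_ext => z z1.
rewrite wgt1E// (cabs_Wzb_logJ ah ag h0 J0)// (Wz_logJ ah ag h0 J0)//.
by rewrite mulr_natl mulr2n.
Qed.
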